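(* Let $d\ge 2$, let $I_1,\dots,I_d$ be open intervals, and for each $1\le i\le d$ let $\mathbf{X}^i$ be the minimal diffusion process on $I_i$ with scaling function $\mathtt{s}_i$, speed measure $m_i$ and no killing inside. Let $E=I_1\times\cdots\times I_d$, $m=m_1\times\cdots\times m_d$, and let $(\mathcal{E},\mathcal{F})$ be the Dirichlet form on $L^2(E,m)$ of the Cartesian product $\mathbf{X}$ of $\{\mathbf{X}^1,\dots,\mathbf{X}^d\}$. Assume $C_c^\infty(E)\subset\mathcal{F}$. Then the smallest closed extension $\bar{\mathcal{F}}$ of $C_c^\infty(E)$ in $\mathcal{F}$ corresponds to the Cartesian product of $\{\bar{\mathbf{X}}^1,\dots,\bar{\mathbf{X}}^d\}$, where $\bar{\mathbf{X}}^i$ is the minimal diffusion process on $I_i$ with scaling function $\bar{\mathtt{s}}_i$ (the absolutely continuous part of $\mathtt{s}_i$) and speed measure $m_i$ (and no killing inside). In particular, $C_c^\infty(E)$ is a special standard core of $(\mathcal{E},\mathcal{F})$ if and only if $\mathbf{s}=(\mathtt{s}_1,\dots,\mathtt{s}_d)$ is absolutely continuous.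
   Context: A scaling function on an open interval $I$ is a strictly increasing continuous function $\mathtt{s}:I\to\mathbb{R}$, normalized to vanish at a fixed point $e\in I$; a speed measure is a fully supported Radon measure on $I$. Absolute continuity on an open interval means on each compact subinterval. The minimal diffusion on $I$ with scaling function $\mathtt{s}$, speed measure $m$ and no killing inside is the diffusion associated with the regular strongly local Dirichlet form on $L^2(I,m)$ given by $\mathcal{E}^{(\mathtt{s},m)}(u,v)=\frac12\int_I\frac{du}{d\mathtt{s}}\frac{dv}{d\mathtt{s}}d\mathtt{s}$ with domain $\mathcal{F}^{(\mathtt{s},m)}_0$, the closure of $\{\varphi\circ\mathtt{s}:\varphi\in C_c^\infty(\mathtt{s}(I))\}$ in the norm $(\mathcal{E}^{(\mathtt{s},m)}(u,u)+\|u\|^2_{L^2(m)})^{1/2}$; here for $u=\varphi\circ\mathtt{s}$ with $\varphi$ absolutely continuous, $\frac{du}{d\mathtt{s}}=\varphi'\circ\mathtt{s}$. The Cartesian product $\mathbf{X}$ of $\{\mathbf{X}^1,\dots,\mathbf{X}^d\}$ is the diffusion on $E$ whose coordinate components are independent with $i$-th component equal in distribution to $\mathbf{X}^i$, the boundary of $E$ being a trap. It is $m$-symmetric, and its Dirichlet form $(\mathcal{E},\mathcal{F})$ on $L^2(E,m)$ is regular; if $\mathcal{C}_i$ is a core of the form $(\mathcal{E}^i,\mathcal{F}^i)$ of $\mathbf{X}^i$, then $\mathcal{C}_1\otimes\cdots\otimes\mathcal{C}_d$ (the span of products $u_1(x_1)\cdots u_d(x_d)$, $u_i\in\mathcal{C}_i$)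 is a core of $(\mathcal{E},\mathcal{F})$, and $\mathcal{E}(u,v)=\sum_{i=1}^d\int \mathcal{E}^i(u_{\hat x_i},v_{\hat x_i})\prod_{j\ne i}m_j(dx_j)$, where $u_{\hat x_i}$ is $u$ viewed as a function of $x_i$ with the other coordinates fixed. The absolutely continuous part $\bar{\mathtt{s}}$ of a scaling function $\mathtt{s}$ is $\bar{\mathtt{s}}(x)=\int_e^x g(y)dy$, where $d\mathtt{s}=g\cdot\lambda+\kappa$, $\kappa\perp\lambda$, is the Lebesgue decomposition of $d\mathtt{s}$ with respect to Lebesgue measure $\lambda$. The map $\mathbf{s}$ is called absolutely continuous if each $\mathtt{s}_i$ is absolutely continuous. The smallest closed extension of $C_c^\infty(E)$ in $\mathcal{F}$ is its closure $\bar{\mathcal{F}}$ in $\mathcal{F}$ under the norm $(\mathcal{E}(u,u)+\|u\|^2_{L^2(m)})^{1/2}$, equipped with the restriction of $\mathcal{E}$; $C_c^\infty(E)$ is a special standard core of $(\mathcal{E},\mathcal{F})$ exactly when it is contained in $\mathcal{F}$ and dense in $\mathcal{F}$ under this norm. *)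

(* Defs.v *)
From HB Require Import structures.
From mathcomp Require Import all_boot all_order all_algebra.
From mathcomp Require Import all_classical all_reals all_analysis.
From mathcomp Require Import measurable_realfun.

Set Implicit Arguments.
Unset Strict Implicit.
Unset Printing Implicit Defensive.

Import Order.TTheory GRing.Theory Num.Theory.
Import numFieldNormedType.Exports.

Local Open Scope classical_set_scope.
Local Open Scope ring_scope.

(* The sigma-algebra of R^n generated by the coordinates, that is, its Borel
   sigma-algebra; the library has the topology of 'rV[R]_n but no measurable
   structure. *)
Section measurable_rV.
Variables (R : realType) (n : nat).

Let coord : 'I_n -> 'rV[R]_n -> R := fun i x => x ord0 i.

Let rV_set0 : g_sigma_preimage coord set0.
Proof. exact: sigma_algebra0. Qed.

Let rV_setC A : g_sigma_preimage coord A -> g_sigma_preimage coord (~` A).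
Proof. exact: sigma_algebraC. Qed.

Let rV_bigcup (F : (set 'rV[R]_n)^nat) :
  (forall i, g_sigma_preimage coord (F i)) ->
  g_sigma_preimage coord (\bigcup_i (F i)).
Proof. exact: sigma_algebra_bigcup. Qed.

HB.instance Definition _ := @isMeasurable.Build default_measure_display
  'rV[R]_n (g_sigma_preimage coord) rV_set0 rV_setC rV_bigcup.

End measurable_rV.

Section function_spaces.
Variable R : realType.

Definition open_interval (I : set R) : Prop :=
  [/\ open I, is_interval I & I !=set0].

Definition box (d : nat) (I : 'I_d -> set R) : set 'rV[R]_d :=
  [set x | forall i, I i (x ord0 i)].

Definition L2 (dT : measure_display) (T : measurableType dT)
    (mu : set T -> \bar R) (D : set T) : set (T -> R) :=
  [set u : T -> R | measurable_fun D u /\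
           (\int[mu]_(x in D) ((u x) ^+ 2)%:E < +oo)%E].

(* [:: v1; ...; vk] is mapped to D_v1 (... (D_vk f)). *)
Definition iter_derive (V : normedModType R) (vs : seq V) (f : V -> R)
  : V -> R := foldr (fun v g => 'D_v g) f vs.

Definition smooth (V : normedModType R) (f : V -> R) : Prop :=
  forall (vs : seq V) (x : V), differentiable (iter_derive vs f) x.

Definition Cc_smooth (V : normedModType R) (U : set V) : set (V -> R) :=
  [set f | smooth f /\
     exists K : set V, [/\ compact K, K `<=` U & forall x, ~ K x -> f x = 0]].

Definition abs_cont (a b : R) (f : R -> R) : Prop :=
  forall eps, 0 < eps -> exists2 delta, 0 < delta &
    forall (n : nat) (x y : 'I_n -> R),
      (forall k, a <= x k /\ x k <= y k /\ y k <= b) ->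
      (forall k l, k != l -> y k <= x l \/ y l <= x k) ->
      \sum_k (y k - x k) < delta ->
      \sum_k `|f (y k) - f (x k)| < eps.

Definition loc_abs_cont (J : set R) (f : R -> R) : Prop :=
  forall a b, a <= b -> `[a, b] `<=` J -> abs_cont a b f.

End function_spaces.

Section one_dimension.
Variable R : realType.
Implicit Types (I : set R) (s : R -> R)
  (ds m : {measure set R -> \bar R}).

Definition scaling_function I (e : R) s : Prop :=
  [/\ I e, s e = 0,
      (forall x y, I x -> I y -> x < y -> s x < s y) &
      {within I, continuous s}].

(* Only the restriction of [m] to [I] is relevant; on an open interval the
   Radon measures are the Borel measures finite on compact sets. *)
Definition speed_measure I m : Prop :=
  (forall K, compact K -> K `<=` I -> (m K < +oo)%E) /\
  (forall U, open U -> U `<=` I -> U !=set0 -> (0 < m U)%E).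

(* [ds], restricted to [I], is the Lebesgue-Stieltjes measure of [s]. *)
Definition stieltjes I s ds : Prop :=
  forall a b, I a -> I b -> a <= b -> ds `]a, b]%classic = (s b - s a)%:E.

(* The (m-class of the) function [u] is phi \o s with phi absolutely
   continuous, and w = du/ds = phi' \o s up to a ds-null set. *)
Definition scale_derivative I s ds m (u w : R -> R) : Prop :=
  measurable_fun I w /\
  exists phi : R -> R,
    [/\ loc_abs_cont (s @` I) phi,
        {ae m, forall x, I x -> u x = phi (s x)} &
        {ae ds, forall x, I x -> is_derive (s x) 1 phi (w x)}].

Definition scale_energy I s ds m (u v : R -> R) (r : R) : Prop :=
  exists wu wv, [/\ scale_derivative I s ds m u wu,
    scale_derivative I s ds m v wv &
    r = 2^-1 * \int[ds]_(x in I) (wu x * wv x)].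

(* F_0^(s,m): the closure of the functions psi \o s, psi in C_c^oo(s(I));
   the scale derivative of psi \o s is psi' \o s. *)
Definition scale_domain I s ds m : set (R -> R) :=
  [set u | L2 m I u /\
    exists w, [/\ scale_derivative I s ds m u w, L2 ds I w &
      forall eps, 0 < eps -> exists2 psi : R -> R,
        Cc_smooth (V := R) (s @` I) psi &
        2^-1 * (\int[ds]_(x in I) (w x - derive1 psi (s x)) ^+ 2) +
        \int[m]_(x in I) (u x - psi (s x)) ^+ 2 < eps]].

Definition signed_integral (g : R -> R) (a b : R) : R :=
  if a <= b then \int[lebesgue_measure]_(x in `[a, b]) g x
  else - \int[lebesgue_measure]_(x in `[b, a]) g x.

(* ds = g lambda + kappa with kappa singular, and sbar is the integral of g. *)
Definition ac_part I (e : R) s (sbar : R -> R) : Prop :=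
  exists (ds kappa : {measure set R -> \bar R}) (g : R -> R),
    [/\ stieltjes I s ds,
        measurable_fun I g /\
          (forall x, I x -> 0 <= g x),
        (exists N : set R, [/\ measurable N,
           lebesgue_measure N = 0%E & kappa (I `\` N) = 0%E]),
        (forall A : set R, measurable A -> A `<=` I ->
           ds A = (\int[lebesgue_measure]_(x in A) (g x)%:E + kappa A)%E) &
        (forall x, I x -> sbar x = signed_integral g e x)].

End one_dimension.

(* A Markov process with state space [D] and lifetime [proc_life]; from its
   lifetime on it is in the cemetery, so [proc_path t w] is relevant only for
   t < proc_life w, and [proc_law x] (the law started at x) only for x in [D]. *)
Record process (R : realType) (dT : measure_display) (T : measurableType dT)
    (D : set T) := Process {
  sample_display : measure_display;
  sample : measurableType sample_display;
  proc_law : T -> probability sample R;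
  proc_path : R -> sample -> T;
  proc_life : sample -> \bar R;
  measurable_life : measurable_fun [set: sample] proc_life;
  measurable_path : forall t, 0 <= t ->
    measurable_fun [set w | (t%:E < proc_life w)%E] (proc_path t);
  path_in : forall t w, 0 <= t -> (t%:E < proc_life w)%E -> D (proc_path t w);
  path_start : forall x, D x ->
    proc_law x [set w | (0%:E < proc_life w)%E /\ proc_path 0 w = x] = 1%E;
  measurable_law : forall t (A : set T), 0 <= t -> measurable A ->
    measurable_fun D (fun x =>
      proc_law x [set w | (t%:E < proc_life w)%E /\ A (proc_path t w)]);
  markov_property : forall x (n : nat) (ts : 'I_n -> R) (A : 'I_n -> set T)
      t h (B : set T), D x -> 0 <= h -> 0 <= t ->
    (forall k, 0 <= ts k /\ ts k <= t) -> (forall k, measurable (A k)) ->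
    measurable B ->
    proc_law x [set w | [/\ ((t + h)%:E < proc_life w)%E,
                            B (proc_path (t + h) w) &
                            forall k, A k (proc_path (ts k) w)]] =
    (\int[proc_law x]_(w in [set w | (t%:E < proc_life w)%E /\
                                     forall k, A k (proc_path (ts k) w)])
       proc_law (proc_path t w)
         [set w' | (h%:E < proc_life w')%E /\ B (proc_path h w')])%E
}.

Section process_form.
Variables (R : realType) (dT : measure_display) (T : measurableType dT).
Variables (D : set T) (X : process R D) (m : {measure set T -> \bar R}).

Definition at_time (t : R) (A : set T) : set (sample X) :=
  [set w | (t%:E < proc_life w)%E /\ A (proc_path t w)].

(* P_t u (x) = E_x [ u (X_t) ; t < lifetime ]. *)
Definition transition (t : R) (u : T -> R) (x : T) : R :=
  \int[proc_law X x]_(w in [set w | (t%:E < proc_life w)%E]) u (proc_path t w).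

Definition symmetric_process : Prop :=
  forall t (A B : set T), 0 <= t -> measurable A -> measurable B ->
    A `<=` D -> B `<=` D ->
    (\int[m]_(x in A) proc_law X x (at_time t B) =
     \int[m]_(x in B) proc_law X x (at_time t A))%E.

(* (1/t) (u - P_t u, v) in L^2(D, m). *)
Definition approx_form (t : R) (u v : T -> R) : R :=
  t^-1 * \int[m]_(x in D) ((u x - transition t u x) * v x).

(* The Dirichlet form of X on L^2(D, m); the domain is a set of functions,
   saturated for equality m-almost everywhere on D. For a symmetric X,
   [approx_form t u u] is nonincreasing in t > 0, so its convergence in R means
   that its limit, which always exists in [0, +oo], is finite. *)
Definition dirichlet_domain : set (T -> R) :=
  [set u | L2 m D u /\
    exists l : R, approx_form t u u @[t --> 0^'+] --> l].

Definition dirichlet_form (u v : T -> R) : R :=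
  lim (approx_form t u v @[t --> 0^'+]).

Definition E1_norm2 (u : T -> R) : R :=
  dirichlet_form u u + \int[m]_(x in D) (u x) ^+ 2.

Definition E1_closure (C : set (T -> R)) : set (T -> R) :=
  [set u | dirichlet_domain u /\
    forall eps, 0 < eps -> exists2 f, C f & E1_norm2 (u \- f) < eps].

End process_form.

Definition continuous_paths (R : realType) (Omega : Type) (T : topologicalType)
    (path : R -> Omega -> T) (life : Omega -> \bar R) : Prop :=
  forall w, {within [set t | 0 <= t /\ (t%:E < life w)%E],
             continuous (fun t => path t w)}.

Definition minimal_diffusion (R : realType) (I : set R) (s : R -> R)
    (m : {measure set R -> \bar R}) (X : process R I) : Prop :=
  [/\ continuous_paths (T := R) (@proc_path _ _ _ _ X) (@proc_life _ _ _ _ X),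
      symmetric_process X m &
      exists ds : {measure set R -> \bar R},
        [/\ stieltjes I s ds,
            dirichlet_domain X m = scale_domain I s ds m &
            forall u v, dirichlet_domain X m u -> dirichlet_domain X m v ->
              scale_energy I s ds m u v (dirichlet_form X m u v)]].

Definition product_measure_on (R : realType) (d : nat) (I : 'I_d -> set R)
    (m : 'I_d -> {measure set R -> \bar R})
    (mE : {measure set 'rV[R]_d -> \bar R}) : Prop :=
  forall A : 'I_d -> set R,
    (forall i, measurable (A i) /\ A i `<=` I i) ->
    mE (box A) = (\prod_i m i (A i))%E.

(* XE has independent components distributed as the X i, up to its lifetime,
   which is the first time one of them leaves its interval: the event
   t < lifetime of XE corresponds to t < lifetime of X i for all i. *)
Definition cartesian_product (R : realType) (d : nat) (I : 'I_d -> set R)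
    (X : forall i, process R (I i)) (XE : process R (box I)) : Prop :=
  continuous_paths (T := 'rV[R]_d)
    (@proc_path _ _ _ _ XE) (@proc_life _ _ _ _ XE) /\
  forall (x : 'rV[R]_d) (n : nat) (t : 'I_n -> R) (A : 'I_n -> 'I_d -> set R),
    box I x -> (forall k, 0 <= t k) -> (forall k i, measurable (A k i)) ->
    proc_law XE x [set w | forall k, at_time (t k) (box (A k)) w] =
    (\prod_i proc_law (X i) (x ord0 i)
       [set w | forall k, at_time (t k) (A k i) w])%E.

Definition special_standard_core (R : realType) (d : nat) (E : set 'rV[R]_d)
    (X : process R E) (m : {measure set 'rV[R]_d -> \bar R}) : Prop :=
  Cc_smooth E `<=` dirichlet_domain X m /\
  dirichlet_domain X m `<=` E1_closure X m (Cc_smooth E).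

(* Main.v *)
Require Import Defs.
From HB Require Import structures.
From mathcomp Require Import all_boot all_order all_algebra.
From mathcomp Require Import all_classical all_reals all_analysis.
From mathcomp Require Import measurable_realfun.
From mathcomp Require Import ring lra.

Set Implicit Arguments.
Unset Strict Implicit.
Unset Printing Implicit Defensive.

Import Order.TTheory GRing.Theory Num.Theory.
Import numFieldNormedType.Exports.

Local Open Scope classical_set_scope.
Local Open Scope ring_scope.

(* The Dirichlet form of a symmetric process is the supremum over t of
   (u - P_t u, u) / t. The semigroup of a Cartesian product is the product of
   the commuting semigroups acting on one coordinate each, so its form is the
   sum of the coordinate forms, each of which integrates a one-dimensional form
   over sections; moreover, products of functions taken from dense classes span
   a dense class. This reduces the theorem to dimension one.

   There, a smooth f with compact support that lies in the domain has a scale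
   derivative w with f' lambda = w ds. Writing ds = g lambda + kappa with kappa
   carried by a null set N, this says that w = f' / g almost everywhere and
   that w = 0 on N, so the energy of f is the integral of f'^2 / (2 g), which
   is also its energy for the scale sbar. For the scale sbar, the functions
   psi o sbar are approximated by smooth functions by approximating the
   derivatives in L^2(lambda / g), with mean zero, by smooth functions of mean
   zero. If kappa gives mass k to ]a, b], take psi with psi' = 1 on
   s([a, b]): as w vanishes on N, the energy of c (psi o s) - f is at least
   c^2 k / 2 for every smooth f, so smooth functions are not dense. Finally,
   kappa vanishes on I exactly when s is locally absolutely continuous.

   The closure of the smooth functions is compared with the domain for sbar by
   lower semicontinuity: two forms that agree on a class are ordered on its
   closure with respect to either of them. *)

(** * Symmetric contraction semigroups and their forms *)

(** The part of spectral calculus is taken by one fact, [psd_contraction]: a symmetric contraction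
    that commutes with [T t] lowers [eform T t]. It yields that [eform T t u u] increases as [t]
    decreases (up to a factor tending to 1), that [T s] maps L^2 boundedly into the form domain, and
    that [T s u] tends to [u] in the form norm. The density of tensors rests on the last two facts:
    [T s] turns the indicator of a box into a tensor of functions of finite form, and combinations
    of such indicators are dense in L^2, a statement in which no form occurs.

    Null sets and divergent integrals shape the rest. Functions are not identified when they agree
    almost everywhere, so inner products are semidefinite and semigroup laws are stated in pairings.
    A real integral has a default value when it diverges, so identities between kernels are first
    proved for nonnegative extended functions, by monotone class arguments, and then carried over to
    L^2.

    In dimension one, the approximation of psi o sbar by smooth functions and that of smooth
    functions by psi o sbar are two instances of [primitive_approximation]. *)

Lemma exists_nat_gt (R : realType) (x : R) : exists n : nat, x < n%:R.
Proof. by exists (Num.truncn x).+1; exact: truncnS_gt. Qed.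

Section psd_form.
Variables (R : realType) (V : lmodType R) (D : set V).
Hypothesis DL : forall a u v, D u -> D v -> D (a *: u + v).

Definition psd (b : V -> V -> R) :=
  [/\ forall u v, D u -> D v -> b u v = b v u,
      forall a u v w, D u -> D v -> D w ->
        b (a *: u + v) w = a * b u w + b v w &
      forall u, D u -> 0 <= b u u].

Lemma lin0 u : D u -> D 0.
Proof. by move=> Du; rewrite -(addNr u) -scaleN1r; apply: DL. Qed.

Lemma linD u v : D u -> D v -> D (u + v).
Proof. by move=> Du Dv; rewrite -(scale1r u); apply: DL. Qed.

Lemma linZ a u : D u -> D (a *: u).
Proof. by move=> Du; rewrite -(addr0 (_ *: _)); apply: DL => //; apply: lin0 Du. Qed.

Lemma linN u : D u -> D (- u).
Proof. by move=> Du; rewrite -scaleN1r; apply: linZ. Qed.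

Lemma linB u v : D u -> D v -> D (u - v).
Proof. by move=> Du Dv; apply: linD => //; apply: linN. Qed.

Variable b : V -> V -> R.
Hypothesis hb : psd b.

Lemma psdC u v : D u -> D v -> b u v = b v u. Proof. by case: hb => h _ _; exact: h. Qed.
Lemma psd_ge0 u : D u -> 0 <= b u u. Proof. by case: hb => _ _; exact. Qed.

Lemma psdDl u v w : D u -> D v -> D w -> b (u + v) w = b u w + b v w.
Proof.
case: hb => _ bL _ Du Dv Dw; rewrite -{1}(scale1r u) bL//.
by rewrite mul1r.
Qed.

Lemma psd0l w : D w -> b 0 w = 0.
Proof.
move=> Dw; have D0 := lin0 Dw; have := psdDl D0 D0 Dw.
by rewrite addr0 => /eqP; rewrite -subr_eq0 opprD addNKr oppr_eq0 => /eqP.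
Qed.

Lemma psdZl a u w : D u -> D w -> b (a *: u) w = a * b u w.
Proof.
case: hb => _ bL _ Du Dw; have D0 := lin0 Dw.
by rewrite -{1}(addr0 (_ *: _)) bL// psd0l// addr0.
Qed.

Lemma psdNl u w : D u -> D w -> b (- u) w = - b u w.
Proof. by move=> Du Dw; rewrite -scaleN1r psdZl// mulN1r. Qed.

Lemma psdBl u v w : D u -> D v -> D w -> b (u - v) w = b u w - b v w.
Proof. by move=> Du Dv Dw; rewrite psdDl ?psdNl//; apply: linN. Qed.

Lemma psdDr u v w : D u -> D v -> D w -> b w (u + v) = b w u + b w v.
Proof.
by move=> Du Dv Dw; rewrite (psdC Dw (linD Du Dv)) psdDl// !(psdC Dw).
Qed.

Lemma psdZr a u w : D u -> D w -> b w (a *: u) = a * b w u.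
Proof. by move=> Du Dw; rewrite (psdC Dw (linZ a Du)) psdZl// (psdC Dw). Qed.

Lemma psdNr u w : D u -> D w -> b w (- u) = - b w u.
Proof. by move=> Du Dw; rewrite -scaleN1r psdZr// mulN1r. Qed.

Lemma psdBr u v w : D u -> D v -> D w -> b w (u - v) = b w u - b w v.
Proof. by move=> Du Dv Dw; rewrite psdDr ?psdNr//; apply: linN. Qed.

Lemma psd_sqr a u v : D u -> D v ->
  b (a *: u + v) (a *: u + v) = a ^+ 2 * b u u + 2 * a * b u v + b v v.
Proof.
move=> Du Dv; have Dau := linZ a Du.
rewrite psdDl ?psdDr ?psdZl ?psdZr ?psdDr ?psdZr//; try exact: linD.
by rewrite (psdC Dv Du); ring.
Qed.

Lemma psd_sqrD u v : D u -> D v ->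
  b (u + v) (u + v) = b u u + 2 * b u v + b v v.
Proof. by move=> Du Dv; rewrite -{1 2}(scale1r u) psd_sqr// expr1n !mul1r mulr1. Qed.

Lemma psd_sqrB u v : D u -> D v ->
  b (u - v) (u - v) = b u u - 2 * b u v + b v v.
Proof. by move=> Du Dv; rewrite psd_sqrD ?psdNr ?psdNl ?psdNr//; [ring|exact: linN..]. Qed.

Lemma psd_cauchy_schwarz u v : D u -> D v -> b u v ^+ 2 <= b u u * b v v.
Proof.
move=> Du Dv.
have [bu0|bu0] := eqVneq (b u u) 0; last first.
  have bup : 0 < b u u by rewrite lt_neqAle eq_sym bu0 psd_ge0.
  have := psd_ge0 (DL (- (b u v / b u u)) Du Dv).
  rewrite psd_sqr// sqrrN => h.
  have : 0 <= b u u * ((b u v / b u u) ^+ 2 * b u u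
    + 2 * - (b u v / b u u) * b u v + b v v) by apply: mulr_ge0 => //; exact: ltW.
  suff -> : b u u * ((b u v / b u u) ^+ 2 * b u u
    + 2 * - (b u v / b u u) * b u v + b v v) = b u u * b v v - b u v ^+ 2.
    by rewrite subr_ge0.
  by field.
rewrite bu0 mul0r.
have [->|buv] := eqVneq (b u v) 0; first by rewrite expr0n.
(* With [b u u = 0] the square of [a *: u + v] is affine in [a]; this coefficient gives it the value
   -1. *)
exfalso; have := psd_ge0 (DL (- (b v v + 1) / (2 * b u v)) Du Dv).
rewrite psd_sqr// bu0 mulr0 add0r.
have -> : 2 * (- (b v v + 1) / (2 * b u v)) * b u v + b v v = -1 by field.
lra.
Qed.

(** Expands the nonnegative square of [- dl^-1 *: (u - v) + v]. It stands in for the triangle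
    inequality of the square root of the form: as no root is taken, it passes to suprema with values
    in the extended reals. *)
Lemma psd_young (dl : R) u v : 0 < dl -> D u -> D v ->
  b u u <= (1 + dl) * b v v + (1 + dl^-1) * b (u - v) (u - v).
Proof.
move=> dl0 Du Dv.
have Duv : D (u - v) by apply: linB.
have := psd_sqrD Duv Dv; rewrite subrK => ->.
have := psd_ge0 (DL (- dl^-1) Duv Dv); rewrite psd_sqr//.
set x := b (u - v) (u - v); set y := b _ _; set z := b v v => h.
have : 0 <= dl * ((- dl^-1) ^+ 2 * x + 2 * - dl^-1 * y + z).
  by apply: mulr_ge0 => //; exact: ltW.
suff -> : dl * ((- dl^-1) ^+ 2 * x + 2 * - dl^-1 * y + z) =
  dl^-1 * x - 2 * y + dl * z by move=> ?; lra.
by field; rewrite gt_eqF.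
Qed.

(* [n |-> b (C^n u) (C^n u)] is log-convex by Cauchy-Schwarz and bounded, hence
   nonincreasing. *)
Lemma psd_contraction (C : V -> V) (M : R) u :
  (forall v, D v -> D (C v)) ->
  (forall v w, D v -> D w -> b (C v) w = b v (C w)) ->
  (forall n, b (iter n C u) (iter n C u) <= M) ->
  D u -> b (C u) (C u) <= b u u.
Proof.
move=> DC bC bM Du.
pose a n := b (iter n C u) (iter n C u).
have Dn n : D (iter n C u) by elim: n => //= n; exact: DC.
have a_ge0 n : 0 <= a n by apply: psd_ge0.
have aS n : a n.+1 ^+ 2 <= a n * a n.+2.
  rewrite /a /= bC//; last exact/DC/Dn.
  exact: psd_cauchy_schwarz (Dn n) (Dn n.+2).
rewrite leNgt; apply/negP => a01; rewrite -/(a 0) -/(a 1) in a01.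
have a1_gt0 : 0 < a 1 by apply: le_lt_trans a01; exact: a_ge0.
have a0_gt0 : 0 < a 0.
  rewrite lt_neqAle a_ge0 andbT eq_sym; apply/eqP => a00.
  by have := aS 0; rewrite a00 mul0r leNgt exprn_gt0.
pose r := a 1 / a 0.
have r1 : 1 < r by rewrite /r ltr_pdivlMr// mul1r.
have step n : 0 < a n /\ r * a n <= a n.+1.
  elim: n => [|n [an h]]; first by rewrite /r divfK ?gt_eqF.
  have an1 : 0 < a n.+1.
    by apply: lt_le_trans h; rewrite mulr_gt0// (lt_trans _ r1).
  split => //; rewrite -(ler_pM2l an).
  apply: le_trans (aS n); rewrite expr2 mulrA (mulrC (a n)).
  by rewrite ler_wpM2r// ltW.
have geo n : r ^+ n * a 0 <= a n.
  elim: n => [|n IH]; first by rewrite mul1r.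
  apply: le_trans (step n).2; rewrite exprS -mulrA ler_wpM2l//.
  by rewrite ltW// (lt_trans _ r1).
(* Bernoulli's inequality, by which the geometric growth of [a] outruns the bound [M]. *)
have bern n : 1 + n%:R * (r - 1) <= r ^+ n.
  elim: n => [|n IH]; first by rewrite mul0r addr0.
  rewrite exprS; apply: (@le_trans _ _ (r * (1 + n%:R * (r - 1)))); last first.
    by rewrite ler_wpM2l// ltW// (lt_trans _ r1).
  have -> : r * (1 + n%:R * (r - 1)) = 1 + n.+1%:R * (r - 1) + n%:R * (r - 1) ^+ 2.
    by rewrite -(natr1 n); ring.
  by rewrite lerDl mulr_ge0// sqr_ge0.
have [n Mn] : exists n : nat, M / a 0 / (r - 1) < n%:R.
    exact: exists_nat_gt.
have := le_trans (geo n) (bM n); rewrite leNgt => /negP; apply.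
have := lt_le_trans _ (bern n) => /(_ (M / a 0)) h.
rewrite -ltr_pdivrMr//; apply: h.
move: Mn; rewrite ltr_pdivrMr ?subr_gt0// => /lt_trans; apply.
lra.
Qed.

End psd_form.

(** The elements are functions rather than classes modulo null sets, so [ip] is only semidefinite;
    the predicate [dom] on an ambient space marks where it makes sense. *)
Record ipspace (R : realType) (V : lmodType R) := IPSpace {
  dom :> V -> Prop;
  ip : V -> V -> R;
  domL : forall a u v, dom u -> dom v -> dom (a *: u + v);
  ip_psd : psd dom ip }.

(** The operators act on functions and are determined only up to null sets, hence laws tested
    against a vector [v]. Linearity follows, in the same weak sense, from [op_sym]. *)
Record semigroup (R : realType) (V : lmodType R) (H : ipspace V) := Semigroup {
  op :> R -> V -> V;
  op_dom : forall t u, 0 <= t -> H u -> H (op t u);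
  op_sym : forall t u v, 0 <= t -> H u -> H v ->
    ip H (op t u) v = ip H u (op t v);
  op_comp : forall s t u v, 0 <= s -> 0 <= t -> H u -> H v ->
    ip H (op s (op t u)) v = ip H (op (s + t) u) v;
  op0 : forall u v, H u -> H v -> ip H (op 0 u) v = ip H u v;
  op_contr : forall t u, 0 <= t -> H u -> ip H (op t u) (op t u) <= ip H u u }.

Section semigroup_form.
Variables (R : realType) (V : lmodType R) (H : ipspace V).
Implicit Types (u v w : V) (t : R).

Local Notation "<< u , v >>" := (ip H u v).
Local Notation q u := (ip H u u).

Definition eform (T : semigroup H) t u v := t^-1 * (<<u, v>> - <<T t u, v>>).

Definition form (T : semigroup H) u : \bar R :=
  ereal_sup [set (eform T t u u)%:E | t in [set t | 0 < t]].

(** A squared norm, infinite off the form domain; being extended-valued it can be estimated before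
    finiteness is known. *)
Definition norm1 (T : semigroup H) u : \bar R := (form T u + (q u)%:E)%E.

Section one_semigroup.
Variable T : semigroup H.
Let DL := @domL _ _ H.
Let hip := ip_psd H.

(** [T t] is weakly the square of the symmetric operator [T (t / 2)]; the positivity statements
    below start here. *)
Lemma op_sqr t u : 0 <= t -> H u -> <<T t u, u>> = q (T (t / 2) u).
Proof.
move=> t0 Hu; have t2 : 0 <= t / 2 by rewrite divr_ge0.
rewrite -op_sym//; last exact: op_dom.
by rewrite op_comp// -splitr.
Qed.

Lemma op_le t u : 0 <= t -> H u -> <<T t u, u>> <= q u.
Proof. by move=> t0 Hu; rewrite op_sqr// op_contr// divr_ge0. Qed.

Lemma op_ge0 t u : 0 <= t -> H u -> 0 <= <<T t u, u>>.
Proof.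
by move=> t0 Hu; rewrite op_sqr// (psd_ge0 hip)//; apply: op_dom; rewrite // divr_ge0.
Qed.

Lemma op_linear t a u v w : 0 <= t -> H u -> H v -> H w ->
  <<T t (a *: u + v), w>> = a * <<T t u, w>> + <<T t v, w>>.
Proof.
move=> t0 Hu Hv Hw; rewrite op_sym//; last exact: DL.
case: (hip) => _ hL _; rewrite hL//; last exact: op_dom.
by rewrite -!op_sym.
Qed.

Lemma eform_psd t : 0 < t -> psd H (eform T t).
Proof.
move=> t0; have t0' := ltW t0; split.
- move=> u v Hu Hv; rewrite /eform (psdC hip Hu Hv) op_sym// (psdC hip Hu)//.
  exact: op_dom.
- move=> a u v w Hu Hv Hw; rewrite /eform op_linear//.
  by case: hip => _ -> // _; ring.
- by move=> u Hu; rewrite /eform mulr_ge0 ?invr_ge0// subr_ge0 op_le.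
Qed.

Lemma eform_ge0 t u : 0 < t -> H u -> 0 <= eform T t u u.
Proof. by move=> t0 Hu; apply: (psd_ge0 (eform_psd t0)). Qed.

Lemma eform_le t u : 0 < t -> H u -> eform T t u u <= t^-1 * q u.
Proof.
move=> t0 Hu; have t0' := ltW t0; rewrite /eform ler_wpM2l ?invr_ge0//.
by rewrite gerBl op_ge0.
Qed.

(** [C] is symmetric for the form [eform T t] too, and along its iterates that form is bounded by
    [t^-1 * q u], so [psd_contraction] applies. [C] will be an operator of the same semigroup or of
    a commuting one. *)
Lemma eform_commute_le t (C : V -> V) u : 0 < t ->
  (forall v, H v -> H (C v)) ->
  (forall v w, H v -> H w -> <<C v, w>> = <<v, C w>>) ->
  (forall v w, H v -> H w -> <<T t (C v), w>> = <<C (T t v), w>>) ->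
  (forall v, H v -> q (C v) <= q v) ->
  H u -> eform T t (C u) (C u) <= eform T t u u.
Proof.
move=> t0 HC Csym CT Cq Hu; have t0' := ltW t0.
have Hn n : H (iter n C u) by elim: n => //= n; exact: HC.
apply: (psd_contraction DL (eform_psd t0) (M := t^-1 * q u)) => //.
  move=> v w Hv Hw; rewrite /eform Csym// CT// Csym//; exact: op_dom.
move=> n; apply: (le_trans (eform_le t0 (Hn n))).
rewrite ler_wpM2l ?invr_ge0//; elim: n => //= n; apply: le_trans.
exact: Cq.
Qed.

Lemma op_commute s t u v : 0 <= s -> 0 <= t -> H u -> H v ->
  <<T s (T t u), v>> = <<T t (T s u), v>>.
Proof. by move=> s0 t0 Hu Hv; rewrite !op_comp// addrC. Qed.

Lemma eform_op_le s t u : 0 <= s -> 0 < t -> H u ->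
  eform T t (T s u) (T s u) <= eform T t u u.
Proof.
move=> s0 t0 Hu; apply: eform_commute_le => //.
- by move=> v; apply: op_dom.
- by move=> v w; apply: op_sym.
- by move=> v w ? ?; apply: op_commute => //; exact: ltW.
- by move=> v; apply: op_contr.
Qed.

Let gap t u := q u - <<T t u, u>>.

Lemma eform_gap t u : 0 < t -> gap t u = t * eform T t u u.
Proof. by move=> t0; rewrite /gap /eform mulrA divff ?mul1r// gt_eqF. Qed.

Lemma op_decr s t u : 0 <= s -> 0 <= t -> H u ->
  <<T (s + t) u, u>> <= <<T s u, u>>.
Proof.
move=> s0 t0 Hu; have s2 : 0 <= s / 2 by rewrite divr_ge0.
have HT := op_dom T s2 Hu.
rewrite (op_sqr s0)//; apply: le_trans (op_le t0 HT).
rewrite op_comp// -op_sym//; last by apply: op_dom => //; rewrite addr_ge0.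
rewrite op_comp//; last by rewrite addr_ge0.
by rewrite addrCA -splitr addrC.
Qed.

(** Convexity of [r |-> <<T r u, u>>]: its decrease over [s, s + t] is the gap of [T (s / 2) u],
    hence at most the gap of [u] by [eform_op_le]. *)
Lemma gap_step s t u : 0 <= s -> 0 < t -> H u ->
  <<T s u, u>> - <<T (s + t) u, u>> <= gap t u.
Proof.
move=> s0 t0 Hu; have s2 : 0 <= s / 2 by rewrite divr_ge0.
have HT := op_dom T s2 Hu; have t0' := ltW t0.
rewrite eform_gap//; apply: le_trans (_ : t * eform T t (T (s / 2) u) (T (s / 2) u) <= _).
  rewrite -eform_gap// /gap -op_sqr// op_comp// -op_sym//; last by apply: op_dom => //; rewrite addr_ge0.
  rewrite op_comp//; last by rewrite addr_ge0.
  by rewrite addrCA -splitr addrC.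
by rewrite ler_wpM2l// eform_op_le.
Qed.

Lemma gap_mul n t u : 0 < t -> H u -> gap (n%:R * t) u <= n%:R * gap t u.
Proof.
move=> t0 Hu; have t0' := ltW t0; elim: n => [|n IH].
  by rewrite !mul0r /gap op0// subrr.
have := gap_step (_ : 0 <= n%:R * t) t0 Hu.
rewrite mulr_ge0// => /(_ isT).
rewrite -natr1 !mulrDl !mul1r => h; move: IH h; rewrite /gap; lra.
Qed.

(* The discretization error of [t |-> eform T t u u] at [s] with mesh [t]. *)
Lemma eform_mono s t u : 0 < s -> 0 < t -> H u ->
  eform T s u u <= (1 + t / s) * eform T t u u.
Proof.
move=> s0 t0 Hu.
(* [n%:R * t] lies between [s] and [s + t]; the excess over [s] is what the factor [1 + t / s] pays
   for. *)
pose n := (Num.truncn (s / t)).+1.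
have st0 : 0 <= s / t by rewrite divr_ge0// ltW.
have /andP[nl nu] := Num.Theory.truncn_itv st0.
have sn : s <= n%:R * t by rewrite -ler_pdivrMr// ltW.
have ns : n%:R * t <= s + t.
  by rewrite /n -natr1 mulrDl mul1r lerD2r -ler_pdivlMr.
have : gap s u <= n%:R * gap t u.
  apply: le_trans (gap_mul n t0 Hu); rewrite /gap lerB//.
  have -> : n%:R * t = s + (n%:R * t - s) by ring.
  by apply: op_decr; rewrite ?subr_ge0// ltW.
rewrite !eform_gap// mulrA => h.
have h2 : s * eform T s u u <= (s + t) * eform T t u u.
  by apply: le_trans h _; rewrite ler_wpM2r// eform_ge0.
rewrite -(ler_pM2l s0); apply: le_trans h2 _.
have -> : s * ((1 + t / s) * eform T t u u) = (s + t) * eform T t u u.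
  by field; rewrite gt_eqF.
by [].
Qed.

(** Monotonicity is exact when the time is halved. Dyadic times thus give monotone sequences, to
    which monotone convergence applies. *)
Lemma eform_half t u : 0 < t -> H u -> eform T t u u <= eform T (t / 2) u u.
Proof.
move=> t0 Hu; have t2 : 0 < t / 2 by rewrite divr_gt0.
have := gap_mul 2 t2 Hu; rewrite mulrCA divff// mulr1 !eform_gap//.
have -> : 2 * (t / 2 * eform T (t / 2) u u) = t * eform T (t / 2) u u by field.
by rewrite ler_pM2l.
Qed.

Lemma eform_dyadic n t u : 0 < t -> H u ->
  eform T t u u <= eform T (t / 2 ^+ n) u u.
Proof.
move=> t0 Hu; elim: n => [|n /le_trans]; first by rewrite expr0 divr1.
apply; rewrite exprSr invfM mulrA; apply: eform_half => //.
by rewrite divr_gt0// exprn_gt0.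
Qed.

Lemma form_ge t u : 0 < t -> ((eform T t u u)%:E <= form T u)%E.
Proof. by move=> t0; apply: ereal_sup_ubound; exists t. Qed.

Lemma form_ge0 u : H u -> (0 <= form T u)%E.
Proof.
by move=> Hu; apply: le_trans (form_ge u ltr01); rewrite lee_fin eform_ge0.
Qed.

Lemma form_leP u (M : \bar R) :
  (forall t, 0 < t -> ((eform T t u u)%:E <= M)%E) -> (form T u <= M)%E.
Proof. by move=> h; apply: ge_ereal_sup => _ [t t0 <-]; exact: h. Qed.

(** At fixed [s] the error factor [1 + 2 ^- n / s] of [eform_mono] tends to 1. A monotone sequence,
    unlike an uncountable supremum, can be exchanged with an integral. *)
Lemma form_dyadic u : H u ->
  form T u = ereal_sup (range (fun n => (eform T (2 ^- n) u u)%:E)).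
Proof.
move=> Hu; apply/le_anti/andP; split; last first.
  by apply: ge_ereal_sup => _ [n _ <-]; apply: form_ge; rewrite invr_gt0 exprn_gt0.
set S := ereal_sup _.
have S0 : (0 <= S)%E.
  apply: (@le_trans _ _ (eform T (2 ^- 0) u u)%:E).
    by rewrite lee_fin eform_ge0// invr_gt0 exprn_gt0.
  by apply: ereal_sup_ubound; exists 0%N.
apply: form_leP => s s0.
case E : S S0 => [M||] // M0; last by rewrite leey.
rewrite lee_fin; apply/ler_addgt0Pr => e e0.
have [n hn] : exists n : nat, M / (s * e) < n%:R.
    exact: exists_nat_gt.
have p2 : 0 < 2 ^- n :> R by rewrite invr_gt0 exprn_gt0.
have hM : eform T (2 ^- n) u u <= M.
  by rewrite -lee_fin -E; apply: ereal_sup_ubound; exists n.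
apply: le_trans (eform_mono s0 p2 Hu) _.
have n2 : n%:R <= 2 ^+ n :> R by rewrite -natrX ler_nat ltnW// ltn_expl.
apply: (@le_trans _ _ ((1 + 2 ^- n / s) * M)).
  by rewrite ler_wpM2l// addr_ge0// divr_ge0// ltW.
rewrite mulrDl mul1r lerD2l.
have -> : 2 ^- n / s * M = (M / (s * e)) * e / 2 ^+ n.
  by field; rewrite ?gt_eqF ?exprn_gt0.
rewrite ler_pdivrMr ?exprn_gt0// mulrC ler_wpM2l// ltW//.
exact: lt_le_trans n2.
Qed.

Lemma form_cvg u : H u -> (form T u < +oo)%E ->
  eform T t u u @[t --> 0^'+] --> fine (form T u).
Proof.
move=> Hu fin; have f0 := form_ge0 Hu.
have ff : form T u = (fine (form T u))%:E by rewrite fineK// ge0_fin_numE.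
set l := fine _ in ff *.
have l0 : 0 <= l by rewrite -lee_fin -ff.
apply/cvgrPdist_le => e e0.
have [s s0 hs] : exists2 s, 0 < s & l - e / 2 < eform T s u u.
  have : ((l - e / 2)%:E < form T u)%E by rewrite ff lte_fin; lra.
  move/ereal_sup_gt => [_ [s s0 <-]]; rewrite lte_fin => ?; by exists s.
have tl t : 0 < t -> eform T t u u <= l.
  by move=> t0; rewrite -lee_fin -ff; exact: form_ge.
near=> t.
have t0 : 0 < t by near: t; exact: nbhs_right_gt.
rewrite ger0_norm ?subr_ge0 ?tl//.
have ts : t * (l + 1) / s <= e / 2.
  rewrite ler_pdivrMr// -ler_pdivlMr; last by lra.
  near: t; apply: nbhs_right_le; rewrite divr_gt0// ?mulr_gt0//; lra.
have := eform_mono s0 t0 Hu; have := tl _ t0.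
have : t / s * eform T t u u <= t * (l + 1) / s.
  rewrite mulrAC ler_pM2r ?invr_gt0// ler_pM2l//; have := tl _ t0; lra.
rewrite mulrDl mul1r; lra.
Unshelve. all: by end_near. Qed.

(** A limit along small times bounds [eform] at every [s] through [eform_mono], so the supremum is
    finite and [form_cvg] identifies it. In the bound [2 * (l + 1)], the 2 comes from [t <= s] and
    [l + 1] from closeness to the limit. *)
Lemma cvg_form u (l : R) : H u ->
  eform T t u u @[t --> 0^'+] --> l -> form T u = l%:E.
Proof.
move=> Hu cl; suff fin : (form T u < +oo)%E.
  have /(cvg_lim (@Rhausdorff R)) <- := cl.
  rewrite (cvg_lim (@Rhausdorff R) (form_cvg Hu fin)).
  by rewrite fineK// ge0_fin_numE// form_ge0.
apply: (@le_lt_trans _ _ (2 * (l + 1))%:E); last by rewrite ltry.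
apply: form_leP => s s0; rewrite lee_fin.
have /cvgrPdist_le/(_ _ ltr01) cl1 := cl.
near (0 : R)^'+ => t.
have t0 : 0 < t by near: t; exact: nbhs_right_gt.
have ts : t / s <= 1.
  by rewrite ler_pdivrMr// mul1r; near: t; exact: nbhs_right_le.
have tl : `|l - eform T t u u| <= 1 by near: t.
have tl2 : eform T t u u <= l + 1 by move: tl; rewrite ler_norml => /andP[? ?]; lra.
apply: le_trans (eform_mono s0 t0 Hu) _; apply: ler_pM => //.
- by rewrite addr_ge0// divr_ge0// ltW.
- exact: eform_ge0.
- lra.
Unshelve. all: by end_near. Qed.

Lemma form_young (dl : R) u v : 0 < dl -> H u -> H v ->
  (form T u <= (1 + dl)%:E * form T v + (1 + dl^-1)%:E * form T (u - v))%E.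
Proof.
move=> dl0 Hu Hv; apply: form_leP => t t0.
have p1 : 0 <= 1 + dl by lra.
have p2 : 0 <= 1 + dl^-1 by rewrite addr_ge0// invr_ge0 ltW.
apply: (@le_trans _ _ ((1 + dl) * eform T t v v
    + (1 + dl^-1) * eform T t (u - v) (u - v))%:E).
  by rewrite lee_fin; exact: (psd_young DL (eform_psd t0)).
rewrite EFinD !EFinM; apply: leeD; apply: lee_wpmul2l; rewrite ?lee_fin//;
  exact: form_ge.
Qed.

Lemma form_lty u v : H u -> H v -> (form T v < +oo)%E ->
  (form T (u - v) < +oo)%E -> (form T u < +oo)%E.
Proof.
move=> Hu Hv fv fuv; apply: le_lt_trans (form_young ltr01 Hu Hv) _.
by rewrite lte_add_pinfty// lte_mul_pinfty ?lee_fin ?addr_ge0 ?invr_ge0//;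
  exact: form_ge0 (linB DL _ _).
Qed.

Lemma formZ a u : H u -> form T (a *: u) = ((a ^+ 2)%:E * form T u)%E.
Proof.
move=> Hu; have Ez t : 0 < t -> eform T t (a *: u) (a *: u) = a ^+ 2 * eform T t u u.
  move=> t0; have ht := eform_psd t0.
  by rewrite (psdZl DL ht) ?(psdZr DL ht) ?mulrA//; exact: linZ.
apply/le_anti/andP; split.
  apply: form_leP => t t0; rewrite Ez// EFinM lee_wpmul2l ?lee_fin ?sqr_ge0//.
  exact: form_ge.
have [->|a0] := eqVneq a 0.
  by rewrite expr0n/= mul0e form_ge0//; exact: linZ.
have a2 : 0 < a ^+ 2 by rewrite lt_neqAle sqr_ge0 eq_sym sqrf_eq0 a0.
rewrite -lee_pdivlMl//; apply: form_leP => t t0; rewrite lee_pdivlMl// -EFinM -Ez//.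
exact: form_ge.
Qed.

Lemma formN u : H u -> form T (- u) = form T u.
Proof. by move=> Hu; rewrite -scaleN1r formZ// sqrrN expr1n mul1e. Qed.

Lemma formB_sym u v : H u -> H v -> form T (u - v) = form T (v - u).
Proof. by move=> Hu Hv; rewrite -formN ?opprB//; exact: linB. Qed.

Lemma form_linear_lty a u v : H u -> H v -> (form T u < +oo)%E ->
  (form T v < +oo)%E -> (form T (a *: u + v) < +oo)%E.
Proof.
move=> Hu Hv fu fv; apply: (form_lty (v := v)) => //; first exact: DL.
by rewrite addrK formZ// lte_mul_pinfty// ?lee_fin ?sqr_ge0.
Qed.

(** For L^2 this is what equality almost everywhere becomes when functions are seen through pairings
    only. *)
Definition weak_eq u v := forall w, H w -> <<u, w>> = <<v, w>>.

Lemma weak_eq_ip u v : H u -> H v -> weak_eq u v -> q u = q v.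
Proof.
by move=> Hu Hv uv; rewrite uv// (psdC hip Hv Hu) uv.
Qed.

Lemma weak_eq_eform t u v : 0 < t -> H u -> H v -> weak_eq u v ->
  eform T t u u = eform T t v v.
Proof.
move=> t0 Hu Hv uv; have t0' := ltW t0; rewrite /eform (weak_eq_ip Hu Hv uv).
rewrite op_sym// uv; last exact: op_dom.
rewrite (psdC hip Hv); last exact: op_dom.
rewrite op_sym// uv; last exact: op_dom.
by rewrite (psdC hip Hv)//; exact: op_dom.
Qed.

Lemma weak_eq_form u v : H u -> H v -> weak_eq u v -> form T u = form T v.
Proof.
move=> Hu Hv uv; congr ereal_sup; apply/seteqP; split => _ [t /= t0 <-];
  by exists t => //; rewrite (weak_eq_eform t0 Hu Hv).
Qed.

(** The left-hand side is [q u - 2 <<T s u, u>> + <<T (s + s) u, u>>], and the last term is at most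
    [<<T s u, u>>]. *)
Lemma ip_opB s u : 0 <= s -> H u -> q (u - T s u) <= gap s u.
Proof.
move=> s0 Hu; have HT := op_dom T s0 Hu.
rewrite (psd_sqrB DL hip)// (psdC hip Hu HT) -op_sym// op_comp//.
have := op_decr s0 s0 Hu; rewrite /gap; lra.
Qed.

Lemma ip_op_form s u : 0 < s -> H u ->
  ((q (u - T s u))%:E <= s%:E * form T u)%E.
Proof.
move=> s0 Hu; apply: le_trans (_ : (s * eform T s u u)%:E <= _)%E.
  by rewrite lee_fin -eform_gap// ip_opB// ltW.
by rewrite EFinM lee_wpmul2l ?lee_fin ?(ltW s0)//; exact: form_ge.
Qed.

(* The increments of [r |-> <<T r u, u>>] decrease in absolute value and sum up
   to at most [q u]. *)
Lemma form_op_bound s u : 0 < s -> H u ->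
  (form T (T s u) <= (q u / s)%:E)%E.
Proof.
move=> s0 Hu; have HT := op_dom T (ltW s0) Hu; apply: form_leP => r' r0'.
have [[|k] hk] := exists_nat_gt (2 * s / r').
  by move: hk; rewrite ltNge divr_ge0 ?mulr_ge0// ltW.
(* The mesh divides [2 * s] rather than [s]: an increment of [<<T a u, u>>] is the form at
   [T (a / 2) u], and [T s u] corresponds to [a = 2 * s]. *)
pose r := 2 * s / k.+1%:R.
have r0 : 0 < r by rewrite /r divr_gt0 ?mulr_gt0.
have rr' : r <= r' by rewrite /r ler_pdivrMr// -ler_pdivrMl// mulrC (ltW hk).
rewrite lee_fin; apply: le_trans (eform_mono r0' r0 HT) _.
have E0 := eform_ge0 r0 HT.
suff : k.+1%:R * (r * eform T r (T s u) (T s u)) <= q u.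
  have -> : k.+1%:R * (r * eform T r (T s u) (T s u)) =
      2 * s * eform T r (T s u) (T s u).
    by rewrite mulrA /r; congr (_ * _); field; rewrite addrC natr1 pnatr_eq0.
  move=> h.
  rewrite ler_pdivlMr//; apply: le_trans h.
  have : r / r' <= 1 by rewrite ler_pdivrMr// mul1r.
  move=> h1; rewrite mulrAC ler_wpM2r// mulrDl mul1r.
  have : r / r' * s <= 1 * s by rewrite ler_wpM2r// ltW.
  lra.
have half a : 0 <= a -> <<T a u, u>> - <<T (a + r) u, u>> =
    r * eform T r (T (a / 2) u) (T (a / 2) u).
  move=> a0; have a2 : 0 <= a / 2 by rewrite divr_ge0.
  have HTa := op_dom T a2 Hu; have r0w := ltW r0.
  rewrite -eform_gap// /gap -op_sqr// op_comp// -op_sym//; last first.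
    by apply: op_dom => //; rewrite addr_ge0.
  rewrite op_comp//; last by rewrite addr_ge0.
  by rewrite addrCA -splitr addrC.
(* Each of the first [k.+1] increments is at least the one at [T s u], which arises from
   [T (n%:R * r / 2) u] by running the semigroup for the remaining time. *)
have mono n : (n <= k.+1)%N ->
    n%:R * (r * eform T r (T s u) (T s u)) <= q u - <<T (n%:R * r) u, u>>.
  elim: n => [_|n IH nk]; first by rewrite !mul0r op0// subrr.
  have nr0 : 0 <= n%:R * r by rewrite mulr_ge0// ltW.
  have := half _ nr0.
  have : r * eform T r (T s u) (T s u) <=
         r * eform T r (T (n%:R * r / 2) u) (T (n%:R * r / 2) u).
    rewrite ler_wpM2l ?(ltW r0)//.
    have nrs : 0 <= s - n%:R * r / 2.
      have -> : s = k.+1%:R * r / 2 by rewrite /r; field; rewrite addrC natr1 pnatr_eq0.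
      by rewrite subr_ge0 ler_pM2r ?invr_gt0// ler_pM2r// ler_nat ltnW.
    have nr2 : 0 <= n%:R * r / 2 by rewrite divr_ge0.
    have HTn := op_dom T nr2 Hu.
    apply: le_trans (eform_op_le nrs r0 HTn).
    rewrite le_eqVlt; apply/orP; left; apply/eqP; apply: weak_eq_eform => //.
      exact: op_dom.
    by move=> w Hw; rewrite op_comp// subrK.
  have := IH (ltnW nk); rewrite -[n.+1%:R]natr1 !mulrDl !mul1r; lra.
apply: le_trans (mono _ (leqnn _)) _; rewrite gerBl op_ge0// mulr_ge0// ltW//.
Qed.

(** For an approximating form E, E(u - T_s u) = E(u) - 2 E(T_{s/2} u) + E(T_s u) <= E(u) - E(T_{s/2}
    u). So it is enough that [T (s / 2) u] keeps nearly all the energy of [u]. This holds at one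
    time [r] for small [s], and it persists at the times [r / 2 ^+ n] because dyadic approximations
    increase. *)
Lemma form_op_cvg u (e : R) : H u -> (form T u < +oo)%E -> 0 < e ->
  exists2 s, 0 < s & (norm1 T (u - T s u) < e%:E)%E.
Proof.
move=> Hu fin e0; have f0 := form_ge0 Hu.
have ff : form T u = (fine (form T u))%:E by rewrite fineK// ge0_fin_numE.
set L := fine _ in ff; have L0 : 0 <= L by rewrite -lee_fin -ff.
have EL t : 0 < t -> eform T t u u <= L by move=> t0; rewrite -lee_fin -ff form_ge.
(* The final error is [4 * c] for the form and [c] for [q], well below [e]. *)
pose c := e / 16; have c0 : 0 < c by rewrite /c; lra.
have [r r0 hr] : exists2 r, 0 < r & L - c < eform T r u u.
  have : ((L - c)%:E < form T u)%E by rewrite ff lte_fin; lra.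
  by move/ereal_sup_gt => [_ [r r0 <-]]; rewrite lte_fin => ?; exists r.
pose dl := c / (2 * (L + 1)).
have dl0 : 0 < dl by rewrite /dl divr_gt0// mulr_gt0//; lra.
have dlL : dl * L <= c / 2.
  rewrite /dl -mulrA ler_wpM2l ?(ltW c0)// mulrC ler_pdivrMr; last by lra.
  have -> : 2^-1 * (2 * (L + 1)) = L + 1 by field.
  lra.
pose K := (1 + dl^-1) / r * L + 1.
have K0 : 0 < K.
  by rewrite /K ltr_wpDl// mulr_ge0// divr_ge0 ?addr_ge0 ?invr_ge0// ltW.
pose s := Num.min (c / (2 * K)) (c / (L + 1)).
have s0 : 0 < s by rewrite /s lt_min !divr_gt0 ?mulr_gt0//; lra.
have s2 : 0 < s / 2 by lra.
have sK : s * ((1 + dl^-1) / r * L) <= c / 2.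
  apply: (@le_trans _ _ (s * K)); first by rewrite ler_wpM2l ?(ltW s0)// lerDl.
  rewrite -ler_pdivlMr//; apply: (@le_trans _ _ (c / (2 * K))).
    by rewrite /s ge_min lexx.
  by rewrite le_eqVlt; apply/orP; left; apply/eqP; field; rewrite gt_eqF.
have sL : s * L <= c.
  apply: (@le_trans _ _ (s * (L + 1))); first by rewrite ler_wpM2l ?(ltW s0)// lerDl.
  by rewrite -ler_pdivlMr; [rewrite /s ge_min lexx orbT|lra].
have qs t : 0 < t -> q (u - T t u) <= t * L.
  by move=> t0; rewrite -lee_fin EFinM -ff; exact: ip_op_form.
have HT t : 0 < t -> H (T t u) by move=> t0; apply: op_dom => //; exact: ltW.
have HB t : 0 < t -> H (u - T t u) by move=> t0; apply: linB => //; exact: HT.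
(* At the fixed time [r] the form is bounded by [r^-1 * q], and [T (s / 2) u] is close to [u] for
   [q]; [dl] and [s] were chosen so that each of the two errors in [psd_young] is at most
   [c / 2]. *)
have low : L - 2 * c <= eform T r (T (s / 2) u) (T (s / 2) u).
  have := psd_young DL (eform_psd r0) dl0 Hu (HT _ s2).
  have := eform_le r0 (HB _ s2).
  have := qs _ s2.
  have : eform T r (T (s / 2) u) (T (s / 2) u) <= L.
    by apply: le_trans (EL _ r0); apply: eform_op_le => //; exact: ltW.
  set X := eform T r (T (s / 2) u) (T (s / 2) u).
  set Y := eform T r (u - _) _; set Z := q _ => XL Zs YZ Y1.
  have : dl * X <= c / 2 by apply: le_trans dlL; rewrite ler_wpM2l// ltW.
  have : (1 + dl^-1) * Y <= c / 2.
    apply: le_trans sK; apply: (@le_trans _ _ ((1 + dl^-1) * (r^-1 * (s * L)))).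
      rewrite ler_wpM2l ?addr_ge0 ?invr_ge0 ?(ltW dl0)//.
      apply: le_trans YZ _; rewrite ler_wpM2l ?invr_ge0 ?(ltW r0)//.
      apply: le_trans Zs _; rewrite ler_wpM2r//; lra.
    by rewrite le_eqVlt; apply/orP; left; apply/eqP; field; rewrite !gt_eqF.
  move: Y1 hr; rewrite mulrDl mul1r; lra.
have dy n : eform T (r / 2 ^+ n) (u - T s u) (u - T s u) <= 2 * c.
  have rn : 0 < r / 2 ^+ n by rewrite divr_gt0// exprn_gt0.
  have ht := eform_psd rn.
  rewrite (psd_sqrB DL ht)//; last exact: HT.
  have -> : eform T (r / 2 ^+ n) u (T s u) =
      eform T (r / 2 ^+ n) (T (s / 2) u) (T (s / 2) u).
    rewrite /eform -!op_sym ?(ltW s2) ?(ltW s0) ?(ltW rn)//; try by [exact: op_dom (ltW rn) _ | apply: HT].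
    rewrite !op_comp ?addr_ge0 ?(ltW s2) ?(ltW s0) ?(ltW rn)//; last by apply: HT.
      by rewrite -splitr addrAC -splitr.
    by apply: op_dom; [exact: ltW|exact: HT].
  have : eform T (r / 2 ^+ n) (T s u) (T s u) <=
      eform T (r / 2 ^+ n) (T (s / 2) u) (T (s / 2) u).
    apply: le_trans (eform_op_le (ltW s2) rn (HT _ s2)).
    rewrite le_eqVlt; apply/orP; left; apply/eqP; apply: weak_eq_eform => //.
    - exact: HT.
    - by apply: op_dom; [exact: ltW|exact: HT].
    - by move=> w Hw; rewrite op_comp ?(ltW s2)// -splitr.
  have := EL _ rn.
  have := eform_dyadic n r0 (HT _ s2); lra.
exists s => //; rewrite /norm1.
(* A factor 2 leads from the times [r / 2 ^+ n] to an arbitrary time. *)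
have : (form T (u - T s u) <= (4 * c)%:E)%E.
  apply: form_leP => r' r0'; rewrite lee_fin.
  have [n hn] := exists_nat_gt (r / r').
  have n2 : n%:R <= 2 ^+ n :> R by rewrite -natrX ler_nat ltnW// ltn_expl.
  have rn : 0 < r / 2 ^+ n by rewrite divr_gt0// exprn_gt0.
  apply: le_trans (eform_mono r0' rn (HB _ s0)) _.
  have h1 : r / 2 ^+ n / r' <= 1.
    rewrite mulrAC ler_pdivrMr ?exprn_gt0// mul1r; apply: le_trans n2; exact: ltW.
  have := dy n; have := eform_ge0 rn (HB _ s0).
  set X := eform _ _ _ _ => X0 X2.
  have : r / 2 ^+ n / r' * X <= 1 * X by rewrite ler_wpM2r.
  rewrite mulrDl mul1r; lra.
move=> h; apply: le_lt_trans (leeD h (_ : _ <= c%:E)%E) _.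
  by rewrite lee_fin; apply: le_trans sL; exact: qs.
by rewrite -EFinD lte_fin /c; lra.
Qed.

Lemma norm1_ge0 u : H u -> (0 <= norm1 T u)%E.
Proof. by move=> Hu; rewrite adde_ge0 ?form_ge0// lee_fin (psd_ge0 hip). Qed.

Lemma norm1D u v : H u -> H v ->
  (norm1 T (u + v) <= 2%:E * norm1 T u + 2%:E * norm1 T v)%E.
Proof.
move=> Hu Hv; have Huv := linD DL Hu Hv.
have := form_young ltr01 Huv Hv; rewrite addrK invr1 => h1.
have h2 := psd_young DL hip ltr01 Huv Hv; rewrite addrK invr1 in h2.
rewrite /norm1 !ge0_muleDr ?form_ge0 ?lee_fin ?(psd_ge0 hip)//.
apply: le_trans (leeD h1 (_ : _ <= (2 * q v)%:E + (2 * q u)%:E)%E) _.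
  by rewrite -EFinD lee_fin.
by rewrite -!EFinM [leRHS]addeC addeACA.
Qed.

Lemma form_le_norm1 u : H u -> (form T u <= norm1 T u)%E.
Proof. by move=> Hu; rewrite leeDl// lee_fin (psd_ge0 hip). Qed.

Lemma ip_le_norm1 u : H u -> ((q u)%:E <= norm1 T u)%E.
Proof. by move=> Hu; rewrite leeDr// form_ge0. Qed.

End one_semigroup.

Lemma weak_eq_semigroup (S T : semigroup H) :
  (forall t u v, 0 < t -> H u -> H v -> <<S t u, v>> = <<T t u, v>>) ->
  forall u, H u -> form S u = form T u.
Proof.
move=> ST u Hu; congr ereal_sup; apply/seteqP; split => _ [t /= t0 <-];
  by exists t => //; rewrite /eform ST.
Qed.

(** The factor [(1 + dl) ^+ 2] is the cost of going from [u] to an approximant and back, each time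
    by a Young inequality. *)
Lemma lee_addgt0_mul (x y : \bar R) : (0 <= y)%E ->
  (forall dl e : R, 0 < dl -> 0 < e ->
    (x <= ((1 + dl) ^+ 2)%:E * y + e%:E)%E) ->
  (x <= y)%E.
Proof.
case: y => [y||] // y0 h; last by rewrite leey.
apply/lee_addgt0Pr => e e0; rewrite lee_fin in y0.
(* As [dl <= 1], expanding the square costs at most [3 * dl * y], that is half of [e]. *)
pose dl := Num.min 1 (e / (6 * (y + 1))).
have dl0 : 0 < dl by rewrite lt_min ltr01 divr_gt0// mulr_gt0//; lra.
have dl1 : dl <= 1 by rewrite ge_min lexx.
have e2 : 0 < e / 2 by lra.
apply: le_trans (h _ _ dl0 e2) _.
rewrite -EFinM -!EFinD lee_fin.
have : dl * (y + 1) <= e / 6.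
  apply: (@le_trans _ _ (e / (6 * (y + 1)) * (y + 1))).
    by rewrite ler_wpM2r; [|lra|rewrite ge_min lexx orbT].
  by rewrite le_eqVlt; apply/orP; left; apply/eqP; field; lra.
have : dl * dl <= dl * 1 by rewrite ler_wpM2l// ltW.
have -> : (1 + dl) ^+ 2 * y = y + 2 * (dl * y) + dl * dl * y by ring.
move=> h1.
have : dl * dl * y <= dl * y by rewrite ler_wpM2r// (le_trans h1)// mulr1.
rewrite mulrDr mulr1; lra.
Qed.

Section dense.
Variables (S T : semigroup H) (C : V -> Prop).
Hypothesis CH : forall f, C f -> H f.
Hypothesis ST : forall f, C f -> form S f = form T f.
Let DL := @domL _ _ H.
Let hip := ip_psd H.

Definition in_closure u :=
  forall e, 0 < e -> exists2 f, C f & (norm1 T (u - f) < e%:E)%E.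

(** At a fixed time [eform S t] is continuous for [q], so it passes from [u] to an approximant [f].
    There the two forms agree, and [form T f] leads back to [form T u] because [u - f] is small for
    [norm1 T]. The supremum over [t] is taken last. *)
Lemma form_le_of_dense u : H u -> in_closure u -> (form S u <= form T u)%E.
Proof.
move=> Hu cu; apply: lee_addgt0_mul; first exact: form_ge0.
move=> dl e dl0 e0; apply: form_leP => t t0.
(* Gathers the coefficients of the two errors, [form T (u - f)] and [t^-1 * q (u - f)]. *)
pose k := (1 + dl) * (1 + dl^-1) + (1 + dl^-1) * t^-1.
have dl1 : 0 < 1 + dl^-1 by rewrite addr_gt0// invr_gt0.
have dl2 : 0 < 1 + dl by lra.
have t1 : 0 < t^-1 by rewrite invr_gt0.
have k0 : 0 < k by rewrite addr_gt0// mulr_gt0.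
have ek0 : 0 < e / k by rewrite divr_gt0.
have [f Cf hf] := cu _ ek0; have Hf := CH Cf; have Huf := linB DL Hu Hf.
have h1 : ((eform S t u u)%:E <=
    (1 + dl)%:E * form S f + ((1 + dl^-1) * t^-1 * (e / k))%:E)%E.
  apply: (@le_trans _ _ ((1 + dl)%:E * (eform S t f f)%:E +
      ((1 + dl^-1) * (t^-1 * q (u - f)))%:E)%E).
    rewrite -EFinM -EFinD lee_fin; apply: le_trans (psd_young DL (eform_psd S t0) dl0 Hu Hf) _.
    by rewrite lerD2l ler_wpM2l ?(ltW dl1)//; exact: eform_le.
  apply: leeD; first by rewrite lee_wpmul2l ?lee_fin ?(ltW dl2)//; exact: form_ge.
  rewrite lee_fin -mulrA ler_wpM2l ?(ltW dl1)// ler_wpM2l ?(ltW t1)//.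
  by rewrite -lee_fin; apply: le_trans (ip_le_norm1 T Huf) (ltW hf).
apply: le_trans h1 _; rewrite ST//.
have h2 : (form T f <= (1 + dl)%:E * form T u + (1 + dl^-1)%:E * (e / k)%:E)%E.
  apply: le_trans (form_young T dl0 Hf Hu) _.
  rewrite leeD2l// lee_wpmul2l ?lee_fin ?(ltW dl1)// formB_sym//.
  by apply: le_trans (form_le_norm1 T Huf) (ltW hf).
apply: le_trans (leeD (lee_wpmul2l _ h2) (lexx _)) _; first by rewrite lee_fin ltW.
rewrite ge0_muleDr ?mule_ge0 ?form_ge0 ?lee_fin ?(ltW dl1) ?(ltW dl2) ?(ltW ek0)//.
rewrite muleA -!EFinM -addeA -EFinD -expr2 leeD2l// lee_fin.
rewrite mulrA -mulrDl -/k mulrCA divff ?mulr1// gt_eqF//.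
Qed.

Hypothesis CB : forall f g, C f -> C g -> C (f - g).

(** For the reverse inequality [form S (u - f)] has to be small. This is [form_le_of_dense] at
    [u - f], which is in the closure because [C] is stable under differences. *)
Lemma form_eq_of_dense u : H u -> in_closure u -> form S u = form T u.
Proof.
move=> Hu cu; apply/le_anti/andP; split; first exact: form_le_of_dense.
apply: lee_addgt0_mul; first exact: form_ge0.
move=> dl e dl0 e0.
pose k := (1 + dl) * (1 + dl^-1) + (1 + dl^-1).
have dl1 : 0 < 1 + dl^-1 by rewrite addr_gt0// invr_gt0.
have dl2 : 0 < 1 + dl by lra.
have k0 : 0 < k by rewrite addr_gt0// mulr_gt0.
have ek0 : 0 < e / k by rewrite divr_gt0.
have [f Cf hf] := cu _ ek0; have Hf := CH Cf; have Huf := linB DL Hu Hf.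
have fT : (form T (u - f) <= (e / k)%:E)%E.
  exact: le_trans (form_le_norm1 T Huf) (ltW hf).
have fS : (form S (u - f) <= (e / k)%:E)%E.
  apply: le_trans fT; apply: form_le_of_dense => // e' e'0.
  have [g Cg hg] := cu _ e'0; exists (g - f); first exact: CB.
  by rewrite opprB addrA subrK.
apply: le_trans (form_young T dl0 Hu Hf) _; rewrite -ST//.
have h2 : (form S f <= (1 + dl)%:E * form S u + (1 + dl^-1)%:E * (e / k)%:E)%E.
  apply: le_trans (form_young S dl0 Hf Hu) _.
  by rewrite leeD2l// lee_wpmul2l ?lee_fin ?(ltW dl1)// formB_sym.
apply: le_trans (leeD (lee_wpmul2l _ h2) (lee_wpmul2l _ fT)) _;
  rewrite ?lee_fin ?(ltW dl1) ?(ltW dl2)//.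
rewrite ge0_muleDr ?mule_ge0 ?form_ge0 ?lee_fin ?(ltW dl1) ?(ltW dl2) ?(ltW ek0)//.
rewrite muleA -!EFinM -addeA -EFinD -expr2 leeD2l// lee_fin.
rewrite mulrA -mulrDl -/k mulrCA divff ?mulr1// gt_eqF//.
Qed.

End dense.

Section product.
Variables A B : semigroup H.
Let DL := @domL _ _ H.
Let hip := ip_psd H.

Definition commuting (A B : semigroup H) := forall s t u v, 0 <= s -> 0 <= t ->
  H u -> H v -> <<A s (B t u), v>> = <<B t (A s u), v>>.

Hypothesis AB : commuting A B.

Let prod_op t u := A t (B t u).

Let prod_dom t u : 0 <= t -> H u -> H (prod_op t u).
Proof. by move=> t0 Hu; do 2 (apply: op_dom => //). Qed.

Let prod_sym t u v : 0 <= t -> H u -> H v ->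
  <<prod_op t u, v>> = <<u, prod_op t v>>.
Proof.
move=> t0 Hu Hv; rewrite /prod_op AB// op_sym//; last exact: op_dom.
rewrite op_sym//; exact: op_dom.
Qed.

Let prod_comp s t u v : 0 <= s -> 0 <= t -> H u -> H v ->
  <<prod_op s (prod_op t u), v>> = <<prod_op (s + t) u, v>>.
Proof.
move=> s0 t0 Hu Hv; rewrite /prod_op; have st0 := addr_ge0 s0 t0.
have HBu := op_dom B t0 Hu.
rewrite op_sym//; [|by do 2 (apply: op_dom => //); exact: op_dom..].
rewrite -AB//; [|exact: op_dom..].
rewrite op_sym//; [|by do 2 (apply: op_dom => //)|exact: op_dom].
rewrite op_comp//; [|do 2 apply: op_dom => //..].
have HB := op_dom B st0 Hu.
rewrite -(op_sym A t0 HB (op_dom A s0 Hv)) -(op_sym A s0 (op_dom A t0 HB) Hv).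
by rewrite op_comp.
Qed.

Let prod0 u v : H u -> H v -> <<prod_op 0 u, v>> = <<u, v>>.
Proof. by move=> Hu Hv; rewrite /prod_op op0 ?op0//; exact: op_dom. Qed.

Let prod_contr t u : 0 <= t -> H u -> q (prod_op t u) <= q u.
Proof.
move=> t0 Hu; apply: (le_trans (op_contr A t0 (op_dom B t0 Hu))).
exact: op_contr.
Qed.

Definition prod_semigroup : semigroup H :=
  Semigroup prod_dom prod_sym prod_comp prod0 prod_contr.

(** By commutation [<<A t (B t u), u>>] is [<<A t v, v>>] for [v = B (t / 2) u], while [q v] is
    [<<B t u, u>>]. *)
Lemma eform_prod t u : 0 < t -> H u -> eform prod_semigroup t u u =
  eform B t u u + eform A t (B (t / 2) u) (B (t / 2) u).
Proof.
move=> t0 Hu; have t0' := ltW t0; have t2 : 0 <= t / 2 by rewrite divr_ge0.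
have HBu := op_dom B t2 Hu.
have -> : eform prod_semigroup t u u = t^-1 * (q u - <<A t (B t u), u>>) by [].
have -> : <<A t (B t u), u>> = <<A t (B (t / 2) u), B (t / 2) u>>.
  rewrite -op_sym//; last exact: op_dom.
  rewrite -AB// !(op_sym A t0')//; [|exact: op_dom..].
  by rewrite op_comp// -?splitr//; exact: op_dom.
by rewrite /eform -(op_sqr B t0' Hu); ring.
Qed.

(** The upper bound holds because [B (t / 2)] commutes with [A] and so lowers its form. For the
    lower bound the suprema are separated: a time [r] for [A] and a time [r'] for [B] are fixed, and
    both are compared with a small common time [t = r / 2 ^+ n], at which [B (t / 2) u] is close to
    [u]. *)
Lemma form_prod u : H u -> form prod_semigroup u = (form A u + form B u)%E.
Proof.
move=> Hu; apply/le_anti/andP; split.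
  apply: form_leP => t t0; rewrite eform_prod// addrC EFinD.
  have t2 : 0 <= t / 2 by rewrite divr_ge0// ltW.
  apply: leeD; last exact: form_ge.
  apply: le_trans (form_ge A _ t0) _; apply: form_leP => r r0.
  apply: le_trans (form_ge A _ r0); rewrite lee_fin.
  apply: eform_commute_le => //.
  - by move=> v; exact: op_dom.
  - by move=> v w; exact: op_sym.
  - by move=> v w Hv Hw; apply: AB => //; exact: ltW.
  - by move=> v; exact: op_contr.
set P := form prod_semigroup u.
have P0 : (0 <= P)%E by exact: form_ge0.
have BP : (form B u <= P)%E.
  apply: form_leP => t t0; apply: le_trans (form_ge _ _ t0).
  rewrite lee_fin eform_prod// lerDl eform_ge0//.
  by apply: op_dom => //; rewrite divr_ge0// ltW.
have [Pfin|] := ltP P +oo%E; last by rewrite leye_eq => /eqP ->; rewrite leey.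
have PE : P = (fine P)%:E by rewrite fineK// ge0_fin_numE.
set p := fine P in PE; have p0 : 0 <= p by rewrite -lee_fin -PE.
suff main r r' : 0 < r -> 0 < r' -> eform A r u u + eform B r' u u <= p.
  have Bfin : form B u \is a fin_num.
    by rewrite ge0_fin_numE ?form_ge0//; exact: le_lt_trans BP Pfin.
  rewrite -leeBrDr//; apply: form_leP => r r0; rewrite leeBrDr// addeC -leeBrDr//.
  apply: form_leP => r' r0'; rewrite leeBrDr// -EFinD PE lee_fin addrC.
  exact: main.
move=> r0 r0'; rewrite -lerBrDr -lee_fin; apply: lee_addgt0_mul.
  rewrite lee_fin subr_ge0 -lee_fin -PE; apply: le_trans BP; exact: form_ge.
move=> dl e dl0 e0.
have dl1 : 0 < 1 + dl^-1 by rewrite addr_gt0// invr_gt0.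
pose k := (1 + dl^-1) * (r^-1 * ((r / 2) * p)) + e.
pose bb := eform B r' u u; have bb0 : 0 <= bb by exact: eform_ge0.
have bbp : bb <= p by rewrite -lee_fin -PE; apply: le_trans BP; exact: form_ge.
(* The first bound makes the error of replacing [u] by [B (t / 2) u] in [eform A r] at most [e / 2];
   the second one controls the factor [1 + t / r'] of [eform_mono] for [B]. *)
have [n hn] := exists_nat_gt (Num.max ((1 + dl^-1) * (p + 1) / e) (r / r' * (p + 1) / (e / (2 * (1 + dl))))).
move: hn; rewrite gt_max => /andP[hn1 hn2].
have n2 : n%:R <= 2 ^+ n :> R by rewrite -natrX ler_nat ltnW// ltn_expl.
have pn : 0 < 2 ^+ n :> R by rewrite exprn_gt0.
pose t := r / 2 ^+ n.
have t0 : 0 < t by rewrite divr_gt0.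
have t2 : 0 < t / 2 by lra.
have HBu := op_dom B (ltW t2) Hu.
have HuB := linB DL Hu HBu.
have hB : bb <= (1 + t / r') * eform B t u u by exact: eform_mono.
have hA : eform A r (B (t / 2) u) (B (t / 2) u) <=
          eform A t (B (t / 2) u) (B (t / 2) u) by exact: eform_dyadic.
have hP : eform B t u u + eform A t (B (t / 2) u) (B (t / 2) u) <= p.
  by rewrite -eform_prod// -lee_fin -PE; exact: form_ge.
have hq : q (u - B (t / 2) u) <= t / 2 * p.
  rewrite -lee_fin EFinM -PE; apply: le_trans (ip_op_form B t2 Hu) _.
  by rewrite lee_wpmul2l// lee_fin ltW.
have hY := psd_young DL (eform_psd A r0) dl0 Hu HBu.
have hE := eform_le A r0 HuB.
have hBp : eform B t u u <= p.
  rewrite -lee_fin -PE; apply: le_trans BP; exact: form_ge.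
have dl2 : 0 < 1 + dl by rewrite addr_gt0.
have ed : 0 < e / (2 * (1 + dl)) by rewrite divr_gt0// mulr_gt0.
have e1 : t / r' * (p + 1) <= e / (2 * (1 + dl)).
  have -> : t / r' * (p + 1) = r / r' * (p + 1) / 2 ^+ n.
    by rewrite /t; field; rewrite !gt_eqF.
  rewrite ler_pdivrMr//; rewrite ltr_pdivrMr// in hn2.
  by apply: le_trans (ltW hn2) _; rewrite mulrC ler_wpM2l// ltW.
have e2 : (1 + dl^-1) * (r^-1 * (t / 2 * p)) <= e / 2.
  have -> : (1 + dl^-1) * (r^-1 * (t / 2 * p)) = (1 + dl^-1) * p / 2 ^+ n / 2.
    by rewrite /t; field; rewrite !gt_eqF.
  rewrite ler_pM2r ?invr_gt0// ler_pdivrMr//; rewrite ltr_pdivrMr// in hn1.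
  apply: le_trans (_ : (1 + dl^-1) * (p + 1) <= _).
    by rewrite ler_wpM2l ?(ltW dl1)// lerDl.
  by apply: le_trans (ltW hn1) _; rewrite mulrC ler_wpM2l// ltW.
have e3 : (1 + dl^-1) * eform A r (u - B (t / 2) u) (u - B (t / 2) u) <= e / 2.
  apply: le_trans e2; rewrite ler_wpM2l ?(ltW dl1)//; apply: le_trans hE _.
  by rewrite ler_wpM2l// invr_ge0 ltW.
have e4 : t / r' * eform B t u u <= e / (2 * (1 + dl)).
  by apply: le_trans e1; apply: ler_wpM2l; [rewrite divr_ge0// ltW|rewrite (le_trans hBp)// lerDl].
rewrite -EFinM -EFinD lee_fin -/bb.
set X := eform A r (B (t / 2) u) _ in hY hA; set Y := eform B t u u in hB hP e4.
have hX : X <= p - bb + e / (2 * (1 + dl)).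
  by move: hB; rewrite mulrDl mul1r => hB; lra.
have : (1 + dl) * X <= (1 + dl) * (p - bb) + e / 2.
  apply: le_trans (_ : (1 + dl) * (p - bb + e / (2 * (1 + dl))) <= _).
    by rewrite ler_wpM2l// ltW.
  by rewrite mulrDr lerD2l le_eqVlt; apply/orP; left; apply/eqP; field; rewrite gt_eqF.
have : (1 + dl) * (p - bb) <= (1 + dl) ^+ 2 * (p - bb).
  by rewrite ler_wpM2r ?subr_ge0// expr2 ler_peMl ?(ltW dl2)//; lra.
move=> h1 h2; apply: le_trans hY _; apply: le_trans (lerD h2 e3) _.
lra.
Qed.

End product.

(** Its form vanishes, so its [norm1] is the squared norm of [ip]. It is the empty product, and it
    also lets [in_closure] express plain closure in L^2. *)
Lemma id_semigroup : {T : semigroup H | forall t u, T t u = u}.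
Proof.
by unshelve (refine (exist _ (@Semigroup _ _ H (fun _ u => u) _ _ _ _ _) _)).
Qed.

Lemma form_id (T : semigroup H) u : (forall t v, T t v = v) -> form T u = 0%E.
Proof.
move=> Tid; rewrite /form (_ : [set _ | t in _] = [set 0%E]) ?ereal_sup1//.
apply/seteqP; split => [_ [t _ <-]|_ ->] /=; first by rewrite /eform Tid subrr mulr0.
by exists 1; rewrite /= ?ltr01// /eform Tid subrr mulr0.
Qed.

Lemma big_semigroup (J : eqType) (P : J -> semigroup H) (l : seq J) :
  uniq l -> (forall i j, i != j -> commuting (P i) (P j)) ->
  exists T : semigroup H,
    (forall t u, T t u = foldr (fun i g => P i t g) u l) /\
    forall u, H u -> form T u = (\sum_(i <- l) form (P i) u)%E.
Proof.
move=> + PP; elim: l => [_|i l IH /= /andP[il ul]].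
  have [T Tid] := id_semigroup; exists T; split => // u Hu.
  by rewrite big_nil (form_id _ Tid).
have [T [TE Tf]] := IH ul.
(* [P i] moves through the composition one factor at a time; [il] ensures that each factor met has
   another index. *)
have PT : commuting (P i) T.
  move=> s t u v s0 t0 Hu; rewrite !TE.
  have Hfold k w : H w -> H (foldr (fun i g => P i t g) w k).
    by elim: k => //= j k IHk Hw; apply: op_dom => //; exact: IHk.
  elim: l il {IH ul T TE Tf} v => //= j l IHl.
  rewrite inE negb_or => /andP[ij il] v Hv.
  rewrite PP//; last exact: Hfold.
  rewrite op_sym//; last by apply: op_dom => //; exact: Hfold.
  rewrite IHl//; last exact: op_dom.
  by rewrite -op_sym//; apply: Hfold; exact: op_dom.
exists (prod_semigroup PT); split => [t u|u Hu]; first by rewrite /= TE.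
by rewrite form_prod// big_cons Tf.
Qed.

End semigroup_form.

(** * Integrals, kernels and processes *)

Section integral_like.
Context d (T : measurableType d) (R : realType).
Implicit Types (f g : T -> \bar R) (Phi Psi : (T -> \bar R) -> \bar R).

Definition nonneg_mfun f := (forall x, (0 <= f x)%E) /\ measurable_fun setT f.

(* The functionals [f |-> \int f dmu] on nonnegative measurable functions,
   before it is known that they come from a measure. *)
Definition integral_like Phi :=
  [/\ forall f, nonneg_mfun f -> (0 <= Phi f)%E,
      forall f g, nonneg_mfun f -> nonneg_mfun g ->
        Phi (fun x => f x + g x)%E = (Phi f + Phi g)%E,
      forall (c : R) f, 0 <= c -> nonneg_mfun f ->
        Phi (fun x => c%:E * f x)%E = (c%:E * Phi f)%E &
      forall (F : nat -> T -> \bar R) f, (forall n, nonneg_mfun (F n)) ->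
        (forall x, nondecreasing_seq (F ^~ x)) ->
        (forall x, F n x @[n --> \oo] --> f x) ->
        Phi (F n) @[n --> \oo] --> Phi f].

Lemma nonneg_mfun_indic (A : set T) : measurable A -> nonneg_mfun (EFin \o \1_A).
Proof.
move=> mA; split => [x|]; first by rewrite lee_fin.
by apply/measurable_EFinP; exact: measurable_indic.
Qed.

Lemma nonneg_mfunD f g : nonneg_mfun f -> nonneg_mfun g ->
  nonneg_mfun (fun x => f x + g x)%E.
Proof.
move=> [f0 mf] [g0 mg]; split => [x|]; first exact: adde_ge0.
exact: emeasurable_funD.
Qed.

Lemma nonneg_mfunM f g : nonneg_mfun f -> nonneg_mfun g ->
  nonneg_mfun (fun x => f x * g x)%E.
Proof.
move=> [f0 mf] [g0 mg]; split => [x|]; first exact: mule_ge0.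
exact: emeasurable_funM.
Qed.

Lemma nonneg_mfunZ (c : R) f : 0 <= c -> nonneg_mfun f ->
  nonneg_mfun (fun x => c%:E * f x)%E.
Proof.
move=> c0 hf; by apply: (nonneg_mfunM (f := cst c%:E)).
Qed.

Lemma nonneg_mfun0 : nonneg_mfun (cst 0%E).
Proof. by split => // x. Qed.

Lemma integral_like0 Phi : integral_like Phi -> Phi (cst 0%E) = 0%E.
Proof.
move=> [_ _ PZ _]; rewrite -[RHS](mul0e (Phi (cst 0%E))).
by rewrite -(PZ 0 _ (lexx 0) nonneg_mfun0); congr Phi; apply/funext => x; rewrite mul0e.
Qed.

Lemma integral_like_sum Phi (I : Type) (s : seq I) (c : I -> R) (A : I -> set T) :
  integral_like Phi -> (forall i, 0 <= c i) -> (forall i, measurable (A i)) ->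
  let f x := (\sum_(i <- s) c i * \1_(A i) x)%:E in
  nonneg_mfun f /\ Phi f = (\sum_(i <- s) (c i)%:E * Phi (EFin \o \1_(A i)))%E.
Proof.
move=> PL c0 mA /=; elim: s => [|i s [IH1 IH2]].
  have -> : (fun x => (\sum_(i <- [::]) c i * \1_(A i) x)%:E) = cst 0%E.
    by apply/funext => x; rewrite big_nil.
  by rewrite big_nil integral_like0//; split => //; exact: nonneg_mfun0.
have -> : (fun x => (\sum_(j <- i :: s) c j * \1_(A j) x)%:E) =
  (fun x => (c i)%:E * (EFin \o \1_(A i)) x + (\sum_(j <- s) c j * \1_(A j) x)%:E)%E.
  by apply/funext => x; rewrite big_cons EFinD EFinM.
have h := nonneg_mfunZ (c0 i) (nonneg_mfun_indic (mA i)).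
split; first exact: nonneg_mfunD.
case: PL => _ PD PZ _; rewrite PD// IH2 big_cons PZ//.
exact: nonneg_mfun_indic.
Qed.

Import HBNNSimple.

Lemma integral_like_eq Phi Psi : integral_like Phi -> integral_like Psi ->
  (forall A, measurable A -> Phi (EFin \o \1_A) = Psi (EFin \o \1_A)) ->
  forall f, nonneg_mfun f -> Phi f = Psi f.
Proof.
move=> PL QL PQ f [f0 mf].
pose F n := EFin \o nnsfun_approx measurableT mf n.
have F0 n : nonneg_mfun (F n).
  split => [x|]; first by rewrite lee_fin.
  by apply/measurable_EFinP; exact: measurable_funPT.
have ndF x : nondecreasing_seq (F ^~ x).
  move=> m n mn; rewrite lee_fin.
  by have /lefP := nd_nnsfun_approx measurableT mf mn; exact.
have Ff x : F n x @[n --> \oo] --> f x.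
  by apply: cvg_nnsfun_approx => // y _; exact: f0.
have PQF n : Phi (F n) = Psi (F n).
  pose h := nnsfun_approx measurableT mf n.
  have /finite_seqP[s hs] : finite_set (range h) by exact: fimfunP.
  (* The functionals are homogeneous for nonnegative scalars only, whereas the sum is indexed by
     real numbers; on values that are attained, [Num.max y 0] is [y]. *)
  have hE : F n = fun x =>
      (\sum_(y <- undup s) Num.max y 0 * \1_(h @^-1` [set y]) x)%:E.
    apply/funext => x; rewrite /F /= -/h; congr _%:E.
    have hx : h x \in undup s.
      by rewrite mem_undup; have : range h (h x) by []; rewrite hs.
    rewrite (bigD1_seq (h x))//= ?undup_uniq// big1 ?addr0 => [|y yhx].
      by rewrite indicE mem_set// mulr1 max_l.
    by rewrite indicE memNset ?mulr0// => /esym/eqP; rewrite (negPf yhx).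
  have c0 (y : R) : 0 <= Num.max y 0 by rewrite le_max lexx orbT.
  have mA (y : R) : measurable (h @^-1` [set y]) by exact: measurable_funPTI.
  rewrite hE (integral_like_sum _ PL c0 mA).2 (integral_like_sum _ QL c0 mA).2.
  by apply: eq_bigr => y _; rewrite PQ.
case: PL => _ _ _ /(_ F f F0 ndF Ff) h1; case: QL => _ _ _ /(_ F f F0 ndF Ff) h2.
rewrite -(cvg_lim _ h1)// -(cvg_lim _ h2)//.
by congr (limn _); apply/funext.
Qed.

Section measure_of.
Variable Phi : (T -> \bar R) -> \bar R.
Hypothesis PL : integral_like Phi.

(** [Phi] is controlled on measurable functions only; the value 0 on other sets keeps [m]
    nonnegative everywhere. *)
Let m (A : set T) := if pselect (measurable A) is left _ then Phi (EFin \o \1_A) else 0%E.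

Let mE A : measurable A -> m A = Phi (EFin \o \1_A).
Proof. by rewrite /m; case: pselect. Qed.

Let m0 : m set0 = 0%E.
Proof. by rewrite mE// indic0; exact: integral_like0. Qed.

Let m_ge0 A : (0 <= m A)%E.
Proof.
rewrite /m; case: pselect => // mA; case: PL => P0 _ _ _.
by apply: P0; exact: nonneg_mfun_indic.
Qed.

Let m_sigma : semi_sigma_additive m.
Proof.
move=> F mF tF mUF; rewrite mE//.
(* These partial sums increase, and disjointness makes their limit the indicator of the union;
   sigma-additivity is then the monotone continuity of [Phi]. *)
pose G n : T -> \bar R := fun x => (\sum_(i <- index_iota 0 n) 1 * \1_(F i) x)%:E.
have GE n := integral_like_sum (index_iota 0 n) PL (fun=> ler01) mF.
have PG n : Phi (G n) = (\sum_(0 <= i < n) m (F i))%E.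
  rewrite (GE n).2; apply: eq_bigr => i _; rewrite mul1e mE//.
under eq_fun do rewrite -PG.
case: PL => _ _ _; apply.
- by move=> n; exact: (GE n).1.
- move=> x k n kn; rewrite lee_fin [leRHS](@big_cat_nat _ _ _ k)//= lerDl.
  by apply: sumr_ge0 => i _; rewrite mul1r.
move=> x; apply: cvg_near_cst.
have [[k _ Fkx]|nFx] := pselect ((\bigcup_i F i) x).
  near=> n; rewrite /G /= indicE mem_set; last by exists k.
  congr _%:E; have kn : (k < n)%N by near: n; exact: nbhs_infty_gt.
  rewrite (@big_cat_nat _ _ _ k)//= ?(ltnW kn)// big_nat_cond big1 ?add0r; last first.
    move=> i /andP[/andP[_ ik] _]; rewrite indicE memNset ?mulr0// => Fix_.
    have := tF i k I I (ex_intro _ x (conj Fix_ Fkx)) => eik.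
    by rewrite eik ltnn in ik.
  rewrite big_ltn// indicE mem_set// mulr1 big_nat_cond big1 ?addr0//.
  move=> i /andP[/andP[ik _] _]; rewrite indicE memNset ?mulr0// => Fix_.
  have := tF i k I I (ex_intro _ x (conj Fix_ Fkx)) => eik.
  by rewrite eik ltnn in ik.
near=> n; rewrite /G /= indicE memNset// big1// => i _.
by rewrite indicE memNset ?mulr0// => Fix_; apply: nFx; exists i.
Unshelve. all: by end_near. Qed.

HB.instance Definition _ := isMeasure.Build _ _ _ m m0 m_ge0 m_sigma.

Lemma integral_like_measure : exists mu : {measure set T -> \bar R},
  forall A, measurable A -> mu A = Phi (EFin \o \1_A).
Proof. by exists m => A mA; exact: mE. Qed.

End measure_of.

(** The measures representing the two functionals are compared on a pi-system. Identities between
    iterated integrals can thus be checked on intervals or boxes. *)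
Lemma integral_like_unique Phi Psi (G : set (set T)) (g : (set T)^nat) :
  measurable = <<s G >> -> setI_closed G -> (forall i, G (g i)) ->
  \bigcup_k (g k) = setT ->
  integral_like Phi -> integral_like Psi ->
  (forall A, G A -> Phi (EFin \o \1_A) = Psi (EFin \o \1_A)) ->
  (forall k, (Phi (EFin \o \1_(g k)) < +oo)%E) ->
  forall f, nonneg_mfun f -> Phi f = Psi f.
Proof.
move=> mG GI Gg gT PL QL PQ Pg; apply: integral_like_eq => // A mA.
have [mu muE] := integral_like_measure PL.
have [nu nuE] := integral_like_measure QL.
have GM B : G B -> measurable B by move=> GB; rewrite mG; exact: sub_sigma_algebra.
rewrite -muE// -nuE//; apply: (measure_unique G g) => //.
- by move=> B GB; rewrite muE ?nuE ?PQ//; exact: GM.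
- by move=> k; rewrite muE//; apply: GM.
Qed.

Lemma integral_like_integral (mu : {measure set T -> \bar R}) :
  integral_like (fun f => \int[mu]_x f x)%E.
Proof.
split.
- by move=> f [f0 mf]; exact: integral_ge0.
- by move=> f g [f0 mf] [g0 mg]; rewrite ge0_integralD.
- by move=> c f c0 [f0 mf]; rewrite ge0_integralZl_EFin.
- move=> F f F0 ndF Ff; have -> : f = fun x => limn (F ^~ x).
    by apply/funext => x; rewrite (cvg_lim _ (Ff x)).
  apply: cvg_monotone_convergence => //.
  + by move=> n; exact: (F0 n).2.
  + by move=> n x _; exact: (F0 n).1.
Qed.

Lemma nonneg_mfun_lim (F : nat -> T -> \bar R) f :
  (forall n, nonneg_mfun (F n)) -> (forall x, nondecreasing_seq (F ^~ x)) ->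
  (forall x, F n x @[n --> \oo] --> f x) -> nonneg_mfun f.
Proof.
move=> F0 ndF Ff; split => [x|].
  rewrite -(cvg_lim _ (Ff x))//; apply: lime_ge; first by apply/cvg_ex; exists (f x).
  by near=> n; exact: (F0 n).1.
apply: (emeasurable_fun_cvg F) => //; first by move=> n; exact: (F0 n).2.
Unshelve. all: by end_near. Qed.

End integral_like.

Section integral_like_comp.
Context d1 (T1 : measurableType d1) d2 (T2 : measurableType d2) (R : realType).

Lemma integral_like_comp (Phi : (T2 -> \bar R) -> \bar R)
    (K : (T1 -> \bar R) -> T2 -> \bar R) :
  integral_like Phi ->
  (forall x, integral_like (K ^~ x)) ->
  (forall f, nonneg_mfun f -> measurable_fun setT (K f)) ->
  integral_like (fun f => Phi (K f)).
Proof.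
move=> [P0 PD PZ PC] KL mK.
have Knn f : nonneg_mfun f -> nonneg_mfun (K f).
  by move=> hf; split=> [x|]; [case: (KL x) => + _ _ _; apply|exact: mK].
split.
- by move=> f hf; apply: P0; exact: Knn.
- move=> f g hf hg; rewrite -PD; [|exact: Knn..]; congr Phi; apply/funext => x.
  by case: (KL x) => _ + _ _; apply.
- move=> c f c0 hf; rewrite -PZ//; [|exact: Knn]; congr Phi; apply/funext => x.
  by case: (KL x) => _ _ + _; apply.
- move=> F f hF ndF Ff; apply: PC.
  + by move=> n; exact: Knn.
  (* Monotonicity is not among the axioms; it is read off the measure that represents [K ^~ x]. *)
  + move=> x k n kn; case: (KL x) => K0 KD _ _.
    have [mu muE] := integral_like_measure (KL x).
    have KE g : nonneg_mfun g -> K g x = (\int[mu]_y g y)%E.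
      move: g; apply: (integral_like_eq (KL x) (integral_like_integral mu)) => A mA.
      by rewrite integral_indic// setIT muE.
    rewrite !KE//; apply: ge0_le_integral => //.
    * by move=> y _; exact: (hF _).1.
    * exact: (hF _).2.
    * exact: (hF _).2.
    * by move=> y _; exact: ndF.
  + by move=> x; case: (KL x) => _ _ _; apply.
Qed.

Lemma integral_like_map (Phi : (T2 -> \bar R) -> \bar R) (h : T2 -> T1) :
  measurable_fun setT h -> integral_like Phi ->
  integral_like (fun f => Phi (f \o h)).
Proof.
move=> mh [P0 PD PZ PC].
have hh (f : T1 -> \bar R) : nonneg_mfun f -> nonneg_mfun (f \o h).
  by move=> [f0 mf]; split=> [x|]; [exact: f0|exact: measurableT_comp].
split.
- by move=> f hf; apply: P0; exact: hh.
- by move=> f g hf hg; rewrite -PD; [|exact: hh..].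
- by move=> c f c0 hf; rewrite -PZ//; exact: hh.
- move=> F f hF ndF Ff; apply: PC => [n|x|x]; [exact: hh|exact: ndF|exact: Ff].
Qed.

End integral_like_comp.

Section L2_space.
Context d (T : measurableType d) (R : realType) (mu : {measure set T -> \bar R}).
Implicit Types u v w : T -> R.

Local Notation L2mu := (L2 mu setT).

Lemma nonneg_mfun_sqr u : measurable_fun setT u ->
  nonneg_mfun (fun x => ((u x) ^+ 2)%:E).
Proof.
move=> mu_; split => [x|]; first by rewrite lee_fin sqr_ge0.
by apply/measurable_EFinP; exact: measurable_funX.
Qed.

Lemma nonneg_mfun_abs u : measurable_fun setT u ->
  nonneg_mfun (fun x => `|u x|%:E).
Proof.
move=> mu_; split => [x|]; first by rewrite lee_fin.
by apply/measurable_EFinP; exact: measurableT_comp.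
Qed.

Lemma nonneg_mfun_EFin u : measurable_fun setT u -> (forall x, 0 <= u x) ->
  nonneg_mfun (EFin \o u).
Proof.
move=> mu_ u0; split => [x|]; first by rewrite lee_fin.
exact/measurable_EFinP.
Qed.

Lemma L2_linear a u v : L2mu u -> L2mu v -> L2mu (a *: u + v).
Proof.
move=> [mu_ iu] [mv iv]; have m : measurable_fun setT (a *: u + v).
  by apply: measurable_funD => //; exact: measurable_funM.
split => //.
apply: (@le_lt_trans _ _ (\int[mu]_x ((2 * a ^+ 2)%:E * ((u x) ^+ 2)%:E + 2%:E * ((v x) ^+ 2)%:E))%E).
  apply: ge0_le_integral => //.
  - by move=> x _; rewrite lee_fin sqr_ge0.
  - exact: (nonneg_mfun_sqr m).2.
  - apply: emeasurable_funD; apply: emeasurable_funM => //; exact: (nonneg_mfun_sqr _).2.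
  - move=> x _; rewrite -!EFinM -EFinD lee_fin.
    rewrite -subr_ge0; have -> : 2 * a ^+ 2 * u x ^+ 2 + 2 * v x ^+ 2 - (a *: u + v) x ^+ 2 = (a * u x - v x) ^+ 2.
      by rewrite -[(a *: u + v) x]/(a * u x + v x); ring.
    exact: sqr_ge0.
rewrite ge0_integralD//; first last.
- by apply: emeasurable_funM => //; exact: (nonneg_mfun_sqr _).2.
- by move=> x _; rewrite -EFinM lee_fin mulr_ge0// sqr_ge0.
- by apply: emeasurable_funM => //; exact: (nonneg_mfun_sqr _).2.
- by move=> x _; rewrite -EFinM lee_fin mulr_ge0 ?sqr_ge0// mulr_ge0 ?sqr_ge0.
have a2 : 0 <= 2 * a ^+ 2 by rewrite mulr_ge0 ?sqr_ge0.
rewrite !ge0_integralZl_EFin//; first last.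
- exact: (nonneg_mfun_sqr _).2.
- by move=> x _; rewrite lee_fin sqr_ge0.
- exact: (nonneg_mfun_sqr _).2.
- by move=> x _; rewrite lee_fin sqr_ge0.
by rewrite lte_add_pinfty// lte_mul_pinfty// ?lee_fin.
Qed.

Lemma L2_le u v : L2mu v -> measurable_fun setT u ->
  (forall x, `|u x| <= `|v x|) -> L2mu u.
Proof.
move=> [mv iv] mu_ uv; split => //; apply: le_lt_trans iv.
apply: ge0_le_integral => //.
- by move=> x _; rewrite lee_fin sqr_ge0.
- exact: (nonneg_mfun_sqr mu_).2.
- exact: (nonneg_mfun_sqr mv).2.
- move=> x _; rewrite lee_fin -(real_normK (num_real (u x))).
  by rewrite -(real_normK (num_real (v x))) ler_sqr ?nnegrE.
Qed.

Lemma L2_integrableM u v : L2mu u -> L2mu v ->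
  mu.-integrable setT (EFin \o (fun x => u x * v x)).
Proof.
move=> [mu_ iu] [mv iv]; apply/integrableP; split.
  by apply/measurable_EFinP; exact: measurable_funM.
apply: (@le_lt_trans _ _ (\int[mu]_x (((u x) ^+ 2)%:E + ((v x) ^+ 2)%:E))%E).
  apply: ge0_le_integral => //.
  - by apply/measurable_EFinP; apply: measurableT_comp => //; exact: measurable_funM.
  - by apply: emeasurable_funD; exact: (nonneg_mfun_sqr _).2.
  - move=> x _; rewrite /= lee_fin ler_norml.
    by have := sqr_ge0 (u x + v x); have := sqr_ge0 (u x - v x); rewrite !expr2; nra.
rewrite ge0_integralD//; first by rewrite lte_add_pinfty.
- by move=> x _; rewrite lee_fin sqr_ge0.
- exact: (nonneg_mfun_sqr _).2.
- by move=> x _; rewrite lee_fin sqr_ge0.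
- exact: (nonneg_mfun_sqr _).2.
Qed.

Definition L2_ip u v : R := \int[mu]_x (u x * v x).

Lemma L2_psd : psd L2mu L2_ip.
Proof.
split.
- by move=> u v _ _; apply: eq_Rintegral => x _; rewrite mulrC.
- move=> a u v w hu hv hw.
  rewrite /L2_ip -RintegralZl//; last exact: L2_integrableM.
  rewrite -RintegralD//.
  + by apply: eq_Rintegral => x _; rewrite -[(a *: u + v) x]/(a * u x + v x); ring.
  + have hau : L2mu (a *: u) by rewrite -[_ *: _]addr0; apply: L2_linear => //; split; [exact: measurable_cst|rewrite (_ : (fun x => _) = cst 0%E) ?integral0// funeqE => x /=; rewrite expr0n].
    have := L2_integrableM hau hw; congr (_.-integrable _ _).
    by apply/funext => x /=; rewrite mulrA.
  + exact: L2_integrableM.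
- by move=> u hu; apply: Rintegral_ge0 => x _; rewrite -expr2 sqr_ge0.
Qed.

Definition L2_space : ipspace (T -> R) :=
  @IPSpace R (T -> R) L2mu L2_ip L2_linear L2_psd.

Lemma L2_ip_ae u v u' v' : L2mu u -> L2mu v -> L2mu u' -> L2mu v' ->
  {ae mu, forall x, u x = u' x} -> {ae mu, forall x, v x = v' x} ->
  L2_ip u v = L2_ip u' v'.
Proof.
move=> hu hv hu' hv' uu vv; rewrite /L2_ip /Rintegral; congr fine.
apply: ae_eq_integral => //.
- exact: measurable_int (L2_integrableM hu hv).
- exact: measurable_int (L2_integrableM hu' hv').
- by apply: filterS2 uu vv => x -> ->.
Qed.

Lemma L2_pos u : L2mu u -> L2mu (fun x => Num.max (u x) 0).
Proof.
move=> hu; apply: L2_le (hu) _ _.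
  by apply: measurable_maxr => //; case: hu.
move=> x; rewrite ger0_norm ?le_max ?lexx ?orbT//.
by rewrite ge_max ler_norm normr_ge0.
Qed.

Lemma L2_neg u : L2mu u -> L2mu (fun x => Num.max (- u x) 0).
Proof.
move=> hu; apply: L2_le (hu) _ _.
  by apply: measurable_maxr => //; apply: measurableT_comp => //; case: hu.
move=> x; rewrite ger0_norm ?le_max ?lexx ?orbT//.
by rewrite ge_max -normrN ler_norm normr_ge0.
Qed.

Lemma max_decomp (a : R) : a = Num.max a 0 - Num.max (- a) 0.
Proof.
have [a0|a0] := leP a 0; first by rewrite max_l ?oppr_ge0// sub0r opprK.
by rewrite max_r ?subr0// oppr_le0 ltW.
Qed.

Definition bilinear_on (b : (T -> R) -> (T -> R) -> R) :=
  (forall u v w, L2mu u -> L2mu v -> L2mu w -> b (u - v) w = b u w - b v w) /\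
  (forall u v w, L2mu u -> L2mu v -> L2mu w -> b w (u - v) = b w u - b w v).

(** Identities in L^2 are reduced to nonnegative functions, for which [L2_ip] is an extended
    integral and default values do not interfere. *)
Lemma bilinear_eq b1 b2 : bilinear_on b1 -> bilinear_on b2 ->
  (forall u v, L2mu u -> L2mu v -> (forall x, 0 <= u x) -> (forall x, 0 <= v x) ->
     b1 u v = b2 u v) ->
  forall u v, L2mu u -> L2mu v -> b1 u v = b2 u v.
Proof.
move=> [b1l b1r] [b2l b2r] e u v hu hv.
have dec w : w = (fun x => Num.max (w x) 0) - (fun x => Num.max (- w x) 0).
  by apply/funext => x; rewrite {1}(max_decomp (w x)).
have pos (a : R) : 0 <= Num.max a 0 by rewrite le_max lexx orbT.
have up := L2_pos hu; have un := L2_neg hu.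
have vp := L2_pos hv; have vn := L2_neg hv.
rewrite (dec u) (dec v) b1l ?b2l//; try exact: linB L2_linear _ _ _ _.
by rewrite !b1r ?b2r ?e//.
Qed.

Lemma L2_ip_ge0 u v : L2mu u -> L2mu v -> (forall x, 0 <= u x) ->
  (forall x, 0 <= v x) -> ((L2_ip u v)%:E = \int[mu]_x ((u x)%:E * (v x)%:E))%E.
Proof.
move=> hu hv u0 v0; rewrite /L2_ip /Rintegral fineK//.
exact: integrable_fin_num (L2_integrableM hu hv).
Qed.

Lemma L2_ip_sqr u : L2mu u -> ((L2_ip u u)%:E = \int[mu]_x ((u x) ^+ 2)%:E)%E.
Proof.
move=> hu; rewrite /L2_ip /Rintegral fineK//.
exact: integrable_fin_num (L2_integrableM hu hu).
Qed.

End L2_space.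

(** * Symmetric sub-Markov kernels as operators on L^2 *)

Section symmetric_kernel.
Context d (T : measurableType d) (R : realType).
Implicit Types (f g : T -> \bar R) (mu : {measure set T -> \bar R}).

Definition kint (k : T -> {measure set T -> \bar R}) f (x : T) : \bar R :=
  (\int[k x]_y f y)%E.

(** The total mass may be less than 1: a process loses mass when its lifetime ends. *)
Definition subMarkov (k : T -> {measure set T -> \bar R}) :=
  (forall A, measurable A -> measurable_fun setT (k ^~ A)) /\
  (forall x, (k x setT <= 1)%E).

Definition symmetric_kernel mu k :=
  forall f g, nonneg_mfun f -> nonneg_mfun g ->
  (\int[mu]_x (kint k f x * g x) = \int[mu]_x (f x * kint k g x))%E.

Lemma nonneg_mfun_kint k f : subMarkov k -> nonneg_mfun f -> nonneg_mfun (kint k f).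
Proof.
move=> [mk _] [f0 mf]; split => [x|]; first exact: integral_ge0.
exact: measurable_fun_integral_kernel.
Qed.

Lemma integral_like_kint k x : integral_like (fun f => kint k f x).
Proof. exact: integral_like_integral. Qed.

(** [c] may be [+oo], and multiplication by it is discontinuous at 0. If [Phi f = 0], all
    [Phi (F n)] vanish; otherwise some [Phi (F n)] is positive, and from there on the products are
    constantly [+oo]. *)
Lemma integral_like_scale (Phi : (T -> \bar R) -> \bar R) (c : \bar R) :
  (0 <= c)%E -> integral_like Phi -> integral_like (fun f => Phi f * c)%E.
Proof.
move=> c0 PL; have [P0 PD PZ PC] := PL; split.
- by move=> f hf; rewrite mule_ge0// P0.
- by move=> f g hf hg; rewrite PD// ge0_muleDl// P0.
- by move=> a f a0 hf; rewrite PZ// muleA.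
move=> F f hF ndF Ff; have PF := PC F f hF ndF Ff.
case: c c0 => [c||] // c0.
  by apply: cvgeZr => //.
have ndP : nondecreasing_seq (fun n => Phi (F n)).
  have [mu muE] := integral_like_measure PL.
  have PE g : nonneg_mfun g -> Phi g = (\int[mu]_y g y)%E.
    move: g; apply: (integral_like_eq PL (integral_like_integral mu)) => A mA.
    by rewrite integral_indic// setIT muE.
  move=> m n mn; rewrite !PE//; apply: ge0_le_integral => //.
  + by move=> y _; exact: (hF _).1.
  + exact: (hF _).2.
  + exact: (hF _).2.
  + by move=> y _; exact: ndF.
have PE : Phi f = ereal_sup (range (fun n => Phi (F n))).
  rewrite -(cvg_lim _ PF)//; apply/cvg_lim => //; exact: ereal_nondecreasing_cvgn.
have Pn n : (Phi (F n) <= Phi f)%E by rewrite PE; apply: ereal_sup_ubound; exists n.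
have [f0|f0] := eqVneq (Phi f) 0%E.
  rewrite f0 mul0e; apply: cvg_near_cst; near=> n.
  suff -> : Phi (F n) = 0%E by rewrite mul0e.
  by apply/le_anti; rewrite P0// andbT -f0.
have fp : (0 < Phi f)%E.
  rewrite lt_neqAle eq_sym f0 P0//; exact: nonneg_mfun_lim Ff.
rewrite gt0_muley//; apply: cvg_near_cst.
move: fp; rewrite {1}PE => /ereal_sup_gt[_ [n _ <-] hn].
near=> m; rewrite gt0_muley//; apply: lt_le_trans hn _; apply: ndP.
by near: m; exact: nbhs_infty_ge.
Unshelve. all: by end_near. Qed.

Lemma integral_like_eval (x : T) : integral_like (fun f => f x).
Proof.
by split => [f [f0 _]|f g|c f|F f _ _ Ff]; [exact: f0|by []|by []|exact: Ff].
Qed.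

(** The identity is extended from sets to functions in one argument at a time, the other one being
    an indicator meanwhile. *)
Lemma symmetric_kernel_sets mu k : subMarkov k ->
  (forall A B, measurable A -> measurable B ->
    \int[mu]_(x in A) k x B = \int[mu]_(x in B) k x A)%E ->
  symmetric_kernel mu k.
Proof.
move=> hk sk f g hf hg.
have L g' : nonneg_mfun g' ->
    integral_like (fun f => \int[mu]_x (kint k f x * g' x))%E.
  move=> hg'; apply: (integral_like_comp (integral_like_integral mu)).
  - by move=> x; apply: integral_like_scale; [exact: hg'.1|exact: integral_like_kint].
  - by move=> h hh; apply: emeasurable_funM; [exact: (nonneg_mfun_kint _ _).2|exact: hg'.2].
have L' f' : nonneg_mfun f' ->
    integral_like (fun g => \int[mu]_x (kint k f' x * g x))%E.
  move=> hf'; apply: (integral_like_comp (integral_like_integral mu)).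
  - move=> x; have h := integral_like_scale ((nonneg_mfun_kint hk hf').1 x) (integral_like_eval x).
    by under eq_fun do rewrite muleC.
  - by move=> h hh; apply: emeasurable_funM; [exact: (nonneg_mfun_kint _ _).2|exact: hh.2].
have comm f' g' : (\int[mu]_x (f' x * kint k g' x) = \int[mu]_x (kint k g' x * f' x))%E.
  by under eq_integral do rewrite muleC.
move: (f) (hf); rewrite [X in forall f, _ -> _ = X f](_ : _ =
  fun f => \int[mu]_x (kint k g x * f x))%E; last by apply/funext.
apply: (integral_like_eq (L g hg) (L' g hg)) => B mB.
have := integral_like_eq (L' _ (nonneg_mfun_indic _ mB)) (L _ (nonneg_mfun_indic _ mB)).
apply => // A mA.
have indE A' B' : measurable A' -> measurable B' ->
    (\int[mu]_x (kint k (EFin \o \1_A') x * (EFin \o \1_B') x) = \int[mu]_(x in B') k x A')%E.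
  move=> mA' mB'; rewrite [RHS]integral_mkcond; apply: eq_integral => x _.
  rewrite /kint integral_indic// setIT patchE /= indicE.
  by case: (x \in B'); rewrite ?mule1 ?mule0.
by rewrite !indE// sk.
Qed.

(** The integral has a default value where [u] is not integrable for [k x]; by [kint_sqr_fin] and
    [kint_integrable] this concerns only a null set of points when [u] is in L^2. *)
Definition kop (k : T -> {measure set T -> \bar R}) (u : T -> R) (x : T) : R :=
  \int[k x]_y u y.

Section operator.
Variables (mu : {measure set T -> \bar R}) (k : T -> {measure set T -> \bar R}).
Hypotheses (hk : subMarkov k) (sk : symmetric_kernel mu k).
Implicit Types u v w : T -> R.

Local Notation L2mu := (L2 mu setT).
Local Notation "<< u , v >>" := (L2_ip mu u v).

(** The symmetry of [k] is tested against the constant 1, and then [k x setT <= 1] is used. *)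
Lemma kint_sqr_le u : measurable_fun setT u ->
  (\int[mu]_x kint k (fun y => ((u y) ^+ 2)%:E) x <= \int[mu]_x ((u x) ^+ 2)%:E)%E.
Proof.
move=> mu_; have h := nonneg_mfun_sqr mu_.
have h1 : nonneg_mfun (cst 1%E : T -> \bar R) by split => //; exact: measurable_cst.
have := sk h h1; under eq_integral do rewrite mule1.
move=> ->; apply: ge0_le_integral => //.
- by move=> x _; apply: mule_ge0; [exact: h.1|exact: (nonneg_mfun_kint hk h1).1].
- by apply: emeasurable_funM; [exact: h.2|exact: (nonneg_mfun_kint hk h1).2].
- exact: h.2.
- move=> x _; rewrite -[leRHS]mule1; apply: lee_wpmul2l; first exact: h.1.
  by rewrite /kint integral_cst// mul1e; exact: hk.2.
Qed.

Lemma kint_sqr_fin u : L2mu u ->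
  {ae mu, forall x, (kint k (fun y => ((u y) ^+ 2)%:E) x < +oo)%E}.
Proof.
move=> [mu_ iu]; have h := nonneg_mfun_kint hk (nonneg_mfun_sqr mu_).
have : mu.-integrable setT (kint k (fun y => ((u y) ^+ 2)%:E)).
  apply/integrableP; split; first exact: h.2.
  under eq_integral do rewrite gee0_abs ?h.1//.
  exact: le_lt_trans (kint_sqr_le mu_) iu.
move=> /integrable_ae-/(_ measurableT); apply: filterS => x /(_ I).
by rewrite ge0_fin_numE ?h.1.
Qed.

Lemma kint_integrable u x : measurable_fun setT u ->
  (kint k (fun y => ((u y) ^+ 2)%:E) x < +oo)%E ->
  (k x).-integrable setT (EFin \o u).
Proof.
move=> mu_ fin; apply/integrableP; split; first exact/measurable_EFinP.
apply: (@le_lt_trans _ _ (\int[k x]_y (((u y) ^+ 2)%:E + 1%:E))%E).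
  apply: ge0_le_integral => //.
  - exact: (nonneg_mfun_abs mu_).2.
  - by apply: emeasurable_funD; [exact: (nonneg_mfun_sqr mu_).2|exact: measurable_cst].
  - move=> y _; rewrite -EFinD lee_fin -(real_normK (num_real (u y))).
    by have := sqr_ge0 (`|u y| - 2^-1); rewrite !expr2; nra.
rewrite ge0_integralD//; last 2 first.
- by move=> y _; rewrite lee_fin sqr_ge0.
- exact: (nonneg_mfun_sqr mu_).2.
rewrite lte_add_pinfty// integral_cst// mul1e.
by apply: le_lt_trans (hk.2 x) _; rewrite ltry.
Qed.

(* Jensen's inequality; where the right-hand side is infinite, the left-hand
   side has a junk value. *)
Lemma kop_sqr_le u x : measurable_fun setT u ->
  (((kop k u x) ^+ 2)%:E <= kint k (fun y => ((u y) ^+ 2)%:E) x)%E.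
Proof.
move=> mu_; set q := kint _ _ _.
have q0 : (0 <= q)%E by apply: (nonneg_mfun_kint hk (nonneg_mfun_sqr mu_)).1.
have [qfin|] := ltP q +oo%E; last by rewrite leye_eq => /eqP ->; rewrite leey.
have iu := kint_integrable mu_ qfin.
have qE : q = (fine q)%:E by rewrite fineK// ge0_fin_numE.
set s := kop k u x.
have isq : (k x).-integrable setT (EFin \o (fun y => u y ^+ 2)).
  apply/integrableP; split; first exact: (nonneg_mfun_sqr mu_).2.
  by under eq_integral do rewrite /= ger0_norm ?sqr_ge0//.
have k1 : (k x setT < +oo)%E by apply: le_lt_trans (hk.2 x) _; rewrite ltry.
have i1 : (k x).-integrable setT (EFin \o (fun=> s ^+ 2)).
  apply/integrableP; split; first exact: measurable_cst.
  rewrite integral_cst// lte_mul_pinfty//.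
(* Integrates [2 * s * u y <= s ^+ 2 + u y ^+ 2]; as [k x] has mass at most 1, [s ^+ 2 <= fine q]
   follows. *)
have : 2 * s * s <= s ^+ 2 * fine (k x setT) + fine q.
  rewrite {2}/s /kop -RintegralZl// -Rintegral_cst// -RintegralD//.
  apply: le_Rintegral => //.
  - exact: (integrableZl measurableT (2 * s) iu).
  - exact: (integrableD measurableT i1 isq).
  - by move=> y _; have := sqr_ge0 (s - u y); rewrite !expr2; nra.
have : fine (k x setT) <= 1.
  by rewrite -lee_fin fineK ?hk.2// ge0_fin_numE.
move=> h1 h2; rewrite qE lee_fin.
have : s ^+ 2 * fine (k x setT) <= s ^+ 2 * 1 by rewrite ler_wpM2l ?sqr_ge0.
move: h2; rewrite !expr2; lra.
Qed.

Lemma measurable_kop u : measurable_fun setT u -> measurable_fun setT (kop k u).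
Proof.
move=> mu_; rewrite /kop /Rintegral; apply: measurableT_comp => //.
rewrite (_ : (fun x => _) = (fun x => kint k (EFin \o u)^\+ x - kint k (EFin \o u)^\- x)%E); last first.
  by apply/funext => x; rewrite integralE.
have m : measurable_fun setT (EFin \o u) by exact/measurable_EFinP.
apply: emeasurable_funB.
- by apply: (nonneg_mfun_kint hk _).2; split => [x|]; [exact: funepos_ge0|exact: measurable_funepos].
- by apply: (nonneg_mfun_kint hk _).2; split => [x|]; [exact: funeneg_ge0|exact: measurable_funeneg].
Qed.

Lemma kop_sqr_int u : L2mu u ->
  (\int[mu]_x ((kop k u x) ^+ 2)%:E <= \int[mu]_x ((u x) ^+ 2)%:E)%E.
Proof.
move=> [mu_ iu]; apply: le_trans (kint_sqr_le mu_).
apply: ge0_le_integral => //.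
- by move=> x _; rewrite lee_fin sqr_ge0.
- by apply: (nonneg_mfun_sqr _).2; exact: measurable_kop.
- exact: (nonneg_mfun_kint hk (nonneg_mfun_sqr mu_)).2.
- by move=> x _; exact: kop_sqr_le.
Qed.

Lemma L2_kop u : L2mu u -> L2mu (kop k u).
Proof.
move=> hu; split; first by apply: measurable_kop; case: hu.
by apply: le_lt_trans (kop_sqr_int hu) _; case: hu.
Qed.

Lemma kop_contraction u : L2mu u -> <<kop k u, kop k u>> <= <<u, u>>.
Proof.
move=> hu; rewrite -lee_fin !L2_ip_sqr//; last exact: L2_kop.
exact: kop_sqr_int.
Qed.

Lemma kop_linear a u v : L2mu u -> L2mu v ->
  {ae mu, forall x, kop k (a *: u + v) x = a * kop k u x + kop k v x}.
Proof.
move=> hu hv; have [mu_ _] := hu; have [mv _] := hv.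
apply: filterS2 (kint_sqr_fin hu) (kint_sqr_fin hv) => x ux vx.
have iu := kint_integrable mu_ ux; have iv := kint_integrable mv vx.
rewrite /kop -RintegralZl// -RintegralD//.
exact: (integrableZl measurableT a iu).
Qed.

Lemma kop_ipE u v : L2mu u -> L2mu v ->
  (forall x, 0 <= u x) -> (forall x, 0 <= v x) ->
  ((<<kop k u, v>>)%:E = \int[mu]_x (kint k (EFin \o u) x * (v x)%:E))%E.
Proof.
move=> hu hv u0 v0; have [mu_ _] := hu; have [mv _] := hv.
rewrite L2_ip_ge0//; [|exact: L2_kop|by move=> x; exact: Rintegral_ge0].
have hu' := nonneg_mfun_EFin mu_ u0.
apply: ae_eq_integral => //.
- by apply: emeasurable_funM; apply/measurable_EFinP => //; exact: measurable_kop.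
- apply: emeasurable_funM; last exact/measurable_EFinP.
  exact: (nonneg_mfun_kint hk hu').2.
- apply: filterS (kint_sqr_fin hu) => x ux _; congr (_ * _)%E.
  rewrite /kop /Rintegral fineK//.
  exact: integrable_fin_num (kint_integrable mu_ ux).
Qed.

Lemma kop_bilinear : bilinear_on mu (fun u v => <<kop k u, v>>).
Proof.
have DL := @L2_linear _ _ _ mu; have hp := L2_psd mu.
have lB u v : L2mu u -> L2mu v -> L2mu (u - v) by exact: linB.
split => u v w hu hv hw; last first.
  by rewrite (psdBr DL hp)//; exact: L2_kop.
rewrite -(psdBl DL hp)//; [|exact: L2_kop..].
have Luv := L2_kop (lB _ _ hu hv).
have Lkuv := lB _ _ (L2_kop hu) (L2_kop hv).
apply: (L2_ip_ae Luv hw Lkuv hw); last exact: aeW.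
have := kop_linear (-1) hv hu; apply: filterS => x.
by rewrite scaleN1r addrC => ->; rewrite mulN1r addrC.
Qed.

Lemma kop_sym u v : L2mu u -> L2mu v -> <<kop k u, v>> = <<u, kop k v>>.
Proof.
have DL := @L2_linear _ _ _ mu; have hp := L2_psd mu.
have [bl br] := kop_bilinear.
move: u v; apply: (bilinear_eq kop_bilinear).
  split => u v w hu hv hw.
    by rewrite (psdBl DL hp)//; exact: L2_kop.
  rewrite (psdC hp hw); last by apply/L2_kop/(linB DL).
  by rewrite bl// (psdC hp hw (L2_kop hu)) (psdC hp hw (L2_kop hv)).
move=> u v hu hv u0 v0; apply/EFin_inj.
rewrite (psdC hp hu (L2_kop hv)) !kop_ipE//.
rewrite (sk (nonneg_mfun_EFin _ _) (nonneg_mfun_EFin _ _))//; [|by case: hu|by case: hv].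
by under eq_integral do rewrite muleC.
Qed.

End operator.

Lemma kop_foldr_dom mu (ks : seq (T -> {measure set T -> \bar R})) u :
  (forall k, List.In k ks -> subMarkov k /\ symmetric_kernel mu k) ->
  L2 mu setT u -> L2 mu setT (foldr kop u ks).
Proof.
elim: ks => //= k ks IH hks hu.
have [hk sk] := hks _ (or_introl erefl).
by apply: L2_kop => //; apply: IH => // k' hk'; apply: hks; right.
Qed.

Lemma kop_foldr_bilinear mu (ks : seq (T -> {measure set T -> \bar R})) :
  (forall k, List.In k ks -> subMarkov k /\ symmetric_kernel mu k) ->
  bilinear_on mu (fun u v => L2_ip mu (foldr kop u ks) v).
Proof.
have DL := @L2_linear _ _ _ mu; have hp := L2_psd mu.
elim: ks => [_|k ks IH hks] /=.
  by split => u v w hu hv hw; [exact: (psdBl DL hp)|exact: (psdBr DL hp)].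
have [hk sk] := hks _ (or_introl erefl).
have hks' k' : List.In k' ks -> subMarkov k' /\ symmetric_kernel mu k'.
  by move=> hk'; apply: hks; right.
have [IHl _] := IH hks'.
have dm := kop_foldr_dom hks'.
split => u v w hu hv hw.
  rewrite !(kop_sym hk sk)//; [|exact: dm|exact: dm|by apply: dm; exact: linB].
  by apply: IHl => //; exact: L2_kop.
by rewrite (psdBr DL hp)//; apply: L2_kop => //; exact: dm.
Qed.

Lemma kop_foldrE mu (ks : seq (T -> {measure set T -> \bar R})) u v :
  (forall k, List.In k ks -> subMarkov k /\ symmetric_kernel mu k) ->
  L2 mu setT u -> L2 mu setT v -> (forall x, 0 <= u x) -> (forall x, 0 <= v x) ->
  ((L2_ip mu (foldr kop u ks) v)%:E =
   \int[mu]_x (foldr kint (EFin \o u) ks x * (v x)%:E))%E.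
Proof.
move=> + hu + u0; have [mu_ _] := hu.
elim: ks v => [v _ hv v0|k ks IH v hks hv v0] /=; first exact: L2_ip_ge0.
have [hk sk] := hks _ (or_introl erefl); have [mv _] := hv.
have hks' k' : List.In k' ks -> subMarkov k' /\ symmetric_kernel mu k'.
  by move=> hk'; apply: hks; right.
have hv' := nonneg_mfun_EFin mv v0.
have hF : nonneg_mfun (foldr kint (EFin \o u) ks).
  elim: {IH hks} ks hks' => [_|k' ks' IH' hks'] /=; first exact: nonneg_mfun_EFin.
  apply: nonneg_mfun_kint; first by case: (hks' _ (or_introl erefl)).
  by apply: IH' => k'' hk''; apply: hks'; right.
rewrite (kop_sym hk sk)//; last exact: kop_foldr_dom.
rewrite IH//; [|exact: L2_kop|by move=> x; exact: Rintegral_ge0].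
rewrite sk//; apply: ae_eq_integral => //.
- apply: emeasurable_funM; first exact: hF.2.
  by apply/measurable_EFinP; exact: measurable_kop.
- by apply: emeasurable_funM; [exact: hF.2|exact: (nonneg_mfun_kint hk hv').2].
- apply: filterS (kint_sqr_fin hk sk hv) => x vx _; congr (_ * _)%E.
  rewrite /kop /Rintegral fineK//.
  exact: integrable_fin_num (kint_integrable hk mv vx).
Qed.

(** Carries an identity between compositions of kernels from nonnegative functions to L^2. The
    semigroup law, the commutation of coordinates and the product formula are all transferred in
    this way. *)
Lemma kop_foldr_eq mu (ks ks' : seq (T -> {measure set T -> \bar R})) :
  (forall k, List.In k ks -> subMarkov k /\ symmetric_kernel mu k) ->
  (forall k, List.In k ks' -> subMarkov k /\ symmetric_kernel mu k) ->
  (forall f g, nonneg_mfun f -> nonneg_mfun g ->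
    \int[mu]_x (foldr kint f ks x * g x) = \int[mu]_x (foldr kint f ks' x * g x))%E ->
  forall u v, L2 mu setT u -> L2 mu setT v ->
    L2_ip mu (foldr kop u ks) v = L2_ip mu (foldr kop u ks') v.
Proof.
move=> h h' e; apply: (bilinear_eq (kop_foldr_bilinear h) (kop_foldr_bilinear h')).
move=> u v hu hv u0 v0; apply/EFin_inj; rewrite !kop_foldrE//.
have [mu_ _] := hu; have [mv _] := hv.
exact: (e _ _ (nonneg_mfun_EFin mu_ u0) (nonneg_mfun_EFin mv v0)).
Qed.

(** The last two laws are integrated against [g] instead of being pointwise: the kernels of a
    process vanish off its state space, whose complement is [mu]-null, so that time 0 gives the
    identity only almost everywhere. *)
Record kernel_semigroup mu := KernelSemigroup {
  ksg :> R -> T -> {measure set T -> \bar R};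
  ksg_subMarkov : forall t, subMarkov (ksg t);
  ksg_sym : forall t, symmetric_kernel mu (ksg t);
  ksg_comp : forall s t f g, 0 <= s -> 0 <= t -> nonneg_mfun f -> nonneg_mfun g ->
    (\int[mu]_x (kint (ksg s) (kint (ksg t) f) x * g x) =
     \int[mu]_x (kint (ksg (s + t)) f x * g x))%E;
  ksg0 : forall f g, nonneg_mfun f -> nonneg_mfun g ->
    (\int[mu]_x (kint (ksg 0) f x * g x) = \int[mu]_x (f x * g x))%E }.

Section kernel_semigroup_theory.
Variables (mu : {measure set T -> \bar R}) (k : kernel_semigroup mu).

Let op_dom t u : 0 <= t -> L2 mu setT u -> L2 mu setT (kop (k t) u).
Proof. by move=> _; apply: L2_kop; [exact: ksg_subMarkov|exact: ksg_sym]. Qed.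

Let op_sym t u v : 0 <= t -> L2 mu setT u -> L2 mu setT v ->
  L2_ip mu (kop (k t) u) v = L2_ip mu u (kop (k t) v).
Proof. by move=> _; apply: kop_sym; [exact: ksg_subMarkov|exact: ksg_sym]. Qed.

Let op_comp s t u v : 0 <= s -> 0 <= t -> L2 mu setT u -> L2 mu setT v ->
  L2_ip mu (kop (k s) (kop (k t) u)) v = L2_ip mu (kop (k (s + t)) u) v.
Proof.
move=> s0 t0; apply: (kop_foldr_eq (ks := [:: k s; k t]) (ks' := [:: k (s + t)])).
- by move=> k' /= [<-|[<-|[]]]; split; [exact: ksg_subMarkov|exact: ksg_sym|exact: ksg_subMarkov|exact: ksg_sym].
- by move=> k' /= [<-|[]]; split; [exact: ksg_subMarkov|exact: ksg_sym].
- by move=> f g hf hg; exact: ksg_comp.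
Qed.

Let op0 u v : L2 mu setT u -> L2 mu setT v ->
  L2_ip mu (kop (k 0) u) v = L2_ip mu u v.
Proof.
have DL := @L2_linear _ _ _ mu; have hp := L2_psd mu.
move: u v; apply: (bilinear_eq (kop_bilinear (ksg_subMarkov k 0) (ksg_sym k 0))).
  by split => u v w hu hv hw; [exact: (psdBl DL hp)|exact: (psdBr DL hp)].
move=> u v hu hv u0 v0; apply/EFin_inj.
rewrite (kop_ipE (ksg_subMarkov k 0) (ksg_sym k 0))// L2_ip_ge0// ksg0//.
- by apply: nonneg_mfun_EFin => //; case: hu.
- by apply: nonneg_mfun_EFin => //; case: hv.
Qed.

Let op_contr t u : 0 <= t -> L2 mu setT u ->
  L2_ip mu (kop (k t) u) (kop (k t) u) <= L2_ip mu u u.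
Proof. by move=> _; apply: kop_contraction; [exact: ksg_subMarkov|exact: ksg_sym]. Qed.

Definition L2_semigroup : semigroup (L2_space mu) :=
  @Semigroup _ _ (L2_space mu) (fun t => kop (k t)) op_dom op_sym op_comp op0 op_contr.

Lemma L2_semigroupE t u : L2_semigroup t u = kop (k t) u.
Proof. by []. Qed.

End kernel_semigroup_theory.
End symmetric_kernel.

Section integral_like_measure_integral.
Context d (T : measurableType d) (R : realType).

Lemma integral_like_measureE (Phi : (T -> \bar R) -> \bar R) :
  integral_like Phi ->
  exists mu : {measure set T -> \bar R},
    forall f, nonneg_mfun f -> (\int[mu]_x f x)%E = Phi f.
Proof.
move=> PL; have [mu muE] := integral_like_measure PL; exists mu.
apply: (integral_like_eq (integral_like_integral mu) PL) => A mA.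
by rewrite integral_indic// setIT muE.
Qed.

Lemma integral_like_mrestr (m : {measure set T -> \bar R}) D (mD : measurable D) f :
  nonneg_mfun f -> (\int[mrestr m mD]_x f x = \int[m]_(x in D) f x)%E.
Proof.
have h : integral_like (fun f => \int[m]_(x in D) f x)%E.
  split.
  - by move=> g [g0 mg]; exact: integral_ge0.
  - move=> g h [g0 mg] [h0 mh]; rewrite ge0_integralD//; exact: measurable_funTS.
  - move=> c g c0 [g0 mg]; rewrite ge0_integralZl_EFin//; exact: measurable_funTS.
  - move=> F g F0 ndF Fg; have -> : g = fun x => limn (F ^~ x).
      by apply/funext => x; rewrite (cvg_lim _ (Fg x)).
    apply: cvg_monotone_convergence => //.
    + by move=> n; apply: measurable_funTS; exact: (F0 n).2.
    + by move=> n x _; exact: (F0 n).1.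
move: f; apply: (integral_like_eq (integral_like_integral (mrestr m mD)) h) => A mA.
by rewrite !integral_indic// setIT.
Qed.

Lemma mrestr_integral (m : {measure set T -> \bar R}) D (mD : measurable D)
    (f : T -> \bar R) :
  measurable_fun D f -> (\int[mrestr m mD]_x (f \_ D) x = \int[m]_(x in D) f x)%E.
Proof.
move=> mf; rewrite [RHS]integral_mkcond.
have m' : measurable_fun setT (f \_ D) by exact/(measurable_restrictT _ mD).1.
have res (g : T -> \bar R) : nonneg_mfun g -> (forall x, ~ D x -> g x = 0%E) ->
    (\int[mrestr m mD]_x g x = \int[m]_x g x)%E.
  move=> hg gD; rewrite integral_like_mrestr// integral_mkcond.
  apply: eq_integral => x _; rewrite patchE; case: ifPn => // /negP xD.
  by rewrite gD// => Dx; apply: xD; rewrite inE.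
rewrite [LHS]integralE [RHS]integralE; congr (_ - _)%E; apply: res.
- by split => [x|]; [exact: funepos_ge0|exact: measurable_funepos].
- by move=> x nDx; rewrite funeposE patchE memNset// maxxx.
- by split => [x|]; [exact: funeneg_ge0|exact: measurable_funeneg].
- by move=> x nDx; rewrite funenegE patchE memNset// oppe0 maxxx.
Qed.

End integral_like_measure_integral.

Section L2_restriction.
Context d (T : measurableType d) (R : realType).
Variables (m : {measure set T -> \bar R}) (D : set T) (mD : measurable D).
Local Notation mu := (mrestr m mD).
Implicit Types u v : T -> R.

(** Functions on [D] become functions on the whole space that vanish off [D], with the measure
    restricted to [D]. This is the setting of the operators above. *)
Lemma L2_restrict u : L2 m D u <-> L2 mu setT (u \_ D).
Proof.
have key : measurable_fun D u ->
    (\int[mu]_x (((u \_ D) x) ^+ 2)%:E = \int[m]_(x in D) ((u x) ^+ 2)%:E)%E.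
  move=> mu_; rewrite -(mrestr_integral m mD); last first.
    by apply/measurable_EFinP; exact: measurable_funX.
  apply: eq_integral => x _; rewrite !patchE; case: ifPn => // _.
  by rewrite expr0n.
split=> [[mu_ iu]|[mu_ iu]]; split.
- exact/(measurable_restrictT _ mD).1.
- by rewrite key.
- exact/(measurable_restrictT _ mD).2.
- by rewrite -key//; exact/(measurable_restrictT _ mD).2.
Qed.

Lemma L2_ip_restrict u v : measurable_fun D u -> measurable_fun D v ->
  L2_ip mu (u \_ D) (v \_ D) = \int[m]_(x in D) (u x * v x).
Proof.
move=> mu_ mv; rewrite /L2_ip /Rintegral -(mrestr_integral m mD); last first.
  by apply/measurable_EFinP; exact: measurable_funM.
congr fine; apply: eq_integral => x _; rewrite !patchE.
by case: ifPn => // _; rewrite mulr0.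
Qed.

End L2_restriction.

(** * Transition kernels of a process and its Dirichlet form *)

Section process_kernel.
Variables (R : realType) (dT : measure_display) (T : measurableType dT).
Variables (D : set T) (mD : measurable D) (X : process R D).
Hypothesis m1 : forall x : T, measurable [set x].

Local Notation alive t := [set w : sample X | (t%:E < proc_life w)%E].

Lemma measurable_alive t : measurable (alive t).
Proof.
by have := emeasurable_fun_o_infty measurableT (@measurable_life _ _ _ _ X) t%:E; rewrite setTI.
Qed.

Lemma at_timeE t A : at_time (X := X) t A = alive t `&` (@proc_path _ _ _ _ X t) @^-1` A.
Proof. by []. Qed.

Lemma measurable_at_time t A : 0 <= t -> measurable A -> measurable (at_time (X := X) t A).
Proof.
by move=> t0 mA; rewrite at_timeE; apply: measurable_path => //; exact: measurable_alive.
Qed.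

(** Kernels are indexed by all reals whereas paths are measurable at nonnegative times, hence the
    cut-off of the time at 0. *)
Let Phi t x (f : T -> \bar R) : \bar R :=
  (\int[proc_law X x]_(w in alive (Num.max t 0)%R) f (proc_path (Num.max t 0)%R w))%E.

Let max0 (t : R) : 0 <= Num.max t 0. Proof. by rewrite le_max lexx orbT. Qed.

Let mpath t (f : T -> \bar R) : nonneg_mfun f ->
  measurable_fun (alive (Num.max t 0)) (fun w => f (proc_path (Num.max t 0) w)).
Proof.
move=> [_ mf]; apply: (measurableT_comp mf); exact: measurable_path.
Qed.

Let PhiL t x : integral_like (Phi t x).
Proof.
have mA := measurable_alive (Num.max t 0); split.
- by move=> f [f0 _]; apply: integral_ge0 => w _; exact: f0.
- move=> f g hf hg; rewrite /Phi ge0_integralD//.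
  + by move=> w _; exact: hf.1.
  + exact: mpath.
  + by move=> w _; exact: hg.1.
  + exact: mpath.
- move=> c f c0 hf; rewrite /Phi ge0_integralZl_EFin//.
  + by move=> w _; exact: hf.1.
  + exact: mpath.
- move=> F f hF ndF Ff; have -> : f = fun x => limn (F ^~ x).
    by apply/funext => y; rewrite (cvg_lim _ (Ff y)).
  have := @cvg_monotone_convergence _ _ _ (proc_law X x) _ mA
    (fun n w => F n (proc_path (Num.max t 0)%R w)); apply.
  + by move=> n; exact: mpath.
  + by move=> n w _; exact: (hF n).1.
  + by move=> w _; exact: ndF.
Qed.

(** Zero off [D], where the law of the process carries no information. *)
Definition process_kernel (t : R) (x : T) : {measure set T -> \bar R} :=
  if x \in D then projT1 (cid (integral_like_measureE (PhiL t x))) else mzero.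

Lemma kint_process t f x : D x -> nonneg_mfun f ->
  kint (process_kernel t) f x =
  (\int[proc_law X x]_(w in alive (Num.max t 0)%R) f (proc_path (Num.max t 0)%R w))%E.
Proof.
move=> Dx hf; rewrite /kint /process_kernel mem_set//.
by case: cid => mu /= muE; rewrite muE.
Qed.

Lemma kint_process_out t f x : ~ D x -> kint (process_kernel t) f x = 0%E.
Proof. by move=> Dx; rewrite /kint /process_kernel memNset// integral_measure_zero. Qed.

Lemma process_kernelE t x A : D x -> measurable A ->
  process_kernel t x A = proc_law X x (at_time (X := X) (Num.max t 0) A).
Proof.
move=> Dx mA; have mal := measurable_alive (Num.max t 0).
have := kint_process t Dx (nonneg_mfun_indic R mA).
rewrite /kint integral_indic// setIT => ->.
have mat := measurable_at_time (max0 t) mA.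
transitivity (\int[proc_law X x]_(w in alive (Num.max t 0)%R)
    (EFin \o \1_(at_time (X := X) (Num.max t 0)%R A)) w)%E.
  apply: eq_integral => w; rewrite inE /= => aw; rewrite !indicE.
  suff -> : (proc_path (Num.max t 0) w \in A) =
    (w \in at_time (X := X) (Num.max t 0) A) by [].
  by apply/idP/idP; rewrite !inE => h; [split|case: h].
rewrite integral_indic//; congr (proc_law X x _).
by apply/seteqP; split => w //; [case|move=> h; split => //; case: h].
Qed.

Lemma process_kernel_out t x A : ~ D x -> process_kernel t x A = 0%E.
Proof. by move=> Dx; rewrite /process_kernel memNset. Qed.

Lemma subMarkov_process t : subMarkov (process_kernel t).
Proof.
split=> [A mA|x].
  rewrite (_ : (fun x => process_kernel t x A) =
      (fun x => proc_law X x (at_time (X := X) (Num.max t 0) A)) \_ D).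
    by apply/(measurable_restrictT _ mD).1; exact: measurable_law.
  apply/funext => x; rewrite patchE; case: ifPn; rewrite ?inE => Dx.
    exact: process_kernelE.
  by rewrite process_kernel_out// => Dx'; move/negP: Dx; apply; rewrite inE.
have [Dx|Dx] := pselect (D x); last by rewrite process_kernel_out.
by rewrite process_kernelE//; apply: probability_le1; exact: measurable_at_time.
Qed.

Lemma process_kernel_comp s t f x : 0 <= s -> 0 <= t -> nonneg_mfun f ->
  kint (process_kernel s) (kint (process_kernel t) f) x =
  kint (process_kernel (s + t)) f x.
Proof.
move=> s0 t0; have [Dx|Dx] := pselect (D x); last by rewrite !kint_process_out.
have L : integral_like (fun f => kint (process_kernel s) (kint (process_kernel t) f) x).
  apply: (integral_like_comp (integral_like_integral (process_kernel s x))).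
    by move=> y; exact: integral_like_kint.
  by move=> g hg; exact: (nonneg_mfun_kint (subMarkov_process t) hg).2.
move: f; apply: (integral_like_eq L (integral_like_kint _ _)) => A mA.
have hA := nonneg_mfun_indic R mA.
rewrite [RHS]/kint integral_indic// setIT process_kernelE//.
rewrite kint_process//; last exact: nonneg_mfun_kint (subMarkov_process t) hA.
rewrite !max_l ?addr_ge0//.
(* The Markov property with an empty family of constraints on the past. *)
have := @markov_property _ _ _ _ X x 0 (fun=> 0) (fun=> setT) s t A Dx t0 s0 _ _ mA.
move=> /(_ (fun=> conj (lexx 0) s0) (fun=> measurableT)) mk.
rewrite (_ : at_time (X := X) (s + t) A = [set w | [/\ ((s + t)%:E < proc_life w)%E,
  A (proc_path (s + t) w) & forall k : 'I_0, setT (proc_path 0 w)]]); last first.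
  by apply/seteqP; split => w [] //.
rewrite mk; rewrite (_ : [set w | _ /\ _] = alive s); last first.
  by apply/seteqP; split => w //= [].
apply: eq_integral => w; rewrite inE /= => aw.
have Dw : D (proc_path s w) by exact: path_in.
by rewrite /kint integral_indic// setIT process_kernelE// max_l.
Qed.

Lemma process_kernel0 f x : D x -> nonneg_mfun f ->
  kint (process_kernel 0) f x = f x.
Proof.
move=> Dx; move: f; apply: (integral_like_eq (integral_like_kint _ _) (integral_like_eval _ _)).
move=> A mA; rewrite /kint integral_indic// setIT process_kernelE// maxxx /=.
have st := @path_start _ _ _ _ X x Dx.
(* At time 0 the law is a Dirac mass: the event that the path starts at [x] has probability 1, and
   it is measurable because [m1] makes singletons measurable. *)
have -> : proc_law X x (at_time (X := X) 0 A) = (\d_x A)%E.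
  pose B := at_time (X := X) 0 [set x].
  have mB : measurable B by exact: measurable_at_time.
  have B1 : proc_law X x B = 1%E by rewrite -st.
  have mAA := measurable_at_time (lexx 0) mA.
  have [Ax|nAx] := pselect (A x).
    rewrite diracE mem_set//; apply/le_anti/andP; split.
      exact: probability_le1.
    by rewrite -B1; apply: le_measure; rewrite ?inE// => w [aw /= ew]; split; rewrite //= ew.
  rewrite diracE memNset//; apply/le_anti/andP; split; last exact: measure_ge0.
  have AB : at_time (X := X) 0 A `&` B = set0.
    by rewrite -subset0 => w [[_ Aw] [_ /= ew]]; apply: nAx; rewrite -ew.
  have h : (proc_law X x (at_time (X := X) 0 A) + proc_law X x B <= 1)%E.
    have := measureU (proc_law X x) mAA mB AB => <-.
    by apply: probability_le1; exact: measurableU.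
  move: h; have -> : proc_law X x B = 1%E by exact: B1.
  by rewrite -[X in (_ <= X)%E]add0e leeD2rE.
by rewrite diracE indicE.
Qed.

Variable m : {measure set T -> \bar R}.
Local Notation mu := (mrestr m mD).

Lemma symmetric_process_kernel t : symmetric_process X m ->
  symmetric_kernel mu (process_kernel t).
Proof.
move=> sX.
have hk := subMarkov_process t.
have key (A B : set T) : measurable A -> measurable B ->
    (\int[mu]_(x in A) process_kernel t x B =
     \int[m]_(x in A `&` D) proc_law X x (at_time (X := X) (Num.max t 0)%R (B `&` D)))%E.
  move=> mA mB; rewrite [LHS]integral_mkcond integral_like_mrestr; last first.
    split=> [x|]; first by rewrite patchE; case: ifPn.
    by apply/(measurable_restrictT _ mA).1; apply: measurable_funTS; exact: hk.1.
  rewrite setIC [RHS]integral_mkcondr [LHS]integral_mkcond [RHS]integral_mkcond.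
  apply: eq_integral => x _; rewrite !patchE; case: ifPn => //; rewrite inE => Dx.
  case: ifPn => // _; rewrite process_kernelE//; congr (proc_law X x _).
  apply/seteqP; split => w [aw]; last by case.
  by move=> Bw; split => //; split => //; exact: path_in.
apply: symmetric_kernel_sets => // A B mA mB; rewrite !key//.
by rewrite sX//; exact: measurableI.
Qed.

Hypothesis sX : forall t, symmetric_kernel mu (process_kernel t).

Definition process_semigroup : kernel_semigroup mu.
Proof.
refine (@KernelSemigroup _ _ _ mu process_kernel subMarkov_process sX _ _).
- move=> s t f g s0 t0 hf hg; apply: eq_integral => x _.
  by rewrite process_kernel_comp.
- move=> f g hf hg; have h0 := nonneg_mfun_kint (subMarkov_process 0) hf.
  rewrite !integral_like_mrestr; [|exact: nonneg_mfunM..].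
  by apply: eq_integral => x; rewrite inE => Dx; rewrite process_kernel0.
Defined.

Definition L2_process := L2_semigroup process_semigroup.

Lemma transition_kop t u x : 0 <= t -> D x -> measurable_fun D u ->
  transition X t u x = kop (process_kernel t) (u \_ D) x.
Proof.
move=> t0 Dx mu_; rewrite /transition /kop /Rintegral.
have mu' : measurable_fun setT (u \_ D) by exact/(measurable_restrictT _ mD).1.
have mu'' : measurable_fun setT (EFin \o (u \_ D)) by exact/measurable_EFinP.
congr fine; transitivity
    (\int[proc_law X x]_(w in alive t) (EFin \o (u \_ D)) (proc_path t w))%E.
  apply: eq_integral => w; rewrite inE /= => aw.
  by rewrite patchE mem_set//; exact: path_in.
rewrite [LHS]integralE [RHS]integralE; congr (_ - _)%E.
  have := kint_process t Dx (f := (EFin \o (u \_ D))^\+%E).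
  rewrite max_l// /kint => ->; first by apply: eq_integral => w _; rewrite !funeposE.
  by split => [y|]; [exact: funepos_ge0|exact: measurable_funepos].
have := kint_process t Dx (f := (EFin \o (u \_ D))^\-%E).
rewrite max_l// /kint => ->; first by apply: eq_integral => w _; rewrite !funenegE.
by split => [y|]; [exact: funeneg_ge0|exact: measurable_funeneg].
Qed.

Lemma approx_form_eform t u v : 0 < t -> L2 m D u -> L2 m D v ->
  approx_form X m t u v = eform L2_process t (u \_ D) (v \_ D).
Proof.
move=> t0 hu hv; have t0' := ltW t0.
rewrite /approx_form /eform; congr (_ * _).
have hu' := (L2_restrict m mD u).1 hu; have hv' := (L2_restrict m mD v).1 hv.
have hp := L2_psd mu; have DL := @L2_linear _ _ _ mu.
have hTu : L2 mu setT (L2_process t (u \_ D)).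
  by apply: (op_dom L2_process t0'); exact: hu'.
rewrite -[RHS](psdBl DL hp)//.
have mtr : measurable_fun D (transition X t u).
  apply: (eq_measurable_fun (L2_process t (u \_ D))).
    by move=> x; rewrite inE => Dx; rewrite transition_kop//; case: hu.
  by apply: measurable_funTS; case: hTu.
have -> : L2_ip mu (u \_ D - L2_process t (u \_ D)) (v \_ D) =
    L2_ip mu ((fun x => u x - transition X t u x) \_ D) (v \_ D).
  rewrite /L2_ip; apply: eq_Rintegral => x _; rewrite !patchE.
  rewrite -[(_ - _) x]/((u \_ D) x - L2_process t (u \_ D) x) patchE.
  case: ifPn; rewrite ?mulr0// inE => Dx; rewrite transition_kop//; by case: hu.
rewrite L2_ip_restrict//; last by case: hv.
by apply: measurable_funB => //; case: hu.
Qed.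

(** Existence of a limit of [approx_form] in R is finiteness of the supremum [form], by [cvg_form]
    in one direction and [form_cvg] in the other. *)
Lemma dirichlet_domainE u : dirichlet_domain X m u <->
  L2 mu setT (u \_ D) /\ (form L2_process (u \_ D) < +oo)%E.
Proof.
split=> [[hu [l cl]]|[/(L2_restrict m mD) hu fu]].
  have hu' := (L2_restrict m mD u).1 hu; split => //.
  suff -> : form L2_process (u \_ D) = l%:E by rewrite ltry.
  apply: cvg_form => //; apply: cvg_trans cl; apply: near_eq_cvg; near=> t.
  by rewrite approx_form_eform//; near: t; exact: nbhs_right_gt.
have hu' := (L2_restrict m mD u).1 hu.
split => //; exists (fine (form L2_process (u \_ D))).
apply: cvg_trans (form_cvg _ fu) => //; apply: near_eq_cvg; near=> t.
by rewrite approx_form_eform//; near: t; exact: nbhs_right_gt.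
Unshelve. all: by end_near. Qed.

Let polarization (a b c : R) : 4^-1 * (a + 2 * b + c - (a - 2 * b + c)) = b.
Proof. by field. Qed.

(** Convergence is known on the diagonal; off the diagonal the limit comes from polarization. It is
    in this shape that the forms of two processes are compared later. *)
Lemma dirichlet_form_cvg u v : dirichlet_domain X m u -> dirichlet_domain X m v ->
  dirichlet_form X m u v =
  4^-1 * (fine (form L2_process ((u + v) \_ D)) - fine (form L2_process ((u - v) \_ D))).
Proof.
move=> hu hv; have [hu1 _] := hu; have [hv1 _] := hv.
move: hu hv => /dirichlet_domainE[hu fu] /dirichlet_domainE[hv fv].
have DL := @L2_linear _ _ _ mu.
have eD : (u + v) \_ D = u \_ D + v \_ D.
  by apply/funext => x; rewrite /= !fctE !patchE; case: ifPn => // _; rewrite addr0.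
have eB : (u - v) \_ D = u \_ D - v \_ D.
  by apply/funext => x; rewrite /= !fctE !patchE; case: ifPn => // _; rewrite subr0.
have hD : L2 mu setT (u \_ D + v \_ D) by exact: (linD DL).
have hB : L2 mu setT (u \_ D - v \_ D) by exact: (linB DL).
have fD : (form L2_process (u \_ D + v \_ D) < +oo)%E.
  by have := @form_linear_lty _ _ _ L2_process 1 _ _ hu hv fu fv; rewrite scale1r.
have fB : (form L2_process (u \_ D - v \_ D) < +oo)%E.
  by have := @form_linear_lty _ _ _ L2_process (-1) _ _ hv hu fv fu; rewrite scaleN1r addrC.
rewrite eD eB; apply/cvg_lim => //.
have h : 4^-1 * (eform L2_process t (u \_ D + v \_ D) (u \_ D + v \_ D) -
    eform L2_process t (u \_ D - v \_ D) (u \_ D - v \_ D)) @[t --> 0^'+] -->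
    4^-1 * (fine (form L2_process (u \_ D + v \_ D)) -
    fine (form L2_process (u \_ D - v \_ D))).
  apply: cvgM; first exact: cvg_cst.
  by apply: cvgB; [exact: (@form_cvg _ _ _ L2_process _ hD fD)|
                   exact: (@form_cvg _ _ _ L2_process _ hB fB)].
apply: cvg_trans h; apply: near_eq_cvg; near=> t.
have t0 : 0 < t by near: t; exact: nbhs_right_gt.
rewrite approx_form_eform//.
have hp := eform_psd L2_process t0.
rewrite /= (psd_sqrD DL hp)// (psd_sqrB DL hp)//; exact: polarization.
Unshelve. all: by end_near. Qed.

Lemma dirichlet_formE u : dirichlet_domain X m u ->
  (dirichlet_form X m u u)%:E = form L2_process (u \_ D).
Proof.
move=> hu; have [hu1 _] := hu; move: hu => /dirichlet_domainE[hu fu].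
have f0 : (0 <= form L2_process (u \_ D))%E by exact: form_ge0.
rewrite -[RHS]fineK ?ge0_fin_numE//; congr _%:E; apply/cvg_lim => //.
apply: cvg_trans (form_cvg _ fu) => //; apply: near_eq_cvg; near=> t.
by rewrite approx_form_eform//; near: t; exact: nbhs_right_gt.
Unshelve. all: by end_near. Qed.

Lemma E1_norm2E u : dirichlet_domain X m u ->
  (E1_norm2 X m u)%:E = norm1 L2_process (u \_ D).
Proof.
move=> hu; rewrite /E1_norm2 /norm1 EFinD dirichlet_formE//; congr (_ + _%:E)%E.
have [[mu_ _] _] := hu; rewrite -[RHS]/(L2_ip mu (u \_ D) (u \_ D)) L2_ip_restrict//.
Qed.

End process_kernel.

(** * Closures in the form norm and density in L^2 *)

Section in_closure_theory.
Variables (R : realType) (V : lmodType R) (H : ipspace V) (T : semigroup H).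
Variable C : V -> Prop.
Hypothesis CH : forall f, C f -> H f.
Hypothesis CL : forall a f g, C f -> C g -> C (a *: f + g).
Local Notation q u := (ip H u u).
Local Notation Cl := (in_closure T C).

Let DL := @domL _ _ H.
Let hip := ip_psd H.

Lemma norm1_weak_eq u v : H u -> H v -> weak_eq H u v -> norm1 T u = norm1 T v.
Proof.
by move=> hu hv uv; rewrite /norm1 (weak_eq_form T hu hv uv) (weak_eq_ip hu hv uv).
Qed.

(** A closure is closed; the quarters of [e] absorb the factors 2 of [norm1D]. *)
Lemma in_closure_trans u : H u ->
  (forall e, 0 < e -> exists v, [/\ H v, Cl v & (norm1 T (u - v) < e%:E)%E]) -> Cl u.
Proof.
move=> hu h e e0; have e4 : 0 < e / 4 by rewrite divr_gt0.
have [v [hv cv uv]] := h _ e4; have [f Cf vf] := cv _ e4; have hf := CH Cf.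
exists f => //; rewrite (_ : u - f = (u - v) + (v - f)); last by rewrite addrA subrK.
apply: (le_lt_trans (norm1D T (linB DL hu hv) (linB DL hv hf))).
have -> : e%:E = (2%:E * (e / 4)%:E + 2%:E * (e / 4)%:E)%E.
  by rewrite -EFinM -EFinD; congr _%:E; field.
apply: lteD; rewrite lte_pmul2l//.
Qed.

Lemma in_closure_lin a u v : H u -> H v -> Cl u -> Cl v -> Cl (a *: u + v).
Proof.
move=> hu hv cu cv e e0; have e4 : 0 < e / 4 by rewrite divr_gt0.
(* Dividing by [1 + a ^+ 2] instead of [a ^+ 2] covers the case [a = 0]. *)
have a0 : 0 < 1 + a ^+ 2 by rewrite ltr_pwDl// sqr_ge0.
have [f Cf uf] := cu _ (divr_gt0 e4 a0); have [g Cg vg] := cv _ e4.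
have [hf hg] := (CH Cf, CH Cg); exists (a *: f + g); first exact: CL.
rewrite (_ : _ - _ = a *: (u - f) + (v - g)); last by rewrite scalerBr opprD addrACA.
have huf := linB DL hu hf; have hvg := linB DL hv hg.
apply: (le_lt_trans (norm1D T (linZ DL a huf) hvg)).
have -> : e%:E = (2%:E * (e / 4)%:E + 2%:E * (e / 4)%:E)%E.
  by rewrite -EFinM -EFinD; congr _%:E; field.
apply: lteD; rewrite lte_pmul2l//.
rewrite /norm1 formZ// (psdZl DL hip a huf (linZ DL a huf)) (psdZr DL hip a huf huf).
have -> : (a * (a * q (u - f)))%:E = ((a ^+ 2)%:E * (q (u - f))%:E)%E.
  by rewrite -EFinM mulrA expr2.
rewrite -ge0_muleDr ?form_ge0 ?lee_fin ?(psd_ge0 hip huf)//.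
apply: (@le_lt_trans _ _ ((1 + a ^+ 2)%:E * norm1 T (u - f))%E).
  by apply: lee_wpmul2r; [exact: norm1_ge0|rewrite lee_fin lerDr].
by rewrite muleC -lte_pdivlMr.
Qed.

Lemma in_closure_weak_eq u v : H u -> H v -> weak_eq H u v -> Cl u -> Cl v.
Proof.
move=> hu hv uv cu e /cu [f Cf]; have hf := CH Cf; exists f => //.
rewrite -(norm1_weak_eq (linB DL hu hf) (linB DL hv hf))// => w hw.
by rewrite !(psdBl DL hip)// uv.
Qed.

Lemma in_closure_op_lin s a u v : 0 <= s -> H u -> H v -> Cl (T s u) -> Cl (T s v) ->
  Cl (T s (a *: u + v)).
Proof.
move=> s0 hu hv cu cv; have [hTu hTv] := (op_dom T s0 hu, op_dom T s0 hv).
apply: (in_closure_weak_eq _ _ _ (in_closure_lin a hTu hTv cu cv)) => //.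
- exact: DL.
- by apply: op_dom => //; exact: DL.
- move=> w hw; rewrite op_linear// (psdDl hip) ?(psdZl DL hip)//; exact: linZ.
Qed.

(** By [form_op_bound] and contraction, [T s] is bounded from [q] to [norm1] with constant
    [s^-1 + 1]. Approximation in L^2 before applying [T s] becomes approximation in the form norm
    afterwards. *)
Lemma in_closure_op_closed s u : 0 < s -> H u ->
  (forall e, 0 < e -> exists f, [/\ H f, Cl (T s f) & q (u - f) < e]) -> Cl (T s u).
Proof.
move=> s0 hu h; have s0' := ltW s0.
apply: in_closure_trans => [|e e0]; first exact: op_dom.
have c0 : 0 < s^-1 + 1 by rewrite addr_gt0 ?invr_gt0.
have [f [hf cf uf]] := h _ (divr_gt0 e0 c0); have huf := linB DL hu hf.
have [hTu hTf] := (op_dom T s0' hu, op_dom T s0' hf).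
exists (T s f); split => //.
rewrite -(@norm1_weak_eq (T s (u - f))); last 3 first.
- exact: op_dom.
- exact: linB.
- move=> w hw; rewrite (psdBl DL hip)// (_ : u - f = -1 *: f + u); last first.
    by rewrite scaleN1r addrC.
  by rewrite op_linear// mulN1r addrC.
apply: (@le_lt_trans _ _ ((q (u - f) * (s^-1 + 1))%:E)).
  rewrite mulrDr mulr1 EFinD; apply: leeD; first exact: form_op_bound.
  by rewrite lee_fin; exact: op_contr.
by rewrite lte_fin -ltr_pdivlMr.
Qed.

(** [T s u] tends to [u] in the form norm by [form_op_cvg], so the problem is moved to regularized
    functions. *)
Lemma in_closure_of_op u : H u -> (form T u < +oo)%E ->
  (forall s, 0 < s -> Cl (T s u)) -> Cl u.
Proof.
move=> hu fu h; apply: in_closure_trans => // e e0.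
have [s s0 us] := form_op_cvg hu fu e0; exists (T s u); split => //; last exact: h.
exact: op_dom (ltW s0) hu.
Qed.

End in_closure_theory.

Lemma fun_linE (T : Type) (R : realType) (a : R) (u v : T -> R) x :
  (a *: u + v) x = a * u x + v x.
Proof. by []. Qed.

(** Dominated convergence for the squares of the differences, with dominating function
    [4 * v ^+ 2]. *)
Lemma L2_dominated d (T : measurableType d) (R : realType)
    (mu : {measure set T -> \bar R}) (F : nat -> T -> R) u v :
  (forall n, measurable_fun setT (F n)) ->
  (forall x, F n x @[n --> \oo] --> u x) -> L2 mu setT v ->
  (forall n x, `|F n x| <= v x) ->
  L2 mu setT u /\ forall e, 0 < e -> exists n, L2_ip mu (u - F n) (u - F n) < e.
Proof.
move=> mF Fu hv Fv; have [mv vfin] := hv.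
have mu_ : measurable_fun setT u by apply: (measurable_fun_cvg mF) => x _; exact: Fu.
have uv x : `|u x| <= v x.
  have h : `|F n x| @[n --> \oo] --> `|u x| by apply: cvg_norm; exact: Fu.
  by apply: (cvgr_to_le h); near=> n; exact: Fv.
have v0 x : 0 <= v x by exact: le_trans (uv x).
have hu : L2 mu setT u by apply: (L2_le hv) => // x; rewrite (ger0_norm (v0 x)).
have hF n : L2 mu setT (F n) by apply: (L2_le hv) => // x; rewrite (ger0_norm (v0 x)).
split=> // e e0.
have h : (\int[mu]_x ((u x - F n x) ^+ 2)%:E)%E @[n --> \oo] --> (\int[mu]_x (cst 0 x))%E.
  apply: (dominated_cvg measurableT (g := fun x => (4 * (v x) ^+ 2)%:E)) => //.
  - move=> n; apply/measurable_EFinP; apply: measurable_funX.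
    exact: measurable_funB.
  - move=> x _; apply: cvg_EFin; first by near=> n.
    have h : u x - F n x @[n --> \oo] --> u x - u x by apply: cvgB (Fu x); exact: cvg_cst.
    by have := cvgM h h; rewrite subrr mulr0; apply.
  - rewrite (_ : (fun x => _) = fun x => (4%:E * ((v x) ^+ 2)%:E)%E); last by [].
    apply: integrableZl => //; apply/integrableP; split.
      by apply/measurable_EFinP; exact: measurable_funX.
    by under eq_integral do rewrite gee0_abs ?lee_fin ?sqr_ge0//.
  - move=> n x _; rewrite lee_fin ger0_norm ?sqr_ge0//.
    rewrite -real_normK ?num_real// (_ : 4 * v x ^+ 2 = (v x + v x) ^+ 2); last by ring.
    apply: lerXn2r; rewrite ?nnegrE ?addr_ge0//.
    by apply: (le_trans (ler_normB _ _)); exact: lerD.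
rewrite integral0 in h.
have /(_ e e0) : forall e : R, 0 < e ->
    \forall n \near \oo, (\int[mu]_x ((u x - F n x) ^+ 2)%:E < e%:E)%E.
  move=> {}e {}e0; have := h (fun y => (y < e%:E)%E); apply.
  by apply: open_nbhs_nbhs; split; [exact: open_ereal_lt_ereal|rewrite /= lte_fin].
move=> [N _ /(_ N (leqnn N)) /= hN]; exists N.
rewrite -lte_fin L2_ip_sqr//.
have -> : u - F N = -1 *: F N + u by apply/funext => x; rewrite !fctE scaleN1r addrC.
exact: L2_linear (hF N) hu.
Unshelve. all: by end_near. Qed.

Section L2_dense.
Context d (T : measurableType d) (R : realType) (mu : {measure set T -> \bar R}).
Variables (G : set (set T)) (g : nat -> set T) (D : (T -> R) -> Prop).
Hypothesis GE : measurable = <<s G>>.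
Hypothesis GI : setI_closed G.
Hypothesis Gg : forall k, G (g k).
Hypothesis g_nd : nondecreasing_seq g.
Hypothesis gT : \bigcup_k g k = setT.
Hypothesis DG : forall A k, G A -> D \1_(A `&` g k).
Hypothesis DH : forall u, D u -> L2 mu setT u.
Hypothesis DL : forall a u v, D u -> D v -> D (a *: u + v).
Hypothesis D_closed : forall u, L2 mu setT u ->
  (forall e, 0 < e -> exists2 f, D f & L2_ip mu (u - f) (u - f) < e) -> D u.

Let G_measurable A : G A -> measurable A.
Proof. by move=> GA; rewrite GE; exact: sub_sigma_algebra. Qed.

Let D_dominated (F : nat -> T -> R) u v : (forall n, D (F n)) ->
  (forall x, F n x @[n --> \oo] --> u x) -> L2 mu setT v ->
  (forall n x, `|F n x| <= v x) -> D u.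
Proof.
move=> DF Fu hv Fv.
have [hu h] := L2_dominated (fun n => (DH (DF n)).1) Fu hv Fv.
by apply: D_closed => // e /h [n hn]; exists (F n).
Qed.

Let D_lin (J : Type) (l : seq J) (c : J -> R) (f : J -> T -> R) k0 :
  (forall j, D (f j)) -> D \1_(g k0) -> D (fun x => \sum_(j <- l) c j * f j x).
Proof.
move=> Df Dg; elim: l => [|j l IH].
  under eq_fun do rewrite big_nil.
  have := DL (-1) Dg Dg; congr D; apply/funext => x; rewrite !fctE.
  by rewrite scaleN1r addNr.
under eq_fun do rewrite big_cons.
by have := DL (c j) (Df j) IH; congr D.
Qed.

Let Dg k : D \1_(g k). Proof. by rewrite -[g k]setIid; exact: DG. Qed.

Let L2g k (c : R) : L2 mu setT (fun x => c * \1_(g k) x).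
Proof.
have h := DL (c - 1) (Dg k) (Dg k).
rewrite (_ : (fun x => _) = (c - 1) *: \1_(g k) + \1_(g k)); first exact: DH.
by apply/funext => x; rewrite fun_linE; ring.
Qed.

Let Dset k A : measurable A -> D \1_(A `&` g k).
Proof.
(* The sets whose cut-off indicator is in [D] form a lambda-system: differences by linearity,
   increasing unions by dominated convergence. *)
rewrite GE; pose H := [set A | measurable A /\ D \1_(A `&` g k)].
have HL : lambda_system setT H.
  split => //.
  - by split => //; rewrite setTI.
  - move=> P B BA [mA DA] [mB DB]; split; first exact: measurableD.
    have := DL (-1) DB DA; congr D; apply/funext => x; rewrite fun_linE !indicI /= !indicE.
    have [Bx|nB] := pselect (B x).
      by rewrite (mem_set Bx) (mem_set (BA x Bx)) (memNset (A := fun x => ~ B x) (fun nB => nB Bx)) /=; ring.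
    rewrite (memNset nB) (mem_set (A := fun x => ~ B x) nB) /=; ring.
  - move=> F ndF HF; split; first by apply: bigcup_measurable => n _; case: (HF n).
    apply: (@D_dominated (fun n => \1_(F n `&` g k)) _ (fun x => 1 * \1_(g k) x)) => //.
    + by move=> n; case: (HF n).
    + move=> x; apply: cvg_near_cst; have [[n _ Fx]|nF] := pselect ((\bigcup_i F i) x).
        near=> m; rewrite !indicE !in_setI; congr ((_ && _)%:R).
        rewrite [RHS]mem_set; last by exists n.
        apply/mem_set; have nm : (n <= m)%N by near: m; exact: nbhs_infty_ge.
        by have /subsetPset := ndF _ _ nm; exact.
      near=> m; rewrite !indicE !in_setI; congr ((_ && _)%:R).
      by rewrite !memNset// => Fx; apply: nF; exists m.
    + move=> n x; rewrite mul1r !indicE in_setI.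
      by case: (x \in F n); case: (x \in g k); rewrite ?normr1 ?normr0.
move=> mA; have [] // : H A; apply: (lambda_system_subset GI HL _ _ mA) => // B GB.
by split; [exact: G_measurable|exact: DG].
Unshelve. all: by end_near. Qed.

Import HBNNSimple.

Let Dpos u : L2 mu setT u -> (forall x, 0 <= u x) -> D u.
Proof.
move=> hu u0; have [mu_ _] := hu.
have nu : nonneg_mfun (EFin \o u) by exact: nonneg_mfun_EFin.
have [u0' mu'] := nu.
pose h n := nnsfun_approx measurableT mu' n.
have hcvg x : h n x @[n --> \oo] --> u x.
  by have /fine_cvgP[] := cvg_nnsfun_approx measurableT mu' (fun y _ => u0' y) (x := x) I.
have hu_le n x : h n x <= u x.
  have nd : nondecreasing_seq (fun n => h n x).
    by move=> a b ab; have /lefP := nd_nnsfun_approx measurableT mu' ab; exact.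
  rewrite -(cvg_lim _ (hcvg x))//; apply: (nondecreasing_cvgn_le nd).
  by apply/cvg_ex; exists (u x); exact: hcvg.
apply: (@D_dominated (fun n x => h n x * \1_(g n) x) u u) => //.
- move=> n; have /finite_seqP[s hs] : finite_set (range (h n)) by exact: fimfunP.
  have mA (y : R) : measurable (h n @^-1` [set y]) by exact: measurable_funPTI.
  rewrite (_ : (fun x => _) = fun x =>
      \sum_(y <- undup s) y * \1_((h n @^-1` [set y]) `&` g n) x); last first.
    apply/funext => x.
    have hx : h n x \in undup s.
      by rewrite mem_undup; have : range (h n) (h n x) by []; rewrite hs.
    rewrite (bigD1_seq (h n x))//= ?undup_uniq// big1 ?addr0 => [|y yhx].
      by rewrite indicI /= !indicE (mem_set (u := x) (A := h n @^-1` [set h n x])) ?mul1r.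
    
    by rewrite indicI /= indicE memNset ?mul0r ?mulr0// => /esym/eqP; rewrite (negPf yhx).
  apply: (@D_lin _ _ _ _ 0%N) => // y; exact: Dset.
- move=> x; rewrite -[u x]mulr1; apply: cvgM.
    exact: hcvg.
  have : setT x by []; rewrite -gT => -[k _ gx].
  apply: cvg_near_cst; near=> n; rewrite indicE mem_set//.
  have kn : (k <= n)%N by near: n; exact: nbhs_infty_ge.
  by have /subsetPset := g_nd kn; exact.
- move=> n x; rewrite indicE ger0_norm; last by rewrite mulr_ge0.
  by apply: le_trans (hu_le n x); rewrite ler_piMr//; case: (_ \in _).
Unshelve. all: by end_near. Qed.

(** Dynkin's argument inside L^2, followed by simple functions cut off by [g n], monotone limits,
    and positive and negative parts. [D] is an arbitrary predicate, so that it can be the class of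
    functions whose regularization is approximable. *)
Lemma L2_dense u : L2 mu setT u -> D u.
Proof.
move=> hu; have := DL (-1) (Dpos (L2_neg hu) _) (Dpos (L2_pos hu) _).
move=> h; rewrite (_ : u = -1 *: (fun x => Num.max (- u x) 0) + (fun x => Num.max (u x) 0)).
  by apply: h => x; rewrite le_max lexx orbT.
apply/funext => x; rewrite [LHS]max_decomp fun_linE; ring.
Qed.

End L2_dense.

(** * Product spaces *)

Section row_vectors.
Variables (R : realType) (n : nat).
Implicit Types (x : 'rV[R]_n) (i j : 'I_n).

Lemma measurable_coord i : measurable_fun setT (fun x => x ord0 i).
Proof.
move=> _ B mB; apply: sub_sigma_algebra; rewrite (bigD1 i)//=; left.
by exists B.
Qed.

Lemma measurable_box (A : 'I_n -> set R) : (forall i, measurable (A i)) ->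
  measurable (box A).
Proof.
move=> mA; rewrite (_ : box A = \bigcap_(i in [set: 'I_n]) (fun x => x ord0 i) @^-1` A i); last first.
  by apply/seteqP; split => x; [move=> Ax i _; exact: Ax|move=> Ax i; exact: Ax].
apply: fin_bigcap_measurable => // i _; rewrite -[X in measurable X]setTI.
exact: measurable_coord.
Qed.

Definition boxes : set (set 'rV[R]_n) :=
  [set B | exists2 A, (forall i, measurable (A i)) & B = box A].

Lemma boxes_setI : setI_closed boxes.
Proof.
move=> _ _ [A mA ->] [B mB ->]; exists (fun i => A i `&` B i).
  by move=> i; exact: measurableI.
by apply/seteqP; split => [x [Ax Bx] i|x ABx]; [split|split => i; case: (ABx i)].
Qed.

Lemma measurable_boxes : measurable = <<s boxes >>.
Proof.
apply/seteqP; split => [A|]; last first.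
  by apply: smallest_sub; [exact: sigma_algebra_measurable|move=> _ [A mA ->]; exact: measurable_box].
apply: smallest_sub; first exact: smallest_sigma_algebra.
elim/big_ind: _ => [//|P Q hP hQ|i _ B [C mC <-]]; first by rewrite subUset.
rewrite setTI; apply: sub_sigma_algebra; exists (fun j => if j == i then C else setT).
  by move=> j; case: ifP.
apply/seteqP; split => [x Cx j|x /(_ i)]; last by rewrite eqxx.
by case: eqP => [->|].
Qed.

Lemma measurable_rV d (T : measurableType d) (f : T -> 'rV[R]_n) :
  (forall i, measurable_fun setT (fun t => f t ord0 i)) -> measurable_fun setT f.
Proof.
move=> mf; apply: (measurability boxes measurable_boxes) => _ [_ [A mA ->] <-].
rewrite (_ : _ `&` _ = \bigcap_(i in [set: 'I_n]) (fun t => f t ord0 i) @^-1` A i); last first.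
  by apply/seteqP; split => [x [_ Ax] i _|x Ax]; [exact: Ax|split => // i; exact: Ax].
apply: fin_bigcap_measurable => // i _; rewrite -[X in measurable X]setTI.
exact: mf.
Qed.

Lemma measurable_set1_rV x : measurable [set x].
Proof.
rewrite (_ : [set x] = box (fun i => [set x ord0 i])); first exact: measurable_box.
apply/seteqP; split => [y ->//|y /= h]; apply/rowP => i; exact: h.
Qed.

Definition upd i x (y : R) : 'rV[R]_n := \row_j (if j == i then y else x ord0 j).

Lemma upd_same i x y : upd i x y ord0 i = y.
Proof. by rewrite mxE eqxx. Qed.

Lemma upd_other i j x y : j != i -> upd i x y ord0 j = x ord0 j.
Proof. by rewrite mxE => /negPf ->. Qed.

Lemma upd_upd i x y z : upd i (upd i x y) z = upd i x z.
Proof. by apply/rowP => j; rewrite !mxE; case: eqP. Qed.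

Lemma measurable_upd2 i : measurable_fun setT (fun xy : 'rV[R]_n * R => upd i xy.1 xy.2).
Proof.
apply: measurable_rV => j; have [->|ji] := eqVneq j i.
  by under eq_fun do rewrite upd_same; exact: measurable_snd.
under eq_fun do rewrite upd_other//.
exact: (measurableT_comp (measurable_coord j) measurable_fst).
Qed.

Lemma measurable_upd i x : measurable_fun setT (upd i x).
Proof.
apply: measurable_rV => j; have [->|ji] := eqVneq j i.
  by under eq_fun do rewrite upd_same; exact: measurable_id.
by under eq_fun do rewrite upd_other//; exact: measurable_cst.
Qed.

Lemma nonneg_mfun_section i x (f : 'rV[R]_n -> \bar R) : nonneg_mfun f ->
  nonneg_mfun (fun y => f (upd i x y)).
Proof.
move=> [f0 mf]; split => [y|]; first exact: f0.
exact: measurableT_comp (measurable_upd i x).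
Qed.

End row_vectors.

Section kernel_measurability.
Variables (R : realType) (d d' : measure_display).
Variables (X : measurableType d) (Y : measurableType d').

Lemma finite_kernel_of (k : X -> {measure set Y -> \bar R}) :
  (forall U, measurable U -> measurable_fun setT (k ^~ U)) -> measure_fam_uub k ->
  exists l : R.-fker X ~> Y, l = k :> (X -> {measure set Y -> \bar R}).
Proof.
move=> mk h; pose M := isKernel.Build _ _ _ _ _ k mk.
pose k' : R.-ker X ~> Y := HB.pack k M.
pose N := Kernel_isFinite.Build _ _ _ _ _ k' h.
pose l : R.-fker X ~> Y := HB.pack (Kernel.sort k') N.
by exists l.
Qed.

Lemma measurable_integral_finite_kernel (k : X -> {measure set Y -> \bar R})
    (f : X * Y -> \bar R) :
  (forall U, measurable U -> measurable_fun setT (k ^~ U)) -> measure_fam_uub k ->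
  nonneg_mfun f -> measurable_fun setT (fun x => \int[k x]_y f (x, y))%E.
Proof.
move=> mk h [f0 mf]; have [l <-] := finite_kernel_of mk h.
exact: measurable_fun_integral_finite_kernel.
Qed.

(** [mu] is exhausted by its restrictions to the sets [A n] of finite mass, for which measurability
    of integrals in a parameter is that of a finite kernel. *)
Lemma measurable_integral_sigma_finite (mu : {measure set Y -> \bar R})
    (A : nat -> set Y) (f : X * Y -> \bar R) :
  (forall n, measurable (A n)) -> (forall n, (mu (A n) < +oo)%E) ->
  nondecreasing_seq A -> \bigcup_n A n = setT ->
  nonneg_mfun f -> measurable_fun setT (fun x => \int[mu]_y f (x, y))%E.
Proof.
move=> mA fA ndA AT [f0 mf].
pose k n (x : X) : {measure set Y -> \bar R} := mrestr mu (mA n).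
have mk n : measurable_fun setT (fun x => \int[k n x]_y f (x, y))%E.
  apply: measurable_integral_finite_kernel => //.
  exists (fine (mu (A n)) + 1) => x; rewrite /k /= /mrestr setTI EFinD fineK ?ge0_fin_numE//.
  by rewrite lteDl ?ge0_fin_numE// lte_fin.
apply: (emeasurable_fun_cvg (fun n x => \int[k n x]_y f (x, y))%E) => // x _.
have mfx : measurable_fun setT (fun y => f (x, y)).
  by apply: measurableT_comp mf _; exact: measurable_pair1.
have hfx : nonneg_mfun (fun y => f (x, y)) by split.
rewrite (_ : (fun n => _) = fun n => \int[mu]_y ((fun y => f (x, y)) \_ (A n)) y)%E; last first.
  by apply/funext => j; rewrite integral_like_mrestr// integral_mkcond.
set g := fun y => f (x, y).
have gE : g = fun y => limn (fun k' => (g \_ (A k')) y).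
  apply/funext => y; have : setT y by []; rewrite -AT => -[k0 _ Any].
  apply/esym/cvg_lim => //; apply: cvg_near_cst; near=> k'.
  rewrite patchE mem_set//; have nk : (k0 <= k')%N by near: k'; exact: nbhs_infty_ge.
  by move/ndA: nk => /subsetPset; exact.
have h : (fun k' => \int[mu]_y (g \_ (A k')) y)%E @ \oo -->
    (\int[mu]_y limn (fun k' => (g \_ (A k')) y))%E.
  apply: cvg_monotone_convergence => //.
  - by move=> k'; apply/(measurable_restrictT _ (mA k')).1; exact: measurable_funTS.
  - by move=> k' y _; rewrite patchE; case: ifPn => // _; exact: hfx.1.
  - move=> y _ a b ab; rewrite !patchE; case: ifPn => [|_]; last first.
      by case: ifPn => // _; exact: hfx.1.
    rewrite inE => Aay; rewrite mem_set//.
    by move/ndA: ab => /subsetPset; exact.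
by rewrite -gE in h.
Unshelve. all: by end_near. Qed.

End kernel_measurability.

(** * Kernels acting on one coordinate of a product space *)

Section product_space.
Variables (R : realType) (n : nat).
Variables (mu : 'I_n -> {measure set R -> \bar R}).
Variable (muE : {measure set 'rV[R]_n -> \bar R}).
Variables (C : 'I_n -> nat -> set R) (K : 'I_n -> set R).
Hypothesis mC : forall i k, measurable (C i k).
Hypothesis Cfin : forall i k, (mu i (C i k) < +oo)%E.
Hypothesis Cnd : forall i, nondecreasing_seq (C i).
Hypothesis CT : forall i, \bigcup_k C i k = setT.
Hypothesis mK : forall i, measurable (K i).
Hypothesis K0 : forall i, (0 < mu i (K i))%E.
Hypothesis Kfin : forall i, (mu i (K i) < +oo)%E.
Hypothesis muEE : forall A : 'I_n -> set R, (forall i, measurable (A i)) ->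
  muE (box A) = (\prod_i mu i (A i))%E.

Lemma boxes_cover : \bigcup_k box (fun i => C i k) = setT.
Proof.
apply/seteqP; split => // x _.
have h i : exists k, C i k (x ord0 i).
  by have : setT (x ord0 i) by []; rewrite -(CT i) => -[k _ ?]; exists k.
have [k hk] := choice h; exists (\max_i k i)%N => // i.
by apply/subsetPset: (hk i); apply: Cnd; exact: leq_bigmax.
Qed.

Lemma muE_cover_fin k : (muE (box (fun i => C i k)) < +oo)%E.
Proof.
rewrite muEE//; suff h : (\prod_i mu i (C i k))%E \is a fin_num.
  by rewrite -ge0_fin_numE//; apply: prode_ge0.
elim/big_ind: _ => [//|x y|i _]; first exact: fin_numM.
by rewrite ge0_fin_numE.
Qed.

Definition set_coord (i : 'I_n) (A : 'I_n -> set R) (B : set R) : 'I_n -> set R :=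
  fun j => if j == i then B else A j.

Lemma measurable_set_coord i A B : (forall i, measurable (A i)) -> measurable B ->
  forall j, measurable (set_coord i A B j).
Proof. by move=> mA mB j; rewrite /set_coord; case: ifP. Qed.

Lemma box_upd i (A : 'I_n -> set R) x y :
  box A (upd i x y) <-> A i y /\ box (set_coord i A setT) x.
Proof.
split => [Ax|[Ay Ax] j].
  split => [|j]; first by have := Ax i; rewrite upd_same.
  by rewrite /set_coord; case: eqVneq => // ji; have := Ax j; rewrite upd_other.
have [->|ji] := eqVneq j i; first by rewrite upd_same.
by rewrite upd_other//; have := Ax j; rewrite /set_coord (negPf ji).
Qed.

Lemma indic_box_upd i (A : 'I_n -> set R) x y :
  \1_(box A) (upd i x y) = \1_(A i) y * \1_(box (set_coord i A setT)) x :> R.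
Proof.
rewrite !indicE -natrM mulnb; congr (nat_of_bool _)%:R.
apply/idP/andP; rewrite !inE; first by move=> /box_upd.
by move=> h; apply/box_upd.
Qed.

Lemma integral_box_upd (k : {measure set R -> \bar R}) i (A : 'I_n -> set R) x :
  measurable (A i) ->
  (\int[k]_y (EFin \o \1_(box A)) (upd i x y) =
   k (A i) * (\1_(box (set_coord i A setT)) x)%:E)%E.
Proof.
move=> mA; under eq_integral do rewrite /= indic_box_upd mulrC EFinM.
rewrite ge0_integralZl_EFin//; last by apply/measurable_EFinP; exact: measurable_indic.
by rewrite integral_indic// setIT muleC.
Qed.

Definition cint i (f : 'rV[R]_n -> \bar R) x : \bar R :=
  (\int[mu i]_y f (upd i x y))%E.

Lemma nonneg_mfun_cint i f : nonneg_mfun f -> nonneg_mfun (cint i f).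
Proof.
move=> [f0 mf]; split => [x|]; first exact: integral_ge0.
pose g (xy : 'rV[R]_n * R) := f (upd i xy.1 xy.2).
apply: (measurable_integral_sigma_finite (f := g) (mC i) (Cfin i) (@Cnd i) (CT i)).
by split => [xy|]; [exact: f0|exact: measurableT_comp (measurable_upd2 i)].
Qed.

Lemma integral_like_cint i x : integral_like (fun f => cint i f x).
Proof.
exact: integral_like_map (measurable_upd i x) (integral_like_integral (mu i)).
Qed.

Let c i := fine (mu i (K i)).
Let c_gt0 i : 0 < c i. Proof. by rewrite fine_gt0// K0 Kfin. Qed.

Definition weight i (x : 'rV[R]_n) : R := (c i)^-1 * \1_(K i) (x ord0 i).

Lemma weight_ge0 i x : 0 <= weight i x.
Proof. by rewrite /weight mulr_ge0// invr_ge0 ltW. Qed.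

Lemma measurable_weight i : measurable_fun setT (weight i).
Proof.
apply: measurable_funM => //.
by apply: (measurableT_comp (measurable_indic _)) => //; exact: measurable_coord.
Qed.

Lemma nonneg_mfun_weight i : nonneg_mfun (EFin \o weight i).
Proof. by apply: nonneg_mfun_EFin; [exact: measurable_weight|exact: weight_ge0]. Qed.

(* Averaging the coordinate [i] over [K i] plays the role of dropping it, so
   that no space of the remaining coordinates is needed. *)
Lemma disintegration i f : nonneg_mfun f ->
  (\int[muE]_x f x = \int[muE]_x ((weight i x)%:E * cint i f x))%E.
Proof.
have L : integral_like (fun f => \int[muE]_x ((weight i x)%:E * cint i f x))%E.
  apply: (integral_like_comp (integral_like_integral muE)).
    move=> x; have := integral_like_scale (c := (weight i x)%:E) _ (integral_like_cint i x).
    by under eq_fun do rewrite muleC; apply; rewrite lee_fin weight_ge0.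
  move=> g hg; apply: emeasurable_funM; first exact: (nonneg_mfun_weight i).2.
  exact: (nonneg_mfun_cint i hg).2.
move: f; apply: (integral_like_unique (G := @boxes R n) (g := fun k => box (fun i => C i k))
  (measurable_boxes R n) (@boxes_setI R n) _ boxes_cover (integral_like_integral muE) L).
- by move=> k; exists (fun i => C i k).
- move=> _ [A mA ->]; have mB := measurable_box mA.
  rewrite integral_indic// setIT.
  under eq_integral do rewrite /cint integral_box_upd// muleCA.
  have mS := measurable_set_coord i mA (mK i).
  have E x : ((weight i x)%:E * (\1_(box (set_coord i A setT)) x)%:E =
      (c i)^-1%:E * (\1_(box (set_coord i A (K i))) x)%:E)%E.
    rewrite /weight -!EFinM -mulrA; congr (_ * _)%:E; rewrite !indicE -natrM mulnb.
    congr (nat_of_bool _)%:R; apply/andP/idP; rewrite !inE.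
      move=> [Kx Ax] j; have := Ax j; rewrite /set_coord; case: eqP => // -> _; exact: Kx.
    move=> Ax; split; first by have := Ax i; rewrite /set_coord eqxx.
    by move=> j; have := Ax j; rewrite /set_coord; case: eqP.
  under eq_integral do rewrite E.
  have mI : measurable_fun setT (\1_(box (set_coord i A (K i))) : _ -> R).
    by apply: measurable_indic; exact: measurable_box.
  have i0 : 0 <= (c i)^-1 by rewrite invr_ge0 ltW.
  have mI' : measurable_fun setT
      (fun x => (\1_(box (set_coord i A (K i))) x)%:E : \bar R) by exact/measurable_EFinP.
  have -> : (\int[muE]_x (mu i (A i) *
      ((c i)^-1%:E * (\1_(box (set_coord i A (K i))) x)%:E)) =
      mu i (A i) * ((c i)^-1%:E * \int[muE]_x (\1_(box (set_coord i A (K i))) x)%:E))%E.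
    rewrite -ge0_integralZl_EFin//; apply: ge0_integralZl => //.
      exact: emeasurable_funM.
    by move=> x _; rewrite -EFinM lee_fin mulr_ge0.
  rewrite integral_indic ?setIT//; last exact: measurable_box.
  rewrite !muEE// (bigD1 i)//= [in RHS](bigD1 i)//= {1}/set_coord eqxx.
  rewrite [X in (_ * (_ * (_ * X)))%E](eq_bigr (fun j => mu j (A j))); last first.
    by move=> j /negPf ji; rewrite /set_coord ji.
  congr (_ * _)%E; rewrite muleA -[mu i (K i)]fineK ?ge0_fin_numE// -EFinM.
  by rewrite mulVf ?mul1e// gt_eqF.
- by move=> k; rewrite integral_indic ?setIT ?muE_cover_fin//; exact: measurable_box.
Qed.

Section coordinate_kernel.
Variable i : 'I_n.

Let L (k : R -> {measure set R -> \bar R}) (x : 'rV[R]_n) :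
  integral_like (fun f => kint k (fun y => f (upd i x y)) (x ord0 i)).
Proof. exact: integral_like_map (measurable_upd i x) (integral_like_kint _ _). Qed.

(** It acts on the coordinate [i] and freezes the others, as a kernel on the full space, so that
    kernels of different coordinates can be composed. *)
Definition coord_kernel (k : R -> {measure set R -> \bar R}) (x : 'rV[R]_n) :
  {measure set 'rV[R]_n -> \bar R} := projT1 (cid (integral_like_measureE (L k x))).

Lemma kint_coord k f x : nonneg_mfun f ->
  kint (coord_kernel k) f x = kint k (fun y => f (upd i x y)) (x ord0 i).
Proof. by move=> hf; rewrite {1}/kint /coord_kernel; case: cid => nu /= ->. Qed.

Lemma kint_coord_upd k f x z : nonneg_mfun f ->
  kint (coord_kernel k) f (upd i x z) = kint k (fun y => f (upd i x y)) z.
Proof.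
by move=> hf; rewrite kint_coord// upd_same; congr kint; apply/funext => y; rewrite upd_upd.
Qed.

Lemma kop_coord_upd k (u : 'rV[R]_n -> R) x z : measurable_fun setT u ->
  kop (coord_kernel k) u (upd i x z) = kop k (fun y => u (upd i x y)) z.
Proof.
move=> mu_; rewrite /kop /Rintegral; congr fine.
have mu' : measurable_fun setT (EFin \o u) by exact/measurable_EFinP.
have hp : nonneg_mfun (EFin \o u)^\+%E.
  by split => [y|]; [exact: funepos_ge0|exact: measurable_funepos].
have hn : nonneg_mfun (EFin \o u)^\-%E.
  by split => [y|]; [exact: funeneg_ge0|exact: measurable_funeneg].
rewrite [LHS]integralE [RHS]integralE.
have := kint_coord_upd k x z hp; have := kint_coord_upd k x z hn.
rewrite /kint => -> ->; congr (_ - _)%E.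
  by apply: eq_integral => y _; rewrite !funeposE.
by apply: eq_integral => y _; rewrite !funenegE.
Qed.

Lemma subMarkov_coord k : subMarkov k -> subMarkov (coord_kernel k).
Proof.
move=> [mk k1]; split => [A mA|x].
  have hA := nonneg_mfun_indic R mA.
  rewrite (_ : (fun x => coord_kernel k x A) =
    fun x => \int[k (x ord0 i)]_y (EFin \o \1_A) (upd i x y))%E; last first.
    apply/funext => x; have := kint_coord k x hA.
    by rewrite {1}/kint integral_indic// setIT.
  pose g (xy : 'rV[R]_n * R) : \bar R := (EFin \o \1_A) (upd i xy.1 xy.2).
  have hg : nonneg_mfun g.
    split => [xy|]; first exact: hA.1.
    by apply: measurableT_comp hA.2 _; exact: measurable_upd2.
  apply: (measurable_integral_finite_kernel (k := fun x : 'rV[R]_n => k (x ord0 i)) _ _ hg).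
    by move=> U mU; apply: (measurableT_comp (mk U mU)); exact: measurable_coord.
  by exists 2 => x; apply: le_lt_trans (k1 _) _; rewrite lte_fin ltr1n.
have mT : measurable [set: 'rV[R]_n] by [].
have e : kint (coord_kernel k) (EFin \o \1_[set: 'rV[R]_n]) x = coord_kernel k x setT.
  by rewrite /kint integral_indic// setIT.
rewrite -e kint_coord; last exact: nonneg_mfun_indic.
rewrite /kint (_ : (fun y => _) = EFin \o \1_[set: R]).
  by rewrite integral_indic// setIT.
by apply/funext => y /=; rewrite !indicE !in_setT.
Qed.

Lemma cint_kint_coord k f g x : nonneg_mfun f ->
  cint i (fun x => kint (coord_kernel k) f x * g x)%E x =
  (\int[mu i]_z (kint k (fun y => f (upd i x y)) z * g (upd i x z)))%E.
Proof. by move=> hf; apply: eq_integral => z _; rewrite kint_coord_upd. Qed.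

Lemma nonneg_mfun_kint_coord k f : subMarkov k -> nonneg_mfun f ->
  nonneg_mfun (kint (coord_kernel k) f).
Proof. by move=> hk hf; apply: nonneg_mfun_kint => //; exact: subMarkov_coord. Qed.

(** After [disintegration], both sides integrate over [x] a one-dimensional pairing of sections, to
    which the symmetry of [k] applies. *)
Lemma symmetric_coord k : subMarkov k -> symmetric_kernel (mu i) k ->
  symmetric_kernel muE (coord_kernel k).
Proof.
move=> hk sk f g hf hg.
have hKf := nonneg_mfun_kint_coord hk hf; have hKg := nonneg_mfun_kint_coord hk hg.
rewrite (disintegration i (nonneg_mfunM hKf hg)) (disintegration i (nonneg_mfunM hf hKg)).
apply: eq_integral => x _; congr (_ * _)%E; rewrite cint_kint_coord//.
rewrite (sk _ _ (nonneg_mfun_section i x hf) (nonneg_mfun_section i x hg)).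
by apply: eq_integral => z _; rewrite kint_coord_upd.
Qed.

Definition coord_semigroup (P : kernel_semigroup (mu i)) : kernel_semigroup muE.
Proof.
refine (@KernelSemigroup _ _ _ muE (fun t => coord_kernel (P t))
  (fun t => subMarkov_coord (ksg_subMarkov P t))
  (fun t => symmetric_coord (ksg_subMarkov P t) (ksg_sym P t)) _ _).
- move=> s t f g s0 t0 hf hg.
  have hKf := nonneg_mfun_kint_coord (ksg_subMarkov P t) hf.
  have hKKf := nonneg_mfun_kint_coord (ksg_subMarkov P s) hKf.
  have hKf' := nonneg_mfun_kint_coord (ksg_subMarkov P (s + t)) hf.
  rewrite (disintegration i (nonneg_mfunM hKKf hg)) (disintegration i (nonneg_mfunM hKf' hg)).
  apply: eq_integral => x _.
  rewrite (cint_kint_coord (P s) g x hKf) (cint_kint_coord (P (s + t)) g x hf).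
  rewrite -(ksg_comp P s0 t0 (nonneg_mfun_section i x hf) (nonneg_mfun_section i x hg)).
  rewrite (_ : (fun y => kint (coord_kernel (P t)) f (upd i x y)) =
               kint (P t) (fun y => f (upd i x y)))//.
  by apply/funext => y; rewrite kint_coord_upd.
- move=> f g hf hg.
  have hKf := nonneg_mfun_kint_coord (ksg_subMarkov P 0) hf.
  rewrite (disintegration i (nonneg_mfunM hKf hg)) (disintegration i (nonneg_mfunM hf hg)).
  apply: eq_integral => x _; rewrite (cint_kint_coord (P 0) g x hf).
  by rewrite (ksg0 P (nonneg_mfun_section i x hf) (nonneg_mfun_section i x hg)).
Defined.

Lemma coord_semigroupE P t : coord_semigroup P t = coord_kernel (P t).
Proof. by []. Qed.

End coordinate_kernel.

(** On a box both compositions are the same product of two masses and an indicator; since sub-Markov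
    kernels are finite, agreement on boxes is enough. *)
Lemma kint_coord_commute i j k l f x : i != j -> subMarkov k -> subMarkov l ->
  nonneg_mfun f ->
  kint (coord_kernel i k) (kint (coord_kernel j l) f) x =
  kint (coord_kernel j l) (kint (coord_kernel i k) f) x.
Proof.
move=> ij hk hl; have hk' := subMarkov_coord i hk; have hl' := subMarkov_coord j hl.
have Lc k1 k2 : subMarkov k1 -> subMarkov k2 ->
    integral_like (fun f : 'rV[R]_n -> \bar R => kint k1 (kint k2 f) x).
  move=> h1 h2; apply: (integral_like_comp (integral_like_integral (k1 x))).
    by move=> y; exact: integral_like_kint.
  by move=> g hg; exact: (nonneg_mfun_kint h2 hg).2.
have kE i' j' k' l' (A : 'I_n -> set R) : i' != j' -> (forall i, measurable (A i)) ->
    subMarkov k' -> subMarkov l' ->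
    kint (coord_kernel i' k') (kint (coord_kernel j' l') (EFin \o \1_(box A))) x =
    (k' (x ord0 i') (A i') * (l' (x ord0 j') (A j') *
     (\1_(box (set_coord i' (set_coord j' A setT) setT)) x)%:E))%E.
  move=> ij' mA hk1 hl1; have mB := measurable_box mA.
  have hB := nonneg_mfun_indic R mB.
  rewrite kint_coord; last exact: nonneg_mfun_kint (subMarkov_coord j' hl1) hB.
  rewrite /kint (eq_integral (fun y => l' (x ord0 j') (A j') *
     (EFin \o \1_(box (set_coord j' A setT))) (upd i' x y))%E); last first.
    move=> y _; rewrite [LHS](kint_coord j' l' (upd i' x y) hB).
    by rewrite /kint integral_box_upd// upd_other// eq_sym.
  have mS := measurable_set_coord j' mA (@measurableT _ R).
  rewrite ge0_integralZl//.
  - by rewrite integral_box_upd// {1}/set_coord (negPf ij') muleCA.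
  - by apply: measurableT_comp (nonneg_mfun_indic R (measurable_box mS)).2 _; exact: measurable_upd.
  - by move=> y _; exact: (nonneg_mfun_indic R (measurable_box mS)).1.
move: f; apply: (integral_like_unique (G := @boxes R n) (g := fun=> setT)
  (measurable_boxes R n) (@boxes_setI R n) _ _ (Lc _ _ hk' hl') (Lc _ _ hl' hk')).
- by move=> _; exists (fun=> setT) => //; apply/seteqP; split.
- by rewrite bigcup_const//; exists 0%N.
- move=> _ [A mA ->]; rewrite !kE// 1?eq_sym// muleCA; congr (_ * (_ * _%:E))%E.
  rewrite (_ : set_coord i (set_coord j A setT) setT = set_coord j (set_coord i A setT) setT)//.
  by apply/funext => a; rewrite /set_coord; do 2 case: ifP.
- move=> _; rewrite (_ : setT = box (fun=> setT)); last by apply/seteqP; split.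
  rewrite kE//; apply: (@le_lt_trans _ _ 1%E); last by rewrite ltry.
  rewrite -[leRHS]mule1; apply: lee_pmul => //; first exact: hk.2.
  rewrite -[leRHS]mule1; apply: lee_pmul => //; first exact: hl.2.
  by rewrite lee_fin indicE; case: (_ \in _).
Qed.

Lemma coord_commuting i j (P : kernel_semigroup (mu i)) (Q : kernel_semigroup (mu j)) :
  i != j -> commuting (L2_semigroup (coord_semigroup P)) (L2_semigroup (coord_semigroup Q)).
Proof.
move=> ij s t u v s0 t0 hu hv.
have hk := ksg_subMarkov P s; have hl := ksg_subMarkov Q t.
have hk' := subMarkov_coord i hk; have hl' := subMarkov_coord j hl.
have sk' := symmetric_coord (i := i) hk (ksg_sym P s).
have sl' := symmetric_coord (i := j) hl (ksg_sym Q t).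
have h1 k : List.In k [:: coord_kernel i (P s); coord_kernel j (Q t)] ->
  subMarkov k /\ symmetric_kernel muE k by move=> /= [<-|[<-|[]]].
have h2 k : List.In k [:: coord_kernel j (Q t); coord_kernel i (P s)] ->
  subMarkov k /\ symmetric_kernel muE k by move=> /= [<-|[<-|[]]].
rewrite !L2_semigroupE !coord_semigroupE.
apply: (kop_foldr_eq h1 h2 _ hu hv) => f g hf hg.
by apply: eq_integral => x _; rewrite /= kint_coord_commute.
Qed.

Section form_of_coordinate.
Variables (i : 'I_n) (P : kernel_semigroup (mu i)).
Implicit Types u v : 'rV[R]_n -> R.

Definition section x u : R -> R := fun y => u (upd i x y).

(** Outside L^2 the value of [form] has no meaning, so such sections are given the value [+oo] by
    hand. *)
Definition section_form u x : \bar R :=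
  if pselect (L2 (mu i) setT (section x u)) is left _
  then form (L2_semigroup P) (section x u) else +oo%E.

Let T := L2_semigroup (coord_semigroup P).
Let Q v x : \bar R := cint i (fun z => ((v z) ^+ 2)%:E) x.
Let w t u := kop (coord_kernel i (P (t / 2))) u.
(** By [op_sqr], the approximating form of a section is a difference of squared norms, those of the
    sections of [u] and of [w t u]. In this form its measurability in [x] is visible. *)
Let F t u x : \bar R :=
  if (Q u x < +oo)%E then (t^-1 * (fine (Q u x) - fine (Q (w t u) x)))%:E else +oo%E.

Lemma measurable_section x u : measurable_fun setT u -> measurable_fun setT (section x u).
Proof. by move=> mu_; apply: measurableT_comp mu_ _; exact: measurable_upd. Qed.

Let nnQ v : measurable_fun setT v -> nonneg_mfun (Q v).
Proof. by move=> mv; apply: nonneg_mfun_cint; exact: nonneg_mfun_sqr. Qed.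

Let Q_int v : L2 muE setT v -> ((L2_ip muE v v)%:E = \int[muE]_x ((weight i x)%:E * Q v x))%E.
Proof.
move=> hv; have [mv _] := hv; rewrite (L2_ip_sqr hv).
exact: (disintegration i (nonneg_mfun_sqr mv)).
Qed.

Let Q_L2 u x : measurable_fun setT u ->
  (Q u x < +oo)%E -> L2 (mu i) setT (section x u).
Proof. by move=> mu_ Qu; split => //; exact: measurable_section. Qed.

Let mw t u : measurable_fun setT u -> measurable_fun setT (w t u).
Proof. by move=> mu_; apply: measurable_kop => //; apply: subMarkov_coord; exact: ksg_subMarkov. Qed.

Let Q_w t u x : measurable_fun setT u ->
  Q (w t u) x = (\int[mu i]_y ((kop (P (t / 2)) (section x u) y) ^+ 2)%:E)%E.
Proof.
by move=> mu_; apply: eq_integral => z _; rewrite /w kop_coord_upd.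
Qed.

Let F_eform t u x : 0 < t -> measurable_fun setT u -> (Q u x < +oo)%E ->
  Q (w t u) x \is a fin_num /\
  F t u x = (eform (L2_semigroup P) t (section x u) (section x u))%:E.
Proof.
move=> t0 mu_ Qu; have hs := Q_L2 mu_ Qu.
have t2 : 0 <= t / 2 by rewrite divr_ge0// ltW.
have hk : L2 (mu i) setT (kop (P (t / 2)) (section x u)).
  exact: (op_dom (L2_semigroup P) t2 hs).
have QwE : Q (w t u) x = (L2_ip (mu i) (kop (P (t / 2)) (section x u)) (kop (P (t / 2)) (section x u)))%:E.
  by rewrite L2_ip_sqr// Q_w.
have QuE : Q u x = (L2_ip (mu i) (section x u) (section x u))%:E by rewrite L2_ip_sqr.
split; first by rewrite QwE.
rewrite /F Qu QuE QwE /= /eform; congr (_ * (_ - _))%:E.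
by have := op_sqr (L2_semigroup P) (ltW t0) hs => ->.
Qed.

Let F_ge0 t u x : 0 < t -> measurable_fun setT u -> (0 <= F t u x)%E.
Proof.
move=> t0 mu_; case: (ltP (Q u x) +oo%E) => [Qu|Qu]; last by rewrite /F ltNge Qu.
have [_ ->] := F_eform t0 mu_ Qu; rewrite lee_fin; apply: eform_ge0 => //.
exact: Q_L2.
Qed.

Let nnF t u : 0 < t -> measurable_fun setT u -> nonneg_mfun (F t u).
Proof.
move=> t0 mu_; split => [x|]; first exact: F_ge0.
apply: measurable_fun_ifT.
- have h := emeasurable_fun_infty_o measurableT (nnQ mu_).2 +oo%E.
  by apply: (measurable_fun_bool true); rewrite setTI in h *.
- apply/measurable_EFinP; apply: measurable_funM => //; apply: measurable_funB.
    by apply: measurableT_comp => //; exact: (nnQ mu_).2.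
  by apply: measurableT_comp => //; exact: (nnQ (mw t mu_)).2.
- exact: measurable_cst.
Qed.

Let F_int t u : 0 < t -> L2 muE setT u ->
  ((eform T t u u)%:E = \int[muE]_x ((weight i x)%:E * F t u x))%E.
Proof.
move=> t0 hu; have [mu_ _] := hu.
have t2 : 0 <= t / 2 by rewrite divr_ge0// ltW.
have hw : L2 muE setT (w t u) by exact: (op_dom T t2 hu).
have hF := nnF t0 mu_; have hW := nonneg_mfun_weight i.
have hQw := nnQ (mw t mu_).
(* Squared norms of sections may be infinite and cannot be subtracted under the integral. The finite
   norm of [w t u] is added to both sides, which leaves integrals of nonnegative functions, and is
   cancelled at the end. *)
have key : ((t * eform T t u u + L2_ip muE (w t u) (w t u))%:E =
    t%:E * \int[muE]_x ((weight i x)%:E * F t u x) + (L2_ip muE (w t u) (w t u))%:E)%E.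
  have -> : t * eform T t u u + L2_ip muE (w t u) (w t u) = L2_ip muE u u.
    rewrite -[L2_ip muE (w t u) (w t u)](op_sqr T (ltW t0) hu) /eform mulrA divff ?gt_eqF// mul1r.
    by rewrite subrK.
  rewrite !Q_int// -ge0_integralZl_EFin ?(ltW t0)//; last 2 first.
  - by move=> x _; apply: (nonneg_mfunM hW hF).1.
  - exact: (nonneg_mfunM hW hF).2.
  rewrite -ge0_integralD//.
  - apply: eq_integral => x _; rewrite muleCA -ge0_muleDr; last 2 first.
    + by rewrite mule_ge0 ?lee_fin ?(ltW t0)//; exact: hF.1.
    + exact: hQw.1.
    have [->|wx] := eqVneq (weight i x) 0; first by rewrite !mul0e.
    congr (_ * _)%E; case: (ltP (Q u x) +oo%E) => Qu; last first.
      rewrite /F ltNge Qu /= gt0_muley ?lte_fin// addye; first by apply/eqP; rewrite -leye_eq.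
      by rewrite gt_eqF// (lt_le_trans _ (hQw.1 x)).
    have [Qwf _] := F_eform t0 mu_ Qu; rewrite /F Qu -EFinM mulrA divff ?gt_eqF// mul1r.
    rewrite EFinB !fineK// ?subeK// ge0_fin_numE//; exact: (nnQ mu_).1.
  - by move=> x _; rewrite mule_ge0 ?lee_fin ?(ltW t0)//; exact: (nonneg_mfunM hW hF).1.
  - by apply: emeasurable_funM => //; exact: (nonneg_mfunM hW hF).2.
  - by move=> x _; exact: (nonneg_mfunM hW hQw).1.
  - exact: (nonneg_mfunM hW hQw).2.
have : ((t * eform T t u u)%:E = t%:E * \int[muE]_x ((weight i x)%:E * F t u x))%E.
  by rewrite -[RHS](@addeK _ (L2_ip muE (w t u) (w t u))%:E)// -key EFinD addeK.
have tVt : (t^-1%:E * t%:E = 1 :> \bar R)%E by rewrite -EFinM mulVf ?gt_eqF.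
by rewrite EFinM => h; rewrite -[LHS]mul1e -tVt -muleA h muleA tVt mul1e.
Qed.

Let F_cvg u x : measurable_fun setT u ->
  nondecreasing_seq (fun k => F (2 ^- k) u x) /\
  F (2 ^- k) u x @[k --> \oo] --> section_form u x.
Proof.
move=> mu_; have p k : 0 < 2 ^- k :> R by rewrite invr_gt0 exprn_gt0.
case: (ltP (Q u x) +oo%E) => Qu; last first.
  have FE k : F (2 ^- k) u x = +oo%E by rewrite /F ltNge Qu.
  split; first by move=> a b ab; rewrite !FE.
  rewrite /section_form; case: pselect => [[_ h]|_].
    by move: Qu; rewrite leNgt h.
  by under eq_fun do rewrite FE; exact: cvg_cst.
have hs := Q_L2 mu_ Qu.
have FE k : F (2 ^- k) u x = (eform (L2_semigroup P) (2 ^- k) (section x u) (section x u))%:E.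
  by have [_] := F_eform (p k) mu_ Qu.
have nd : nondecreasing_seq (fun k => F (2 ^- k) u x).
  apply/nondecreasing_seqP => k; rewrite !FE lee_fin exprSr invfM.
  exact: eform_half.
split => //; rewrite /section_form; case: pselect => // _.
rewrite form_dyadic//.
rewrite (_ : (fun k => _) = fun k => F (2 ^- k) u x) in nd *; last by apply/funext.
exact: ereal_nondecreasing_cvgn nd.
Qed.

Lemma nonneg_mfun_section_form u : measurable_fun setT u -> nonneg_mfun (section_form u).
Proof.
move=> mu_; apply: (nonneg_mfun_lim (F := fun k => F (2 ^- k) u)).
- by move=> k; apply: nnF => //; rewrite invr_gt0 exprn_gt0.
- by move=> x; exact: (F_cvg x mu_).1.
- by move=> x; exact: (F_cvg x mu_).2.
Qed.

(** Monotone convergence along the dyadic times, where the approximating forms of [u] and of its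
    sections increase. *)
Lemma form_coord u : L2 muE setT u ->
  (form T u = \int[muE]_x ((weight i x)%:E * section_form u x))%E.
Proof.
move=> hu; have [mu_ _] := hu; have p k : 0 < 2 ^- k :> R by rewrite invr_gt0 exprn_gt0.
have hW := nonneg_mfun_weight i.
have nd x : nondecreasing_seq (fun k => (weight i x)%:E * F (2 ^- k) u x)%E.
  move=> a b ab; apply: lee_wpmul2l; first by rewrite lee_fin weight_ge0.
  exact: (F_cvg x mu_).1 _ _ ab.
have cv x : ((weight i x)%:E * F (2 ^- k) u x)%E @[k --> \oo] -->
    ((weight i x)%:E * section_form u x)%E.
  by apply: cvgeZl => //; exact: (F_cvg x mu_).2.
have [_ _ _ mc] := integral_like_integral muE.
have := mc _ _ (fun k => nonneg_mfunM hW (nnF (p k) mu_)) nd cv.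
under eq_fun do rewrite -F_int//.
move=> h; have ndE : nondecreasing_seq (fun k => (eform T (2 ^- k) u u)%:E).
  apply/nondecreasing_seqP => k; rewrite lee_fin exprSr invfM.
  exact: eform_half.
by rewrite form_dyadic// -(cvg_lim _ (ereal_nondecreasing_cvgn ndE))// (cvg_lim _ h).
Qed.

End form_of_coordinate.

Lemma form_coord_congr i (P P' : kernel_semigroup (mu i)) (u : 'rV[R]_n -> R) :
  L2 muE setT u ->
  (forall x, L2 (mu i) setT (section i x u) ->
     form (L2_semigroup P) (section i x u) = form (L2_semigroup P') (section i x u)) ->
  form (L2_semigroup (coord_semigroup P)) u = form (L2_semigroup (coord_semigroup P')) u.
Proof.
move=> hu PP'; rewrite (form_coord P hu) (form_coord P' hu).
suff -> : section_form P u = section_form P' u by [].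
apply/funext => x; rewrite /section_form.
by case: pselect => [hs|//]; exact: (PP' x hs).
Qed.

Lemma form_coord_ge i (P : kernel_semigroup (mu i)) (u : 'rV[R]_n -> R) g :
  L2 muE setT u -> nonneg_mfun g ->
  (forall x, L2 (mu i) setT (section i x u) ->
     (g x <= form (L2_semigroup P) (section i x u))%E) ->
  (\int[muE]_x ((weight i x)%:E * g x) <= form (L2_semigroup (coord_semigroup P)) u)%E.
Proof.
move=> hu hg gu; rewrite (form_coord P hu).
have h := nonneg_mfunM (nonneg_mfun_weight i) hg.
have h' := nonneg_mfunM (nonneg_mfun_weight i) (nonneg_mfun_section_form P hu.1).
apply: ge0_le_integral => //.
- by move=> x _; exact: h.1.
- exact: h.2.
- exact: h'.2.
- move=> x _; apply: lee_wpmul2l; first by rewrite lee_fin weight_ge0.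
  rewrite /section_form; case: pselect => [hs|_]; first exact: gu.
  exact: leey.
Qed.

Section tensor.
Implicit Types (u : 'I_n -> R -> R) (f : 'I_n -> R -> \bar R).

Definition tensor u : 'rV[R]_n -> R := fun x => \prod_i u i (x ord0 i).

Lemma measurable_tensor u : (forall i, measurable_fun setT (u i)) ->
  measurable_fun setT (tensor u).
Proof.
move=> mu_; apply: measurable_prod => i _.
exact: measurableT_comp (mu_ i) (measurable_coord i).
Qed.

Lemma nonneg_mfun_etensor f : (forall i, nonneg_mfun (f i)) ->
  nonneg_mfun (fun x : 'rV[R]_n => \prod_i f i (x ord0 i))%E.
Proof.
move=> hf; have h (l : seq 'I_n) :
    nonneg_mfun (fun x : 'rV[R]_n => \prod_(i <- l) f i (x ord0 i))%E.
  elim: l => [|i l IH].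
    under eq_fun do rewrite big_nil; split => // x; exact: lee01.
  under eq_fun do rewrite big_cons; apply: nonneg_mfunM => //.
  split => [x|]; first exact: (hf i).1.
  exact: measurableT_comp (hf i).2 (measurable_coord i).
exact: h.
Qed.

Lemma integral_tensor f : (forall i, nonneg_mfun (f i)) ->
  (\int[muE]_x \prod_i f i (x ord0 i) = \prod_i \int[mu i]_y f i y)%E.
Proof.
(* Induction on the list of coordinates in which the factor is not yet an indicator. Both sides are
   [integral_like] in a single factor, so that this factor may be taken to be an indicator. *)
suff h (l : seq 'I_n) f' : (forall i, nonneg_mfun (f' i)) ->
    (forall i, i \notin l -> exists2 A, measurable A & f' i = EFin \o \1_A) ->
    (\int[muE]_x \prod_i f' i (x ord0 i) = \prod_i \int[mu i]_y f' i y)%E.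
  by move=> hf; apply: (h (enum 'I_n)) => // i; rewrite mem_enum.
elim: l f' => [|i l IH] {}f hf fl.
  have /choice[A hA] : forall i, exists A, measurable A /\ f i = EFin \o \1_A.
    by move=> i; have [|A] := fl i; [rewrite in_nil|exists A].
  have mA i : measurable (A i) by case: (hA i).
  under [RHS]eq_bigr => i _ do rewrite (hA i).2 integral_indic// setIT.
  rewrite -muEE// -[box A]setIT -integral_indic//; last exact: measurable_box.
  apply: eq_integral => x _; rewrite indicE.
  have [Ax|] := pselect (box A x).
    rewrite mem_set// big1// => i _; rewrite (hA i).2 /= indicE mem_set//; exact: Ax.
  move=> nA; rewrite memNset//; have /existsNP[i nAi] := nA.
  by rewrite (bigD1 i)//= (hA i).2 /= indicE memNset// mul0e.
pose W (x : 'rV[R]_n) := (\prod_(j | j != i) f j (x ord0 j))%E.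
have hW : nonneg_mfun W.
  have := @nonneg_mfun_etensor (fun j => if j == i then cst 1%E else f j) _.
  rewrite (_ : (fun x : 'rV[R]_n => _) = W).
    by apply => j; case: eqP => // _; split => // x; exact: lee01.
  apply/funext => x; rewrite (bigD1 i)//= eqxx mul1e.
  by apply: eq_bigr => j /negPf ->.
pose b := (\prod_(j | j != i) \int[mu j]_y f j y)%E.
have b0 : (0 <= b)%E by apply: prode_ge0 => j _; apply: integral_ge0 => y _; exact: (hf j).1.
have LW : integral_like (fun g => \int[muE]_x (g x * W x))%E.
  apply: (integral_like_comp (integral_like_integral muE) (K := fun g x => (g x * W x)%E)).
    by move=> x; exact: integral_like_scale (hW.1 x) (integral_like_eval _ x).
  by move=> g hg; exact: (nonneg_mfunM hg hW).2.
have L1 := integral_like_map (measurable_coord i) LW.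
have L2' := integral_like_scale b0 (integral_like_integral (mu i)).
have key := integral_like_eq L1 L2' _ (hf i).
rewrite [RHS](bigD1 i)//= -/b -key; last first.
  move=> A mA; pose f' j := if j == i then EFin \o \1_A else f j.
  have f'i : f' i = EFin \o \1_A by rewrite /f' eqxx.
  have f'j j : j != i -> f' j = f j by rewrite /f' => /negPf ->.
  transitivity (\int[muE]_x \prod_j f' j (x ord0 j))%E.
    apply: eq_integral => x _; rewrite [RHS](bigD1 i)//= f'i; congr (_ * _)%E.
    by apply: eq_bigr => j ji; rewrite f'j.
  rewrite IH.
  - rewrite (bigD1 i)//= f'i; congr (_ * _)%E.
    by apply: eq_bigr => j ji; rewrite f'j.
  - by move=> j; rewrite /f'; case: eqP => // _; exact: nonneg_mfun_indic.
  - move=> j jl; have [->|ji] := eqVneq j i; first by exists A.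
    by rewrite f'j//; apply: fl; rewrite inE negb_or ji.
by apply: eq_integral => x _; rewrite (bigD1 i).
Qed.

Lemma tensor_sqr u x : ((tensor u x) ^+ 2)%:E = (\prod_i ((u i (x ord0 i)) ^+ 2)%:E)%E.
Proof. by rewrite /tensor -prodrXl prodEFin. Qed.

Lemma integral_tensor_sqr u : (forall i, measurable_fun setT (u i)) ->
  (\int[muE]_x ((tensor u x) ^+ 2)%:E = \prod_i \int[mu i]_y ((u i y) ^+ 2)%:E)%E.
Proof.
move=> mu_; under eq_integral do rewrite tensor_sqr.
by apply: (@integral_tensor (fun i y => ((u i y) ^+ 2)%:E)) => i; exact: nonneg_mfun_sqr.
Qed.

Lemma tensor_ip u : (forall i, L2 (mu i) setT (u i)) ->
  L2 muE setT (tensor u) /\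
  L2_ip muE (tensor u) (tensor u) = \prod_i L2_ip (mu i) (u i) (u i).
Proof.
move=> hu; have mu_ i : measurable_fun setT (u i) by case: (hu i).
have E : (\int[muE]_x ((tensor u x) ^+ 2)%:E = (\prod_i L2_ip (mu i) (u i) (u i))%:E)%E.
  rewrite integral_tensor_sqr// -prodEFin; apply: eq_bigr => i _.
  by rewrite L2_ip_sqr.
have h : L2 muE setT (tensor u).
  by split; [exact: measurable_tensor|rewrite E ltry].
by split => //; apply: EFin_inj; rewrite L2_ip_sqr.
Qed.

Definition coprod i u (x : 'rV[R]_n) : R := \prod_(j | j != i) u j (x ord0 j).

Lemma section_tensor i u x : section i x (tensor u) = coprod i u x *: u i.
Proof.
apply/funext => y; rewrite /section /tensor (bigD1 i)//= upd_same mulrC /coprod.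
by congr (_ * _); apply: eq_bigr => j ji; rewrite upd_other.
Qed.

(** The weight takes the place of the missing factor [i] and integrates to 1 in that coordinate. *)
Lemma integral_weight_coprod i u : (forall j, L2 (mu j) setT (u j)) ->
  (\int[muE]_x ((weight i x)%:E * ((coprod i u x) ^+ 2)%:E) =
   (\prod_(j | j != i) L2_ip (mu j) (u j) (u j))%:E)%E.
Proof.
move=> hu; pose f j := if j == i then EFin \o ((c i)^-1 \*o \1_(K i))
  else fun y => ((u j y) ^+ 2)%:E.
have h : forall j, nonneg_mfun (f j).
  move=> j; rewrite /f; case: eqP => _; last by apply: nonneg_mfun_sqr; case: (hu j).
  apply: nonneg_mfun_EFin; first exact: measurable_funM.
  by move=> x; rewrite /= mulr_ge0// invr_ge0 ltW.
transitivity (\int[muE]_x \prod_j f j (x ord0 j))%E.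
  apply: eq_integral => x _; rewrite (bigD1 i)//= {1}/f eqxx; congr (_ * _)%E.
  rewrite /coprod -prodrXl -prodEFin; apply: eq_bigr => j /negPf ji.
  by rewrite /f ji.
rewrite integral_tensor// (bigD1 i)//= {1}/f eqxx.
rewrite [X in (X * _)%E](_ : _ = 1%E); last first.
  under eq_integral do rewrite /= EFinM.
  rewrite ge0_integralZl_EFin//; last 2 first.
  - by apply/measurable_EFinP; exact: measurable_indic.
  - by rewrite invr_ge0 ltW.
  by rewrite integral_indic// setIT -[mu i (K i)]fineK ?ge0_fin_numE// -EFinM mulVf// gt_eqF.
rewrite mul1e -prodEFin; apply: eq_bigr => j /negPf ji; rewrite /f ji L2_ip_sqr//.
Qed.

(** Each section of a tensor is a multiple of [u i]; the square of the coefficient leaves the form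
    by [formZ] and is then integrated. *)
Lemma form_tensor i (P : kernel_semigroup (mu i)) u :
  (forall j, L2 (mu j) setT (u j)) ->
  form (L2_semigroup (coord_semigroup P)) (tensor u) =
  ((\prod_(j | j != i) L2_ip (mu j) (u j) (u j))%:E * form (L2_semigroup P) (u i))%E.
Proof.
move=> hu; have [hT _] := tensor_ip hu.
rewrite (form_coord P hT) -integral_weight_coprod//.
have F0 := form_ge0 (L2_semigroup P) (hu i).
have mC' : measurable_fun setT (coprod i u).
  rewrite (_ : coprod i u = tensor (fun j => if j == i then cst 1 else u j)).
    by apply: measurable_tensor => j; case: eqP => // _; case: (hu j).
  apply/funext => x; rewrite /tensor (bigD1 i)//= eqxx mul1r.
  by apply: eq_bigr => j /negPf ->.
have hw := nonneg_mfunM (nonneg_mfun_weight i) (nonneg_mfun_sqr mC').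
rewrite -ge0_integralZr//; [|exact: hw.2|by move=> x _; exact: hw.1].
apply: eq_integral => x _; rewrite -muleA; congr (_ * _)%E.
rewrite /section_form section_tensor; case: pselect => [_|[]]; first by rewrite formZ//; exact: hu.
exact: (linZ (@L2_linear _ _ _ (mu i))).
Qed.

End tensor.

Section product_semigroup.
Variable P : forall i, kernel_semigroup (mu i).
Local Notation TP := (fun i => L2_semigroup (coord_semigroup (P i))).

Let ks t (l : seq 'I_n) := [seq coord_kernel i (P i t) | i <- l].

Let setl (l : seq 'I_n) (A : 'I_n -> set R) j := if j \in l then setT else A j.

Let kint_ks_box t l A x : uniq l -> (forall i, measurable (A i)) ->
  foldr (@kint _ _ _) (EFin \o \1_(box A)) (ks t l) x =
  ((\prod_(i <- l) P i t (x ord0 i) (A i)) * (\1_(box (setl l A)) x)%:E)%E.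
Proof.
move=> + mA; elim: l x => [|i l IH] x /= => [_|/andP[il ul]].
  by rewrite big_nil mul1e (_ : setl [::] A = A).
have mS : forall j, measurable (setl l A j) by move=> j; rewrite /setl; case: ifP.
rewrite (_ : foldr _ _ _ = fun x : 'rV[R]_n => ((\prod_(i <- l) P i t (x ord0 i) (A i)) *
    (\1_(box (setl l A)) x)%:E)%E); last by apply/funext => y; exact: IH.
have mB := measurable_box mS.
have hB := nonneg_mfun_indic R mB.
rewrite kint_coord; last first.
  apply: nonneg_mfunM => //; split => [y|].
    by apply: prode_ge0 => j _; exact: measure_ge0.
  have h (l' : seq 'I_n) : measurable_fun setT
      (fun x : 'rV[R]_n => \prod_(i <- l') P i t (x ord0 i) (A i))%E.
    elim: l' => [|j l' IH']; first by under eq_fun do rewrite big_nil; exact: measurable_cst.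
    under eq_fun do rewrite big_cons; apply: emeasurable_funM => //.
    have [h _] := ksg_subMarkov (P j) t.
    exact: (measurableT_comp (h _ (mA j)) (measurable_coord j)).
  exact: h.
rewrite /kint (eq_integral (fun y => (\prod_(i <- l) P i t (x ord0 i) (A i)) *
   (EFin \o \1_(box (setl l A))) (upd i x y))%E); last first.
  move=> y _; congr (_ * _)%E; apply: eq_big_seq => j jl; rewrite upd_other//.
  by apply: contraNneq il => <-.
rewrite ge0_integralZl//; last 3 first.
- by apply: measurableT_comp hB.2 _; exact: measurable_upd.
- by move=> y _; exact: hB.1.
- by apply: prode_ge0 => j _; exact: measure_ge0.
rewrite integral_box_upd// big_cons [setl l A i]/setl (negPf il) muleA.
congr (_ * _)%E; first by rewrite muleC.
congr (\1_(box _) x)%:E; apply/funext => j; rewrite /set_coord /setl inE.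
by case: eqP.
Qed.

Lemma foldr_kint_box t l A x : perm_eq l (enum 'I_n) -> (forall i, measurable (A i)) ->
  foldr (@kint _ _ _) (EFin \o \1_(box A)) (ks t l) x = (\prod_i P i t (x ord0 i) (A i))%E.
Proof.
move=> le mA; rewrite kint_ks_box//; last by rewrite (perm_uniq le) enum_uniq.
rewrite (perm_big _ le) big_enum indicE mem_set ?mule1// => i.
by rewrite /setl (perm_mem le) mem_enum.
Qed.

Let ks_in t l k : List.In k (ks t l) -> subMarkov k /\ symmetric_kernel muE k.
Proof.
elim: l => //= i l IH [<-|]; last exact: IH.
split; first by apply: subMarkov_coord; exact: ksg_subMarkov.
by apply: symmetric_coord; [exact: ksg_subMarkov|exact: ksg_sym].
Qed.

Let nonneg_mfun_ks t l f : nonneg_mfun f -> nonneg_mfun (foldr (@kint _ _ _) f (ks t l)).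
Proof.
move=> hf; elim: l => [//|j l IH] /=.
by apply: nonneg_mfun_kint => //; apply: subMarkov_coord; exact: ksg_subMarkov.
Qed.

Let integral_like_ks t l x : integral_like (fun f => foldr (@kint _ _ _) f (ks t l) x).
Proof.
elim: l x => [|i l IH] x /=; first exact: integral_like_eval.
apply: (integral_like_comp (integral_like_integral _) IH) => f hf.
by case: (nonneg_mfun_ks t l hf).
Qed.

Variable PE : R -> 'rV[R]_n -> {measure set 'rV[R]_n -> \bar R}.
Hypothesis PE_subMarkov : forall t, subMarkov (PE t).
Hypothesis PE_box : forall t x (A : 'I_n -> set R), (forall i, measurable (A i)) ->
  PE t x (box A) = (\prod_i P i t (x ord0 i) (A i))%E.

Lemma kint_product t l x f : perm_eq l (enum 'I_n) -> nonneg_mfun f ->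
  kint (PE t) f x = foldr (@kint _ _ _) f (ks t l) x.
Proof.
move=> le; apply: (integral_like_unique (G := @boxes R n) (g := fun=> setT)
  (measurable_boxes R n) (@boxes_setI R n) _ _ (integral_like_kint _ _) (@integral_like_ks t l x)).
- by move=> _; exists (fun=> setT) => //; apply/seteqP; split.
- by rewrite bigcup_const//; exists 0%N.
- move=> _ [A mA ->]; rewrite foldr_kint_box// /kint integral_indic ?setIT ?PE_box//.
  exact: measurable_box.
- move=> _; rewrite /kint integral_indic// setIT.
  by apply: le_lt_trans ((PE_subMarkov t).2 x) _; rewrite ltry.
Qed.

Let ks_adjoint t l f g : nonneg_mfun f -> nonneg_mfun g ->
  (\int[muE]_x (foldr (@kint _ _ _) f (ks t l) x * g x) =
   \int[muE]_x (f x * foldr (@kint _ _ _) g (ks t (rev l)) x))%E.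
Proof.
elim: l f g => [|i l IH] f g hf hg; first by [].
have [hk sk] := @ks_in t (i :: l) _ (or_introl erefl).
rewrite /= (sk _ _ (nonneg_mfun_ks t l hf) hg) IH//; last exact: nonneg_mfun_kint.
by apply: eq_integral => x _; rewrite rev_cons /ks map_rcons foldr_rcons.
Qed.

(** The adjoint of the composition of the coordinate kernels is their composition in the reverse
    order, and [kint_product] identifies both orders with [PE]. *)
Lemma symmetric_product t : symmetric_kernel muE (PE t).
Proof.
move=> f g hf hg.
under eq_integral do rewrite (kint_product _ _ (perm_refl (enum 'I_n)) hf).
rewrite ks_adjoint//; apply: eq_integral => x _; congr (_ * _)%E.
by rewrite (@kint_product _ (rev (enum 'I_n)) _ _ _ hg)// perm_rev.
Qed.

End product_semigroup.

Section product_form.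
Variables (P : forall i, kernel_semigroup (mu i)) (PE : kernel_semigroup muE).
Hypothesis PE_box : forall t x (A : 'I_n -> set R), (forall i, measurable (A i)) ->
  PE t x (box A) = (\prod_i P i t (x ord0 i) (A i))%E.

(** [PE] acts as the composition of the commuting coordinate semigroups, whose form [big_semigroup]
    splits into a sum. *)
Lemma form_product u : L2 muE setT u -> form (L2_semigroup PE) u =
  (\sum_i form (L2_semigroup (coord_semigroup (P i))) u)%E.
Proof.
move=> hu; have [T [TE formT]] := big_semigroup
  (P := fun i => L2_semigroup (coord_semigroup (P i))) (enum_uniq 'I_n)
  (fun i j ij => coord_commuting (P i) (P j) ij).
rewrite -[RHS]big_enum -formT//; apply: weak_eq_semigroup => // t u' v t0 hu' hv.
pose ks := [seq coord_kernel i (P i t) | i <- enum 'I_n].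
have -> : T t u' = foldr (@kop _ _ _) u' ks by rewrite TE /ks; elim: (enum _) => //= i l ->.
apply: (@kop_foldr_eq _ _ _ _ [:: PE t] ks) => //.
- by move=> k /= [<-|[]//]; split; [exact: ksg_subMarkov|exact: ksg_sym].
- rewrite /ks; elim: (enum _) => [//|i l IH] k /= [<-|]; last exact: IH.
  split; first by apply: subMarkov_coord; exact: ksg_subMarkov.
  by apply: symmetric_coord; [exact: ksg_subMarkov|exact: ksg_sym].
- move=> f g hf hg; apply: eq_integral => x _; congr (_ * _)%E.
  exact: (kint_product (@ksg_subMarkov _ _ _ _ PE) PE_box _ _ (perm_refl _) hf).
Qed.

Lemma lee_prod (J : Type) (l : seq J) (Q : pred J) (a b : J -> \bar R) :
  (forall j, 0 <= a j)%E -> (forall j, a j <= b j)%E ->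
  (\prod_(j <- l | Q j) a j <= \prod_(j <- l | Q j) b j)%E.
Proof.
move=> a0 ab.
suff: (0 <= \prod_(j <- l | Q j) a j <= \prod_(j <- l | Q j) b j)%E by case/andP.
elim/big_ind2: _ => [|x1 x2 y1 y2 /andP[h1 h2] /andP[h3 h4]|j _]; last by rewrite a0 ab.
  by rewrite lee01 lexx.
by rewrite mule_ge0// lee_pmul.
Qed.

Local Notation T i := (L2_semigroup (P i)).
Local Notation TE := (L2_semigroup PE).

(** One summand for each of the [n] coordinate forms and one for the L^2 norm, each at most the
    product of the norms of the factors. *)
Lemma norm1_tensor_le u : (forall i, L2 (mu i) setT (u i)) ->
  (norm1 TE (tensor u) <= \sum_(k < n.+1) \prod_i norm1 (T i) (u i))%E.
Proof.
move=> hu; have [hT qT] := tensor_ip hu.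
have qN i : ((L2_ip (mu i) (u i) (u i))%:E <= norm1 (T i) (u i))%E by exact: (@ip_le_norm1 _ _ _ (T i) _ (hu i)).
have q0 i : (0 <= (L2_ip (mu i) (u i) (u i))%:E)%E.
  by rewrite lee_fin (psd_ge0 (L2_psd (mu i)) (hu i)).
rewrite [leLHS]/norm1 (form_product hT) big_ord_recr/=; apply: leeD.
  apply: lee_sum => i _; rewrite form_tensor// [leRHS](bigD1 i)//= muleC.
  apply: lee_pmul; [exact: (form_ge0 (T i) (hu i))|by rewrite -prodEFin; apply: prode_ge0|exact: (form_le_norm1 (T i) (hu i))|].
  by rewrite -prodEFin; exact: lee_prod.
by rewrite qT -prodEFin; exact: lee_prod.
Qed.

Section density.
Variables (Ci : 'I_n -> (R -> R) -> Prop) (CE : ('rV[R]_n -> R) -> Prop).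
Hypothesis CiH : forall i f, Ci i f -> L2 (mu i) setT f.
Hypothesis Ci_fin : forall i f, Ci i f -> (form (T i) f < +oo)%E.
Hypothesis Ci_dense : forall i v, L2 (mu i) setT v -> (form (T i) v < +oo)%E ->
  in_closure (T i) (Ci i) v.
Hypothesis CEH : forall f, CE f -> L2 muE setT f.
Hypothesis CEL : forall a f g, CE f -> CE g -> CE (a *: f + g).
Hypothesis CE_tensor : forall u, (forall i, Ci i (u i)) -> CE (tensor u).

Let norm1_fin i v : L2 (mu i) setT v -> (form (T i) v < +oo)%E ->
  norm1 (T i) v \is a fin_num.
Proof.
move=> hv fv; rewrite ge0_fin_numE; first by rewrite lte_add_pinfty// ltry.
exact: norm1_ge0.
Qed.

Let in_closure_tensor u : (forall i, L2 (mu i) setT (u i)) ->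
  (forall i, (form (T i) (u i) < +oo)%E) -> in_closure TE CE (tensor u).
Proof.
(* The factors are replaced by elements of [Ci] one after the other; those outside [l] have been
   replaced already. *)
suff h (l : seq 'I_n) u' : (forall i, L2 (mu i) setT (u' i)) ->
    (forall i, (form (T i) (u' i) < +oo)%E) ->
    (forall i, i \notin l -> Ci i (u' i)) -> in_closure TE CE (tensor u').
  by move=> hu fu; apply: (h (enum 'I_n)) => // i; rewrite mem_enum.
elim: l u' => [|i l IH] {}u hu fu ul.
  move=> e e0; exists (tensor u); first by apply: CE_tensor => i; exact: ul.
  rewrite subrr /norm1 (_ : 0 = 0 *: (0 : 'rV[R]_n -> R)); last by rewrite scale0r.
  have h0 := lin0 (@domL _ _ (L2_space muE)) (tensor_ip hu).1.
  rewrite formZ// expr0n mul0e add0e (psdZl (@domL _ _ _) (ip_psd _))//; first by rewrite mul0r lte_fin.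
  by rewrite scale0r.
apply: (@in_closure_trans _ _ (L2_space muE) TE CE CEH _ (tensor_ip hu).1) => e e0.
(* The error made in the factor [i] is multiplied by this product; [n.+1] in the tolerance below is
   the number of summands in [norm1_tensor_le]. *)
pose M := fine (\prod_(j | j != i) norm1 (T j) (u j))%E.
have M0 : 0 <= M.
  by apply: fine_ge0; apply: prode_ge0 => j _; exact: (norm1_ge0 (T j) (hu j)).
have ME : (\prod_(j | j != i) norm1 (T j) (u j) = M%:E)%E.
  rewrite /M fineK//; elim/big_ind: _ => [//|x y|j _]; first exact: fin_numM.
  exact: norm1_fin.
have d0 : 0 < e / (n.+1%:R * (M + 1)) by rewrite divr_gt0// mulr_gt0// ltr_wpDl.
have [f Cf uf] := Ci_dense (hu i) (fu i) d0.
have hf := CiH Cf; have ff := Ci_fin Cf.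
pose u1 j := if j == i then f else u j.
have hu1 j : L2 (mu j) setT (u1 j).
  by rewrite /u1; case: eqP => [->//|_]; exact: hu.
have fu1 j : (form (T j) (u1 j) < +oo)%E.
  by rewrite /u1; case: eqP => [->//|_]; exact: fu.
exists (tensor u1); split; first by case: (tensor_ip hu1).
  apply: IH => // j jl; rewrite /u1; have [->//|ji] := eqVneq j i.
  by apply: ul; rewrite inE negb_or ji.
pose u2 j := if j == i then u i - f else u j.
have hu2 j : L2 (mu j) setT (u2 j).
  rewrite /u2; case: eqP => [->|_]; last exact: hu.
  exact: (linB (@L2_linear _ _ _ (mu i)) (hu i) hf).
have -> : tensor u - tensor u1 = tensor u2.
  apply/funext => x; rewrite !fctE /tensor (bigD1 i)//= [X in _ - X](bigD1 i)//= [RHS](bigD1 i)//=.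
  rewrite /u1 /u2 eqxx !fctE mulrBl; congr (_ * _ - _ * _); apply: eq_bigr => j /negPf -> //.
apply: le_lt_trans (norm1_tensor_le hu2) _.
have -> : (\prod_j norm1 (T j) (u2 j) = norm1 (T i) (u i - f)%R * M%:E)%E.
  rewrite -ME (bigD1 i)//= /u2 eqxx; congr (_ * _)%E.
  by apply: eq_bigr => j /negPf ->.
have : norm1 (T i) (u i - f) \is a fin_num.
  rewrite ge0_fin_numE; first by apply: lt_trans uf _; rewrite ltry.
  by apply: norm1_ge0; exact: (linB (@L2_linear _ _ _ (mu i)) (hu i) hf).
case: (norm1 (T i) (u i - f)) uf => // r rd _.
rewrite -EFinM sumEFin lte_fin sumr_const card_ord -mulr_natl.
rewrite lte_fin ltr_pdivlMr in rd; last by rewrite mulr_gt0// ltr_wpDl.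
case: (lerP r 0) => r0.
  by apply: le_lt_trans e0; rewrite mulr_ge0_le0// mulr_le0_ge0.
by apply: le_lt_trans rd; rewrite mulrCA ler_pM2l// ler_pM2l// lerDl.
Qed.

(** [TE s] sends the indicator of a box to the tensor of the functions [T i s \1_(B i)]. Each of
    them has finite form by [form_op_bound], although the indicators themselves may not. *)
Let in_closure_box s A k : 0 < s -> (forall i, measurable (A i)) ->
  L2 muE setT (\1_(box A `&` box (C ^~ k))) /\
  in_closure TE CE (TE s (\1_(box A `&` box (C ^~ k)))).
Proof.
move=> s0 mA; pose B i := A i `&` C i k.
have -> : box A `&` box (C ^~ k) = box B.
  by apply/seteqP; split => [x [Ax Cx] i|x Bx]; [split|split => i; case: (Bx i)].
have mB i : measurable (B i) by exact: measurableI.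
have hB i : L2 (mu i) setT \1_(B i).
  split; first exact: measurable_indic.
  rewrite (eq_integral (EFin \o \1_(B i))).
    rewrite integral_indic// setIT; apply: le_lt_trans (Cfin i k).
    by apply: le_measure; rewrite ?inE//; exact: subIsetr.
  by move=> x _ /=; rewrite indicE; case: (_ \in _); rewrite ?expr1n ?expr0n.
have tE : tensor (fun i => \1_(B i)) = \1_(box B).
  apply/funext => x; rewrite /tensor indicE.
  have [Bx|] := pselect (box B x).
    by rewrite mem_set// big1// => i _; rewrite indicE mem_set//; exact: Bx.
  move=> nB; rewrite memNset//; have /existsNP[i nBi] := nB.
  by rewrite (bigD1 i)//= indicE memNset// mul0r.
split; first by rewrite -tE; exact: (tensor_ip hB).1.
have -> : TE s \1_(box B) = tensor (fun i => T i s \1_(B i)).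
  apply/funext => x; rewrite /tensor !L2_semigroupE /kop /Rintegral.
  have mBB := measurable_box mB.
  rewrite (integral_indic (PE s x) measurableT mBB) setIT PE_box//.
  under [RHS]eq_bigr => i _ do rewrite L2_semigroupE /kop /Rintegral integral_indic// setIT.
  rewrite (eq_bigr (fun i => (fine (P i s (x ord0 i) (B i)))%:E)) ?prodEFin// => i _.
  rewrite fineK// ge0_fin_numE//; apply: (@le_lt_trans _ _ 1%E); last by rewrite ltry.
  apply: le_trans ((ksg_subMarkov (P i) s).2 (x ord0 i)).
  by apply: le_measure; rewrite ?inE.
apply: in_closure_tensor => i; first exact: (op_dom (T i) (ltW s0) (hB i)).
by apply: le_lt_trans (form_op_bound (T i) s0 (hB i)) _; rewrite ltry.
Qed.

(** For fixed [s], the functions whose image under [TE s] is approximable form a class to which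
    [L2_dense] applies, with the boxes as generators. Letting [s] tend to 0 then reaches every
    function of finite form. *)
Lemma product_density u : L2 muE setT u -> (form TE u < +oo)%E -> in_closure TE CE u.
Proof.
move=> hu fu; apply: (@in_closure_of_op _ _ (L2_space muE) TE CE CEH _ hu fu) => s s0.
pose D v := L2 muE setT v /\ in_closure TE CE (TE s v).
suff [] : D u by [].
have gnd : nondecreasing_seq (fun k => box (C ^~ k)).
  by move=> a b ab; apply/subsetPset => x Cx i; have /subsetPset := Cnd i ab; apply.
have Gg k : boxes (box (C ^~ k)) by exists (C ^~ k).
have DG A k : boxes A -> D (\1_(A `&` box (C ^~ k))).
  by move=> [B mB ->]; exact: in_closure_box.
have DH v : D v -> L2 muE setT v by case.
have DL a v w : D v -> D w -> D (a *: v + w).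
  move=> [hv cv] [hw cw]; split; first exact: L2_linear.
  exact: (@in_closure_op_lin _ _ (L2_space muE) TE CE CEH CEL _ _ _ _ (ltW s0)).
have Dc v : L2 muE setT v ->
    (forall e, 0 < e -> exists2 f, D f & L2_ip muE (v - f) (v - f) < e) -> D v.
  move=> hv h; split => //; apply: (@in_closure_op_closed _ _ (L2_space muE) TE CE CEH _ _ s0 hv) => e e0.
  by have [f [hf cf] vf] := h _ e0; exists f.
exact: (L2_dense (measurable_boxes R n) (@boxes_setI R n) Gg gnd boxes_cover DG DH DL Dc hu).
Qed.

End density.
End product_form.
End product_space.

(** * Smooth functions *)

Section smooth_functions.
Variable R : realType.

Section span.
Variable V : normedModType R.
Implicit Types (f g : V -> R) (S : (V -> R) -> Prop).

Inductive span S : (V -> R) -> Prop :=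
| span0 : span S (cst 0)
| span_lin a f g : S f -> span S g -> span S (a *: f + g).

Lemma span_base S f : S f -> span S f.
Proof.
move=> Sf; rewrite (_ : f = 1 *: f + cst 0); first exact: span_lin (span0 S).
by rewrite scale1r addr0.
Qed.

Lemma span_linear S a f g : span S f -> span S g -> span S (a *: f + g).
Proof.
move=> Sf Sg; elim: Sf => [|b {}f h Sf _ IH].
  by rewrite scaler0 add0r.
by rewrite scalerDr scalerA -addrA; exact: span_lin.
Qed.

Lemma derive_lin v x a f g : differentiable f x -> differentiable g x ->
  'D_v (a *: f + g) x = a * 'D_v f x + 'D_v g x.
Proof.
move=> df dg; rewrite deriveD ?deriveZ//.
- exact: diff_derivable.
- apply: diff_derivable; exact: differentiableZ.
- exact: diff_derivable.
Qed.

(* Coinduction up to linear combinations. *)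
Lemma smooth_span S : (forall f, S f ->
    (forall x, differentiable f x) /\ forall v, span S (fun x => 'D_v f x)) ->
  forall f, span S f -> smooth f.
Proof.
move=> h; have df f : span S f -> forall x, differentiable f x.
  elim=> [|a {}f g Sf _ IH] x; first exact: differentiable_cst.
  by apply: differentiableD => //; apply: differentiableZ; case: (h _ Sf).
have Df f v : span S f -> span S (fun x => 'D_v f x).
  elim=> [|a {}f g Sf Sg IH].
    by rewrite (_ : (fun x => _) = cst 0); [exact: span0|apply/funext => x; rewrite derive_cst].
  rewrite (_ : (fun x => _) = a *: (fun x => 'D_v f x) + (fun x => 'D_v g x)).
    by apply: span_linear => //; case: (h _ Sf).
  apply/funext => x; rewrite derive_lin//; last exact: df.
  by case: (h _ Sf).
move=> f Sf vs x; apply: df.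
by elim: vs => [//|v vs IH]; exact: Df.
Qed.

Lemma smooth_differentiable f x : smooth f -> differentiable f x.
Proof. by move=> /(_ [::]); exact. Qed.

Lemma smooth_continuous f : smooth f -> continuous f.
Proof. by move=> sf x; apply: differentiable_continuous; exact: smooth_differentiable. Qed.

Lemma smooth_derive v f : smooth f -> smooth (fun x => 'D_v f x).
Proof. by move=> sf vs x; have := sf (rcons vs v) x; rewrite /iter_derive foldr_rcons. Qed.

Lemma smooth_lin a f g : smooth f -> smooth g -> smooth (a *: f + g).
Proof.
move=> sf sg; have : span (@smooth R V) (a *: f + g).
  by apply: span_lin => //; exact: span_base.
apply: smooth_span => h sh; split=> [x|v]; first exact: smooth_differentiable.
by apply: span_base; exact: smooth_derive.
Qed.

Lemma smooth_cst (c : R) : smooth (cst c : V -> R).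
Proof.
apply: (@smooth_span (fun f => exists c, f = cst c)) => [f [{}c ->]|].
  split=> [x|v]; first exact: differentiable_cst.
  rewrite (_ : (fun x => _) = cst 0); first exact: span0.
  by apply/funext => x; rewrite derive_cst.
by apply: span_base; exists c.
Qed.

Lemma smoothM f g : smooth f -> smooth g -> smooth (f * g).
Proof.
move=> sf sg.
pose S h := exists f' g', [/\ smooth f', smooth g' & h = f' * g'].
apply: (@smooth_span S) => [_ [{sf}f [{sg}g [sf sg ->]]]|]; last first.
  by apply: span_base; exists f, g.
split=> [x|v]; first by apply: differentiableM; exact: smooth_differentiable.
have sDf := smooth_derive v sf; have sDg := smooth_derive v sg.
rewrite (_ : (fun x => _) = 1 *: (f * (fun x => 'D_v g x)) + g * (fun x => 'D_v f x)).
  by apply: span_lin; [exists f, (fun x => 'D_v g x)|apply: span_base; exists g, (fun x => 'D_v f x)].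
apply/funext => x; rewrite deriveM ?scale1r//; apply: diff_derivable; exact: smooth_differentiable.
Qed.

Lemma smooth_prod (J : Type) (l : seq J) (Q : pred J) (f : J -> V -> R) :
  (forall j, smooth (f j)) -> smooth (fun x => \prod_(j <- l | Q j) f j x).
Proof.
move=> sf; elim: l => [|j l IH].
  by under eq_fun do rewrite big_nil; exact: smooth_cst.
under eq_fun do rewrite big_cons; case: (Q j) => //.
exact: smoothM.
Qed.

End span.

(** The differential of [L] is the same map at every point, so the derivative of [g \o L] along [v]
    is that of [g] along [l v], composed with [L]: the class of such compositions is stable under
    derivation. *)
Lemma smooth_comp (V W : normedModType R) (L : V -> W) (l : V -> W) (f : W -> R) :
  (forall x, differentiable L x) -> (forall x v, 'd L x v = l v) ->
  smooth f -> smooth (f \o L).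
Proof.
move=> dL dLE sf.
apply: (@smooth_span V (fun h => exists2 g, smooth g & h = g \o L)); last first.
  by apply: span_base; exists f.
move=> _ [g sg ->]; split=> [x|v].
  by apply: differentiable_comp => //; exact: smooth_differentiable.
apply: span_base; exists (fun y => 'D_(l v) g y); first exact: smooth_derive.
apply/funext => x /=; rewrite deriveE; last first.
  by apply: differentiable_comp => //; exact: smooth_differentiable.
rewrite diff_comp//; last exact: smooth_differentiable.
by rewrite /= dLE deriveE//; exact: smooth_differentiable.
Qed.

Lemma smooth_affine (a b : R) (f : R -> R) : smooth (V := R) f ->
  smooth (V := R) (fun x => f (a * x + b)).
Proof.
have dL (x : R) : is_derive x 1 (fun y : R => a * y + b) a.
  apply: (is_derive_eq (is_deriveD (is_deriveZ a (is_derive_id x 1)) (is_derive_cst b x 1))).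
  by rewrite addr0 [_ *: 1]mulr1.
have dL' x : differentiable (fun y : R => a * y + b) x.
  by apply/derivable1_diffP; case: (dL x).
apply: (@smooth_comp R R (fun x : R => a * x + b) (fun x => a * x)) => // x v.
rewrite -[v in LHS]mulr1 -[v * 1]/(v *: 1) linearZ -deriveE//.
by have [_ ->] := dL x; rewrite mulrC.
Qed.

Lemma deriveE1 (f : R -> R) v x : differentiable f x -> 'D_v f x = v * f^`()%classic x.
Proof.
move=> df; rewrite derive1E' // deriveE// -[v in LHS]mulr1.
by rewrite -[v * 1]/(v *: 1) linearZ.
Qed.

(** The class made of [F] and of all smooth functions is stable under derivation up to linear
    combinations. *)
Lemma smooth_primitive (F f : R -> R) : (forall x : R, is_derive x 1 F (f x)) ->
  smooth (V := R) f -> smooth (V := R) F.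
Proof.
move=> dF sf; apply: (@smooth_span R (fun h => h = F \/ smooth (V := R) h)); last first.
  by apply: span_base; left.
move=> h [->|sh]; last first.
  split=> [x|v]; first exact: smooth_differentiable.
  by apply: span_base; right; exact: smooth_derive.
have df x : differentiable F x by apply/derivable1_diffP; case: (dF x).
split=> // v; rewrite (_ : (fun x => _) = v *: f + cst 0).
  by apply: span_lin; [right|exact: span0].
apply/funext => x; rewrite deriveE1// derive1E addr0; have [_ ->//] := dF x.
Qed.

Lemma smooth_derive1 (f : R -> R) : smooth (V := R) f -> smooth (V := R) (f^`()%classic).
Proof.
move=> sf; rewrite (_ : f^`()%classic = fun x => 'D_1 f x); first exact: smooth_derive.
by apply/funext => x; rewrite derive1E.
Qed.

Lemma is_derive_smooth (f : R -> R) (x : R) : smooth (V := R) f -> is_derive x 1 f (f^`()%classic x).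
Proof.
move=> sf; split; first by apply/derivable1_diffP; exact: smooth_differentiable.
by rewrite derive1E.
Qed.

Section exp_inv.

(** The functions x^-n exp(-1/x). The derivative of [ei n] is [ei n.+2 - n%:R * ei n.+1], so their
    span is stable under derivation. *)
Let ei n (x : R) : R := if 0 < x then x^-1 ^+ n * expR (- x^-1) else 0.

(** From exp(y) >= y^(n+2) / (n+2)! at y = 1/x; the two powers of [x] that are gained give the
    derivative 0 at the origin. *)
Let ei_bound n x : `|ei n x| <= (n.+2)`!%:R * x ^+ 2.
Proof.
rewrite /ei; case: ifPn => [x0|_]; last by rewrite normr0 mulr_ge0// sqr_ge0.
have xi : 0 < x^-1 by rewrite invr_gt0.
rewrite ger0_norm; last by rewrite mulr_ge0 ?expR_ge0// exprn_ge0 ?ltW.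
rewrite expRN ler_pdivrMr ?expR_gt0//.
have := expR_ge1Dxn n.+1 (ltW xi).
set k := (n.+2)`!%:R; have k0 : 0 < k by rewrite ltr0n fact_gt0.
move=> h; apply: (@le_trans _ _ (k * x ^+ 2 * (x^-1 ^+ n.+2 / k))).
  rewrite le_eqVlt; apply/orP; left; apply/eqP.
  rewrite (_ : x^-1 ^+ n.+2 = x^-1 ^+ n * (x^-1 * x^-1)); last by rewrite !exprSr mulrA.
  move: (x^-1 ^+ n) => y.
  by field; rewrite !gt_eqF.
apply: ler_wpM2l; first by rewrite mulr_ge0 ?exprn_ge0 ?ltW.
by apply: le_trans h; rewrite lerDr.
Qed.

Let is_derive_flat (f : R -> R) c : (forall x, `|f x| <= c * x ^+ 2) ->
  is_derive (0 : R) 1 f 0.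
Proof.
move=> fc; have f0 : f 0 = 0.
  by apply/eqP; rewrite -normr_le0; apply: le_trans (fc 0) _; rewrite expr0n mulr0.
have h : h^-1 *: (f (h *: 1 + 0) - f 0) @[h --> 0^'] --> (0 : R).
  apply/cvgr0Pnorm_le => e e0; near=> h.
  rewrite f0 subr0 addr0 [h *: 1]mulr1 [_ *: _]/(_ * _) normrM normfV.
  have h0 : h != 0 by near: h; exact: nbhs_dnbhs_neq.
  rewrite ler_pdivrMl ?normr_gt0//; apply: le_trans (fc h) _.
  apply: (@le_trans _ _ ((`|c| + 1) * h ^+ 2)).
    by rewrite ler_wpM2r ?sqr_ge0// (le_trans (ler_norm c))// lerDl.
  rewrite -real_normK ?num_real// expr2 mulrCA ler_wpM2l//.
  have c1 : 0 < `|c| + 1 by rewrite ltr_wpDl.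
  rewrite -ler_pdivlMl// mulrC; near: h; by apply: dnbhs0_le; rewrite divr_gt0.
split; first by apply/cvg_ex; exists 0.
exact: cvg_lim.
Unshelve. all: by end_near. Qed.

Let is_derive_ei n (x : R) : is_derive x 1 (ei n) (ei n.+2 x - n%:R * ei n.+1 x).
Proof.
have [x0|x0|->] := ltgtP x 0.
- rewrite {2 3}/ei ltNge (ltW x0)/= mulr0 subr0.
  apply: (@near_eq_is_derive R R R (cst 0) _ x 1 0).
  near=> y; rewrite /ei ltNge (_ : y <= 0)//.
  by apply: ltW; near: y; exact: lt_nbhsl.
- rewrite {2 3}/ei x0.
  apply: (@near_eq_is_derive R R R (fun y : R => y^-1 ^+ n * expR (- y^-1)) _ x 1).
    near=> y; rewrite /ei ifT//; near: y; exact: lt_nbhsr.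
  have xN0 : x != 0 by rewrite gt_eqF.
  have dV : is_derive x 1 (fun y : R => y^-1) (- x ^- 2 *: 1) by exact: is_deriveV.
  have dE := @is_derive1_comp R expR (fun y : R => - y^-1) x _ _ (is_derive_expR (- x^-1)) (is_deriveN dV).
  case: n => [|n].
    rewrite (_ : (fun y => _) = expR \o (fun y : R => - y^-1)); last first.
      by apply/funext => y; rewrite expr0 mul1r.
    by apply: (is_derive_eq dE); rewrite mul0r subr0 [_ *: 1]mulr1 opprK exprVn mulrC.
  rewrite (_ : (fun y => _) = (fun y : R => y^-1) ^+ n.+1 * (expR \o (fun y : R => - y^-1))); last first.
    by apply/funext => y; rewrite !fctE.
  apply: (is_derive_eq (is_deriveM (is_deriveX n.+1 dV) dE)).
  rewrite !fctE /= [_ *: 1]mulr1 /GRing.scale/= !exprS; move: (expR _) (x^-1 ^+ n) => a b.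
  by field.
- rewrite {2 3}/ei ltxx mulr0 subr0; exact: is_derive_flat (ei_bound n).
Unshelve. all: by end_near. Qed.

Lemma smooth_exp_inv : smooth (V := R) (fun x => if 0 < x then expR (- x^-1) else 0).
Proof.
have e0 : (fun x : R => if 0 < x then expR (- x^-1) else 0) = ei 0.
  by apply/funext => x; rewrite /ei expr0 mul1r.
rewrite e0; apply: (@smooth_span R (fun h => exists n, h = ei n)).
  move=> _ [n ->]; have df x : differentiable (ei n) x.
    by apply/derivable1_diffP; case: (is_derive_ei n x).
  split=> // v; rewrite (_ : (fun x => _) = v *: ei n.+2 + (- (v * n%:R)) *: ei n.+1).
    by apply: span_lin; [exists n.+2|rewrite -[_ *: _]addr0; apply: span_lin; [exists n.+1|exact: span0]].
  apply/funext => x; rewrite deriveE1// derive1E; have [_ ->] := is_derive_ei n x.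
  by rewrite -[RHS]/(v * ei n.+2 x + - (v * n%:R) * ei n.+1 x); ring.
by apply: span_base; exists 0%N.
Qed.

End exp_inv.

Local Notation leb := (@lebesgue_measure R).

Lemma primitive (f : R -> R) a : continuous f -> (forall x, x <= a -> f x = 0) ->
  exists F : R -> R, (forall x : R, is_derive x 1 F (f x)) /\
                     (forall x, x <= a -> F x = 0).
Proof.
(* Starting the integral at [a - 1] makes every point [x >= a] interior, so that the fundamental
   theorem applies there. *)
move=> cf f0; pose F x := \int[leb]_(t in `[a - 1, x]) f t.
have F0 x : x <= a -> F x = 0.
  move=> xa; rewrite /F /Rintegral integral0_eq ?fine0// => t /=.
  by rewrite in_itv/= => /andP[_ tx]; rewrite f0//; exact: le_trans tx xa.
exists F; split=> // x; have [xa|ax] := ltP x a.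
  rewrite f0; last exact: ltW.
  apply: (@near_eq_is_derive R R R (cst 0) _ x 1 0).
  near=> y; rewrite F0//; apply: ltW; near: y; exact: lt_nbhsl.
have ax1 : a - 1 < x by rewrite ltrBlDr ltr_pwDr.
have fi : leb.-integrable `[a - 1, x + 1] (EFin \o f).
  apply: continuous_compact_integrable; first exact: segment_compact.
  exact: continuous_subspaceT.
have xx1 : x < x + 1 by rewrite ltrDl.
have [dF dFE] := continuous_FTC1_closed xx1 fi ax1 (cf x).
by split; [exact: dF|rewrite -derive1E; exact: dFE].
Unshelve. all: by end_near. Qed.

(** The normalized primitive of the product of exp(-1/x) functions of x - a and b - x, which is
    positive exactly between [a] and [b]. *)
Lemma smooth_step (a b : R) : a < b -> exists th : R -> R,
  [/\ smooth (V := R) th, forall x, 0 <= th x <= 1, forall x, x <= a -> th x = 0 &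
      forall x, b <= x -> th x = 1].
Proof.
move=> ab; pose e (x : R) := if 0 < x then expR (- x^-1) else 0.
have e0 x : x <= 0 -> e x = 0 by rewrite /e ltNge => ->.
have e_ge0 x : 0 <= e x by rewrite /e; case: ifP => // _; exact: expR_ge0.
have e_gt0 x : 0 < x -> 0 < e x by rewrite /e => ->; exact: expR_gt0.
pose f x := e (1 * x + - a) * e (-1 * x + b).
have sf : smooth (V := R) f.
  by apply: smoothM; apply: smooth_affine; exact: smooth_exp_inv.
have f_ge0 x : 0 <= f x by exact: mulr_ge0.
have fa x : x <= a -> f x = 0 by move=> xa; rewrite /f e0 ?mul0r// mul1r subr_le0.
have fb x : b <= x -> f x = 0.
  by move=> bx; rewrite /f [X in _ * X]e0 ?mulr0// mulN1r addrC subr_le0.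
have [F [dF F0]] := primitive (smooth_continuous sf) fa.
have cF : continuous F.
  by move=> x; apply: differentiable_continuous; apply/derivable1_diffP; case: (dF x).
have mvt x y : x < y -> exists2 z, z \in `]x, y[ & F y - F x = f z * (y - x).
  move=> xy; apply: (MVT xy); exact: continuous_subspaceT.
have ndF x y : x <= y -> F x <= F y.
  rewrite le_eqVlt => /orP[/eqP->//|xy]; have [z _ E] := mvt _ _ xy.
  by rewrite -subr_ge0 E mulr_ge0// subr_ge0 ltW.
have Fb x : b <= x -> F x = F b.
  rewrite le_eqVlt => /orP[/eqP->//|bx]; have [z] := mvt _ _ bx.
  rewrite in_itv/= => /andP[bz _]; rewrite fb ?mul0r ?(ltW bz)// => /eqP.
  by rewrite subr_eq0 => /eqP.
have Fb0 : 0 < F b.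
  have [z] := mvt _ _ ab; rewrite in_itv/= => /andP[az zb].
  rewrite (F0 a)// subr0 => ->; rewrite !mulr_gt0 ?subr_gt0//; apply: e_gt0.
    by rewrite mul1r subr_gt0.
  by rewrite mulN1r addrC subr_gt0.
exists ((F b)^-1 *: F + cst 0); split.
- exact: smooth_lin (smooth_primitive dF sf) (smooth_cst 0).
- move=> x; rewrite -[(_ + _) x]/((F b)^-1 * F x + 0) addr0.
  have Fx0 : 0 <= F x.
    have [xa|/ltW ax] := leP x a; first by rewrite F0.
    by rewrite -(F0 a (lexx a)) ndF.
  rewrite mulr_ge0 ?invr_ge0 ?(ltW Fb0)//= ler_pdivrMl// mulr1.
  have [bx|/ltW xb] := leP b x; first by rewrite Fb.
  exact: ndF.
- by move=> x xa; rewrite -[(_ + _) x]/((F b)^-1 * F x + 0) (F0 x xa) mulr0 addr0.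
- move=> x bx; rewrite -[(_ + _) x]/((F b)^-1 * F x + 0) Fb// addr0 mulVf//.
  by rewrite gt_eqF.
Qed.

Lemma smooth_plateau (a a' b' b : R) : a < a' -> b' < b -> exists th : R -> R,
  [/\ smooth (V := R) th, forall x, 0 <= th x <= 1,
      forall x, x <= a \/ b <= x -> th x = 0 &
      forall x, a' <= x <= b' -> th x = 1].
Proof.
move=> aa bb; have [f [sf f01 f0 f1]] := smooth_step aa.
have nbb : - b < - b' by rewrite ltrN2.
have [g [sg g01 g0 g1]] := smooth_step nbb.
exists (fun x => f x * g (-1 * x + 0)); split.
- by apply: smoothM => //; exact: smooth_affine.
- move=> x; have /andP[f0x f1x] := f01 x; have /andP[g0x g1x] := g01 (-1 * x + 0).
  by rewrite mulr_ge0// -[leRHS]mulr1 ler_pM.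
- move=> x [xa|bx]; first by rewrite f0 ?mul0r.
  by rewrite g0 ?mulr0// mulN1r addr0 lerN2.
- move=> x /andP[ax xb]; rewrite f1// g1 ?mulr1// mulN1r addr0 lerN2//.
Qed.

Lemma Cc_smooth_lin (V : normedModType R) (U : set V) a (f g : V -> R) :
  Cc_smooth U f -> Cc_smooth U g -> Cc_smooth U (a *: f + g).
Proof.
move=> [sf [K [cK KU fK]]] [sg [L [cL LU gL]]]; split; first exact: smooth_lin.
exists (K `|` L); split.
- exact: compactU.
- by rewrite subUset.
- by move=> x KL; rewrite fun_linE fK ?gL ?mulr0 ?addr0// => ?; apply: KL; [right|left].
Qed.

Lemma Cc_smooth_seg (U : set R) (a b : R) (f : R -> R) : `[a, b] `<=` U ->
  smooth (V := R) f -> (forall x, x <= a \/ b <= x -> f x = 0) -> Cc_smooth (V := R) U f.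
Proof.
move=> abU sf f0; split=> //; exists `[a, b]%classic; split=> //.
  exact: segment_compact.
move=> x; rewrite /= in_itv/= => /negP; rewrite negb_and -!ltNge => /orP[/ltW xa|/ltW bx].
  by apply: f0; left.
by apply: f0; right.
Qed.

Section row_vector.
Variable n : nat.

Lemma smooth_coord (i : 'I_n) (f : R -> R) : smooth (V := R) f ->
  smooth (fun x : 'rV[R]_n => f (x ord0 i)).
Proof.
have lin : linear (fun v : 'rV[R]_n => v ord0 i : R) by move=> a u v; rewrite !mxE.
pose M := GRing.isLinear.Build R 'rV[R]_n R _ _ lin.
pose L : {linear 'rV[R]_n -> R} := HB.pack (fun v : 'rV[R]_n => v ord0 i : R) M.
apply: (@smooth_comp 'rV[R]_n R L (fun v => v ord0 i)) => [x|x v].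
  exact: differentiable_coord.
by rewrite diff_lin//; exact: coord_continuous.
Qed.

Lemma smooth_section (i : 'I_n) x (f : 'rV[R]_n -> R) : smooth f ->
  smooth (V := R) (section i x f).
Proof.
have dL (y : R) : is_diff y (upd i x) ( *:%R^~ (delta_mx ord0 i : 'rV[R]_n)).
  have := is_diffD (is_diff_scalel y (delta_mx ord0 i : 'rV[R]_n)) (is_diff_cst (upd i x 0) y).
  rewrite addr0 (_ : _ + _ = upd i x)//; apply/funext => z; apply/rowP => j.
  by rewrite !mxE/=; case: (eqVneq j i) => _; rewrite ?mulr1 ?addr0 ?mulr0 ?add0r.
apply: (@smooth_comp R 'rV[R]_n (upd i x) (fun v => v *: delta_mx ord0 i)).
  by move=> y; case: (dL y).
by move=> y v; case: (dL y) => _ ->.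
Qed.

Lemma Cc_smooth_section (I : 'I_n -> set R) i x (f : 'rV[R]_n -> R) :
  Cc_smooth (box I) f -> Cc_smooth (V := R) (I i) (section i x f).
Proof.
move=> [sf [K [cK KI fK]]]; split; first exact: smooth_section.
exists ((fun y : 'rV[R]_n => y ord0 i) @` K); split.
- apply: continuous_compact => //; apply: continuous_subspaceT.
  exact: coord_continuous.
- by move=> _ [y Ky <-]; exact: KI Ky i.
- move=> y nK; apply: fK => Ky; apply: nK; exists (upd i x y) => //.
  exact: upd_same.
Qed.

Lemma Cc_smooth_tensor (I : 'I_n -> set R) (u : 'I_n -> R -> R) :
  (forall i, Cc_smooth (V := R) (I i) (u i)) -> Cc_smooth (box I) (tensor u).
Proof.
move=> hu; split.
  by apply: smooth_prod => i; apply: smooth_coord; case: (hu i).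
have /choice[K hK] : forall i, exists K : set R,
    [/\ compact K, K `<=` I i & forall x, ~ K x -> u i x = 0].
  by move=> i; case: (hu i).
exists (box K); split.
- by apply: rV_compact => i; case: (hK i).
- by move=> x Kx i; have [_ h _] := hK i; apply: h; exact: Kx.
- move=> x /existsNP[i nKi]; rewrite /tensor (bigD1 i)//=.
  by have [_ _ ->//] := hK i; rewrite mul0r.
Qed.

End row_vector.

End smooth_functions.

(** * Stieltjes measures and scales *)

Section lebesgue.
Variable R : realType.

(* The library's Lebesgue measure lives on a copy of [R] with the same
   measurable sets but another display. *)
Definition lam (A : set R) : \bar R := lebesgue_measure A.

Let lam0 : lam set0 = 0%E. Proof. exact: measure0 (@lebesgue_measure R). Qed.

Let lam_ge0 A : (0 <= lam A)%E. Proof. exact: measure_ge0 (@lebesgue_measure R) A. Qed.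

Let lam_sigma : semi_sigma_additive lam.
Proof. exact: (@measure_semi_sigma_additive _ _ _ (@lebesgue_measure R)). Qed.

HB.instance Definition _ := isMeasure.Build _ _ _ lam lam0 lam_ge0 lam_sigma.

Let integral_lam_nonneg f : nonneg_mfun f ->
  (\int[lam]_x f x = \int[@lebesgue_measure R]_x f x)%E.
Proof.
move=> hf; apply: (integral_like_eq (integral_like_integral lam)
  (integral_like_integral (@lebesgue_measure R)) _ hf) => A mA.
rewrite integral_indic// setIT.
by rewrite (integral_indic (@lebesgue_measure R) measurableT mA) setIT.
Qed.

Lemma integral_lam (D : set R) (f : R -> \bar R) : measurable D -> measurable_fun D f ->
  (\int[lam]_(x in D) f x = \int[@lebesgue_measure R]_(x in D) f x)%E.
Proof.
move=> mD /(measurable_restrictT _ mD) mf.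
rewrite integral_mkcond [RHS]integral_mkcond integralE [RHS]integralE.
have [mp mn] := (measurable_funepos mf, measurable_funeneg mf).
by rewrite (integral_lam_nonneg (conj (funepos_ge0 _) mp))
  (integral_lam_nonneg (conj (funeneg_ge0 _) mn)).
Qed.

Lemma lam_oc (a b : R) : a <= b -> lam `]a, b]%classic = (b - a)%:E.
Proof.
move=> ab; rewrite /lam lebesgue_measure_itv/= lte_fin.
have [//|ba] := ltP a b; rewrite EFinB.
by have -> : a = b by [apply/eqP; rewrite eq_le ab ba]; rewrite subee.
Qed.

Lemma FTC_lam (F f : R -> R) (a b : R) : (forall x : R, is_derive x 1 F (f x)) ->
  continuous f -> a <= b -> \int[lam]_(x in `]a, b]) f x = F b - F a.
Proof.
move=> dF cf; rewrite le_eqVlt => /orP[/eqP->|ab].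
  by rewrite set_itvoc0 Rintegral_set0 subrr.
have cF : continuous F.
  by move=> x; apply: differentiable_continuous; apply/derivable1_diffP; case: (dF x).
have mf : measurable_fun setT f by exact: continuous_measurable_fun.
rewrite /Rintegral integral_lam//; last first.
  by apply: measurable_funTS; exact/measurable_EFinP.
rewrite integral_itv_obnd_cbnd; last by apply: measurable_funTS; exact/measurable_EFinP.
rewrite (@continuous_FTC2 R f F a b ab)//.
- exact: continuous_subspaceT.
- split.
  + by move=> x _; case: (dF x).
  + by apply: cvg_at_right_filter; exact: cF.
  + by apply: cvg_at_left_filter; exact: cF.
- by move=> x _; rewrite derive1E; case: (dF x).
Qed.

End lebesgue.
Arguments lam {R} A.

Section density.
Context d (T : measurableType d) (R : realType).

Lemma density_measure (mu : {measure set T -> \bar R}) f : nonneg_mfun f ->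
  exists nu : {measure set T -> \bar R},
    forall g, nonneg_mfun g -> (\int[nu]_x g x = \int[mu]_x (g x * f x))%E.
Proof.
move=> hf; apply: integral_like_measureE.
apply: (integral_like_comp (integral_like_integral mu) (K := fun g x => (g x * f x)%E)).
  by move=> x; exact: integral_like_scale (hf.1 x) (integral_like_eval _ x).
by move=> g hg; exact: (nonneg_mfunM hg hf).2.
Qed.

Lemma density_measureE (mu : {measure set T -> \bar R}) D f : measurable D ->
  measurable_fun D f -> (forall x, D x -> (0 <= f x)%E) ->
  exists nu : {measure set T -> \bar R},
    (forall A, measurable A -> nu A = \int[mu]_(x in A `&` D) f x)%E /\
    forall E g, measurable E -> E `<=` D -> measurable_fun E g ->
      (forall x, E x -> (0 <= g x)%E) ->
      (\int[nu]_(x in E) g x = \int[mu]_(x in E) (g x * f x))%E.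
Proof.
move=> mD mf f0; have hf : nonneg_mfun (f \_ D).
  split=> [x|]; last exact/(measurable_restrictT _ mD).
  by rewrite patchE; case: ifPn => // /set_mem; exact: f0.
have [nu nuE] := density_measure mu hf; exists nu; split.
  move=> A mA; have := nuE _ (nonneg_mfun_indic R mA).
  rewrite integral_indic// setIT => ->; rewrite [RHS]integral_mkcond.
  apply: eq_integral => x _; rewrite /= !patchE indicE in_setI.
  by case: (x \in A); rewrite ?mul1e ?mul0e.
move=> E g mE ED mg g0; rewrite integral_mkcond nuE; last first.
  split=> [x|]; last exact/(measurable_restrictT _ mE).
  by rewrite patchE; case: ifPn => // /set_mem; exact: g0.
rewrite [RHS]integral_mkcond; apply: eq_integral => x _; rewrite !patchE.
by case: ifPn => [/set_mem/ED/mem_set ->//|_]; rewrite mul0e.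
Qed.

(** [h] is truncated at a level [N] above which little of its integral remains; the integral of the
    truncated part is at most [N%:R * mu A]. *)
Lemma integral_abs_cont (mu : {measure set T -> \bar R}) D (h : T -> R) (e : R) :
  measurable D -> measurable_fun D h -> (forall x, D x -> 0 <= h x) ->
  (\int[mu]_(x in D) (h x)%:E < +oo)%E -> 0 < e ->
  exists2 dl : R, 0 < dl & forall A, measurable A -> A `<=` D ->
    (mu A < dl%:E)%E -> (\int[mu]_(x in A) (h x)%:E < e%:E)%E.
Proof.
move=> mD mh h0 hfin e0; pose hn n x := Num.min (h x) n%:R.
have mhn n : measurable_fun D (hn n) by apply: measurable_minr.
have cvg : (\int[mu]_(x in D) (hn n x)%:E)%E @[n --> \oo] --> (\int[mu]_(x in D) (h x)%:E)%E.
  rewrite (_ : (\int[mu]_(x in D) (h x)%:E = \int[mu]_(x in D) limn (fun n => (hn n x)%:E))%E); last first.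
    apply: eq_integral => x xD; apply/esym/cvg_lim => //; apply: cvg_near_cst.
    have [N hN] := exists_nat_gt (h x); near=> n; rewrite /hn min_l//.
    apply: (le_trans (ltW hN)); rewrite ler_nat; near: n; exact: nbhs_infty_ge.
  apply: cvg_monotone_convergence => //.
  - by move=> n; exact/measurable_EFinP.
  - by move=> n x Dx; rewrite lee_fin le_min h0//=.
  - by move=> x Dx p q pq; rewrite lee_fin /hn le_min ge_min lexx /= ge_min ler_nat pq orbT.
have e2 : 0 < e / 2 by rewrite divr_gt0.
have hfn : (\int[mu]_(x in D) (h x)%:E)%E \is a fin_num.
  by rewrite ge0_fin_numE//; apply: integral_ge0 => x Dx; rewrite lee_fin h0.
have [N hN] : exists N, (\int[mu]_(x in D) (h x)%:E < \int[mu]_(x in D) (hn N x)%:E + (e / 2)%:E)%E.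
  have : (\int[mu]_(x in D) (h x)%:E - (e / 2)%:E < \int[mu]_(x in D) (h x)%:E)%E.
    by rewrite lteBlDr// lteDl// lte_fin.
  move=> hlt; have [|N _ /(_ N (leqnn N)) hN] := cvg (fun y => (\int[mu]_(x in D) (h x)%:E - (e / 2)%:E < y)%E).
    by apply: open_nbhs_nbhs; split; [exact: open_ereal_gt_ereal|].
  by exists N; rewrite -lteBlDr.
have hnh x : hn N x <= h x by rewrite /hn ge_min lexx.
have hn0 x : D x -> 0 <= hn N x by move=> Dx; rewrite le_min h0/=.
have md : measurable_fun D (fun x => (h x - hn N x)%:E).
  by apply/measurable_EFinP; exact: measurable_funB.
have split_int E : measurable E -> E `<=` D ->
    (\int[mu]_(x in E) (h x)%:E = \int[mu]_(x in E) (hn N x)%:E +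
     \int[mu]_(x in E) (h x - hn N x)%:E)%E.
  move=> mE ED; rewrite -ge0_integralD//.
  - by apply: eq_integral => x _; rewrite -EFinD subrKC.
  - by move=> x /ED Dx; rewrite lee_fin hn0.
  - by apply: (measurable_funS mD ED); exact/measurable_EFinP.
  - by move=> x _; rewrite lee_fin subr_ge0.
  - exact: (measurable_funS mD ED).
have dN : (\int[mu]_(x in D) (h x - hn N x)%:E < (e / 2)%:E)%E.
  rewrite split_int// in hN; rewrite lteD2lE// in hN.
  rewrite ge0_fin_numE; last by apply: integral_ge0 => x Dx; rewrite lee_fin hn0.
  apply: le_lt_trans hfin; apply: ge0_le_integral => //.
  - exact/measurable_EFinP.
  - exact/measurable_EFinP.
  - by move=> x _; rewrite lee_fin.
exists (e / 2 / (N.+1)%:R) => [|A mA AD muA]; first by rewrite divr_gt0.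
rewrite split_int// (_ : e%:E = (e / 2)%:E + (e / 2)%:E)%E; last first.
  by rewrite -EFinD; congr _%:E; field.
apply: lee_ltD.
- rewrite ge0_fin_numE; last by apply: integral_ge0 => x /AD Dx; rewrite lee_fin hn0.
  apply: (@le_lt_trans _ _ (\int[mu]_(x in A) (h x)%:E)%E).
    by rewrite split_int// leeDl//; apply: integral_ge0 => x _; rewrite lee_fin subr_ge0.
  apply: le_lt_trans hfin; apply: ge0_subset_integral => //.
  exact/measurable_EFinP.
- apply: (@le_trans _ _ (\int[mu]_(x in A) (cst N%:R%:E) x)%E).
    apply: ge0_le_integral => //.
    + by move=> x /AD Dx; rewrite lee_fin hn0.
    + by apply: (measurable_funS mD AD); exact/measurable_EFinP.
    + by move=> x _; rewrite lee_fin /hn ge_min lexx orbT.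
  rewrite integral_cst//; apply: (@le_trans _ _ (N%:R%:E * (e / 2 / (N.+1)%:R)%:E)%E).
    by apply: lee_wpmul2l; rewrite ?lee_fin// ltW.
  by rewrite -EFinM lee_fin mulrA ler_pdivrMr// mulrC ler_wpM2l ?(ltW e2)// ler_nat.
- apply: le_lt_trans dN; apply: ge0_subset_integral => //.
  by move=> x _; rewrite lee_fin subr_ge0.
Unshelve. all: by end_near. Qed.

End density.

(** * Measures determined by half-open intervals, and the change of scale *)

Section stieltjes.
Variable R : realType.
Implicit Types (mu nu : {measure set R -> \bar R}) (a b c d : R) (h : R -> R).

Lemma ocI a b c d : `]c, d]%classic `&` `]a, b]%classic = `]Num.max c a, Num.min d b]%classic :> set R.
Proof.
apply/seteqP; split=> x /=; rewrite !in_itv/= gt_max le_min.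
  by move=> [/andP[-> ->] /andP[-> ->]].
by move=> /andP[/andP[-> ->] /andP[-> ->]].
Qed.

Let oc_setI : setI_closed [set A | exists c d, A = `]c, d]%classic :> set R].
Proof. by move=> _ _ [a [b ->]] [c [d ->]]; rewrite ocI; do 2 eexists. Qed.

Let oc_measurable : @measurable _ R = <<s [set A | exists c d, A = `]c, d]%classic :> set R] >>.
Proof.
rewrite [LHS]/(<<s @ocitv R >>); congr <<s _ >>; apply/seteqP; split => A.
  by move=> /= [[c d] _ <-]; exists c, d.
by move=> [c [d ->]]; exists (c, d).
Qed.

Let oc_cover : \bigcup_k `](- k%:R), k%:R]%classic = setT :> set R.
Proof.
apply/seteqP; split=> // x _; have [N hN] := exists_nat_gt `|x|.
exists N => //=; rewrite in_itv/=; move: hN; rewrite ltr_norml => /andP[-> /ltW ->//].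
Qed.

Lemma integral_like_oc_unique (Phi Psi : (R -> \bar R) -> \bar R) :
  integral_like Phi -> integral_like Psi ->
  (forall c d, Phi (EFin \o \1_`]c, d]%classic) = Psi (EFin \o \1_`]c, d]%classic)) ->
  (forall c d, (Phi (EFin \o \1_`]c, d]%classic) < +oo)%E) ->
  forall f, nonneg_mfun f -> Phi f = Psi f.
Proof.
move=> hPhi hPsi E fin.
apply: (integral_like_unique oc_measurable oc_setI _ oc_cover hPhi hPsi) => //.
- by move=> i; do 2 eexists.
- by move=> _ [c [d ->]].
Qed.

Lemma integral_eq_oc mu nu a b :
  (forall c d, a <= c -> c <= d -> d <= b -> mu `]c, d]%classic = nu `]c, d]%classic) ->
  a <= b -> (mu `]a, b]%classic < +oo)%E ->
  forall f : R -> \bar R, measurable_fun `]a, b] f -> (forall x, a < x <= b -> (0 <= f x)%E) ->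
  (\int[mu]_(x in `]a, b]) f x = \int[nu]_(x in `]a, b]) f x)%E.
Proof.
move=> E ab fin f mf f0; have mD : measurable (`]a, b]%classic : set R) by [].
rewrite -!(mrestr_integral _ mD)//.
apply: (integral_like_oc_unique (integral_like_integral _) (integral_like_integral _)).
- move=> c d; rewrite !integral_indic// !setIT /= /mrestr ocI.
  have [h|h] := leP (Num.max c a) (Num.min d b).
    by apply: E => //; rewrite ?le_max ?ge_min lexx orbT.
  by rewrite set_itv_ge ?measure0// bnd_simp -leNgt ltW.
- move=> c d; rewrite integral_indic// setIT /= /mrestr; apply: le_lt_trans fin.
  by apply: le_measure; rewrite ?inE//; exact: measurableI.
- split=> [x|]; last exact/(measurable_restrictT _ mD).
  by rewrite patchE; case: ifPn => // /set_mem; rewrite /= in_itv/=; exact: f0.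
Qed.

Lemma measure_eq_oc mu nu a b :
  (forall c d, a <= c -> c <= d -> d <= b -> mu `]c, d]%classic = nu `]c, d]%classic) ->
  a <= b -> (mu `]a, b]%classic < +oo)%E ->
  forall A, measurable A -> A `<=` `]a, b]%classic -> mu A = nu A.
Proof.
move=> E ab fin A mA Aab.
have := integral_eq_oc E ab fin (f := EFin \o \1_A); rewrite !integral_indic// setIidl//.
apply=> [|x _]; last by rewrite lee_fin.
by apply: measurable_funTS; apply/measurable_EFinP; exact: measurable_indic.
Qed.

Lemma integral_pos_neg mu D h : measurable D -> mu.-integrable D (EFin \o h) ->
  let hp x := Num.max (h x) 0 in let hm x := Num.max (- h x) 0 in
  [/\ (\int[mu]_(x in D) (hp x)%:E < +oo)%E, (\int[mu]_(x in D) (hm x)%:E < +oo)%E &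
   forall A, measurable A -> A `<=` D -> \int[mu]_(x in A) h x =
    fine (\int[mu]_(x in A) (hp x)%:E) - fine (\int[mu]_(x in A) (hm x)%:E)].
Proof.
move=> mD ih hp hm.
have pE x : (hp x)%:E = ((EFin \o h)^\+ x)%E by rewrite /hp funeposE /= EFin_max.
have nE x : (hm x)%:E = ((EFin \o h)^\- x)%E by rewrite /hm funenegE /= EFin_max.
have fp := integral_funepos_lt_pinfty mD ih; have fn := integral_funeneg_lt_pinfty mD ih.
have fA A (f : R -> \bar R) : (forall x, 0 <= f x)%E -> measurable_fun D f -> measurable A ->
    A `<=` D -> (\int[mu]_(x in D) f x < +oo)%E -> (\int[mu]_(x in A) f x)%E \is a fin_num.
  move=> f0 mf mA AD; rewrite ge0_fin_numE; last by apply: integral_ge0.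
  by apply: le_lt_trans; apply: ge0_subset_integral.
have mh := measurable_int mu ih.
split; rewrite ?(eq_integral _ _ (fun x _ => pE x)) ?(eq_integral _ _ (fun x _ => nE x))//.
move=> A mA AD; rewrite /Rintegral integralE.
rewrite (eq_integral _ _ (fun x _ => pE x)) (eq_integral _ _ (fun x _ => nE x)) fineB//.
  by apply: fA fp => //; exact: measurable_funepos.
by apply: fA fn => //; exact: measurable_funeneg.
Qed.

(** Moving the negative parts to the other side turns an equality of signed measures into one of
    finite measures, which half-open intervals determine. *)
Lemma Rintegral_eq_oc mu nu a b h k : a <= b ->
  mu.-integrable `]a, b] (EFin \o h) -> nu.-integrable `]a, b] (EFin \o k) ->
  (forall c d, a <= c -> c <= d -> d <= b ->
     \int[mu]_(x in `]c, d]) h x = \int[nu]_(x in `]c, d]) k x) ->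
  forall A, measurable A -> A `<=` `]a, b]%classic ->
    \int[mu]_(x in A) h x = \int[nu]_(x in A) k x.
Proof.
move=> ab ih ik E A mA Aab; have mD : measurable (`]a, b]%classic : set R) by [].
have [hpf hmf hE] := integral_pos_neg mD ih; have [kpf kmf kE] := integral_pos_neg mD ik.
set hp := fun x => Num.max (h x) 0 in hpf hE; set hm := fun x => Num.max (- h x) 0 in hmf hE.
set kp := fun x => Num.max (k x) 0 in kpf kE; set km := fun x => Num.max (- k x) 0 in kmf kE.
have mh : measurable_fun `]a, b] h by apply/measurable_EFinP; exact: (measurable_int mu).
have mk : measurable_fun `]a, b] k by apply/measurable_EFinP; exact: (measurable_int nu).
have max0 (x : R) : (0 <= (Num.max x 0)%:E)%E by rewrite lee_fin le_max lexx orbT.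
have mmax (f : R -> R) : measurable_fun `]a, b] f ->
    measurable_fun `]a, b] (fun x => (Num.max (f x) 0)%:E).
  by move=> mf; apply/measurable_EFinP; exact: measurable_maxr.
have [r1 [r1E _]] := density_measureE mu mD (mmax _ mh) (fun x _ => max0 _).
have [r2 [r2E _]] := density_measureE mu mD (mmax _ (measurable_funN mh)) (fun x _ => max0 _).
have [q1 [q1E _]] := density_measureE nu mD (mmax _ mk) (fun x _ => max0 _).
have [q2 [q2E _]] := density_measureE nu mD (mmax _ (measurable_funN mk)) (fun x _ => max0 _).
have fin (r : {measure set R -> \bar R}) A' : (r `]a, b]%classic < +oo)%E ->
    measurable A' -> A' `<=` `]a, b]%classic -> r A' \is a fin_num.
  move=> rf mA' A'ab; rewrite ge0_fin_numE//; apply: le_lt_trans rf.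
  by apply: le_measure; rewrite ?inE.
have r1f : (r1 `]a, b]%classic < +oo)%E by rewrite r1E// setIid.
have r2f : (r2 `]a, b]%classic < +oo)%E by rewrite r2E// setIid.
have q1f : (q1 `]a, b]%classic < +oo)%E by rewrite q1E// setIid.
have q2f : (q2 `]a, b]%classic < +oo)%E by rewrite q2E// setIid.
have hrE A' : measurable A' -> A' `<=` `]a, b]%classic ->
    \int[mu]_(x in A') h x = fine (r1 A') - fine (r2 A').
  by move=> mA' A'ab; rewrite hE// r1E// r2E// setIidl.
have kqE A' : measurable A' -> A' `<=` `]a, b]%classic ->
    \int[nu]_(x in A') k x = fine (q1 A') - fine (q2 A').
  by move=> mA' A'ab; rewrite kE// q1E// q2E// setIidl.
have add (r q : {measure set R -> \bar R}) : exists M : {measure set R -> \bar R},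
    forall X, (M X = r X + q X)%E.
  exists (measure_add r q) => X; rewrite /measure_add /= /msum !big_ord_recr/= big_ord0 add0e//.
have [M1 M1E] := add r1 q2; have [M2 M2E] := add q1 r2.
have key : M1 A = M2 A.
  apply: (@measure_eq_oc _ _ a b) => // [c d ac cd db|]; last first.
    by rewrite M1E lte_add_pinfty.
  rewrite M1E M2E.
  have sub : (`]c, d]%classic : set R) `<=` `]a, b]%classic.
    by move=> x /=; rewrite !in_itv/= => /andP[cx xd]; rewrite (le_lt_trans ac cx) (le_trans xd db).
  have := E c d ac cd db; rewrite hrE// kqE//.
  rewrite -(fineK (fin _ _ r1f _ sub))// -(fineK (fin _ _ r2f _ sub))//.
  rewrite -(fineK (fin _ _ q1f _ sub))// -(fineK (fin _ _ q2f _ sub))//=.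
  by move=> ?; rewrite -!EFinD; congr _%:E; lra.
rewrite hrE// kqE//; move: key; rewrite M1E M2E.
rewrite -(fineK (fin _ _ r1f mA Aab)) -(fineK (fin _ _ r2f mA Aab)).
rewrite -(fineK (fin _ _ q1f mA Aab)) -(fineK (fin _ _ q2f mA Aab)).
by rewrite -!EFinD /= => -[?]; lra.
Qed.

Section transport.
Variables (mu : {measure set R -> \bar R}) (a b : R) (t : R -> R).
Hypothesis ab : a < b.
Hypothesis tmono : forall x y, a <= x -> x < y -> y <= b -> t x < t y.
Hypothesis tcont : {within `[a, b], continuous t}.
Hypothesis muE : forall c d, a <= c -> c <= d -> d <= b -> mu `]c, d]%classic = (t d - t c)%:E.

Let mD : measurable (`]a, b]%classic : set R). Proof. by []. Qed.

Let tmono_le x y : a <= x -> x <= b -> a <= y -> y <= b -> (t x <= t y) = (x <= y).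
Proof.
move=> ax xb ay yb; have [xy|yx] := leP x y.
  by move: xy; rewrite le_eqVlt => /orP[/eqP->|xy]; [rewrite lexx|rewrite ltW// tmono].
by apply/negbTE; rewrite -ltNge tmono.
Qed.

Lemma measurable_scale : measurable_fun `]a, b] t.
Proof.
apply: (@measurable_funS _ _ _ _ `[a, b]%classic) => //.
  by move=> x /=; rewrite !in_itv/= => /andP[/ltW-> ->].
exact: subspace_continuous_measurable_fun.
Qed.

Lemma scale_ivt v : t a <= v -> v <= t b -> exists c, [/\ a <= c, c <= b & t c = v].
Proof.
move=> av vb; have [|c] := @IVT R t a b v (ltW ab) tcont.
  by rewrite ge_min av le_max vb orbT.
by rewrite in_itv/= => /andP[ac cb] <-; exists c.
Qed.

(** The image of [mu] under [t] is Lebesgue measure: the preimage of an interval is an interval,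
    whose end points come from the intermediate value theorem. *)
Lemma integral_scale_nonneg (f : R -> \bar R) : nonneg_mfun f ->
  (\int[mu]_(x in `]a, b]) f (t x) = \int[lam]_(y in `]t a, t b]) f y)%E.
Proof.
have mt := (measurable_restrictT _ mD).1 measurable_scale.
have L1 := integral_like_map mt (integral_like_integral (mrestr mu mD)).
have mE : measurable (`]t a, t b]%classic : set R) by [].
have L2' := integral_like_integral (mrestr lam mE).
have key g : nonneg_mfun g -> (\int[mrestr mu mD]_x (g \o (t \_ `]a, b])) x =
    \int[mu]_(x in `]a, b]) g (t x))%E.
  move=> [f0 mf]; rewrite integral_like_mrestr; last first.
    by split => [x|]; [exact: f0|exact: measurableT_comp].
  by apply: eq_integral => x xD; rewrite /= patchE xD.
move=> hh; rewrite -key// -[RHS]integral_like_mrestr//.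
apply: (integral_like_oc_unique L1 L2') hh => c d.
  rewrite key; last exact: nonneg_mfun_indic.
  rewrite [RHS]integral_indic// setIT /= /mrestr ocI.
  have [h|h] := leP (Num.max c (t a)) (Num.min d (t b)); last first.
    rewrite [in RHS]set_itv_ge ?measure0//; last by rewrite bnd_simp -leNgt ltW.
    rewrite integral0_eq// => x /=; rewrite in_itv/= => /andP[ax xb]; rewrite indicE memNset//=.
    rewrite in_itv/= => /andP[cx xd]; move: h; rewrite ltNge => /negP; apply.
    apply: (@le_trans _ _ (t x)); first by rewrite ge_max (ltW cx) (ltW (tmono (lexx a) ax xb)).
    by rewrite le_min xd (tmono_le (ltW ax) xb (ltW ab) (lexx b)).
  have := h; rewrite ge_max !le_min => /andP[/andP[cd cb] /andP[ad _]].
  have [|| p [ap pb pE]] := @scale_ivt (Num.max c (t a)); rewrite ?le_max ?lexx ?orbT//.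
    by rewrite ge_max cb tmono_le ?lexx ?(ltW ab).
  have [|| q [aq qb qE]] := @scale_ivt (Num.min d (t b)); rewrite ?ge_min ?lexx ?orbT//.
    by rewrite le_min ad tmono_le ?lexx ?(ltW ab).
  have pq : p <= q by rewrite -tmono_le// pE qE.
  rewrite lam_oc// -pE -qE -muE//.
  rewrite (_ : (\int[mu]_(x in `]a, b]) (EFin \o \1_`]c, d]%classic) (t x) =
      \int[mu]_(x in `]a, b]) (EFin \o \1_`]p, q]%classic) x)%E).
    by rewrite integral_indic// setIidl// => x /=; rewrite !in_itv/= => /andP[px xq];
      rewrite (le_lt_trans ap px) (le_trans xq qb).
  apply: eq_integral => x; rewrite inE /= in_itv/= => /andP[ax xb].
  congr (nat_of_bool _)%:R%:E; apply/idP/idP; rewrite !inE /= !in_itv/= => /andP[h1 h2].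
    rewrite ltNge -(tmono_le (ltW ax) xb ap pb) pE -ltNge gt_max h1.
    rewrite ltNge tmono_le ?lexx ?(ltW ax) ?(ltW ab)// -ltNge ax/=.
    by rewrite -(tmono_le (ltW ax) xb aq qb) qE le_min h2 tmono_le// ltW.
  move: h1 h2; rewrite ltNge -(tmono_le (ltW ax) xb ap pb) pE -ltNge gt_max => /andP[-> _].
  by rewrite -(tmono_le (ltW ax) xb aq qb) qE le_min => /andP[].
rewrite key; last exact: nonneg_mfun_indic.
apply: (@le_lt_trans _ _ (\int[mu]_(x in `]a, b]) (cst 1 x))%E).
  apply: ge0_le_integral => //.
  - by move=> x _; rewrite lee_fin.
  - have [_ m1] := nonneg_mfun_indic R (measurable_itv `]c, d] : measurable (`]c, d]%classic : set R)).
    exact: measurableT_comp m1 measurable_scale.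
  - by move=> x _; rewrite lee_fin /= indicE; case: (_ \in _).
by rewrite integral_cst// mul1e muE ?ltry// ltW.
Qed.

Lemma Rintegral_scale (h : R -> R) : measurable_fun setT h ->
  \int[mu]_(x in `]a, b]) h (t x) = \int[lam]_(y in `]t a, t b]) h y.
Proof.
move=> mh; rewrite /Rintegral integralE [in RHS]integralE.
have mh' : measurable_fun setT (EFin \o h) by exact/measurable_EFinP.
have := integral_scale_nonneg (conj (funepos_ge0 (EFin \o h)) (measurable_funepos mh')).
have := integral_scale_nonneg (conj (funeneg_ge0 (EFin \o h)) (measurable_funeneg mh')).
have pE x : ((EFin \o (fun x => h (t x)))^\+ x = (EFin \o h)^\+ (t x))%E by rewrite !funeposE.
have nE x : ((EFin \o (fun x => h (t x)))^\- x = (EFin \o h)^\- (t x))%E by rewrite !funenegE.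
by rewrite (eq_integral _ _ (fun x _ => pE x)) (eq_integral _ _ (fun x _ => nE x)) => -> ->.
Qed.

Lemma FTC_scale (F f : R -> R) : (forall x : R, is_derive x 1 F (f x)) ->
  continuous f -> \int[mu]_(x in `]a, b]) f (t x) = F (t b) - F (t a).
Proof.
move=> dF cf; rewrite Rintegral_scale; last exact: continuous_measurable_fun.
by rewrite (FTC_lam dF cf)// ltW// tmono.
Qed.

End transport.

End stieltjes.

Section L2_on.
Context d (T : measurableType d) (R : realType) (mu : {measure set T -> \bar R}).
Implicit Types (D E : set T) (u v : T -> R).

Lemma L2_subset D E u : measurable D -> measurable E -> E `<=` D -> L2 mu D u -> L2 mu E u.
Proof.
move=> mD mE ED [mu_ fu]; split; first exact: (measurable_funS mD ED).
apply: le_lt_trans fu; apply: ge0_subset_integral => //.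
  by apply/measurable_EFinP; exact: measurable_funX.
by move=> x _; rewrite lee_fin sqr_ge0.
Qed.

Lemma L2_on_linear D a u v : measurable D -> L2 mu D u -> L2 mu D v -> L2 mu D (a *: u + v).
Proof.
move=> mD /(L2_restrict mu mD) hu /(L2_restrict mu mD) hv; apply/(L2_restrict mu mD).
rewrite (_ : _ \_ D = a *: (u \_ D) + v \_ D); first exact: L2_linear.
apply/funext => x; rewrite fun_linE !patchE; case: ifP => // _.
by rewrite mulr0 addr0.
Qed.

Lemma L2_cst D (c : R) : measurable D -> (mu D < +oo)%E -> L2 mu D (cst c).
Proof.
move=> mD fD; split; first exact: measurable_cst.
rewrite (_ : (fun x => _) = cst (c ^+ 2)%:E)//.
by rewrite integral_cst// lte_mul_pinfty ?lee_fin ?sqr_ge0.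
Qed.

Lemma L2_bounded D (c : R) u : measurable D -> (mu D < +oo)%E -> measurable_fun D u ->
  (forall x, D x -> `|u x| <= c) -> L2 mu D u.
Proof.
move=> mD fD mu_ uc; split=> //; apply: le_lt_trans (L2_cst c mD fD).2.
apply: ge0_le_integral => //.
- by move=> x _; rewrite lee_fin sqr_ge0.
- by apply/measurable_EFinP; exact: measurable_funX.
- exact: (measurable_cst (c ^+ 2)%:E).
- move=> x Dx; rewrite lee_fin -[u x ^+ 2]real_normK ?num_real// lerXn2r ?nnegrE ?uc//.
  exact: le_trans (uc x Dx).
Qed.

Lemma L2_on_integrableM D u v : measurable D -> L2 mu D u -> L2 mu D v ->
  mu.-integrable D (EFin \o (fun x => u x * v x)).
Proof.
move=> mD hu hv; apply/integrableP; split.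
  by apply/measurable_EFinP; apply: measurable_funM; [case: hu|case: hv].
have /integrableP[_] := L2_integrableM ((L2_restrict mu mD u).1 hu) ((L2_restrict mu mD v).1 hv).
apply: le_lt_trans; rewrite -mrestr_integral; last first.
  apply: measurableT_comp => //; apply/measurable_EFinP.
  by apply: measurable_funM; [case: hu|case: hv].
rewrite le_eqVlt; apply/orP; left; apply/eqP; apply: eq_integral => x _.
by rewrite /= !patchE; case: ifP => // _; rewrite mulr0 normr0.
Qed.

Lemma L2_integrable D u : measurable D -> (mu D < +oo)%E -> L2 mu D u ->
  mu.-integrable D (EFin \o u).
Proof.
move=> mD fD hu; have := L2_on_integrableM mD hu (L2_cst 1 mD fD).
by under eq_fun do rewrite /= mulr1.
Qed.

Lemma Rintegral_sqr_EFin D u : measurable D -> L2 mu D u ->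
  ((\int[mu]_(x in D) (u x) ^+ 2)%:E = \int[mu]_(x in D) ((u x) ^+ 2)%:E)%E.
Proof.
move=> mD hu; rewrite /Rintegral fineK// ge0_fin_numE; first by case: hu.
by apply: integral_ge0 => x _; rewrite lee_fin sqr_ge0.
Qed.

Lemma Rintegral_sqr_ge0 D u : 0 <= \int[mu]_(x in D) (u x) ^+ 2.
Proof.
by rewrite /Rintegral fine_ge0//; apply: integral_ge0 => x _; rewrite lee_fin sqr_ge0.
Qed.

Lemma Rintegral_sqr_subset D E u : measurable D -> measurable E -> E `<=` D -> L2 mu D u ->
  \int[mu]_(x in E) (u x) ^+ 2 <= \int[mu]_(x in D) (u x) ^+ 2.
Proof.
move=> mD mE ED hu; rewrite -lee_fin !Rintegral_sqr_EFin//; last exact: (L2_subset mD).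
apply: ge0_subset_integral => //; last by move=> x _; rewrite lee_fin sqr_ge0.
by apply/measurable_EFinP; apply: measurable_funX; case: hu.
Qed.

Lemma Rintegral_cauchy_schwarz D u v : measurable D -> L2 mu D u -> L2 mu D v ->
  (\int[mu]_(x in D) (u x * v x)) ^+ 2 <=
  (\int[mu]_(x in D) (u x) ^+ 2) * \int[mu]_(x in D) (v x) ^+ 2.
Proof.
move=> mD hu hv.
have := psd_cauchy_schwarz (@L2_linear _ _ _ _) (L2_psd (mrestr mu mD))
  ((L2_restrict mu mD u).1 hu) ((L2_restrict mu mD v).1 hv).
by rewrite !L2_ip_restrict//; case: hu; case: hv.
Qed.

Lemma Rintegral_sqr_le D u : measurable D -> (mu D < +oo)%E -> L2 mu D u ->
  (\int[mu]_(x in D) u x) ^+ 2 <= (\int[mu]_(x in D) (u x) ^+ 2) * fine (mu D).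
Proof.
move=> mD fD hu; have := Rintegral_cauchy_schwarz mD hu (L2_cst 1 mD fD).
rewrite (_ : \int[mu]_(x in D) (u x * cst 1 x) = \int[mu]_(x in D) u x); last first.
  by apply: eq_Rintegral => x _; rewrite mulr1.
rewrite (_ : \int[mu]_(x in D) (cst 1 x) ^+ 2 = fine (mu D))//.
by under eq_Rintegral do rewrite /= expr1n; rewrite Rintegral_cst// mul1r.
Qed.

Lemma Rintegral_sqrD D u v : measurable D -> L2 mu D u -> L2 mu D v ->
  \int[mu]_(x in D) (u x + v x) ^+ 2 <=
  2 * (\int[mu]_(x in D) (u x) ^+ 2) + 2 * \int[mu]_(x in D) (v x) ^+ 2.
Proof.
move=> mD hu hv.
have h (f : T -> R) : L2 mu D f -> mu.-integrable D (EFin \o (fun x => f x ^+ 2)).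
  by move=> hf; have := L2_on_integrableM mD hf hf; under eq_fun do rewrite -expr2.
have h2 (f : T -> R) : L2 mu D f -> mu.-integrable D (EFin \o (fun x => 2 * f x ^+ 2)).
  by move=> hf; have := integrableZl mD 2 (h _ hf); under eq_fun do rewrite /= -EFinM.
rewrite -!RintegralZl ?h// -RintegralD ?h2//.
apply: le_Rintegral => //.
- apply: (h (fun x => u x + v x)); have := L2_on_linear 1 mD hu hv; rewrite scale1r; exact.
- by have := integrableD mD (h2 _ hu) (h2 _ hv).
- move=> x _; have := sqr_ge0 (u x - v x); rewrite !expr2; nra.
Qed.

(** Chebyshev's inequality, in the form that converts closeness in L^2 into closeness at some point
    of a prescribed set. *)
Lemma exists_small D u (e : R) : measurable D -> L2 mu D u -> 0 < e ->
  (\int[mu]_(x in D) (u x) ^+ 2 < e ^+ 2 * fine (mu D)) -> (mu D < +oo)%E ->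
  exists2 x, D x & `|u x| < e.
Proof.
move=> mD hu e0 h fD; apply: contrapT => /forall2NP no.
have : (\int[mu]_(x in D) (cst (e ^+ 2)%:E) x <= \int[mu]_(x in D) ((u x) ^+ 2)%:E)%E.
  apply: ge0_le_integral => //.
  - by move=> x _; rewrite lee_fin sqr_ge0.
  - by apply/measurable_EFinP; apply: measurable_funX; case: hu.
  - move=> x Dx; rewrite lee_fin -[u x ^+ 2]real_normK ?num_real// lerXn2r ?nnegrE ?(ltW e0)//.
    by have [//|/negP] := no x; rewrite -leNgt.
rewrite integral_cst// -Rintegral_sqr_EFin// -[mu D]fineK ?ge0_fin_numE//.
by rewrite -EFinM lee_fin leNgt h.
Qed.

End L2_on.

Section stieltjes_abs_cont.
Variable R : realType.

(** [integral_abs_cont] is applied to the union of the intervals, whose [mu]-mass is the sum of the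
    increments of [t]. With [t] the identity this gives absolute continuity of primitives; with [t]
    a scale, that of functions of the scale. *)
Lemma abs_cont_integral (mu : {measure set R -> \bar R}) (a b : R) (t F h : R -> R) (e : R) :
  (forall c d, a <= c -> c <= d -> d <= b -> mu `]c, d]%classic = (t d - t c)%:E) ->
  measurable_fun `]a, b] h -> (forall x, a < x <= b -> 0 <= h x) ->
  (\int[mu]_(x in `]a, b]) (h x)%:E < +oo)%E ->
  (forall c d, a <= c -> c <= d -> d <= b ->
     (`|F d - F c|%:E <= \int[mu]_(x in `]c, d]) (h x)%:E)%E) ->
  0 < e -> exists2 dl, 0 < dl & forall (n : nat) (x y : 'I_n -> R),
    (forall k, a <= x k /\ x k <= y k /\ y k <= b) ->
    (forall k l, k != l -> y k <= x l \/ y l <= x k) ->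
    \sum_k (t (y k) - t (x k)) < dl -> \sum_k `|F (y k) - F (x k)| < e.
Proof.
move=> muE mh h0 hfin Fh e0; have mD : measurable (`]a, b]%classic : set R) by [].
have h0' x : `]a, b]%classic x -> 0 <= h x by rewrite /= in_itv/=; exact: h0.
have [dl dl0 hdl] := integral_abs_cont mD mh h0' hfin e0.
exists dl => // n x y xy disj sdl.
pose A k : set R := `]x k, y k]%classic; pose U := \big[setU/set0]_(k <- index_enum 'I_n) A k.
have mA k : measurable (A k) by exact: measurable_itv.
have tA : trivIset [set` index_enum 'I_n] A.
  apply/trivIsetP => k l _ _ kl; apply/seteqP; split=> // z []; rewrite /A /= !in_itv/=.
  move=> /andP[xkz zyk] /andP[xlz zyl]; have [h1|h1] := disj k l kl.
    by move: xlz; rewrite ltNge (le_trans zyk h1).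
  by move: xkz; rewrite ltNge (le_trans zyl h1).
have AD k : A k `<=` `]a, b]%classic.
  move=> z; rewrite /A /= !in_itv/= => /andP[xz zy]; have [ax [_ yb]] := xy k.
  by rewrite (le_lt_trans ax xz) (le_trans zy yb).
have UD : U `<=` `]a, b]%classic.
  by rewrite /U; elim/big_ind: _ => [//|P Q hP hQ|k _]; [rewrite subUset|exact: AD].
have mU : measurable U by apply: bigsetU_measurable.
have muU : (mu U < dl%:E)%E.
  have -> : mu U = (\int[mu]_(x in U) (cst 1%E) x)%E by rewrite integral_cst// mul1e.
  rewrite ge0_integral_bigsetU//; last exact: index_enum_uniq.
  rewrite (eq_bigr (fun k => (t (y k) - t (x k))%:E)) ?sumEFin ?lte_fin// => k _.
  by rewrite integral_cst// mul1e; have [ax [xy' yb]] := xy k; rewrite muE.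
have := hdl U mU UD muU; rewrite ge0_integral_bigsetU//.
- move=> hlt; rewrite -lte_fin -sumEFin; apply: le_lt_trans hlt; apply: lee_sum => k _.
  by have [ax [xy' yb]] := xy k; exact: Fh.
- exact: index_enum_uniq.
- by apply: (measurable_funS mD UD); exact/measurable_EFinP.
- by move=> z /UD /h0'; rewrite lee_fin.
Qed.

Lemma abs_cont_continuous (a b : R) (f : R -> R) (y : R) : abs_cont a b f ->
  a < y -> y < b -> {for y, continuous f}.
Proof.
move=> ac ay yb; apply/cvgrPdist_lt => e e0; have [dl dl0 h] := ac e e0.
near=> z; have az : a < z by near: z; exact: lt_nbhsr.
have zb : z < b by near: z; exact: lt_nbhsl.
have yz : `|y - z| < dl.
  by near: z; apply: (@cvgr_dist_lt _ _ _ _ _ id y) => //; exact: cvg_id.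
have := h 1%N (fun=> Num.min y z) (fun=> Num.max y z); rewrite !big_ord_recl !big_ord0 !addr0.
have [yz'|zy] := leP y z.
  move=> h1; rewrite distrC; apply: h1.
  - by move=> _; rewrite (ltW ay) yz' (ltW zb).
  - by move=> k l; rewrite !ord1 eqxx.
  - by apply: le_lt_trans yz; rewrite distrC ler_norm.
apply.
- by move=> _; rewrite (ltW az) (ltW zy) (ltW yb).
- by move=> k l; rewrite !ord1 eqxx.
- by apply: le_lt_trans yz; rewrite ler_norm.
Unshelve. all: by end_near. Qed.

End stieltjes_abs_cont.

Section scale.
Variables (R : realType) (I : set R) (s : R -> R).
Hypothesis oI : open_interval I.
Hypothesis smono : forall x y, I x -> I y -> x < y -> s x < s y.
Hypothesis scont : {within I, continuous s}.

Lemma interval_seg a b : I a -> I b -> `[a, b]%classic `<=` I.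
Proof.
by case: oI => _ iI _ Ia Ib x /=; rewrite in_itv/=; exact: iI.
Qed.

Lemma interval_oc a b : I a -> I b -> `]a, b]%classic `<=` I.
Proof.
move=> Ia Ib x /= h; apply: (interval_seg Ia Ib); move: h; rewrite /= !in_itv/=.
by move=> /andP[/ltW-> ->].
Qed.

Lemma measurable_interval : measurable I.
Proof. by case: oI => + _ _; exact: open_measurable. Qed.

Lemma interval_nbhs x (e : R) : I x -> 0 < e ->
  exists a b, [/\ I a, I b, a < x < b & b - a < e].
Proof.
case: oI => oI' _ _ Ix e0; have : nbhs x I by exact: open_nbhs_nbhs.
move=> /nbhs_ballP[r /= r0 rI].
pose q := Num.min (r / 2) (e / 4); have q0 : 0 < q by rewrite lt_min !divr_gt0.
have qr : q < r by rewrite gt_min ltr_pdivrMr// ltr_pMr// ltr1n.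
have qe : q <= e / 4 by rewrite ge_min lexx orbT.
exists (x - q), (x + q); split.
- by apply: rI; rewrite /ball/= opprB addrC subrK gtr0_norm.
- by apply: rI; rewrite /ball/= opprD addNKr normrN gtr0_norm.
- by rewrite ltrBlDr ltrDl q0.
- by rewrite opprB addrC addrA subrK; move: qe; lra.
Qed.

Lemma scale_continuous x : I x -> {for x, continuous s}.
Proof.
case: oI => oI' _ _ Ix; move: scont; rewrite continuous_open_subspace//.
by apply; rewrite inE.
Qed.

Lemma scale_within a b : I a -> I b -> {within `[a, b], continuous s}.
Proof. by move=> Ia Ib; apply: continuous_subspaceW scont; exact: interval_seg. Qed.

Lemma scale_mono_on a b : I a -> I b ->
  forall x y, a <= x -> x < y -> y <= b -> s x < s y.
Proof.
move=> Ia Ib x y ax xy yb; have Iab := interval_seg Ia Ib.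
apply: smono => //; apply: Iab; rewrite /= in_itv/=.
  by rewrite ax (le_trans (ltW xy)).
by rewrite yb (le_trans ax (ltW xy)).
Qed.

Lemma scale_le x y : I x -> I y -> (s x <= s y) = (x <= y).
Proof.
move=> Ix Iy; have [xy|yx] := leP x y.
  by move: xy; rewrite le_eqVlt => /orP[/eqP->|xy]; [rewrite lexx|rewrite ltW// smono].
by apply/negbTE; rewrite -ltNge smono.
Qed.

Lemma scale_lt x y : I x -> I y -> (s x < s y) = (x < y).
Proof. by move=> Ix Iy; rewrite !ltNge scale_le. Qed.

Lemma scale_inj x y : I x -> I y -> s x = s y -> x = y.
Proof.
move=> Ix Iy sxy; apply/eqP; rewrite eq_le -(scale_le Ix Iy) -(scale_le Iy Ix).
by rewrite sxy lexx.
Qed.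

Lemma scale_image a b y : I a -> I b -> s a <= y <= s b ->
  exists c, [/\ I c, a <= c <= b & s c = y].
Proof.
move=> Ia Ib /andP[ay yb]; have ab : a <= b by rewrite -scale_le// (le_trans ay yb).
have [|c] := @IVT R s a b y ab (scale_within Ia Ib).
  by rewrite ge_min ay le_max yb orbT.
move=> cab <-; exists c; split=> //; exact: (interval_seg Ia Ib cab).
Qed.

Lemma scale_image_seg a b : I a -> I b -> `[s a, s b]%classic `<=` s @` I.
Proof.
move=> Ia Ib y /=; rewrite in_itv/= => h; have [c [Ic _ <-]] := scale_image Ia Ib h.
by exists c.
Qed.

Lemma near_scale_image x : I x -> \forall y \near s x, (s @` I) y.
Proof.
move=> Ix; have [a [b [Ia Ib /andP[ax xb] _]]] := interval_nbhs Ix ltr01.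
have sax : s a < s x by rewrite scale_lt. have sxb : s x < s b by rewrite scale_lt.
near=> y; apply: (scale_image_seg Ia Ib); rewrite /= in_itv/=.
apply/andP; split; apply: ltW; near: y; [exact: lt_nbhsr|exact: lt_nbhsl].
Unshelve. all: by end_near. Qed.

Lemma compact_in_interval (K : set R) : compact K -> K `<=` I ->
  exists a b, [/\ I a, I b, a < b & K `<=` `]a, b[%classic].
Proof.
move=> cK KI; have [[x Kx]|K0] := pselect (K !=set0); last first.
  have [_ _ [x Ix]] := oI; have [a [b [Ia Ib /andP[ax xb] _]]] := interval_nbhs Ix ltr01.
  exists a, b; split=> //; first exact: lt_trans ax xb.
  by move=> y Ky; case: K0; exists y.
have cid : {within K, continuous (id : R -> R)} by apply: continuous_subspaceT => y; exact: cvg_id.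
have [p /set_mem Kp hp] := compact_EVT_min (ex_intro _ x Kx) cK cid.
have [q /set_mem Kq hq] := compact_EVT_max (ex_intro _ x Kx) cK cid.
have [a [_ [Ia _ /andP[ap _] _]]] := interval_nbhs (KI _ Kp) ltr01.
have [_ [b [_ Ib /andP[_ qb] _]]] := interval_nbhs (KI _ Kq) ltr01.
have h y : K y -> a < y < b.
  move=> Ky; rewrite (lt_le_trans ap (hp y (mem_set Ky))).
  by rewrite (le_lt_trans (hq y (mem_set Ky)) qb).
exists a, b; split=> //; first by have /andP[/lt_trans h1 /h1] := h _ Kx.
Qed.

Lemma compact_in_image (K : set R) : compact K -> K `<=` s @` I ->
  exists a b, [/\ I a, I b, a < b & K `<=` `]s a, s b[%classic].
Proof.
move=> cK KJ; have [[y Ky]|K0] := pselect (K !=set0); last first.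
  have [_ _ [x Ix]] := oI; have [a [b [Ia Ib /andP[ax xb] _]]] := interval_nbhs Ix ltr01.
  exists a, b; split=> //; first exact: lt_trans ax xb.
  by move=> y Ky; case: K0; exists y.
have cid : {within K, continuous (id : R -> R)} by apply: continuous_subspaceT => z; exact: cvg_id.
have [p /set_mem Kp hp] := compact_EVT_min (ex_intro _ y Ky) cK cid.
have [q /set_mem Kq hq] := compact_EVT_max (ex_intro _ y Ky) cK cid.
have [p' Ip' pE] := KJ _ Kp; have [q' Iq' qE] := KJ _ Kq.
have [a [_ [Ia _ /andP[ap _] _]]] := interval_nbhs Ip' ltr01.
have [_ [b [_ Ib /andP[_ qb] _]]] := interval_nbhs Iq' ltr01.
have h z : K z -> s a < z < s b.
  move=> Kz; rewrite (lt_le_trans _ (hp z (mem_set Kz)))/= -?pE ?scale_lt//.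
  by rewrite (le_lt_trans (hq z (mem_set Kz)))// -qE scale_lt.
exists a, b; split=> //; first by have /andP[/lt_trans h1 /h1] := h _ Ky; rewrite scale_lt.
Qed.

Lemma Cc_smooth_interval (f : R -> R) : Cc_smooth (V := R) I f ->
  exists a b, [/\ I a, I b, a < b & forall x, x <= a \/ b <= x -> f x = 0].
Proof.
move=> [_ [K [cK KI fK]]]; have [a [b [Ia Ib ab Kab]]] := compact_in_interval cK KI.
exists a, b; split=> // x xab; apply: fK => /Kab; rewrite /= in_itv/= => /andP[ax xb].
by case: xab; [rewrite leNgt ax|rewrite leNgt xb].
Qed.

Lemma Cc_smooth_image (f : R -> R) : Cc_smooth (V := R) (s @` I) f ->
  exists a b, [/\ I a, I b, a < b & forall y, y <= s a \/ s b <= y -> f y = 0].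
Proof.
move=> [_ [K [cK KI fK]]]; have [a [b [Ia Ib ab Kab]]] := compact_in_image cK KI.
exists a, b; split=> // x xab; apply: fK => /Kab; rewrite /= in_itv/= => /andP[ax xb].
by case: xab; [rewrite leNgt ax|rewrite leNgt xb].
Qed.

End scale.

(** * One-dimensional diffusions *)

Section density_change.
Context d (T : measurableType d) (R : realType).
Variables (mu nu : {measure set T -> \bar R}) (D : set T) (g : T -> R).
Hypothesis mD : measurable D.
Hypothesis mg : measurable_fun D g.
Hypothesis g0 : forall x, D x -> 0 <= g x.
Hypothesis muE : forall A, measurable A -> A `<=` D ->
  mu A = (\int[nu]_(x in A) (g x)%:E)%E.

Lemma density_change (E : set T) (h : T -> \bar R) : measurable E -> E `<=` D ->
  measurable_fun E h -> (forall x, E x -> (0 <= h x)%E) ->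
  (\int[mu]_(x in E) h x = \int[nu]_(x in E) (h x * (g x)%:E))%E.
Proof.
move=> mE ED mh h0.
have mg' : measurable_fun D (fun x => (g x)%:E) by exact/measurable_EFinP.
have g0' x : D x -> (0 <= (g x)%:E)%E by move=> /g0; rewrite lee_fin.
have [r [rE rI]] := density_measureE nu mD mg' g0'; rewrite -rI//.
apply: eq_measure_integral => A mA AE; rewrite rE// muE//; last exact: subset_trans AE ED.
by rewrite setIidl//; exact: subset_trans AE ED.
Qed.

Lemma Rdensity_change (E : set T) (h : T -> R) : measurable E -> E `<=` D ->
  measurable_fun E h ->
  \int[mu]_(x in E) h x = \int[nu]_(x in E) (h x * g x).
Proof.
move=> mE ED mh; rewrite /Rintegral integralE [in RHS]integralE.
have mh' : measurable_fun E (EFin \o h) by exact/measurable_EFinP.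
rewrite (density_change mE ED (measurable_funepos mh'))//.
rewrite (density_change mE ED (measurable_funeneg mh'))//.
congr (fine (_ - _)%E); apply: eq_integral => x /set_mem /ED /g0 gx.
  rewrite !funeposE /= -EFin_max -EFinM -EFin_max; congr _%:E.
  by rewrite maxr_pMl// mul0r.
rewrite !funenegE /= -EFin_max -EFinM -EFin_max; congr _%:E.
by rewrite maxr_pMl// mul0r mulNr.
Qed.

End density_change.

Section support.
Context d (T : measurableType d) (R : realType) (mu : {measure set T -> \bar R}).

Lemma integral_supp (D E : set T) (f : T -> \bar R) : E `<=` D ->
  (forall x, D x -> ~ E x -> f x = 0%E) ->
  (\int[mu]_(x in D) f x = \int[mu]_(x in E) f x)%E.
Proof.
move=> ED f0; rewrite integral_mkcond [RHS]integral_mkcond; apply: eq_integral => x _.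
rewrite !patchE; have [Ex|nEx] := pselect (E x).
  by rewrite (mem_set Ex) (mem_set (ED _ Ex)).
by rewrite (memNset nEx); case: ifPn => // /set_mem Dx; exact: f0.
Qed.

Lemma Rintegral_supp (D E : set T) (f : T -> R) : E `<=` D ->
  (forall x, D x -> ~ E x -> f x = 0) ->
  \int[mu]_(x in D) f x = \int[mu]_(x in E) f x.
Proof.
by move=> ED f0; rewrite /Rintegral (integral_supp ED)// => x Dx nEx; rewrite f0.
Qed.

Lemma L2_supp (D E : set T) (f : T -> R) : E `<=` D -> measurable_fun D f ->
  (forall x, D x -> ~ E x -> f x = 0) -> L2 mu E f -> L2 mu D f.
Proof.
move=> ED mf f0 [_ hf]; split=> //; rewrite (integral_supp ED)// => x Dx nEx.
by rewrite f0// expr0n.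
Qed.

End support.

Section real_helpers.
Variable R : realType.

Lemma Rintegral_oc_split (mu : {measure set R -> \bar R}) (a x b : R) (f : R -> R) :
  a <= x -> x <= b -> mu.-integrable `]a, b] (EFin \o f) ->
  \int[mu]_(z in `]a, b]) f z = \int[mu]_(z in `]a, x]) f z + \int[mu]_(z in `]x, b]) f z.
Proof.
move=> ax xb hf.
have E : `]a, b]%classic = `]a, x]%classic `|` `]x, b]%classic :> set R.
  by rewrite -itv_bndbnd_setU// bnd_simp.
rewrite E in hf *; rewrite Rintegral_setU//.
apply/disj_set2P; apply/seteqP; split=> // z [] /=; rewrite !in_itv/= => /andP[_ zx] /andP[xz _].
by move: xz; rewrite ltNge zx.
Qed.

Lemma abs_le_sqr (x e : R) : 0 <= e -> x ^+ 2 <= e ^+ 2 -> `|x| <= e.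
Proof. by move=> e0; rewrite -[x ^+ 2]real_normK ?num_real// ler_pXn2r ?nnegrE. Qed.

(** Adds up the seven errors of [scale_domain_FTC]. *)
Lemma abs_sum7 (e a b c d f g h : R) : `|a| <= e -> `|b| <= e -> `|c| <= e ->
  `|d| <= e -> `|f| <= e -> `|g| <= e -> `|h| <= e ->
  `|a + b - c - d - f - g - h| <= 7 * e.
Proof.
rewrite !ler_norml => /andP[? ?] /andP[? ?] /andP[? ?] /andP[? ?] /andP[? ?] /andP[? ?] /andP[? ?].
by apply/andP; split; lra.
Qed.

Lemma measurable_inv : measurable_fun setT (GRing.inv : R -> R).
Proof.
have -> : setT = [set 0] `|` ~` [set 0] :> set R by rewrite setUv.
have m0 : measurable (~` [set 0] : set R) by exact: measurableC.
apply/(measurable_funU _ (measurable_set1 _) m0); split; first exact: measurable_fun_set1.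
apply: open_continuous_measurable_fun; first by apply: closed_openC; exact: closed_eq.
by move=> x; rewrite inE => /= /eqP x0; exact: inv_continuous.
Qed.

Lemma bounded_supp (f : R -> R) (a b : R) : continuous f ->
  (forall x, x <= a \/ b <= x -> f x = 0) -> exists2 c, 0 <= c & forall x, `|f x| <= c.
Proof.
move=> cf f0; have [ba|ab] := leP b a.
  exists 0 => // x; have [xa|ax] := leP x a; first by rewrite f0 ?normr0//; left.
  by rewrite f0 ?normr0//; right; exact: le_trans ba (ltW ax).
have cn : {within `[a, b], continuous (fun x => `|f x|)}.
  by apply: continuous_subspaceT => x; apply: cvg_norm; exact: cf.
have [c cab hc] := EVT_max (ltW ab) cn; exists `|f c| => // x.
have [xa|ax] := leP x a; first by rewrite f0 ?normr0//; left.
have [bx|xb] := leP b x; first by rewrite f0 ?normr0//; right.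
by apply: hc; rewrite in_itv/= !ltW.
Qed.

Lemma derive1_supp (f : R -> R) (a b : R) :
  (forall x, x <= a \/ b <= x -> f x = 0) -> forall x, x < a \/ b < x -> f^`()%classic x = 0.
Proof.
move=> f0 x xab; rewrite derive1E -(derive_cst 0 x 1); apply: near_eq_derive.
case: xab => h; near=> y; apply: f0; [left|right]; apply: ltW; near: y.
  exact: lt_nbhsl.
exact: lt_nbhsr.
Unshelve. all: by end_near. Qed.

End real_helpers.

Section Rintegral_helpers.
Context d (T : measurableType d) (R : realType).

Lemma EFin_Rintegral (mu : {measure set T -> \bar R}) D (f : T -> R) : measurable D ->
  mu.-integrable D (EFin \o f) -> ((\int[mu]_(x in D) f x)%:E = \int[mu]_(x in D) (f x)%:E)%E.
Proof. by move=> mD hf; rewrite /Rintegral fineK//; exact: integrable_fin_num. Qed.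

Lemma integrable_density (mu nu : {measure set T -> \bar R}) D (g h : T -> R) :
  measurable D -> measurable_fun D g -> (forall x, D x -> 0 <= g x) ->
  (forall A, measurable A -> A `<=` D -> mu A = (\int[nu]_(x in A) (g x)%:E)%E) ->
  mu.-integrable D (EFin \o h) -> nu.-integrable D (EFin \o (fun x => h x * g x)).
Proof.
move=> mD mg g0 muE /integrableP[mh fh]; have mh' : measurable_fun D h by exact/measurable_EFinP.
apply/integrableP; split; first by apply/measurable_EFinP; exact: measurable_funM.
rewrite (eq_integral (fun x => `|(EFin \o h) x| * (g x)%:E)%E); last first.
  by move=> x /set_mem Dx; rewrite /= normrM EFinM (ger0_norm (g0 _ Dx)).
rewrite -(density_change mD mg g0 muE)//.
exact: measurableT_comp.
Qed.

Lemma ae_eq_Rintegral (mu : {measure set T -> \bar R}) D (f h : T -> R) : measurable D ->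
  mu.-integrable D (EFin \o f) -> mu.-integrable D (EFin \o h) ->
  (forall E, measurable E -> E `<=` D -> \int[mu]_(x in E) f x = \int[mu]_(x in E) h x) ->
  {ae mu, forall x, D x -> f x = h x}.
Proof.
move=> mD hf hh E.
have : ae_eq mu D (EFin \o f) (EFin \o h).
  apply: integral_ae_eq => // [|A AD mA]; first exact: (measurable_int mu).
  have := congr1 EFin (E A mA AD).
  by rewrite !EFin_Rintegral//; exact: (integrableS mD).
by apply: filterS => x h1 Dx; case: (h1 Dx).
Qed.

End Rintegral_helpers.

Section one_dimension.
Variables (R : realType) (I : set R).
Hypothesis oI : open_interval I.

Let mI : measurable I. Proof. exact: measurable_interval oI. Qed.

(** [m] has full support: continuous functions that differ at a point differ on a neighborhood,
    which has positive mass. *)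
Lemma ae_continuous_eq (m : {measure set R -> \bar R}) (f g : R -> R) :
  speed_measure I m -> (forall x, I x -> {for x, continuous f}) ->
  (forall x, I x -> {for x, continuous g}) ->
  {ae m, forall x, I x -> f x = g x} -> forall x, I x -> f x = g x.
Proof.
move=> [_ mpos] cf cg [Z [mZ Z0 fgZ]] x Ix; apply: contrapT => /eqP fgx.
have cfg : {for x, continuous (fun y => f y - g y)} by apply: cvgB; [exact: cf|exact: cg].
have : \forall y \near x, f y - g y != 0.
  by apply: (cvgr_neq0 _ cfg); rewrite subr_eq0.
have [oI' _ _] := oI.
have nI : nbhs x I by exact: open_nbhs_nbhs.
move=> nfg; have /nbhs_ballP[r /= r0 h] : nbhs x [set y | f y - g y != 0 /\ I y].
  exact: filterI.
have BI : ball x r `<=` I by move=> y /h [].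
have : (0 < m (ball x r))%E by apply: mpos => //; [exact: ball_open|exists x; exact: ballxx].
rewrite lt_neqAle => /andP[/eqP h0 _]; apply: h0; apply/esym/eqP; rewrite eq_le measure_ge0 andbT.
rewrite -Z0; apply: le_measure; rewrite ?inE//; first by rewrite ball_itv.
by move=> y /h [/eqP fy Iy]; apply: fgZ => /(_ Iy) E; apply: fy; rewrite E subrr.
Qed.

Section scaled.
Variables (s : R -> R) (ds m : {measure set R -> \bar R}).
Hypothesis smono : forall x y, I x -> I y -> x < y -> s x < s y.
Hypothesis scont : {within I, continuous s}.
Hypothesis hst : stieltjes I s ds.
Hypothesis hm : speed_measure I m.

Lemma ds_oc_fin a b : I a -> I b -> a <= b -> (ds `]a, b]%classic < +oo)%E.
Proof. by move=> Ia Ib ab; rewrite hst// ltry. Qed.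

Lemma stieltjes_seg a b : I a -> I b -> forall c d, a <= c -> c <= d -> d <= b ->
  ds `]c, d]%classic = (s d - s c)%:E.
Proof.
move=> Ia Ib c d ac cd db; apply: hst => //; apply: (interval_seg oI Ia Ib); rewrite /= in_itv/=.
  by rewrite ac (le_trans cd).
by rewrite db (le_trans ac).
Qed.

Lemma loc_abs_cont_continuous phi : loc_abs_cont (s @` I) phi ->
  forall x, I x -> {for s x, continuous phi}.
Proof.
move=> lac x Ix; have [a [b [Ia Ib /andP[ax xb] _]]] := interval_nbhs oI Ix ltr01.
apply: (@abs_cont_continuous R (s a) (s b)).
- apply: lac; last exact: (scale_image_seg oI smono scont Ia Ib).
  by rewrite ltW// smono// (lt_trans ax).
- exact: smono.
- exact: smono.
Qed.

Lemma scale_comp_continuous (phi : R -> R) : (forall x, I x -> {for s x, continuous phi}) ->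
  forall x, I x -> {for x, continuous (fun y => phi (s y))}.
Proof.
move=> cphi x Ix; apply: (@continuous_comp _ _ _ s phi); last exact: cphi.
exact: (scale_continuous oI scont).
Qed.

Lemma scale_derivative_continuous u w : scale_derivative I s ds m u w ->
  (forall x, I x -> {for x, continuous u}) ->
  exists phi, [/\ forall x, I x -> {for s x, continuous phi},
    forall x, I x -> u x = phi (s x) &
    {ae ds, forall x, I x -> is_derive (s x) 1 phi (w x)}].
Proof.
move=> [_ [phi [lac uphi dphi]]] cu; exists phi.
have cphi := loc_abs_cont_continuous lac; split=> //.
by apply: (ae_continuous_eq hm) => //; exact: scale_comp_continuous.
Qed.

Lemma scale_derivative_unique u w w' : scale_derivative I s ds m u w ->
  scale_derivative I s ds m u w' -> {ae ds, forall x, I x -> w x = w' x}.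
Proof.
move=> [_ [phi [lac uphi dphi]]] [_ [psi [lac' upsi dpsi]]].
have E : forall x, I x -> phi (s x) = psi (s x).
  apply: (ae_continuous_eq hm).
  - by apply: scale_comp_continuous; exact: loc_abs_cont_continuous.
  - by apply: scale_comp_continuous; exact: loc_abs_cont_continuous.
  - by apply: filterS2 uphi upsi => x h1 h2 Ix; rewrite -h1// -h2.
apply: filterS2 dphi dpsi => x h1 h2 Ix.
have h1' : is_derive (s x) 1 psi (w x).
  apply: near_eq_is_derive (h1 Ix).
  have := near_scale_image oI smono scont Ix; apply: filterS => y [z Iz <-]; exact: E.
by have [_ <-] := h1'; have [_ ->] := h2 Ix.
Qed.

Lemma scale_derivative_linear c u u' w w' : scale_derivative I s ds m u w ->
  scale_derivative I s ds m u' w' ->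
  (forall phi psi, loc_abs_cont (s @` I) phi -> loc_abs_cont (s @` I) psi ->
     loc_abs_cont (s @` I) (c *: phi + psi)) ->
  scale_derivative I s ds m (c *: u + u') (c *: w + w').
Proof.
move=> [mw [phi [lac uphi dphi]]] [mw' [psi [lac' upsi dpsi]]] hlac; split.
  by apply: measurable_funD => //; exact: measurable_funM.
exists (c *: phi + psi); split; first exact: hlac.
- by apply: filterS2 uphi upsi => x h1 h2 Ix; rewrite !fun_linE h1// h2.
- apply: filterS2 dphi dpsi => x h1 h2 Ix; have [h1' h2'] := (h1 Ix, h2 Ix).
  exact: (is_deriveD (is_deriveZ c h1') h2').
Qed.

Lemma abs_cont_lin a b c (phi psi : R -> R) : abs_cont a b phi -> abs_cont a b psi ->
  abs_cont a b (c *: phi + psi).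
Proof.
move=> h1 h2 e e0; have c0 : 0 < `|c| + 1 by rewrite ltr_wpDl.
have e1 : 0 < e / 2 / (`|c| + 1) by rewrite !divr_gt0.
have [d1 d10 H1] := h1 _ e1; have [d2 d20 H2] := h2 (e / 2) (divr_gt0 e0 (ltr0Sn _ _)).
exists (Num.min d1 d2); first by rewrite lt_min d10.
move=> n x y xy disj; rewrite lt_min => /andP[s1 s2].
have := H1 n x y xy disj s1; have := H2 n x y xy disj s2.
set S1 := \sum_k `|phi _ - _|; set S2 := \sum_k `|psi _ - _| => l2 l1.
apply: (@le_lt_trans _ _ (`|c| * S1 + S2)).
  rewrite mulr_sumr -big_split /=; apply: ler_sum => k _.
  rewrite !fun_linE (_ : _ - _ = c * (phi (y k) - phi (x k)) + (psi (y k) - psi (x k))); last by ring.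
  by apply: le_trans (ler_normD _ _) _; rewrite normrM.
rewrite (_ : e = e / 2 + e / 2); last by field.
apply: ler_ltD l2; apply: (@le_trans _ _ ((`|c| + 1) * S1)).
  by rewrite ler_wpM2r ?lerDl//; apply: sumr_ge0.
by rewrite -ler_pdivlMl// mulrC ltW.
Qed.

Lemma scale_derivative_lin c u u' w w' : scale_derivative I s ds m u w ->
  scale_derivative I s ds m u' w' -> scale_derivative I s ds m (c *: u + u') (c *: w + w').
Proof.
move=> h h'; apply: scale_derivative_linear => // phi psi l l' a b ab abJ.
by apply: abs_cont_lin; [exact: l|exact: l'].
Qed.

Let L2_oc a b w : I a -> I b -> L2 ds I w -> L2 ds `]a, b] w.
Proof. by move=> Ia Ib; apply: L2_subset => //; exact: (interval_oc oI). Qed.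

Lemma scale_domain_integrable a b w : I a -> I b -> a <= b -> L2 ds I w ->
  ds.-integrable `]a, b] (EFin \o w).
Proof.
move=> Ia Ib ab hw; apply: L2_integrable => //; first exact: ds_oc_fin.
exact: L2_oc.
Qed.

Let integral_bound a b w (M : R) : I a -> I b -> a <= b -> L2 ds I w ->
  \int[ds]_(x in I) (w x) ^+ 2 <= M ->
  (\int[ds]_(x in `]a, b]) w x) ^+ 2 <= M * (s b - s a).
Proof.
move=> Ia Ib ab hw wM; apply: le_trans (Rintegral_sqr_le _ (ds_oc_fin Ia Ib ab) (L2_oc Ia Ib hw)) _ => //.
rewrite hst//=; apply: ler_wpM2r; first by rewrite subr_ge0 (scale_le smono).
apply: le_trans wM; apply: Rintegral_sqr_subset => //; exact: (interval_oc oI).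
Qed.

Let mscomp (f : R -> R) : continuous f -> measurable_fun I (fun x => f (s x)).
Proof.
move=> cf; apply: measurableT_comp; first exact: continuous_measurable_fun.
exact: subspace_continuous_measurable_fun.
Qed.

Lemma L2_scale_comp (f : R -> R) a b : continuous f -> I a -> I b -> a < b ->
  (forall y, y <= s a \/ s b <= y -> f y = 0) ->
  L2 m I (fun x => f (s x)) /\ L2 ds I (fun x => f (s x)).
Proof.
move=> cf Ia Ib ab f0; have [c c0 fc] := bounded_supp cf f0.
have [mfin _] := hm.
have sub : `]a, b]%classic `<=` I by exact: interval_oc.
have fs0 x : I x -> ~ `]a, b]%classic x -> f (s x) = 0.
  move=> Ix /= /negP; rewrite in_itv/= negb_and -leNgt -ltNge => /orP[xa|/ltW bx].
    by rewrite f0//; left; rewrite (scale_le smono).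
  by rewrite f0//; right; rewrite (scale_le smono).
have mab : (m `]a, b]%classic < +oo)%E.
  apply: (@le_lt_trans _ _ (m `[a, b]%classic)).
    apply: le_measure; rewrite ?inE//.
    by move=> x /=; rewrite !in_itv/= => /andP[/ltW-> ->].
  by apply: mfin; [exact: segment_compact|exact: (interval_seg oI)].
have mf := mscomp cf.
have mf' : measurable_fun `]a, b] (fun x => f (s x)) by exact: measurable_funS mf.
split; apply: (L2_supp sub mf fs0); apply: (@L2_bounded _ _ _ _ _ c) => //.
by apply: ds_oc_fin => //; exact: ltW.
Qed.

(** The identity holds for the approximants psi o s. Closeness in L^2(ds) controls integrals of [w],
    but closeness in L^2(m) says nothing about the values at [a] and [b]. Hence points [x] near [a]
    and [y] near [b] are chosen at which [u] and psi o s are close, and the two short end pieces are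
    estimated by continuity. *)
Lemma scale_domain_FTC u w a b :
  (forall x, I x -> {for x, continuous u}) -> L2 m I u -> L2 ds I w ->
  (forall eps, 0 < eps -> exists2 psi : R -> R,
        Cc_smooth (V := R) (s @` I) psi &
        2^-1 * (\int[ds]_(x in I) (w x - derive1 psi (s x)) ^+ 2) +
        \int[m]_(x in I) (u x - psi (s x)) ^+ 2 < eps) ->
  I a -> I b -> a < b -> u b - u a = \int[ds]_(x in `]a, b]) w x.
Proof.
move=> cu hu hw happ Ia Ib ab.
set W := \int[ds]_(x in `]a, b]) w x.
suff h (e : R) : 0 < e -> `|u b - u a - W| <= 7 * e.
  apply/eqP; rewrite -subr_eq0 -normr_le0; apply/ler_addgt0Pl => e e0.
  have := h (e / 7) (divr_gt0 e0 (ltr0Sn _ _)); rewrite addr0 mulrC divfK//.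
move=> e0; set M := \int[ds]_(x in I) (w x) ^+ 2.
have M0 : 0 <= M by exact: Rintegral_sqr_ge0.
(* By Cauchy-Schwarz, [w] then has an integral of size at most [e] over an interval on which [s]
   grows by less than [c1]. *)
pose c1 := e ^+ 2 / (M + 1); have M1 : 0 < M + 1 by rewrite ltr_wpDl.
have c10 : 0 < c1 by rewrite divr_gt0// exprn_gt0.
have cs := scale_continuous oI scont.
(* a neighborhood of each end point on which [u] and [s] vary little *)
have near_end x : I x -> \forall y \near x, `|u x - u y| < e /\ `|s x - s y| < c1.
  move=> Ix; have h1 := @cvgr_dist_lt _ _ _ _ _ u (u x) (cu x Ix) e e0.
  have h2 := @cvgr_dist_lt _ _ _ _ _ s (s x) (cs x Ix) c1 c10.
  exact: filterI (h1 _) (h2 _).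
have /nbhs_ballP[ra /= ra0 ha] := near_end a Ia; have /nbhs_ballP[rb /= rb0 hb] := near_end b Ib.
(* The end intervals stay inside the neighborhoods just found; the midpoint keeps them disjoint. *)
pose a' := Num.min (a + ra) ((a + b) / 2); pose b' := Num.max (b - rb) ((a + b) / 2).
have aa' : a < a' by rewrite lt_min ltrDl ra0/=; move: ab; lra.
have b'b : b' < b by rewrite gt_max ltrBlDr ltrDl rb0/=; move: ab; lra.
have a'b' : a' <= b'.
  by apply: (@le_trans _ _ ((a + b) / 2)); rewrite ?ge_min ?le_max lexx orbT.
have Iab := interval_seg oI Ia Ib.
have UI : `]a, a'[%classic `<=` I.
  move=> x /=; rewrite in_itv/= => /andP[ax xa']; apply: Iab; rewrite /= in_itv/= (ltW ax)/=.
  exact: (le_trans (ltW xa') (le_trans a'b' (ltW b'b))).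
have VI : `]b', b[%classic `<=` I.
  move=> x /=; rewrite in_itv/= => /andP[bx xb]; apply: Iab; rewrite /= in_itv/= (ltW xb) andbT.
  exact: (le_trans (ltW aa') (le_trans a'b' (ltW bx))).
have pos (p q : R) : p < q -> I p -> I q -> `]p, q[%classic `<=` I ->
    (0 < m `]p, q[%classic)%E /\ (m `]p, q[%classic < +oo)%E.
  move=> pq Ip Iq pqI; have [mfin mpos] := hm; split.
    apply: mpos => //.
    by exists ((p + q) / 2); rewrite /= in_itv/=; apply/andP; split; lra.
  apply: (@le_lt_trans _ _ (m `[p, q]%classic)).
    apply: le_measure; rewrite ?inE//.
    by move=> x /=; rewrite !in_itv/= => /andP[/ltW-> /ltW->].
  by apply: mfin; [exact: segment_compact|exact: (interval_seg oI)].
have Ia' : I a' by apply: Iab; rewrite /= in_itv/= (ltW aa')/= (le_trans a'b' (ltW b'b)).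
have Ib' : I b' by apply: Iab; rewrite /= in_itv/= (ltW b'b) andbT (le_trans (ltW aa') a'b').
have [mU0 mUf] := pos a a' aa' Ia Ia' UI; have [mV0 mVf] := pos b' b b'b Ib' Ib VI.
set U := `]a, a'[%classic : set R in UI mU0 mUf; set V := `]b', b[%classic : set R in VI mV0 mVf.
have sab : 0 < s b - s a by rewrite subr_gt0 smono.
(* The first two bounds serve [exists_small] on [U] and [V], the third one the middle piece; its
   factor 2 makes up for the [2^-1] of the energy. *)
pose dl := Num.min (e ^+ 2 * fine (m U)) (Num.min (e ^+ 2 * fine (m V)) (e ^+ 2 / (2 * (s b - s a)))).
have e20 : 0 < e ^+ 2 by exact: exprn_gt0.
have dl0 : 0 < dl.
  by rewrite !lt_min !mulr_gt0 ?fine_gt0 ?mU0 ?mV0//= invr_gt0 mulr_gt0.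
have [psi Cpsi app] := happ dl dl0.
have spsi : smooth (V := R) psi by case: Cpsi.
set A := \int[ds]_(x in I) _ in app; set B := \int[m]_(x in I) _ in app.
have A0 : 0 <= A by exact: Rintegral_sqr_ge0.
have B0 : 0 <= B by exact: Rintegral_sqr_ge0.
have Bdl : B < dl by apply: le_lt_trans app; rewrite lerDr mulr_ge0.
have Adl : A <= 2 * dl by move: app B0; lra.
have cpsi : continuous psi by exact: smooth_continuous spsi.
have cdpsi : continuous (psi^`()%classic).
  by apply: smooth_continuous; exact: smooth_derive1.
have [al [be [Ial Ibe albe psi0]]] := Cc_smooth_image oI smono Cpsi.
have [al' [_ [Ial' _ /andP[al'al _] _]]] := interval_nbhs oI Ial ltr01.
have [_ [be' [_ Ibe' /andP[_ bebe'] _]]] := interval_nbhs oI Ibe ltr01.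
have dpsi0 y : y <= s al' \/ s be' <= y -> psi^`()%classic y = 0.
  move=> h; apply: (derive1_supp psi0); case: h => h; [left|right].
    by apply: le_lt_trans h _; exact: smono.
  by apply: lt_le_trans h; exact: smono.
have al'be' : al' < be' by apply: lt_trans al'al _; exact: lt_trans bebe'.
have [L2psi _] := L2_scale_comp cpsi Ial Ibe albe psi0.
have [_ L2dpsi] := L2_scale_comp cdpsi Ial' Ibe' al'be' dpsi0.
have L2d : L2 m I (fun x => u x - psi (s x)).
  have := L2_on_linear (-1) mI L2psi hu; congr (L2 _ _ _).
  by apply/funext => x; rewrite fun_linE mulN1r addrC.
have L2e : L2 ds I (fun x => w x - psi^`()%classic (s x)).
  have := L2_on_linear (-1) mI L2dpsi hw; congr (L2 _ _ _).
  by apply/funext => x; rewrite fun_linE mulN1r addrC.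
have mUo : measurable U by exact: measurable_itv.
have mVo : measurable V by exact: measurable_itv.
have [x Ux ux] : exists2 x, U x & `|u x - psi (s x)| < e.
  apply: (@exists_small _ _ _ m) => //; first exact: (L2_subset mI mUo UI).
  apply: (@le_lt_trans _ _ B); first exact: Rintegral_sqr_subset.
  by apply: lt_le_trans Bdl _; rewrite ge_min lexx.
have [y Vy uy] : exists2 y, V y & `|u y - psi (s y)| < e.
  apply: (@exists_small _ _ _ m) => //; first exact: (L2_subset mI mVo VI).
  apply: (@le_lt_trans _ _ B); first exact: Rintegral_sqr_subset.
  by apply: lt_le_trans Bdl _; rewrite !ge_min lexx orbT.
have [Ix Iy] := (UI _ Ux, VI _ Vy).
move: Ux Vy; rewrite /U /V /= !in_itv/= => /andP[ax xa'] /andP[b'y yb].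
have xy : x < y by apply: (lt_trans xa'); exact: le_lt_trans a'b' b'y.
have [uax sax] : `|u a - u x| < e /\ `|s a - s x| < c1.
  apply: ha; rewrite /ball/= distrC gtr0_norm ?subr_gt0// ltrBlDl.
  by apply: lt_le_trans xa' _; rewrite ge_min lexx.
have [uby sby] : `|u b - u y| < e /\ `|s b - s y| < c1.
  apply: hb; rewrite /ball/= gtr0_norm ?subr_gt0// ltrBlDl -ltrBlDr.
  by apply: le_lt_trans b'y; rewrite le_max lexx.
have iw := scale_domain_integrable Ia Ib (ltW ab) hw.
have Wsplit : W = \int[ds]_(z in `]a, x]) w z + (\int[ds]_(z in `]x, y]) w z + \int[ds]_(z in `]y, b]) w z).
  rewrite /W (Rintegral_oc_split (ltW ax) _ iw) ?(ltW (lt_trans xy yb))//; congr (_ + _).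
  apply: Rintegral_oc_split => //; rewrite ?(ltW xy) ?(ltW yb)//.
  exact: (scale_domain_integrable Ix Ib (ltW (lt_trans xy yb)) hw).
have c1M : M * c1 <= e ^+ 2.
  by rewrite /c1 mulrA ler_pdivrMr// mulrC ler_wpM2l ?sqr_ge0// lerDl.
have W1 : `|\int[ds]_(z in `]a, x]) w z| <= e.
  apply: (abs_le_sqr (ltW e0)); apply: le_trans (integral_bound Ia Ix (ltW ax) hw (lexx _)) _.
  apply: le_trans c1M; apply: ler_wpM2l => //; apply: ltW; apply: le_lt_trans sax.
  by rewrite distrC ler_norm.
have W3 : `|\int[ds]_(z in `]y, b]) w z| <= e.
  apply: (abs_le_sqr (ltW e0)); apply: le_trans (integral_bound Iy Ib (ltW yb) hw (lexx _)) _.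
  apply: le_trans c1M; apply: ler_wpM2l => //; apply: ltW; apply: le_lt_trans sby.
  exact: ler_norm.
have W2 : `|\int[ds]_(z in `]x, y]) w z - (psi (s y) - psi (s x))| <= e.
  apply: (abs_le_sqr (ltW e0)).
  have <- := FTC_scale xy (scale_mono_on oI smono Ix Iy) (scale_within oI scont Ix Iy)
    (stieltjes_seg Ix Iy) (fun z : R => is_derive_smooth z spsi) cdpsi.
  rewrite -RintegralB//; last 2 first.
  - exact: (scale_domain_integrable Ix Iy (ltW xy) hw).
  - exact: (scale_domain_integrable Ix Iy (ltW xy) L2dpsi).
  apply: le_trans (integral_bound Ix Iy (ltW xy) L2e Adl) _.
  apply: (@le_trans _ _ (2 * dl * (s b - s a))).
    apply: ler_wpM2l; first by rewrite mulr_ge0// ltW.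
    by apply: lerB; rewrite (scale_le smono)// ltW.
  have : dl <= e ^+ 2 / (2 * (s b - s a)) by rewrite !ge_min lexx !orbT.
  by rewrite ler_pdivlMr ?mulr_gt0// mulrA [dl * 2]mulrC.
rewrite Wsplit.
set w1 := \int[ds]_(z in `]a, x]) w z in W1 *; set w2 := \int[ds]_(z in `]x, y]) w z in W2 *.
set w3 := \int[ds]_(z in `]y, b]) w z in W3 *.
rewrite (_ : _ - _ = (u b - u y) + (u y - psi (s y)) - (w2 - (psi (s y) - psi (s x)))
   - (u x - psi (s x)) - (u a - u x) - w1 - w3); last by ring.
by apply: abs_sum7 => //; exact: ltW.
Qed.

(** * Smooth functions in the domain and the Lebesgue decomposition of the scale *)

Section lebesgue_decomposition.
Variables (kappa : {measure set R -> \bar R}) (g : R -> R) (N : set R).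
Hypothesis mg : measurable_fun I g.
Hypothesis g0 : forall x, I x -> 0 <= g x.
Hypothesis mN : measurable N.
Hypothesis N0 : lam N = 0%E.
Hypothesis kN : kappa (I `\` N) = 0%E.
Hypothesis dsE : forall a b A, I a -> I b -> a < b -> measurable A -> A `<=` `]a, b]%classic ->
  ds A = (\int[lam]_(x in A) (g x)%:E + kappa A)%E.

Let ds_off a b A : I a -> I b -> a < b -> measurable A -> A `<=` `]a, b]%classic `\` N ->
  ds A = (\int[lam]_(x in A) (g x)%:E)%E.
Proof.
move=> Ia Ib ab mA AD; rewrite (dsE Ia Ib ab)//; last by move=> x /AD[].
rewrite (_ : kappa A = 0%E) ?adde0//; apply/eqP; rewrite eq_le measure_ge0 andbT -kN.
apply: le_measure; rewrite ?inE//; first exact: measurableD.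
by move=> x /AD [xab nN]; split=> //; exact: (interval_oc oI Ia Ib).
Qed.

Lemma lam_oc_fin (a b : R) : a <= b -> (lam `]a, b]%classic < +oo :> \bar R)%E.
Proof. by move=> ab; rewrite lam_oc// ltry. Qed.

Lemma lam_integrable (f : R -> R) (c a b : R) : a <= b -> continuous f ->
  (forall x, `|f x| <= c) -> lam.-integrable `]a, b] (EFin \o f).
Proof.
move=> ab cf fc; apply: L2_integrable => //; first exact: lam_oc_fin.
apply: (@L2_bounded _ _ _ _ _ c) => //; first exact: lam_oc_fin.
by apply: measurable_funTS; exact: continuous_measurable_fun.
Qed.

Let mD a b : measurable (`]a, b]%classic `\` N : set R).
Proof. by apply: measurableD. Qed.

Let DI a b : I a -> I b -> (`]a, b]%classic `\` N : set R) `<=` I.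
Proof. by move=> Ia Ib x [xab _]; exact: (interval_oc oI Ia Ib). Qed.

Section derivative.
Variables (f w : R -> R).
Hypothesis Cf : Cc_smooth (V := R) I f.
Hypothesis hw : L2 ds I w.
Hypothesis ftc : forall a b, I a -> I b -> a < b -> f b - f a = \int[ds]_(x in `]a, b]) w x.

Let sf : smooth (V := R) f. Proof. by case: Cf. Qed.

Let cdf : continuous (f^`()%classic).
Proof. by apply: smooth_continuous; exact: smooth_derive1. Qed.

Let df_bounded : exists c, forall x, `|f^`()%classic x| <= c.
Proof.
have [a [b [Ia Ib ab f0]]] := Cc_smooth_interval oI Cf.
have [|c _ hc] := @bounded_supp R (f^`()%classic) (a - 1) (b + 1) cdf; last by exists c.
by move=> x h; apply: (derive1_supp f0); case: h => h; [left|right]; lra.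
Qed.

Let w_int a b : I a -> I b -> a < b -> ds.-integrable `]a, b] (EFin \o w).
Proof. by move=> Ia Ib ab; exact: scale_domain_integrable (ltW ab) hw. Qed.

Let df_int a b : a < b -> lam.-integrable `]a, b] (EFin \o f^`()%classic).
Proof.
by move=> ab; have [c hc] := df_bounded; exact: lam_integrable (ltW ab) cdf hc.
Qed.

(** Both sides are signed measures of the set, and both give an interval from [c] to [d] the value
    [f d - f c]. *)
Lemma derivative_measure_eq a b A : I a -> I b -> a < b -> measurable A ->
  A `<=` `]a, b]%classic -> \int[lam]_(x in A) f^`()%classic x = \int[ds]_(x in A) w x.
Proof.
move=> Ia Ib ab; apply: Rintegral_eq_oc; rewrite ?(ltW ab)//.
- exact: df_int.
- exact: w_int.
- move=> c d' ac; rewrite le_eqVlt => /orP[/eqP->|cd] db.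
    by rewrite set_itvoc0 !Rintegral_set0.
  have Iab := interval_seg oI Ia Ib.
  rewrite (FTC_lam (fun x : R => is_derive_smooth x sf) cdf (ltW cd)) ftc//.
    by apply: Iab; rewrite /= in_itv/= ac (ltW (lt_le_trans cd db)).
  by apply: Iab; rewrite /= in_itv/= db (ltW (le_lt_trans ac cd)).
Qed.

Lemma derivative_density a b : I a -> I b -> a < b ->
  {ae lam, forall x, `]a, b]%classic x -> f^`()%classic x = w x * g x}.
Proof.
move=> Ia Ib ab; have sub : (`]a, b]%classic `\` N : set R) `<=` `]a, b]%classic by move=> x [].
have mgD := measurable_funS mI (DI Ia Ib) mg.
have g0D x : (`]a, b]%classic `\` N) x -> 0 <= g x by move=> /(DI Ia Ib); exact: g0.
have dsD := fun A mA AD => ds_off Ia Ib ab (A := A) mA AD.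
have wD : ds.-integrable (`]a, b] `\` N) (EFin \o w) by exact: integrableS (w_int Ia Ib ab).
have h : {ae lam, forall x, (`]a, b]%classic `\` N) x -> f^`()%classic x = w x * g x}.
  apply: ae_eq_Rintegral => //.
  - exact: integrableS (df_int ab).
  - exact: (integrable_density (mD a b) mgD g0D dsD).
  - move=> E mE ED; rewrite -(Rdensity_change (mD a b) mgD g0D dsD)//.
      by apply: (derivative_measure_eq Ia Ib ab) => //; exact: subset_trans ED sub.
    apply: (measurable_funS (mD a b) ED); apply/measurable_EFinP.
    exact: (measurable_int ds).
have hN : {ae lam, forall x, ~ N x} by exists N; split=> // x /contrapT.
by apply: filterS2 h hN => x h1 nN xab; apply: h1.
Qed.

Lemma derivative_null a b : I a -> I b -> a < b ->
  {ae ds, forall x, (`]a, b]%classic `&` N) x -> w x = 0}.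
Proof.
move=> Ia Ib ab; have mDN : measurable (`]a, b]%classic `&` N : set R) by exact: measurableI.
apply: ae_eq_Rintegral => //.
- by apply: integrableS (w_int Ia Ib ab) => //; exact: subIsetl.
- exact: integrable0.
- move=> E mE ED; rewrite -(derivative_measure_eq Ia Ib ab)//; last by move=> x /ED[].
  rewrite (_ : \int[ds]_(x in E) (fun=> 0) x = 0); last by rewrite /Rintegral integral0.
  rewrite /Rintegral null_set_integral//.
    have /integrableP[mf _] := df_int ab.
    by apply: (measurable_funS (measurable_itv _) _ mf) => x /ED[].
  apply/eqP; rewrite eq_le measure_ge0 andbT -N0; apply: le_measure; rewrite ?inE//.
  by move=> x /ED[].
Qed.

Hypothesis gpos : forall a b, I a -> I b -> a < b ->
  {ae lam, forall x, `]a, b]%classic x -> g x != 0}.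

Let mw a b : I a -> I b -> measurable_fun `]a, b] w.
Proof. by move=> Ia Ib; apply: (measurable_funS mI (interval_oc oI Ia Ib)); case: hw. Qed.

(** Off [N], where [ds] has density [g], one has w^2 g = f'^2 / g. At zeros of [g] the quotient has
    the default value 0; by [gpos] they are negligible. *)
Lemma derivative_energy a b : I a -> I b -> a < b ->
  (\int[ds]_(x in `]a, b]) ((w x) ^+ 2)%:E =
   \int[lam]_(x in `]a, b]) ((f^`()%classic x) ^+ 2 / g x)%:E)%E.
Proof.
move=> Ia Ib ab; have mab := mw Ia Ib.
have mw2 : measurable_fun `]a, b] (fun x => ((w x) ^+ 2)%:E).
  by apply/measurable_EFinP; exact: measurable_funX.
have sub : (`]a, b]%classic `\` N : set R) `<=` `]a, b]%classic by move=> x [].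
transitivity (\int[ds]_(x in `]a, b] `\` N) ((w x) ^+ 2)%:E)%E.
  rewrite -{1}(setDUK (@subIsetl _ `]a, b]%classic N)) setDIr setDv set0U ge0_integral_setU//.
  - rewrite (_ : (\int[ds]_(x in `]a, b] `&` N) _ = 0)%E) ?add0e//.
    have mDN : measurable (`]a, b]%classic `&` N : set R) by exact: measurableI.
    rewrite (ae_eq_integral (cst 0%E)) ?integral0//.
    + by apply: (measurable_funS _ _ mw2) => //; exact: subIsetl.
    + by have := derivative_null Ia Ib ab; apply: filterS => x h /h ->; rewrite expr0n.
  - exact: measurableI.
  - by rewrite setUC setDE -setIUr setUCl setIT.
  - by move=> x _; rewrite lee_fin sqr_ge0.
  - apply/disj_set2P; rewrite setDE setIACA setICr setI0//.
have mgD := measurable_funS mI (DI Ia Ib) mg.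
have g0D x : (`]a, b]%classic `\` N) x -> 0 <= g x by move=> /(DI Ia Ib); exact: g0.
have dsD := fun A mA AD => ds_off Ia Ib ab (A := A) mA AD.
rewrite (density_change (mD a b) mgD g0D dsD)//; last 2 first.
- exact: (measurable_funS _ sub mw2).
- by move=> x _; rewrite lee_fin sqr_ge0.
have mgab := measurable_funS mI (interval_oc oI Ia Ib) mg.
have mdf : measurable_fun (`]a, b] : set R) (f^`()%classic).
  by apply: measurable_funTS; exact: continuous_measurable_fun.
have mf2 : measurable_fun `]a, b] (fun x => ((f^`()%classic x) ^+ 2 / g x)%:E).
  apply/measurable_EFinP; apply: measurable_funM; first exact: measurable_funX.
  by apply: (measurableT_comp _ mgab); exact: measurable_inv.
have f20 x : `]a, b]%classic x -> (0 <= ((f^`()%classic x) ^+ 2 / g x)%:E)%E.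
  by move=> xab; rewrite lee_fin mulr_ge0 ?sqr_ge0// invr_ge0 g0//; exact: (interval_oc oI Ia Ib).
rewrite (ge0_negligible_integral mN _ mf2 f20 N0)//.
apply: ge0_ae_eq_integral => //.
- apply: emeasurable_funM; first exact: (measurable_funS _ sub mw2).
  exact/measurable_EFinP.
- exact: (measurable_funS _ sub mf2).
- by move=> x Dx; rewrite mule_ge0 ?lee_fin ?sqr_ge0 ?g0D.
- by move=> x /sub; exact: f20.
- apply: filterS2 (derivative_density Ia Ib ab) (gpos Ia Ib ab) => x h1 h2 Dx.
  rewrite -EFinM; congr _%:E; rewrite (h1 (sub _ Dx)); have := h2 (sub _ Dx) => gx.
  by field.
Qed.

End derivative.

(** What the inclusion of the smooth functions in the domain gives in dimension one: [g] and its
    inverse are locally integrable. The middle condition prevents the default [0^-1 = 0] from hiding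
    zeros of [g]. *)
Definition good_density := forall a b, I a -> I b -> a < b ->
  [/\ (\int[lam]_(x in `]a, b]) (g x)%:E < +oo)%E,
      {ae lam, forall x, `]a, b]%classic x -> g x != 0} &
      (\int[lam]_(x in `]a, b]) (g x)^-1%:E < +oo)%E].

(** A test function with derivative 1 on ]a, b] settles two points: [1 = w x * g x] excludes zeros
    of [g], and the integral of [w ^+ 2] over ]a, b] is that of the inverse of [g]. *)
Lemma density_good :
  (forall f, Cc_smooth (V := R) I f -> exists2 w, L2 ds I w &
     forall a b, I a -> I b -> a < b -> f b - f a = \int[ds]_(x in `]a, b]) w x) ->
  good_density.
Proof.
move=> H.
have key a b : I a -> I b -> a < b -> exists f, Cc_smooth (V := R) I f /\
    forall x, `]a, b]%classic x -> f^`()%classic x = 1.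
  move=> Ia Ib ab.
  have [a1 [_ [Ia1 _ /andP[a1a _] _]]] := interval_nbhs oI Ia ltr01.
  have [_ [b1 [_ Ib1 /andP[_ bb1] _]]] := interval_nbhs oI Ib ltr01.
  have a12 : a1 < (a1 + a) / 2 by lra. have b12 : (b + b1) / 2 < b1 by lra.
  have [th [sth _ th0 th1]] := smooth_plateau a12 b12.
  exists (fun x => (1 * x + 0) * th x); split.
    apply: (@Cc_smooth_seg R I a1 b1) => //.
    - exact: (interval_seg oI).
    - apply: smoothM => //; apply: (@smooth_affine R 1 0 id).
      by apply: (@smooth_primitive R id (cst 1)) => //; exact: smooth_cst.
    - by move=> x /th0 ->; rewrite mulr0.
  move=> x /=; rewrite in_itv/= => /andP[ax xb].
  rewrite derive1E; transitivity ('D_1 (id : R -> R) x); last exact: derive_id.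
  apply: near_eq_derive.
  near=> y; rewrite th1 ?mulr1 ?mul1r ?addr0//; apply/andP; split; apply: ltW; near: y.
    by apply: lt_nbhsr; lra.
  by apply: lt_nbhsl; lra.
have gfin a b : I a -> I b -> a < b -> (\int[lam]_(x in `]a, b]) (g x)%:E < +oo)%E.
  move=> Ia Ib ab; apply: le_lt_trans (ds_oc_fin Ia Ib (ltW ab)).
  by rewrite (dsE Ia Ib ab)// leeDl.
have gpos a b : I a -> I b -> a < b -> {ae lam, forall x, `]a, b]%classic x -> g x != 0}.
  move=> Ia Ib ab; have [f [Cf f1]] := key a b Ia Ib ab; have [w hw ftc] := H f Cf.
  apply: filterS (derivative_density Cf hw ftc Ia Ib ab) => x h xab.
  by apply/eqP => gx; move: (h xab); rewrite f1// gx mulr0 => /eqP; rewrite oner_eq0.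
move=> a b Ia Ib ab; split; [exact: gfin|exact: gpos|].
have [f [Cf f1]] := key a b Ia Ib ab; have [w hw ftc] := H f Cf.
have := derivative_energy Cf hw ftc gpos Ia Ib ab.
rewrite [X in _ = X -> _](eq_integral (fun x => (g x)^-1%:E)); last first.
  by move=> x /set_mem xab; rewrite f1// expr1n mul1r.
by move=> <-; case: (L2_oc Ia Ib hw).
Unshelve. all: by end_near. Qed.

End lebesgue_decomposition.
End scaled.
End one_dimension.

Section scale_energy_theory.
Variables (R : realType) (I : set R) (s : R -> R) (ds m : {measure set R -> \bar R}).
Hypothesis oI : open_interval I.
Hypothesis smono : forall x y, I x -> I y -> x < y -> s x < s y.
Hypothesis scont : {within I, continuous s}.
Hypothesis hst : stieltjes I s ds.
Hypothesis hm : speed_measure I m.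
Let mI : measurable I. Proof. exact: measurable_interval oI. Qed.

Lemma ae_Rintegral (mu : {measure set R -> \bar R}) (D : set R) (f h : R -> R) : measurable D ->
  measurable_fun D f -> measurable_fun D h -> {ae mu, forall x, D x -> f x = h x} ->
  \int[mu]_(x in D) f x = \int[mu]_(x in D) h x.
Proof.
move=> mD mf mh fh; congr fine; apply: ae_eq_integral => //; try exact/measurable_EFinP.
by apply: filterS fh => x h1 Dx; rewrite h1.
Qed.

Lemma scale_energyE u w r : scale_derivative I s ds m u w -> scale_energy I s ds m u u r ->
  r = 2^-1 * \int[ds]_(x in I) (w x) ^+ 2.
Proof.
move=> hw [w1 [w2 [h1 h2 ->]]]; congr (_ * _).
have [mw _] := hw; have [mw1 _] := h1; have [mw2 _] := h2.
apply: ae_Rintegral => //; [exact: measurable_funM|exact: measurable_funX|].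
have := scale_derivative_unique oI smono scont hm h1 hw.
have := scale_derivative_unique oI smono scont hm h2 hw.
by apply: filterS2 => x e2 e1 Ix; rewrite e1// e2// expr2.
Qed.

Lemma scale_derivative_supp f w a b : scale_derivative I s ds m f w ->
  (forall x, I x -> {for x, continuous f}) -> I a -> I b ->
  (forall x, x <= a \/ b <= x -> f x = 0) ->
  {ae ds, forall x, I x -> x < a \/ b < x -> w x = 0}.
Proof.
move=> hw cf Ia Ib f0.
have [phi [cphi fphi dphi]] := scale_derivative_continuous oI smono scont hm hw cf.
apply: filterS dphi => x d Ix xab; move: (d Ix) => {}d.
suff h : \forall y \near s x, phi y = (cst 0 : R -> R) y.
  have d0 : is_derive (s x) 1 (cst 0 : R -> R) (w x) by exact: near_eq_is_derive h d.
  by move: (@derive_val _ _ _ _ _ _ _ d0) => <-; rewrite derive_cst.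
have near_supp : \forall y \near s x, y < s a \/ s b < y.
  case: xab => xab.
    by apply: filterS (lt_nbhsl _) => [y ya|]; [by left; exact: ya|rewrite (scale_lt smono)].
  by apply: filterS (lt_nbhsr _) => [y ya|]; [by right; exact: ya|rewrite (scale_lt smono)].
apply: filterS2 (near_scale_image oI smono scont Ix) near_supp => y [z Iz <-] zab /=.
rewrite -fphi// f0//; case: zab; rewrite (scale_lt smono)// => /ltW; by [left|right].
Qed.

Lemma scale_domain_smooth f : Cc_smooth (V := R) I f -> scale_domain I s ds m f ->
  exists w, [/\ L2 ds I w, scale_derivative I s ds m f w &
    forall a b, I a -> I b -> a < b -> f b - f a = \int[ds]_(x in `]a, b]) w x].
Proof.
move=> [sf _] [L2f [w [hw L2w app]]]; exists w; split => // a b Ia Ib ab.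
apply: (scale_domain_FTC oI smono scont hst hm _ L2f L2w app) => // x _.
exact: smooth_continuous.
Qed.

Section decomposed.
Variables (kappa : {measure set R -> \bar R}) (g : R -> R) (N : set R).
Hypothesis mg : measurable_fun I g.
Hypothesis g0 : forall x, I x -> 0 <= g x.
Hypothesis mN : measurable N.
Hypothesis N0 : lam N = 0%E.
Hypothesis kN : kappa (I `\` N) = 0%E.
Hypothesis dsE : forall a b A, I a -> I b -> a < b -> measurable A -> A `<=` `]a, b]%classic ->
  ds A = (\int[lam]_(x in A) (g x)%:E + kappa A)%E.
Hypothesis Cdom : Cc_smooth (V := R) I `<=` scale_domain I s ds m.

Lemma smooth_good_density : good_density I g.
Proof.
apply: (density_good oI hst mg g0 mN N0 kN dsE) => f Cf.
by have [w [L2w _ ftc]] := scale_domain_smooth Cf (Cdom Cf); exists w.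
Qed.

Definition smooth_energy (f : R -> R) := 2^-1 * \int[lam]_(x in I) ((f^`()%classic x) ^+ 2 / g x).

Lemma scale_energy_smooth f r : Cc_smooth (V := R) I f ->
  scale_energy I s ds m f f r -> r = smooth_energy f.
Proof.
move=> Cf hr; have [w [L2w hw ftc]] := scale_domain_smooth Cf (Cdom Cf).
have gpos a b : I a -> I b -> a < b -> {ae lam, forall x, `]a, b]%classic x -> g x != 0}.
  by move=> Ia Ib ab; have [] := smooth_good_density Ia Ib ab.
rewrite (scale_energyE hw hr) /smooth_energy; congr (_ * _).
have [a [b [Ia Ib ab f0]]] := Cc_smooth_interval oI Cf.
(* The interval is enlarged because the scale derivative is known to vanish strictly outside [a, b]
   only. *)
have [a' [_ [Ia' _ /andP[a'a _] _]]] := interval_nbhs oI Ia ltr01.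
have [_ [b' [_ Ib' /andP[_ bb'] _]]] := interval_nbhs oI Ib ltr01.
have ab' : a' < b' by lra.
have sub := interval_oc oI Ia' Ib'.
have cf x : I x -> {for x, continuous f} by move=> _; apply: smooth_continuous; case: Cf.
have out x : ~ `]a', b']%classic x -> x < a \/ b < x.
  move=> h; have [xa|ax] := ltP x a; first by left.
  right; rewrite ltNge; apply/negP => xb; apply: h => /=; rewrite in_itv/=.
  by apply/andP; split; lra.
rewrite (@Rintegral_supp _ _ _ lam I `]a', b']%classic)//; last first.
  by move=> x _ /out h; rewrite (derive1_supp f0 h) expr0n/= mul0r.
transitivity (\int[ds]_(x in I) ((w \_ `]a', b']) x) ^+ 2).
  have [mw _] := L2w.
  apply: ae_Rintegral => //; [exact: measurable_funX| |].
    apply: measurable_funX; apply: (measurable_restrict w _ mI).1 => //.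
    by apply: measurable_funS mw => // x [].
  apply: filterS (scale_derivative_supp hw cf Ia Ib f0) => x h Ix.
  rewrite patchE; case: ifPn => // xab; rewrite h//; apply: out.
  by move=> h'; rewrite mem_set// in xab.
rewrite (@Rintegral_supp _ _ _ ds I `]a', b']%classic)//; last first.
  by move=> x _ h; rewrite patchE memNset// expr0n.
have -> : \int[ds]_(x in `]a', b']) ((w \_ `]a', b']) x) ^+ 2 = \int[ds]_(x in `]a', b']) (w x) ^+ 2.
  by apply: eq_Rintegral => x xab; rewrite patchE xab.
rewrite /Rintegral; congr fine.
exact: (derivative_energy oI hst mg g0 mN N0 kN dsE Cf L2w ftc gpos Ia' Ib' ab').
Qed.

(* On [N] the scale derivative of a smooth function vanishes, while [ds] is
   there the singular part [kappa]. *)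
Lemma singular_energy_ge a b psi c f r : I a -> I b -> a < b ->
  Cc_smooth (V := R) (s @` I) psi ->
  (forall y, s a <= y <= s b -> psi^`()%classic y = 1) ->
  Cc_smooth (V := R) I f ->
  scale_derivative I s ds m (psi \o s) (psi^`()%classic \o s) ->
  scale_energy I s ds m (c *: (psi \o s) + (- 1) *: f) (c *: (psi \o s) + (- 1) *: f) r ->
  L2 ds I (psi^`()%classic \o s) ->
  c ^+ 2 * fine (kappa `]a, b]%classic) / 2 <= r.
Proof.
move=> Ia Ib ab Cpsi psi1 Cf hpsi hr L2psi.
have [w [L2w hw ftc]] := scale_domain_smooth Cf (Cdom Cf).
(* [scale_derivative_lin] produces combinations with last coefficient 1, so the opposite of [w] is
   written as such a combination. *)
have h0 := scale_derivative_lin (-1) hw (scale_derivative_lin (-1) hw hw).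
have hc := scale_derivative_lin c hpsi h0.
have e0 (v : R -> R) : (-1) *: v + ((-1) *: v + v) = (-1) *: v by rewrite scaleN1r addNr addr0.
rewrite !e0 in hc.
rewrite (scale_energyE hc hr) mulrC ler_pM2l ?invr_gt0//.
set D := `]a, b]%classic `&` N.
have mD : measurable D by exact: measurableI.
have DI : D `<=` I by move=> x [/(interval_oc oI Ia Ib)].
have L2h : L2 ds I (c *: (psi^`()%classic \o s) + (-1) *: w).
  by apply: L2_on_linear => //; rewrite -(e0 w); do 2!apply: L2_on_linear => //.
apply: le_trans (Rintegral_sqr_subset mI mD DI L2h).
have -> : \int[ds]_(x in D) ((c *: (psi^`()%classic \o s) + (-1) *: w) x) ^+ 2 =
          \int[ds]_(x in D) (cst (c ^+ 2) x).
  apply: ae_Rintegral => //.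
    by apply: measurable_funX; apply: measurable_funS L2h.1.
  apply: filterS (derivative_null oI hst mN N0 Cf L2w ftc Ia Ib ab) => x h Dx.
  rewrite fun_linE; have -> : ((-1) *: w) x = 0 by rewrite -[LHS]/(-1 * w x) h// mulr0.
  rewrite addr0 /= psi1 ?mulr1//.
  move: Dx => [/=]; rewrite in_itv/= => /andP[ax xb] _.
  have Ix : I x by apply: (interval_oc oI Ia Ib); rewrite /= in_itv/= ax.
  by rewrite !(scale_le smono)// xb ltW.
rewrite Rintegral_cst//.
suff -> : kappa `]a, b]%classic = ds D by [].
have lamD : lam D = 0%E.
  by apply/eqP; rewrite eq_le measure_ge0 andbT -N0; apply: le_measure; rewrite ?inE// => x [].
rewrite (dsE Ia Ib ab mD) => [|x []//].
rewrite (null_set_integral mD _ lamD) ?add0e; last first.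
  by apply/measurable_EFinP; apply: measurable_funS mg.
have -> : kappa `]a, b]%classic = (kappa D + kappa (`]a, b]%classic `\` N))%E.
  rewrite -measureU//; [by rewrite setUIDK|exact: measurableD|].
  by rewrite /D setDE setIACA setICr setI0.
have -> : kappa (`]a, b] `\` N) = 0%E.
  apply/eqP; rewrite eq_le measure_ge0 andbT -kN; apply: le_measure; rewrite ?inE; try exact: measurableD.
  by move=> x [/(interval_oc oI Ia Ib)].
by rewrite adde0.
Qed.

End decomposed.
End scale_energy_theory.

(** * Scale derivatives obtained from integral identities *)

Section interval_cover.
Variables (R : realType) (I : set R).
Hypothesis oI : open_interval I.

Lemma interval_cover : exists a b : nat -> R,
  (forall k, [/\ I (a k), I (b k) & a k < b k]) /\
  forall x, I x -> exists k, a k < x < b k.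
Proof.
have [_ _ [x0 Ix0]] := oI.
have [a0 [b0 [Ia0 Ib0 /andP[ax0 xb0] _]]] := interval_nbhs oI Ix0 ltr01.
have ab0 := lt_trans ax0 xb0.
(* Pairs of rationals are enumerated; codes that give no segment in [I] fall back on the fixed pair
   [a0], [b0]. *)
pose good (p : rat * rat) := [/\ I (ratr p.1), I (ratr p.2) & ratr p.1 < ratr p.2 :> R].
pose pt (k : nat) : rat * rat := odflt (0, 0) (unpickle k).
exists (fun k => if pselect (good (pt k)) then ratr (pt k).1 else a0).
exists (fun k => if pselect (good (pt k)) then ratr (pt k).2 else b0).
split; first by move=> k /=; case: (pselect (good (pt k))) => h /=; [case: h|].
move=> x Ix; have [a [b [Ia Ib /andP[ax xb] _]]] := interval_nbhs oI Ix ltr01.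
have [p] := rat_in_itvoo ax; rewrite in_itv/= => /andP[ap px].
have [q] := rat_in_itvoo xb; rewrite in_itv/= => /andP[xq qb].
have sub := interval_seg oI Ia Ib.
have gpq : good (p, q).
  split => /=; last exact: lt_trans px xq.
    by apply: sub; rewrite /= in_itv/= (ltW ap) (ltW (lt_trans px xb)).
  by apply: sub; rewrite /= in_itv/= (ltW qb) (ltW (lt_trans ax xq)).
exists (pickle (p, q)); have -> : pt (pickle (p, q)) = (p, q) by rewrite /pt pickleK.
by case: (pselect (good (p, q))) => // _ /=; rewrite px xq.
Qed.

Lemma ae_interval (mu : {measure set R -> \bar R}) (P : R -> Prop) :
  (forall a b, I a -> I b -> a < b -> {ae mu, forall x, a < x < b -> P x}) ->
  {ae mu, forall x, I x -> P x}.
Proof.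
move=> h; have [a [b [abI cov]]] := interval_cover.
have : {ae mu, forall x k, a k < x < b k -> P x}.
  by apply/ae_foralln => k; have [Ia Ib ab] := abI k; exact: h.
by apply: filterS => x hx /cov[k]; exact: hx.
Qed.

End interval_cover.

Section lebesgue_derivative.
Variable R : realType.

(** Lebesgue's differentiation theorem for [h] extended by 0 to the line; between [a] and [b], [phi]
    is its primitive plus the constant [phi a]. *)
Lemma ae_is_derive (a b : R) (phi h : R -> R) : a < b ->
  lam.-integrable `]a, b] (EFin \o h) ->
  (forall c d, a <= c -> c <= d -> d <= b -> phi d - phi c = \int[lam]_(x in `]c, d]) h x) ->
  {ae lam, forall y, a < y < b -> is_derive y 1 phi (h y)}.
Proof.
move=> ab hi hphi; set h' := h \_ `]a, b]%classic.
have hi' : (@lebesgue_measure R).-integrable setT (EFin \o h').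
  have : lam.-integrable setT (EFin \o h').
    by rewrite /h' -restrict_EFin; exact: (integrable_mkcond _ _).1.
  move=> /integrableP[mf f1]; apply/integrableP; split => //.
  rewrite -integral_lam//; exact: measurableT_comp.
have loc : locally_integrable setT h'.
  by apply: open_integrable_locally => //; exact: openT.
have ip y : (@lebesgue_measure R).-integrable `]-oo, y] (EFin \o h').
  exact: integrableS hi'.
have [B [mB B0 PB]] := @FTC1 R h' -oo%O ip loc.
exists B; split => // y /= ny; apply: PB => /= P; apply: ny => /andP[ay yb].
have [|d1 d2] := P; first by rewrite ?ltNyr.
set F := fun y => _ in d1 d2.
have hy : h' y = h y by rewrite /h' patchE mem_set//= in_itv/= ay ltW.
apply: (@near_eq_is_derive _ _ _ (fun z => F z + (phi a : R))).
  near=> z; have az : a <= z by apply: ltW; near: z; exact: lt_nbhsr.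
  have zb : z <= b by apply: ltW; near: z; exact: lt_nbhsl.
  have -> : F z = phi z - phi a; last by rewrite subrK.
  rewrite hphi// /F /Rintegral; congr fine.
  rewrite -integral_lam//; last by have /integrableP[] := ip z.
  rewrite (@integral_supp _ _ _ lam `]-oo, z]%classic `]a, z]%classic).
  - apply: eq_integral => x /set_mem /=; rewrite in_itv/= => /andP[ax xz].
    by rewrite /h' patchE mem_set//= in_itv/= ax (le_trans xz).
  - by move=> x /=; rewrite !in_itv/= => /andP[_ ->].
  - move=> x /=; rewrite !in_itv/= => xz; rewrite xz andbT => /negP ax.
    by rewrite /h' patchE memNset//= in_itv/= => /andP[ax' _]; rewrite ax' in ax.
rewrite -hy -[h' y]addr0; apply: is_deriveD.
by rewrite -d2 derive1E; exact/derivableP.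
Unshelve. all: by end_near. Qed.

(** The image of [mu] under [t] is Lebesgue measure, so the preimage of a Lebesgue null set is
    [mu]-null. *)
Lemma ae_scale (mu : {measure set R -> \bar R}) (a b : R) (t : R -> R) (P : R -> Prop) :
  a < b -> (forall x y, a <= x -> x < y -> y <= b -> t x < t y) ->
  {within `[a, b], continuous t} ->
  (forall c d, a <= c -> c <= d -> d <= b -> mu `]c, d]%classic = (t d - t c)%:E) ->
  {ae lam, forall y, t a < y < t b -> P y} -> {ae mu, forall x, a < x < b -> P (t x)}.
Proof.
move=> ab tmono tcont muE [B [mB B0 PB]].
set A := `]a, b]%classic `&` t @^-1` B.
have mA : measurable A by apply: (measurable_scale tcont).
exists A; split => //; last first.
  move=> x /= nx; have /andP[ax xb] : a < x < b by apply: contrapT => h; apply: nx => /h.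
  split; first by rewrite /= in_itv/= ax ltW.
  apply: PB => /= h; apply: nx => _; apply: h; apply/andP; split; apply: tmono => //; exact: ltW.
have -> : mu A = (\int[mu]_(x in `]a, b]) (\1_B (t x))%:E)%E.
  rewrite -[A in LHS]setTI setIC -integral_indic//.
  rewrite integral_mkcond [RHS]integral_mkcond; apply: eq_integral => x _.
  rewrite !patchE in_setT /A indicI /=; case: ifPn => xab.
    by rewrite indicE xab mul1r.
  by rewrite indicE (negbTE xab) mul0r.
rewrite (integral_scale_nonneg ab tmono tcont muE (nonneg_mfun_indic R mB)).
rewrite integral_indic//.
apply/eqP; rewrite eq_le measure_ge0 andbT -B0; apply: le_measure; rewrite ?inE//.
exact: measurableI.
Qed.

End lebesgue_derivative.

Section scale_inverse.
Variables (R : realType) (I : set R) (t : R -> R) (dt m : {measure set R -> \bar R}).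
Hypothesis oI : open_interval I.
Hypothesis tmono : forall x y, I x -> I y -> x < y -> t x < t y.
Hypothesis tcont : {within I, continuous t}.
Hypothesis hst : stieltjes I t dt.

Let tinv (y : R) : R := xget 0 [set x | I x /\ t x = y].

Let tinvK x : I x -> tinv (t x) = x.
Proof.
move=> Ix; rewrite /tinv; case: xgetP => [z _ [Iz tz]|/(_ x)]; last by case.
exact: (scale_inj tmono).
Qed.

Let tinv_continuous a b : I a -> I b -> a < b -> {within `[t a, t b], continuous tinv}.
Proof.
move=> Ia Ib ab; apply: segment_inc_surj_continuous.
  move=> y z; rewrite !in_itv/= => /(scale_image oI tmono tcont Ia Ib)[x [Ix _ <-]].
  move=> /(scale_image oI tmono tcont Ia Ib)[x' [Ix' _ <-]].
  by rewrite !tinvK// (scale_le tmono).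
rewrite !tinvK// => x /=; rewrite in_itv/= => /andP[ax xb].
have Ix : I x by apply: (interval_seg oI Ia Ib); rewrite /= in_itv/= ax.
exists (t x); last exact: tinvK.
by rewrite /= in_itv/= !(scale_le tmono)// ax.
Qed.

(** A converse of [scale_domain_FTC]. For phi = f o t^-1, the change of scale makes phi a Lebesgue
    primitive of w o t^-1; it is differentiable Lebesgue-almost everywhere, and [ae_scale] pulls
    this back to [dt]. The absolute continuity of phi comes from the integral of |w|. *)
Lemma scale_derivative_FTC f w : measurable_fun I w ->
  (forall a b, I a -> I b -> a < b -> dt.-integrable `]a, b] (EFin \o w)) ->
  (forall a b, I a -> I b -> a < b -> f b - f a = \int[dt]_(x in `]a, b]) w x) ->
  scale_derivative I t dt m f w.
Proof.
move=> mw iw ftc; split => //; exists (f \o tinv).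
have mI := measurable_interval oI.
have ftc' a b : I a -> I b -> a <= b -> f b - f a = \int[dt]_(x in `]a, b]) w x.
  move=> Ia Ib; rewrite le_eqVlt => /predU1P[->|]; last exact: ftc.
  by rewrite subrr set_itvoc0 Rintegral_set0.
have iw' a b : I a -> I b -> a <= b -> dt.-integrable `]a, b] (EFin \o w).
  move=> Ia Ib; rewrite le_eqVlt => /predU1P[->|]; last exact: iw.
  by rewrite set_itvoc0; exact: integrable_set0.
split; last 2 first.
- by apply: aeW => x Ix /=; rewrite tinvK.
- apply: (ae_interval oI) => a b Ia Ib ab.
  have sub x : a <= x -> x <= b -> I x.
    by move=> ax xb; apply: (interval_seg oI Ia Ib); rewrite /= in_itv/= ax.
  have tab : t a < t b by rewrite (scale_lt tmono).
  have hmono := scale_mono_on oI tmono Ia Ib.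
  have hcont := scale_within oI tcont Ia Ib.
  have hmu := stieltjes_seg oI hst Ia Ib.
  set h := (w \o tinv) \_ `]t a, t b]%classic.
  have hE x : a < x -> x <= b -> h (t x) = w x.
    move=> ax xb; rewrite /h patchE mem_set/= ?tinvK//; try exact: sub (ltW ax) xb.
    by rewrite in_itv/= (scale_lt tmono)// ?(scale_le tmono)// ?ax//; exact: sub (ltW ax) xb.
  have mh : measurable_fun setT h.
    apply: (measurable_restrictT _ _).1 => //.
    apply: (@measurable_comp _ _ _ _ _ _ I) => //.
    + move=> _ [y /= + <-]; rewrite in_itv/= => /andP[/ltW ay yb].
      have [|c [Ic _ <-]] := @scale_image R I t oI tmono tcont a b y Ia Ib; first by rewrite ay.
      by rewrite tinvK.
    + apply: (@measurable_funS _ _ _ _ `[t a, t b]%classic) => //.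
        by move=> x /=; rewrite !in_itv/= => /andP[/ltW-> ->].
      by apply: subspace_continuous_measurable_fun => //; exact: tinv_continuous.
  have ih : lam.-integrable `]t a, t b] (EFin \o h).
    apply/integrableP; split; first by apply/measurable_EFinP; exact: measurable_funS mh.
    have /= <- := integral_scale_nonneg ab hmono hcont hmu (f := fun y => `|h y|%:E) _; last first.
      by split => [y|]; [rewrite lee_fin|apply/measurable_EFinP; exact: measurableT_comp].
    have /integrableP[_ /=] := iw a b Ia Ib ab.
    rewrite (eq_integral (fun x => `|h (t x)|%:E))// => x /set_mem /=.
    by rewrite in_itv/= => /andP[ax xb]; rewrite hE.
  have key := @ae_is_derive R (t a) (t b) (f \o tinv) h tab ih.
  have {key} := ae_scale ab hmono hcont hmu (key _) => key.
  apply: filterS (key _) => [x hx xab|].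
    have /andP[ax xb] := xab; rewrite -(hE x)// ?ltW//; exact: hx.
  move=> y z ay yz zb.
  have [|c [Ic /andP[ac cb] cE]] := @scale_image R I t oI tmono tcont a b y Ia Ib.
    by rewrite ay (le_trans yz).
  have [|d [Id /andP[ad db] dE]] := @scale_image R I t oI tmono tcont a b z Ia Ib.
    by rewrite zb (le_trans ay).
  have cd : c <= d by rewrite -(scale_le tmono)// cE dE.
  rewrite -cE -dE /= !tinvK// ftc'//.
  have [cd0|dc] := ltP c d; last first.
    have -> : c = d by apply/eqP; rewrite eq_le cd.
    by rewrite !set_itvoc0 !Rintegral_set0.
  rewrite -(@Rintegral_scale R dt c d t)//.
  + apply: eq_Rintegral => x /set_mem /=; rewrite in_itv/= => /andP[cx xd].
    by rewrite hE//; [exact: le_lt_trans cx|exact: le_trans db].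
  + exact: (scale_mono_on oI tmono).
  + exact: (scale_within oI).
  + exact: (stieltjes_seg oI hst).
move=> al be albe sub.
have [|a Ia aE] := sub al; first by rewrite /= in_itv/= lexx.
have [|b Ib bE] := sub be; first by rewrite /= in_itv/= lexx andbT.
have ab : a <= b by rewrite -(scale_le tmono)// aE bE.
move=> e e0.
have /integrableP[_ fw] := iw' a b Ia Ib ab.
have [] := @abs_cont_integral R dt a b t f (fun x => `|w x|) e _ _ _ fw _ e0.
- exact: (stieltjes_seg oI hst).
- by apply: measurableT_comp => //; apply: measurable_funS mw => //; exact: (interval_oc oI).
- by move=> x _.
- move=> c d ac cd db.
  have Ic : I c by apply: (interval_seg oI Ia Ib); rewrite /= in_itv/= ac (le_trans cd).
  have Id : I d by apply: (interval_seg oI Ia Ib); rewrite /= in_itv/= db (le_trans ac).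
  rewrite ftc'// -abse_EFin EFin_Rintegral//; last exact: iw'.
  by apply: le_abse_integral => //; have /integrableP[] := iw' c d Ic Id cd.
move=> dl dl0 hdl; exists dl => // n x y hxy dis lt.
have pre z : al <= z -> z <= be -> exists c, [/\ I c, a <= c <= b & t c = z].
  by move=> az zb; apply: (scale_image oI tmono tcont Ia Ib); rewrite aE bE az.
have hx k : [/\ I (tinv (x k)), a <= tinv (x k) <= b & t (tinv (x k)) = x k].
  have [h1 [h2 h3]] := hxy k.
  by have [c [Ic cab <-]] := pre (x k) h1 (le_trans h2 h3); rewrite tinvK.
have hy k : [/\ I (tinv (y k)), a <= tinv (y k) <= b & t (tinv (y k)) = y k].
  have [h1 [h2 h3]] := hxy k.
  by have [c [Ic cab <-]] := pre (y k) (le_trans h1 h2) h3; rewrite tinvK.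
apply: hdl.
- move=> k; have [Ixk /andP[h1 h2] xE] := hx k; have [Iyk /andP[h3 h4] yE] := hy k.
  by do 2!split => //; rewrite -(scale_le tmono)// xE yE; case: (hxy k) => _ [].
- move=> k l kl; have [Ixk _ xE] := hx k; have [Iyk _ yE] := hy k.
  have [Ixl _ xE'] := hx l; have [Iyl _ yE'] := hy l.
  by case: (dis k l kl) => h; [left|right]; rewrite -(scale_le tmono)// ?xE ?yE ?xE' ?yE'.
- rewrite (eq_bigr (fun k => y k - x k))// => k _.
  by have [_ _ ->] := hx k; have [_ _ ->] := hy k.
Qed.

End scale_inverse.

(** * Smooth approximation for an absolutely continuous scale *)

Section smooth_approximation.
Variables (R : realType) (nu : {measure set R -> \bar R}) (a b : R) (t : R -> R).
Hypothesis ab : a < b.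
Hypothesis tmono : forall x y, a <= x -> x < y -> y <= b -> t x < t y.
Hypothesis tcont : {within `[a, b], continuous t}.
Hypothesis nufin : (nu `]a, b]%classic < +oo)%E.

Let tlt x y : a <= x -> x <= b -> a <= y -> y <= b -> (t x < t y) = (x < y).
Proof.
move=> ax xb ay yb; have [xy|yx] := ltP x y; first exact: tmono.
by apply/negbTE; rewrite -leNgt; move: yx; rewrite le_eqVlt => /predU1P[->//|/tmono h]; apply/ltW/h.
Qed.

Let tle x y : a <= x -> x <= b -> a <= y -> y <= b -> (t x <= t y) = (x <= y).
Proof. by move=> ax xb ay yb; rewrite !leNgt tlt. Qed.

Let supp (f : R -> R) := smooth (V := R) f /\ forall y, y <= t a \/ t b <= y -> f y = 0.

Let supp_lin c f h : supp f -> supp h -> supp (c *: f + h).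
Proof.
move=> [sf f0] [sh h0]; split; first exact: smooth_lin.
by move=> y hy; rewrite fun_linE f0// h0// mulr0 addr0.
Qed.

Local Notation D := (`]a, b[%classic : set R).
Let mD : measurable D. Proof. by []. Qed.
Let Dfin : (nu D < +oo)%E.
Proof.
apply: le_lt_trans nufin; apply: le_measure; rewrite ?inE//.
by move=> x /=; rewrite !in_itv/= => /andP[-> /ltW].
Qed.

Let mt : measurable_fun D t.
Proof.
apply: (@measurable_funS _ _ _ _ `]a, b]%classic) => //.
  by move=> x /=; rewrite !in_itv/= => /andP[-> /ltW].
exact: (measurable_scale tcont).
Qed.

Let msupp f : supp f -> measurable_fun D (f \o t).
Proof.
move=> [sf _]; apply: (measurable_comp (F := setT)) => //.
by apply: continuous_measurable_fun; exact: smooth_continuous.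
Qed.

Let mub := mrestr nu mD.

Let patch_lin c (f h : R -> R) : (c *: f + h) \_ D = c *: (f \_ D) + h \_ D.
Proof. by apply/funext => x; rewrite fun_linE !patchE; case: ifPn => // _; rewrite mulr0 addr0. Qed.

Let L2_mrestr (u : R -> R) : L2 mub setT (u \_ D) <-> L2 nu D u.
Proof. by split => /(L2_restrict nu mD u). Qed.

Let ip_mrestr (u : R -> R) : measurable_fun D u ->
  L2_ip mub (u \_ D) (u \_ D) = \int[nu]_(x in D) (u x) ^+ 2.
Proof. by move=> mu; rewrite /mub (L2_ip_restrict nu mD mu mu); under eq_Rintegral do rewrite -expr2. Qed.

Let L2supp (f : R -> R) : supp f -> L2 mub setT ((f \o t) \_ D).
Proof.
move=> hf; apply/L2_mrestr; have [sf f0] := hf.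
have [c c0 fc] := bounded_supp (@smooth_continuous _ _ _ sf) f0.
exact: (L2_bounded mD Dfin (msupp hf) (fun x _ => fc (t x))).
Qed.

(** With the zero form, [in_closure idT] is closure in L^2(nu), and the lemmas on closures become
    available for it. *)
Let idT : semigroup (L2_space mub) := sval (id_semigroup (L2_space mub)).

Let norm1_id u : norm1 idT u = (L2_ip mub u u)%:E.
Proof. by rewrite /norm1 form_id ?add0e//; exact: (svalP (id_semigroup (L2_space mub))). Qed.

Let C (f : R -> R) := exists2 h, supp h & f = (h \o t) \_ D.

Let CH f : C f -> L2_space mub f.
Proof. by move=> [h sh ->]; exact: L2supp. Qed.

Let CL c f h : C f -> C h -> C (c *: f + h).
Proof.
move=> [f' sf ->] [h' sh ->]; exists (c *: f' + h'); first exact: supp_lin.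
by rewrite -patch_lin.
Qed.

Let app u := L2 mub setT u /\ in_closure idT C u.

Let app_lin c u v : app u -> app v -> app (c *: u + v).
Proof.
move=> [hu au] [hv av]; split; first exact: (L2_linear c hu hv).
exact: (in_closure_lin CH CL).
Qed.

Let app_closed u : L2 mub setT u ->
  (forall e, 0 < e -> exists2 f, app f & L2_ip mub (u - f) (u - f) < e) -> app u.
Proof.
move=> hu h; split => //; apply: (in_closure_trans CH) => // e /h[f [hf cf] fe].
by exists f; split => //; rewrite norm1_id lte_fin.
Qed.

Let app_weak u v : L2 mub setT u -> L2 mub setT v -> (forall x, D x -> u x = v x) ->
  app u -> app v.
Proof.
move=> hu hv uv [_ cu]; split => //.
apply: (in_closure_weak_eq CH hu hv _ cu) => w hw.
apply: L2_ip_ae => //; last exact: aeW.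
exists (~` D); split; [exact: measurableC| |by move=> x /= h Dx; apply: h; exact: uv].
by rewrite /mub/= /mrestr setICl.
Qed.

Let app_indic p q : app \1_`]p, q[%classic.
Proof.
(* Clamping to [a, b] brings the end points into the range where [t] is monotone and changes nothing
   on ]a, b[. *)
set p1 := Num.min (Num.max p a) b; set q1 := Num.max (Num.min q b) a.
have ap1 : a <= p1 by rewrite /p1 le_min le_max lexx orbT (ltW ab).
have p1b : p1 <= b by rewrite /p1 ge_min lexx orbT.
have aq1 : a <= q1 by rewrite /q1 le_max lexx orbT.
have q1b : q1 <= b by rewrite /q1 ge_max ge_min lexx orbT (ltW ab).
have pE x : D x -> (p1 < x) = (p < x).
  by rewrite /= in_itv/= => /andP[ax xb]; rewrite /p1 gt_min gt_max ax andbT (ltNge b) (ltW xb) orbF.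
have qE x : D x -> (x < q1) = (x < q).
  by rewrite /= in_itv/= => /andP[ax xb]; rewrite /q1 lt_max lt_min xb andbT (ltNge x a) (ltW ax) orbF.
have DE x : D x -> [/\ a <= x, x <= b, (t p1 < t x) = (p < x) & (t x < t q1) = (x < q)].
  by move=> Dx; have := Dx; rewrite /= in_itv/= => /andP[/ltW ax /ltW xb]; rewrite !tlt// pE// qE.
have hth n : exists f, [/\ smooth (V := R) f, forall x, 0 <= f x <= 1,
    forall x, x <= t p1 \/ t q1 <= x -> f x = 0 &
    forall x, t p1 + n.+1%:R^-1 <= x <= t q1 - n.+1%:R^-1 -> f x = 1].
  by apply: smooth_plateau; rewrite ?ltrDl ?gtrBl invr_gt0.
have [th thP] := choice hth.
have sth n : supp (th n).
  have [s _ h0 _] := thP n; split => // y hy; apply: h0.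
  by case: hy => h; [left; rewrite (le_trans h)// tle// ltW|right; rewrite (le_trans _ h)// tle// ltW].
have [| | | |hu] := @L2_dominated _ _ R mub (fun n => (th n \o t) \_ D)
    ((\1_`]p, q[%classic : R -> R) \_ D) ((cst 1 : R -> R) \_ D).
- by move=> n; have [] := L2supp (sth n).
- move=> x; have [Dx|nDx] := pselect (D x); last first.
    by under eq_fun do rewrite patchE memNset//; rewrite patchE memNset//; exact: cvg_cst.
  rewrite patchE mem_set//; have [ax xb tp tq] := DE x Dx.
  under eq_fun do rewrite patchE mem_set//.
  have [pq|npq] := boolP (p < x < q).
    rewrite indicE mem_set/=; last by rewrite in_itv.
    apply: cvg_near_cst.
    move/andP: pq; rewrite -tp -tq => -[h1 h2].
    near=> n; have [_ _ _ ->//] := thP n; apply/andP; split.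
      by rewrite -lerBrDl ltW//; near: n; apply: near_infty_natSinv_lt (PosNum _); rewrite subr_gt0.
    by rewrite lerBrDl -lerBrDr ltW//; near: n; apply: near_infty_natSinv_lt (PosNum _); rewrite subr_gt0.
  rewrite indicE memNset/=; last by rewrite in_itv/=; exact/negP.
  under eq_fun => n.
    have [_ _ h0 _] := thP n; rewrite h0; last first.
      by move: npq; rewrite negb_and -tp -tq -!leNgt => /orP.
    over.
  exact: cvg_cst.
- by apply/L2_mrestr; apply: L2_cst.
- move=> n x; rewrite !patchE; case: ifPn => _; last by rewrite normr0.
  by have [_ h _ _] := thP n; have /andP[h1 h2] := h (t x); rewrite /= ger0_norm.
move=> h; have ap : app ((\1_`]p, q[%classic : R -> R) \_ D).
  split => // e e0; have [n hn] := h e e0; exists ((th n \o t) \_ D); first by exists (th n).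
  by rewrite norm1_id lte_fin.
apply: app_weak ap => //; last by move=> x Dx; rewrite patchE mem_set.
apply: (@L2_bounded _ _ _ _ _ 1) => //; first by rewrite /mub/= /mrestr setTI.
by move=> x _; rewrite indicE; case: (_ \in _); rewrite ?normr1 ?normr0.
Unshelve. all: by end_near. Qed.

(** Indicators of intervals are limits of plateau functions of [t], and [L2_dense] extends this to
    all of L^2. The support is kept between [t a] and [t b] so that, once its mean is corrected, the
    approximant has a compactly supported primitive. *)
Lemma scale_smooth_dense (u : R -> R) (e : R) : L2 nu D u -> 0 < e ->
  exists f, [/\ smooth (V := R) f, forall y, y <= t a \/ t b <= y -> f y = 0 &
    \int[nu]_(x in D) (u x - f (t x)) ^+ 2 < e].
Proof.
move=> hu e0; have : app (u \_ D).
  apply: (@L2_dense _ _ R mub [set A | exists p q, A = `]p, q[%classic]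
            (fun k => `](- k%:R), k%:R[%classic) app).
  - exact: RGenOpens.measurableE.
  - move=> _ _ [p [q ->]] [p' [q' ->]]; exists (Num.max p p'), (Num.min q q').
    by apply/seteqP; split => x /=; rewrite !in_itv/= gt_max lt_min; [move=> [/andP[-> ->] /andP[-> ->]]|move=> /andP[/andP[-> ->] /andP[-> ->]]].
  - by move=> k; exists (- k%:R), k%:R.
  - apply/nondecreasing_seqP => k; apply/subsetPset => x /=; rewrite !in_itv/= => /andP[h1 h2].
    have := ler_nat R k k.+1; rewrite leqnSn => kk.
    by apply/andP; split; lra.
  - apply/seteqP; split => // x _; have [k hk] := exists_nat_gt `|x|.
    by exists k => //=; rewrite in_itv/= -ltr_norml.
  - move=> _ k [p [q ->]].
    suff -> : `]p, q[ `&` `]- k%:R, k%:R[ = `]Num.max p (- k%:R), Num.min q k%:R[%classic :> set R by exact: app_indic.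
    by apply/seteqP; split => x /=; rewrite !in_itv/= gt_max lt_min; [move=> [/andP[-> ->] /andP[-> ->]]|move=> /andP[/andP[-> ->] /andP[-> ->]]].
  - by move=> v [].
  - by move=> c v w; exact: app_lin.
  - exact: app_closed.
  - exact/L2_mrestr.
move=> [_ /(_ e e0)[_ [f [sf f0] ->]]]; rewrite norm1_id lte_fin => h.
exists f; split => //; apply: le_lt_trans h.
have -> : u \_ D - (f \o t) \_ D = (fun x => u x - f (t x)) \_ D.
  by apply/funext => x; rewrite !fctE !patchE; case: ifPn; rewrite ?subr0.
rewrite ip_mrestr//; apply: measurable_funB => //; [by case: hu|exact: msupp].
Qed.

End smooth_approximation.

Section primitive_approximation.
Variables (R : realType) (nu mu : {measure set R -> \bar R}) (a b : R) (t rho : R -> R).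
Hypothesis ab : a < b.
Hypothesis tmono : forall x y, a <= x -> x < y -> y <= b -> t x < t y.
Hypothesis tcont : {within `[a, b], continuous t}.
Hypothesis muE : forall c d, a <= c -> c <= d -> d <= b -> mu `]c, d]%classic = (t d - t c)%:E.
Hypothesis nufin : (nu `]a, b]%classic < +oo)%E.
Hypothesis rho0 : forall x, `]a, b]%classic x -> 0 <= rho x.
Hypothesis L2rho : L2 nu `]a, b] rho.
Hypothesis rhoE : forall A, measurable A -> A `<=` `]a, b]%classic ->
  mu A = (\int[nu]_(x in A) (rho x)%:E)%E.

Local Notation D := (`]a, b]%classic : set R).
Let mD : measurable D. Proof. by []. Qed.
Let mt : measurable_fun D t. Proof. exact: (measurable_scale tcont). Qed.
Let mrho : measurable_fun D rho. Proof. by case: L2rho. Qed.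

Let mcomp (f : R -> R) : continuous f -> measurable_fun D (f \o t).
Proof.
by move=> cf; apply: (measurable_comp (F := setT)) => //; exact: continuous_measurable_fun.
Qed.

Let L2comp (f : R -> R) (c : R) : continuous f -> (forall x, `|f x| <= c) -> L2 nu D (f \o t).
Proof. by move=> cf fc; exact: (L2_bounded mD nufin (mcomp cf) (fun x _ => fc (t x))). Qed.

Let FTC (F f : R -> R) c : (forall x : R, is_derive x 1 F (f x)) -> continuous f ->
  a <= c -> c <= b -> \int[nu]_(x in `]a, c]) (f (t x) * rho x) = F (t c) - F (t a).
Proof.
move=> dF cf; rewrite le_eqVlt => /predU1P[<-|ac] cb.
  by rewrite set_itvoc0 Rintegral_set0 subrr.
have sub : `]a, c]%classic `<=` D.
  by move=> x /=; rewrite !in_itv/= => /andP[-> /le_trans ->].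
rewrite -(Rdensity_change mD mrho rho0 rhoE (E := `]a, c]%classic))//; last first.
  by apply: measurable_funS (mcomp cf).
apply: (@FTC_scale R mu a c t) => //.
- by move=> x y ax xy yc; apply: tmono => //; exact: le_trans cb.
- apply: continuous_subspaceW tcont => x /=; rewrite !in_itv/= => /andP[->] /=.
  by move=> /le_trans; apply.
- by move=> x y ax xy yc; apply: muE => //; exact: le_trans cb.
Qed.

(** One lemma for two approximations. With [nu = mu = dt], [rho = 1] and [t] the scale, it
    approximates a smooth function by functions psi o t; with [nu = lam / g], [mu = lam], [rho = g]
    and [t] the identity, it approximates a function psi o t by smooth ones. In both cases [om] is
    the derivative to be approximated, and [rho] converts integrals for [nu] into integrals for
    [mu], to which the fundamental theorem in the scale [t] applies. *)
Lemma primitive_approximation (om : R -> R) (e : R) : L2 nu D om -> om b = 0 ->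
  \int[nu]_(x in D) (om x * rho x) = 0 -> 0 < e ->
  exists psi, [/\ smooth (V := R) psi,
    forall y, y <= t a \/ t b <= y -> psi y = 0,
    forall y, y <= t a \/ t b <= y -> psi^`()%classic y = 0,
    \int[nu]_(x in D) (om x - psi^`()%classic (t x)) ^+ 2 < e &
    forall c, a <= c <= b ->
      (\int[nu]_(x in `]a, c]) (om x * rho x) - psi (t c)) ^+ 2 <= e].
Proof.
move=> hom omb mean0 e0.
have tab : t a < t b by apply: tmono.
have tab' : t a + (t b - t a) / 3 < t b - (t b - t a) / 3 by lra.
have [th [sth th01 tha thb]] := smooth_step tab'.
(* The derivative of a step is a bump of integral 1 in the scale; a multiple of it corrects the mean
   of the approximant. *)
have sbt := smooth_derive1 sth; set bt := th^`()%classic in sbt.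
have bt0 y : y <= (t a) \/ (t b) <= y -> bt y = 0.
  move=> hy; rewrite /bt derive1E.
  have [k hk] : exists k, \forall z \near y, th z = cst k z.
    case: hy => hy.
      exists 0; near=> z; apply: tha; apply: ltW; near: z; apply: lt_nbhsl; lra.
    exists 1; near=> z; apply: thb; apply: ltW; near: z; apply: lt_nbhsr; lra.
  by rewrite (near_eq_derive _ hk) derive_cst.
have cbt := @smooth_continuous _ _ _ sbt.
have [M M0 btM] := bounded_supp cbt bt0.
set P := \int[nu]_(x in D) (rho x) ^+ 2.
set V := \int[nu]_(x in D) (bt (t x)) ^+ 2.
have P0 : 0 <= P by exact: Rintegral_sqr_ge0.
have V0 : 0 <= V by exact: Rintegral_sqr_ge0.
(* The correction has [k ^+ 2 <= dl * P], so it costs at most [2 * dl * P * V], and the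
   approximation itself [2 * dl]. The factor [1 + P] is reserved for the bound on primitives, where
   Cauchy-Schwarz multiplies by [P]. *)
pose dl := e / (1 + P) / (2 + 2 * P * V).
have PV : 0 <= P * V by rewrite mulr_ge0.
have dl0 : 0 < dl by rewrite !divr_gt0//; lra.
have hom' : L2 nu `]a, b[ om.
  apply: L2_subset hom => // x /=; by rewrite !in_itv/= => /andP[-> /ltW].
have [eta [seta eta0 heta]] := scale_smooth_dense ab tmono tcont nufin hom' dl0.
have ceta := @smooth_continuous _ _ _ seta.
have [Me Me0 etaM] := bounded_supp ceta eta0.
have [ps [dps ps0]] := primitive ceta (fun x xa => eta0 x (or_introl xa)).
have sps := smooth_primitive dps seta.
set k := ps (t b).
pose psi : R -> R := (- k) *: th + ps.
have spsi : smooth (V := R) psi by exact: smooth_lin.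
have dpsi (x : R) : is_derive x 1 psi (- k * bt x + eta x).
  by apply: is_deriveD; apply: is_deriveZ; exact: is_derive_smooth.
have dpsiE x : psi^`()%classic x = - k * bt x + eta x by rewrite derive1E derive_val.
have cdpsi := @smooth_continuous _ _ _ (smooth_derive1 spsi).
have L2eta : L2 nu D (eta \o t) by exact: L2comp etaM.
have L2bt : L2 nu D (bt \o t) by exact: L2comp btM.
have L2om_eta : L2 nu D (-1 *: (eta \o t) + om) by exact: L2_on_linear.
have heta' : \int[nu]_(x in D) ((-1 *: (eta \o t) + om) x) ^+ 2 < dl.
  (* The approximation is made on the open interval; at the end point [b], which might carry mass,
     both functions vanish. *)
  rewrite (@Rintegral_supp _ _ _ nu D `]a, b[%classic).
  - apply: le_lt_trans heta; rewrite le_eqVlt; apply/orP; left; apply/eqP.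
    by apply: eq_Rintegral => x _; rewrite fun_linE mulN1r addrC.
  - by move=> x /=; rewrite !in_itv/= => /andP[-> /ltW].
  - move=> x /=; rewrite !in_itv/= => /andP[ax xb] /negP; rewrite ax/= -leNgt => bx.
    have -> : x = b by apply/eqP; rewrite eq_le xb.
    by rewrite fun_linE omb/= eta0; [rewrite mulr0 addr0 expr0n|right].
(* Since [om] has mean zero, [k] is minus the mean of [om - eta], and hence small. *)
have kE : k = - \int[nu]_(x in D) ((-1 *: (eta \o t) + om) x * rho x).
  have hh := FTC dps ceta (ltW ab) (lexx b); rewrite (ps0 (t a) (lexx _)) subr0 in hh.
  rewrite /k -hh -[LHS]subr0 -mean0.
  rewrite -RintegralB//; [|exact: L2_on_integrableM|exact: L2_on_integrableM].
  rewrite -[RHS]mulN1r -RintegralZl//; last exact: L2_on_integrableM.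
  by apply: eq_Rintegral => x _; rewrite fun_linE /=; ring.
have k2 : k ^+ 2 <= dl * P.
  rewrite kE sqrrN; apply: le_trans (Rintegral_cauchy_schwarz mD L2om_eta L2rho) _.
  by rewrite ler_wpM2r// ltW.
have L2d : L2 nu D (k *: (bt \o t) + (-1 *: (eta \o t) + om)) by exact: L2_on_linear.
have L2kbt : L2 nu D (k *: (bt \o t)).
  have := L2_on_linear (k - 1) mD L2bt L2bt; congr L2; apply/funext => x; rewrite fun_linE.
  by rewrite -[RHS]/(k * bt (t x)) /=; ring.
have dE x : om x - psi^`()%classic (t x) = (k *: (bt \o t) + (-1 *: (eta \o t) + om)) x.
  by rewrite dpsiE !fun_linE /=; ring.
have main : \int[nu]_(x in D) (om x - psi^`()%classic (t x)) ^+ 2 < e / (1 + P).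
  under eq_Rintegral do rewrite dE.
  have := Rintegral_sqrD mD L2kbt L2om_eta => h; apply: le_lt_trans h _.
  have -> : \int[nu]_(x in D) ((k *: (bt \o t)) x) ^+ 2 = k ^+ 2 * V.
    rewrite /V -RintegralZl//; first by apply: eq_Rintegral => x _; rewrite -exprMn.
    by have := L2_on_integrableM mD L2bt L2bt; apply: eq_integrable => // x _ /=; rewrite expr2.
  have h1 : k ^+ 2 * V <= dl * P * V by rewrite ler_wpM2r.
  have h2 : dl * (2 + 2 * P * V) = e / (1 + P) by rewrite /dl divfK// gt_eqF// -mulrA ltr_pwDl// mulr_ge0.
  lra.
have eP : e / (1 + P) <= e by rewrite ler_pdivrMr ?mulrDr ?mulr1 ?lerDl ?mulr_ge0 ?(ltW e0) ?ltr_pwDl.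
have psi0 y : y <= (t a) \/ (t b) <= y -> psi y = 0.
  case=> hy; rewrite /psi fun_linE.
    by rewrite tha ?ps0//; [rewrite mulr0 addr0|rewrite (le_trans hy)// lerDl divr_ge0// subr_ge0 ltW].
  rewrite thb; last by rewrite (le_trans _ hy)// gerBl divr_ge0// subr_ge0 ltW.
  have := FTC_lam dps ceta hy; rewrite (_ : \int[lam]_(x in _) eta x = 0).
    by rewrite -/k => h; lra.
  transitivity (\int[lam]_(x in `]t b, y]) (cst 0 x : R)); last by rewrite Rintegral_cst ?mul0r.
  apply: eq_Rintegral => x /set_mem /=.
  by rewrite in_itv/= => /andP[/ltW xb _]; rewrite eta0//; right.
exists psi; split => //.
- by move=> y hy; rewrite dpsiE bt0// eta0// mulr0 addr0.
- exact: lt_le_trans main eP.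
move=> c /andP[ac cb].
have sub : `]a, c]%classic `<=` D.
  by move=> x /=; rewrite !in_itv/= => /andP[-> /le_trans ->].
have mc : measurable (`]a, c]%classic : set R) by [].
have cpsi := FTC (fun x => is_derive_smooth x spsi) cdpsi ac cb.
rewrite [psi (t a)]psi0 ?subr0 in cpsi; last by left.
have L2d' : L2 nu `]a, c] (k *: (bt \o t) + (-1 *: (eta \o t) + om)) by exact: L2_subset L2d.
have L2rho' : L2 nu `]a, c] rho by exact: L2_subset L2rho.
have L2om' : L2 nu `]a, c] om by exact: L2_subset hom.
have -> : \int[nu]_(x in `]a, c]) (om x * rho x) - psi (t c) =
  \int[nu]_(x in `]a, c]) ((k *: (bt \o t) + (-1 *: (eta \o t) + om)) x * rho x).
  rewrite -cpsi -RintegralB//; [|exact: L2_on_integrableM|].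
    by apply: eq_Rintegral => x _; rewrite -dE; ring.
  suff L2p : L2 nu `]a, c] (psi^`()%classic \o t) by exact: (L2_on_integrableM mc L2p L2rho').
  have := L2_on_linear (-1) mc L2d' L2om'; congr L2; apply/funext => x.
  by rewrite fun_linE -dE /=; ring.
apply: le_trans (Rintegral_cauchy_schwarz mc L2d' L2rho') _.
apply: (@le_trans _ _ (e / (1 + P) * P)).
  apply: ler_pM; rewrite ?Rintegral_sqr_ge0//; last exact: (Rintegral_sqr_subset mD mc sub L2rho).
  apply: le_trans (Rintegral_sqr_subset mD mc sub L2d) _; apply: ltW.
  by under eq_Rintegral do rewrite -dE.
by rewrite mulrAC ler_pdivrMr ?ltr_pwDl// ler_pM2l// lerDr ler01.
Unshelve. all: by end_near. Qed.

End primitive_approximation.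

Section absolutely_continuous_scale.
Variables (R : realType) (I : set R) (t : R -> R) (dt m : {measure set R -> \bar R}) (g : R -> R).
Hypothesis oI : open_interval I.
Hypothesis tmono : forall x y, I x -> I y -> x < y -> t x < t y.
Hypothesis tcont : {within I, continuous t}.
Hypothesis hst : stieltjes I t dt.
Hypothesis hm : speed_measure I m.
Hypothesis mg : measurable_fun I g.
Hypothesis g0 : forall x, I x -> 0 <= g x.
Hypothesis gd : good_density I g.
Hypothesis dtE : forall a b A, I a -> I b -> a < b -> measurable A -> A `<=` `]a, b]%classic ->
  dt A = (\int[lam]_(x in A) (g x)%:E)%E.
Let mI : measurable I. Proof. exact: measurable_interval oI. Qed.

Lemma Rintegral_sqr_le_cst (u : R -> R) (D : set R) (e : R) : measurable D -> (m D < +oo)%E ->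
  measurable_fun D u -> (forall x, D x -> (u x) ^+ 2 <= e) ->
  \int[m]_(x in D) (u x) ^+ 2 <= e * fine (m D).
Proof.
move=> mD mDfin mu ue.
have L2u : L2 m D u.
  apply: (L2_bounded (c := Num.sqrt e)) => // x Dx.
  rewrite -sqrtr_sqr ler_wsqrtr//; exact: ue.
rewrite -(@Rintegral_cst _ _ _ m D mD e); apply: le_Rintegral => //.
  by have := L2_on_integrableM mD L2u L2u; apply: eq_integrable => // x _ /=; rewrite expr2.
exact: (L2_integrable mD mDfin (L2_cst e mD mDfin)).
Qed.

Section on_interval.
Variables a b : R.
Hypotheses (Ia : I a) (Ib : I b) (ab : a < b).
Local Notation D := (`]a, b]%classic : set R).
Let DI : D `<=` I. Proof. exact: (interval_oc oI). Qed.
Let mD : measurable D. Proof. by []. Qed.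
Let mgD : measurable_fun D g. Proof. exact: measurable_funS mg. Qed.
Let g0D x : D x -> 0 <= g x. Proof. by move=> /DI; exact: g0. Qed.
Let hmono := scale_mono_on oI tmono Ia Ib.
Let hcont := scale_within oI tcont Ia Ib.
Let hmu := stieltjes_seg oI hst Ia Ib.
Let gne : {ae lam, forall x, D x -> g x != 0}.
Proof. by have [] := gd Ia Ib ab. Qed.
Let dtED A : measurable A -> A `<=` D -> dt A = (\int[lam]_(x in A) (g x)%:E)%E.
Proof. exact: dtE. Qed.
Let mDfin : (m D < +oo)%E.
Proof.
apply: le_lt_trans (hm.1 `[a, b]%classic _ _).
- by apply: le_measure; rewrite ?inE// => x /=; rewrite !in_itv/= => /andP[/ltW -> ->].
- exact: segment_compact.
- exact: (interval_seg oI).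
Qed.
Let mt : measurable_fun D t. Proof. exact: (measurable_scale hcont). Qed.
Let mtcomp (f : R -> R) : continuous f -> measurable_fun D (fun x => f (t x)).
Proof.
by move=> cf; apply: (measurable_comp (F := setT)) => //; exact: continuous_measurable_fun.
Qed.
Let mginv : measurable_fun D (fun x => (g x)^-1).
Proof. by apply: (measurable_comp (F := setT)) => //; exact: measurable_inv. Qed.

Lemma smooth_sqr_density_fin (f : R -> R) c : measurable_fun D f -> (forall x, D x -> `|f x| <= c) ->
  (\int[lam]_(x in D) ((f x) ^+ 2 * (g x)^-1)%:E < +oo)%E.
Proof.
move=> mf fc; have [_ _ fin] := gd Ia Ib ab.
apply: (@le_lt_trans _ _ (\int[lam]_(x in D) ((c ^+ 2)%:E * (g x)^-1%:E))%E).
  apply: ge0_le_integral => //.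
  - by move=> x Dx; rewrite lee_fin mulr_ge0 ?sqr_ge0// invr_ge0 g0D.
  - by apply/measurable_EFinP; apply: measurable_funM => //; exact: measurable_funX.
  - by apply/measurable_EFinP; apply: measurable_funM.
  move=> x Dx; rewrite -EFinM lee_fin ler_wpM2r ?invr_ge0 ?g0D//.
  by rewrite -[f x ^+ 2]real_normK ?num_real//; apply: lerXn2r; rewrite ?nnegrE ?fc// (le_trans _ (fc x Dx)).
rewrite ge0_integralZl//.
- by apply: lte_mul_pinfty; rewrite ?lee_fin ?sqr_ge0.
- exact/measurable_EFinP.
- by move=> x Dx; rewrite lee_fin invr_ge0 g0D.
- by rewrite lee_fin sqr_ge0.
Qed.

Lemma smooth_over_density_L2 (f : R -> R) c : measurable_fun D f -> (forall x, D x -> `|f x| <= c) ->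
  L2 dt D (fun x => f x / g x).
Proof.
move=> mf fc; split; first exact: measurable_funM.
rewrite (density_change mD mgD g0D dtED)//; last 2 first.
- by apply/measurable_EFinP; apply: measurable_funX; exact: measurable_funM.
- by move=> x _; rewrite lee_fin sqr_ge0.
under eq_integral => x _.
  rewrite -EFinM (_ : (f x / g x) ^+ 2 * g x = (f x) ^+ 2 * (g x)^-1); last first.
    have [->|gx] := eqVneq (g x) 0; first by rewrite invr0 !mulr0.
    by field.
  over.
exact: (smooth_sqr_density_fin mf fc).
Qed.

Lemma smooth_over_density_FTC (f : R -> R) c : smooth (V := R) f ->
  (forall x, `|f^`()%classic x| <= c) ->
  \int[dt]_(x in D) (f^`()%classic x / g x) = f b - f a.
Proof.
move=> sf fc; have cf := @smooth_continuous _ _ _ (smooth_derive1 sf).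
have mf : measurable_fun D (f^`()%classic).
  by apply: measurable_funTS; exact: continuous_measurable_fun.
rewrite (Rdensity_change mD mgD g0D dtED)//; last exact: measurable_funM.
rewrite -(FTC_lam (fun x => is_derive_smooth x sf) cf (ltW ab)).
apply: ae_Rintegral => //; first by apply: measurable_funM => //; exact: measurable_funM.
by apply: filterS gne => x gx Dx; rewrite divfK// gx.
Qed.

Lemma smooth_composite_fin (f : R -> R) c : continuous f -> (forall x, `|f x| <= c) ->
  (\int[lam]_(x in D) ((f (t x)) ^+ 2 * g x)%:E < +oo)%E.
Proof.
move=> cf fc; have L2f : L2 dt D (fun x => f (t x)).
  by apply: (L2_bounded mD _ (mtcomp cf) (fun x _ => fc (t x))); exact: (ds_oc_fin hst Ia Ib (ltW ab)).
have [_] := L2f; rewrite (density_change mD mgD g0D dtED)//.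
- by apply/measurable_EFinP; apply: measurable_funX; exact: mtcomp.
- by move=> x _; rewrite lee_fin sqr_ge0.
Qed.

Lemma composite_FTC (F f : R -> R) : (forall x : R, is_derive x 1 F (f x)) -> continuous f ->
  \int[lam]_(x in D) (f (t x) * g x) = F (t b) - F (t a).
Proof.
move=> dF cf; rewrite -(FTC_scale ab hmono hcont hmu dF cf).
by rewrite (Rdensity_change mD mgD g0D dtED)//; exact: mtcomp.
Qed.

Lemma speed_fin : (m D < +oo)%E. Proof. exact: mDfin. Qed.

Lemma measurable_scale_comp (f : R -> R) : continuous f -> measurable_fun D (fun x => f (t x)).
Proof. exact: mtcomp. Qed.

(** This is lam / g. The energy of a smooth function is half the squared norm of its derivative in
    the corresponding L^2, which contains [g] because g^2 / g = g is integrable. *)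
Lemma density_inverse : exists nu : {measure set R -> \bar R},
  [/\ forall E (h : R -> R), measurable E -> E `<=` D -> measurable_fun E h ->
        \int[nu]_(x in E) h x = \int[lam]_(x in E) (h x / g x),
      forall h : R -> R, measurable_fun D h ->
        (\int[nu]_(x in D) ((h x) ^+ 2)%:E = \int[lam]_(x in D) ((h x) ^+ 2 / g x)%:E)%E,
      (nu D < +oo)%E,
      L2 nu D g &
      forall A, measurable A -> A `<=` D -> lam A = (\int[nu]_(x in A) (g x)%:E)%E].
Proof.
have gi0 x : D x -> (0 <= (g x)^-1%:E)%E by move=> Dx; rewrite lee_fin invr_ge0 g0D.
have mgi : measurable_fun D (fun x => (g x)^-1%:E) by exact/measurable_EFinP.
have [nu [nuA nuE]] := density_measureE lam mD mgi gi0.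
have nuD A : measurable A -> A `<=` D -> nu A = (\int[lam]_(x in A) (g x)^-1%:E)%E.
  by move=> mA AD; rewrite nuA// setIidl.
have [gfin _ gifin] := gd Ia Ib ab.
have sqrE (h : R -> R) : measurable_fun D h ->
    (\int[nu]_(x in D) ((h x) ^+ 2)%:E = \int[lam]_(x in D) ((h x) ^+ 2 / g x)%:E)%E.
  move=> mh; rewrite nuE//; last by move=> x _; rewrite lee_fin sqr_ge0.
  by apply/measurable_EFinP; exact: measurable_funX.
exists nu; split => //.
- move=> E h mE ED mh.
  by rewrite (Rdensity_change mD mginv _ nuD)// => x Dx; rewrite -lee_fin gi0.
- by rewrite nuD.
- split=> //; rewrite sqrE//.
  rewrite (eq_integral (fun x => (g x)%:E))// => x _; congr _%:E.
  by have [->|gx] := eqVneq (g x) 0; [rewrite expr0n mul0r|rewrite expr2 mulfK].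
move=> A mA AD; rewrite nuE//; last 2 first.
- by apply/measurable_EFinP; exact: measurable_funS mgD.
- by move=> x /AD /g0D; rewrite lee_fin.
rewrite -[LHS]mul1e -(integral_cst lam mA); apply: ae_eq_integral => //.
  apply: emeasurable_funM; [apply/measurable_EFinP; exact: measurable_funS mgD|exact: measurable_funS mgi].
by apply: filterS gne => x gx Ax; rewrite -EFinM divff// gx//; exact: AD.
Qed.

End on_interval.

Lemma smooth_scale_approx a b (f : R -> R) (e : R) : I a -> I b -> a < b -> smooth (V := R) f ->
  (exists c, forall x, `|f^`()%classic x| <= c) ->
  f a = 0 -> f b = 0 -> f^`()%classic b = 0 -> 0 < e ->
  exists psi, [/\ smooth (V := R) psi,
    forall y, y <= t a \/ t b <= y -> psi y = 0,
    forall y, y <= t a \/ t b <= y -> psi^`()%classic y = 0,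
    \int[dt]_(x in `]a, b]) (f^`()%classic x / g x - psi^`()%classic (t x)) ^+ 2 < e &
    \int[m]_(x in `]a, b]) (f x - psi (t x)) ^+ 2 < e].
Proof.
move=> Ia Ib ab sf [c fc] fa fb dfb e0.
have mD : measurable (`]a, b]%classic : set R) by [].
have DI := interval_oc oI Ia Ib.
have mf : measurable_fun `]a, b] (f^`()%classic).
  by apply: measurable_funTS; apply: continuous_measurable_fun; exact/smooth_continuous/smooth_derive1.
have hom := smooth_over_density_L2 Ia Ib ab mf (fun x _ => fc x).
have mfin := speed_fin Ia Ib.
have M0 : 0 <= fine (m `]a, b]%classic) by exact: fine_ge0.
set M := fine _ in M0.
have dfin := ds_oc_fin hst Ia Ib (ltW ab).
have e1 : 0 < e / (1 + M) by rewrite divr_gt0// ltr_pwDl.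
have FTC c' : I c' -> a < c' -> \int[dt]_(x in `]a, c']) (f^`()%classic x / g x * 1) = f c'.
  move=> Ic ac; under eq_Rintegral do rewrite mulr1.
  by rewrite (smooth_over_density_FTC Ia Ic ac sf fc) fa subr0.
have [|||psi [h1 h2 h3 h4 h5]] := @primitive_approximation R dt dt a b t (cst 1) ab
  (scale_mono_on oI tmono Ia Ib) (scale_within oI tcont Ia Ib) (stieltjes_seg oI hst Ia Ib)
  dfin (fun _ _ => ler01) (L2_cst 1 mD dfin) _ _ (e / (1 + M)) hom _ _ e1.
- by move=> A mA AD; rewrite -[LHS]mul1e -(integral_cst dt mA).
- by rewrite dfb mul0r.
- by rewrite FTC.
exists psi; split => //.
  by apply: lt_le_trans h4 _; rewrite ler_pdivrMr ?ltr_pwDl// mulrDr mulr1 lerDl mulr_ge0// ltW.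
apply: (@le_lt_trans _ _ (e / (1 + M) * M)).
  apply: Rintegral_sqr_le_cst => //.
    apply: measurable_funB; last by apply: measurable_scale_comp => //; exact: smooth_continuous.
    by apply: measurable_funTS; apply: continuous_measurable_fun; exact: smooth_continuous.
  move=> x Dx; have := Dx; rewrite /= in_itv/= => /andP[ax xb].
  by rewrite -(FTC x)//; [apply: h5; rewrite ltW|exact: DI].
by rewrite mulrAC ltr_pdivrMr ?ltr_pwDl// mulrDr mulr1 ltrDr.
Qed.

(** The segment is wider than the support, so that the derivative vanishes at its end points as
    well. *)
Lemma smooth_support f : Cc_smooth (V := R) I f -> exists a b,
  [/\ I a, I b, a < b, forall x, x <= a \/ b <= x -> f x = 0 &
      (forall x, x <= a \/ b <= x -> f^`()%classic x = 0) /\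
      exists c, forall x, `|f^`()%classic x| <= c].
Proof.
move=> Cf; have [a' [b' [Ia' Ib' ab' f0]]] := Cc_smooth_interval oI Cf.
have [a [_ [Ia _ /andP[aa' _] _]]] := interval_nbhs oI Ia' ltr01.
have [_ [b [_ Ib /andP[_ bb'] _]]] := interval_nbhs oI Ib' ltr01.
have df0 x : x <= a \/ b <= x -> f^`()%classic x = 0.
  by move=> h; apply: (derive1_supp f0); case: h => h; [left|right]; lra.
exists a, b; split => //; first lra.
  by move=> x h; apply: f0; case: h => h; [left|right]; lra.
split => //; have [|c _ fc] := bounded_supp _ df0; last by exists c.
by apply: smooth_continuous; apply: smooth_derive1; case: Cf.
Qed.

Lemma smooth_in_scale_domain f : Cc_smooth (V := R) I f ->
  [/\ L2 m I f, L2 dt I (fun x => f^`()%classic x / g x),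
      scale_derivative I t dt m f (fun x => f^`()%classic x / g x) &
      scale_domain I t dt m f].
Proof.
move=> Cf; have sf : smooth (V := R) f by case: Cf.
have [a [b [Ia Ib ab f0 [df0 [c fc]]]]] := smooth_support Cf.
have mD : measurable (`]a, b]%classic : set R) by [].
have DI := interval_oc oI Ia Ib.
have mdf : measurable_fun setT (f^`()%classic).
  by apply: continuous_measurable_fun; exact/smooth_continuous/smooth_derive1.
have mf : measurable_fun setT f by apply: continuous_measurable_fun; exact: smooth_continuous.
have out x : ~ `]a, b]%classic x -> x <= a \/ b <= x.
  move=> h; have [xa|ax] := lerP x a; first by left.
  by right; rewrite leNgt; apply/negP => xb; apply: h; rewrite /= in_itv/= ax ltW.
have mw : measurable_fun I (fun x => f^`()%classic x / g x).
  apply: measurable_funM; first exact: measurable_funTS.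
  by apply: (measurable_comp (F := setT)) => //; exact: measurable_inv.
have L2w : L2 dt I (fun x => f^`()%classic x / g x).
  apply: (L2_supp DI) => //; first by move=> x _ /out/df0 ->; rewrite mul0r.
  by apply: (smooth_over_density_L2 Ia Ib ab (c := c)) => //; exact: measurable_funTS.
have L2f : L2 m I f.
  apply: (L2_supp DI) => //; [exact: measurable_funTS|by move=> x _ /out/f0|].
  have [cf _ hcf] := bounded_supp (@smooth_continuous _ _ _ sf) f0.
  apply: (L2_bounded (c := cf)) => //; [exact: speed_fin|exact: measurable_funTS].
have hw : scale_derivative I t dt m f (fun x => f^`()%classic x / g x).
  apply: (@scale_derivative_FTC R I t dt m) => //.
    by move=> a' b' Ia' Ib' ab'; exact: (scale_domain_integrable oI hst Ia' Ib' (ltW ab') L2w).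
  by move=> a' b' Ia' Ib' ab'; rewrite (smooth_over_density_FTC Ia' Ib' ab' sf fc).
split => //; split => //; exists (fun x => f^`()%classic x / g x); split => // e e0.
have e2 : 0 < e / 2 by rewrite divr_gt0.
have [|||psi [h1 h2 h3 h4 h5]] := smooth_scale_approx Ia Ib ab sf (ex_intro _ c fc) _ _ _ e2.
- by apply: f0; left.
- by apply: f0; right.
- by apply: df0; right.
have tout x : I x -> ~ `]a, b]%classic x -> t x <= t a \/ t b <= t x.
  by move=> Ix /out; rewrite !(scale_le tmono).
exists psi; first by apply: Cc_smooth_seg h1 h2; exact: (scale_image_seg oI tmono tcont).
rewrite (@Rintegral_supp _ _ _ dt I `]a, b]%classic)//; last first.
  by move=> x Ix ho; rewrite (df0 x (out x ho)) mul0r (h3 _ (tout x Ix ho)) subrr expr0n.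
rewrite (@Rintegral_supp _ _ _ m I `]a, b]%classic)//; last first.
  by move=> x Ix ho; rewrite (f0 x (out x ho)) (h2 _ (tout x Ix ho)) subrr expr0n.
set A := \int[dt]_(x in _) _ in h4 *; set B := \int[m]_(x in _) _ in h5 *.
have A0 : 0 <= A by exact: Rintegral_sqr_ge0.
clearbody A B; lra.
Qed.

(** [u] is replaced by some psi o t, as membership in the domain allows, and psi o t by a smooth [f]
    by approximating its Lebesgue derivative psi'(t) g in L^2(lam / g). *)
Lemma scale_domain_smooth_dense u w e : L2 m I u -> L2 dt I w ->
  (forall eps, 0 < eps -> exists2 psi : R -> R,
        Cc_smooth (V := R) (t @` I) psi &
        2^-1 * (\int[dt]_(x in I) (w x - derive1 psi (t x)) ^+ 2) +
        \int[m]_(x in I) (u x - psi (t x)) ^+ 2 < eps) -> 0 < e ->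
  exists2 f, Cc_smooth (V := R) I f &
    2^-1 * (\int[dt]_(x in I) (w x - f^`()%classic x / g x) ^+ 2) +
        \int[m]_(x in I) (u x - f x) ^+ 2 < e.
Proof.
(* Splitting the two squared distances through psi o t doubles each piece; altogether five eighths
   of [e] are spent. *)
move=> L2u L2w app e0; have e8 : 0 < e / 8 by rewrite divr_gt0.
have [ps Cps happ] := app _ e8.
have sps : smooth (V := R) ps by case: Cps.
have [a' [b' [Ia' Ib' ab' ps0']]] := Cc_smooth_image oI tmono Cps.
have [a [_ [Ia _ /andP[aa' _] _]]] := interval_nbhs oI Ia' ltr01.
have [_ [b [_ Ib /andP[_ bb'] _]]] := interval_nbhs oI Ib' ltr01.
have ab : a < b by lra.
have taa' : t a < t a' by apply: tmono. have tbb' : t b' < t b by apply: tmono.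
have ps0 y : y <= t a \/ t b <= y -> ps y = 0.
  by move=> h; apply: ps0'; case: h => h; [left|right]; lra.
have dps0 y : y <= t a \/ t b <= y -> ps^`()%classic y = 0.
  by move=> h; apply: (derive1_supp ps0'); case: h => h; [left|right]; lra.
have cps := @smooth_continuous _ _ _ sps.
have sdps := smooth_derive1 sps; have cdps := @smooth_continuous _ _ _ sdps.
have [c c0 psc] := bounded_supp cdps dps0.
have mD : measurable (`]a, b]%classic : set R) by [].
have DI : `]a, b]%classic `<=` I := interval_oc oI Ia Ib.
have mgD : measurable_fun `]a, b]%classic g by exact: measurable_funS mg.
have [nu [nuR nuS nufin L2g lamE]] := density_inverse Ia Ib ab.
have mcomp := measurable_scale_comp Ia Ib.
pose om x := ps^`()%classic (t x) * g x.
have mom : measurable_fun `]a, b]%classic om by apply: measurable_funM => //; exact: mcomp.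
have L2om : L2 nu `]a, b]%classic om.
  split => //; rewrite nuS//.
  rewrite (eq_integral (fun x => ((ps^`()%classic (t x)) ^+ 2 * g x)%:E)).
    exact: (smooth_composite_fin Ia Ib ab cdps psc).
  move=> x _; congr _%:E; rewrite /om.
  by have [->|gx] := eqVneq (g x) 0; [rewrite !mulr0 expr0n mul0r|by rewrite exprMn (expr2 (g x)) -mulrA mulfK].
have gne : {ae lam, forall x, `]a, b]%classic x -> g x != 0} by have [] := gd Ia Ib ab.
have prim z : a <= z -> z <= b -> \int[nu]_(x in `]a, z]) (om x * g x) = ps (t z).
  rewrite le_eqVlt => /predU1P[<-|az] zb.
    by rewrite set_itvoc0 Rintegral_set0 ps0//; left.
  have Iz : I z by apply: DI; rewrite /= in_itv/= az.
  have sub : `]a, z]%classic `<=` `]a, b]%classic by move=> x /=; rewrite !in_itv/= => /andP[-> /le_trans ->].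
  have mom' : measurable_fun `]a, z] om by exact: measurable_funS mom.
  have mg' : measurable_fun `]a, z] g by exact: measurable_funS mgD.
  rewrite nuR//; last exact: measurable_funM.
  rewrite -[RHS]subr0 -[X in _ = _ - X](ps0 (t a) (or_introl (lexx _))).
  rewrite -(composite_FTC Ia Iz az (fun x => is_derive_smooth x sps) cdps).
  apply: ae_Rintegral => //.
    apply: measurable_funM; first exact: measurable_funM.
    by apply: (measurable_comp (F := setT)) => //; exact: measurable_inv.
  by apply: filterS gne => x gx /sub/gx gx'; rewrite mulfK.
have mfin := speed_fin Ia Ib.
set M := fine (m `]a, b]%classic).
have M0 : 0 <= M by exact: fine_ge0.
have e1 : 0 < e / 8 / (1 + M) by rewrite !divr_gt0// ltr_pwDl.
have [||||||f [sf f0 df0 dfe fe]] := @primitive_approximation R nu lam a b id g ab _ _ _ nufin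
   _ L2g lamE om (e / 8 / (1 + M)) L2om _ _ e1.
- by [].
- by apply: continuous_subspaceT => x; exact: cvg_id.
- by move=> c' d' _ cd _; exact: lam_oc.
- by move=> x /DI; exact: g0.
- by rewrite /om dps0 ?mul0r//; right.
- by rewrite prim ?(ltW ab)// ps0//; right.
have Cf : Cc_smooth (V := R) I f by apply: (@Cc_smooth_seg R I a b) => //; exact: (interval_seg oI).
have mdf : measurable_fun setT (f^`()%classic).
  by apply: continuous_measurable_fun; exact/smooth_continuous/smooth_derive1.
have mf : measurable_fun setT f by apply: continuous_measurable_fun; exact: smooth_continuous.
have out x : ~ `]a, b]%classic x -> x <= a \/ b <= x.
  move=> h; have [xa|ax] := lerP x a; first by left.
  by right; rewrite leNgt; apply/negP => xb; apply: h; rewrite /= in_itv/= ax ltW.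
have tout x : I x -> ~ `]a, b]%classic x -> t x <= t a \/ t b <= t x.
  by move=> Ix /out; rewrite !(scale_le tmono).
have [L2f L2df hf _] := smooth_in_scale_domain Cf.
have [L2ps L2dps] : L2 m I (ps \o t) /\ L2 dt I (ps^`()%classic \o t).
  by split; [have [] := L2_scale_comp oI tmono tcont hst hm cps Ia Ib ab ps0|
             have [] := L2_scale_comp oI tmono tcont hst hm cdps Ia Ib ab dps0].
have P1 : \int[dt]_(x in I) (ps^`()%classic (t x) - f^`()%classic x / g x) ^+ 2 < e / 8.
  rewrite (@Rintegral_supp _ _ _ dt I `]a, b]%classic)//; last first.
    by move=> x Ix ho; rewrite (df0 x (out x ho)) mul0r (dps0 _ (tout x Ix ho)) subrr expr0n.
  have mwD : measurable_fun `]a, b]%classic (fun x => ps^`()%classic (t x) - f^`()%classic x / g x).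
    apply: measurable_funB; first exact: mcomp.
    by apply: measurable_funS L2df.1.
  have g0D x : `]a, b]%classic x -> 0 <= g x by move=> /DI; exact: g0.
  have dtED A : measurable A -> A `<=` `]a, b]%classic -> dt A = (\int[lam]_(x in A) (g x)%:E)%E.
    exact: dtE.
  rewrite (Rdensity_change mD mgD g0D dtED)//; last exact: measurable_funX.
  apply: (@lt_le_trans _ _ (e / 8 / (1 + M))); last first.
    by rewrite ler_pdivrMr ?ltr_pwDl// mulrDr mulr1 lerDl mulr_ge0// ltW.
  apply: le_lt_trans dfe.
  have mo : measurable_fun `]a, b]%classic (fun x => om x - f^`()%classic x).
    by apply: measurable_funB => //; exact: measurable_funTS.
  rewrite nuR//; last exact: measurable_funX.
  rewrite le_eqVlt; apply/orP; left; apply/eqP; apply: ae_Rintegral => //.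
  - by apply: measurable_funM => //; exact: measurable_funX.
  - apply: measurable_funM; first exact: measurable_funX.
    by apply: (measurable_comp (F := setT)) => //; exact: measurable_inv.
  by apply: filterS gne => x gx /gx gx'; rewrite /om; field.
have P2 : \int[m]_(x in I) (ps (t x) - f x) ^+ 2 < e / 8.
  rewrite (@Rintegral_supp _ _ _ m I `]a, b]%classic)//; last first.
    by move=> x Ix ho; rewrite (f0 x (out x ho)) (ps0 _ (tout x Ix ho)) subrr expr0n.
  apply: (@le_lt_trans _ _ (e / 8 / (1 + M) * M)).
    apply: Rintegral_sqr_le_cst => //.
      by apply: measurable_funB; [exact: mcomp|exact: measurable_funTS].
    move=> x Dx; have := Dx; rewrite /= in_itv/= => /andP[ax xb].
    by rewrite -(prim x) ?(ltW ax)//; apply: fe; rewrite ltW.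
  by rewrite mulrAC ltr_pdivrMr ?ltr_pwDl// mulrDr mulr1 ltrDr.
exists f => //.
have L2B (mu : {measure set R -> \bar R}) (x y : R -> R) : L2 mu I x -> L2 mu I y -> L2 mu I (-1 *: y + x).
  by move=> hx hy; exact: L2_on_linear.
have Q1 := Rintegral_sqrD mI (L2B _ _ _ L2w L2dps) (L2B _ _ _ L2dps L2df).
have Q2 := Rintegral_sqrD mI (L2B _ _ _ L2u L2ps) (L2B _ _ _ L2ps L2f).
have Q1' : \int[dt]_(x in I) (w x - f^`()%classic x / g x) ^+ 2 <=
  2 * (\int[dt]_(x in I) (w x - ps^`()%classic (t x)) ^+ 2) +
  2 * \int[dt]_(x in I) (ps^`()%classic (t x) - f^`()%classic x / g x) ^+ 2.
  move: Q1; congr (_ <= 2 * _ + 2 * _); apply: eq_Rintegral => x _; rewrite !fun_linE /=; congr (_ ^+ 2); ring.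
have Q2' : \int[m]_(x in I) (u x - f x) ^+ 2 <=
  2 * (\int[m]_(x in I) (u x - ps (t x)) ^+ 2) + 2 * \int[m]_(x in I) (ps (t x) - f x) ^+ 2.
  move: Q2; congr (_ <= 2 * _ + 2 * _); apply: eq_Rintegral => x _; rewrite !fun_linE /=; congr (_ ^+ 2); ring.
have A0 := Rintegral_sqr_ge0 dt I (fun x => w x - ps^`()%classic (t x)).
have B0 := Rintegral_sqr_ge0 m I (fun x => u x - ps (t x)).
move: Q1' Q2' A0 B0 P1 P2 happ.
move: (\int[dt]_(x in I) (w x - f^`()%classic x / g x) ^+ 2) => A1.
move: (\int[m]_(x in I) (u x - f x) ^+ 2) => A2.
move: (\int[dt]_(x in I) (w x - ps^`()%classic (t x)) ^+ 2) => A3.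
move: (\int[m]_(x in I) (u x - ps (t x)) ^+ 2) => A4.
move: (\int[dt]_(x in I) _ ^+ 2) => A5.
move: (\int[m]_(x in I) _ ^+ 2) => A6.
lra.
Qed.

End absolutely_continuous_scale.

(** * Absolutely continuous scales charge no Lebesgue null set *)

Section singular_part.
Variable R : realType.

(** [abs_cont] speaks of finitely many intervals, whereas a small open set [U] around the null set
    may have infinitely many components. The cells of a grid that lie in [U] are finitely many and
    of small total length, so they have [ds]-mass at most [e]; as the mesh shrinks, each point of
    the null set is covered from some rank on. *)
Lemma abs_cont_null (s : R -> R) (ds : {measure set R -> \bar R}) (a b : R) (N : set R) : a < b ->
  (forall c d, a <= c -> c <= d -> d <= b -> ds `]c, d]%classic = (s d - s c)%:E) ->
  abs_cont a b s -> measurable N -> lam N = 0%E -> ds (`]a, b[%classic `&` N) = 0%E.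
Proof.
move=> ab dsE ac mN N0; set A := _ `&` N.
have mA : measurable A by exact: measurableI.
have A0 : lam A = 0%E.
  by apply/eqP; rewrite eq_le measure_ge0 andbT -N0; apply: le_measure; rewrite ?inE// => x [].
apply/eqP; rewrite eq_le measure_ge0 andbT; apply/lee_addgt0Pr => e e0; rewrite add0e.
have [dl dl0 hdl] := ac e e0.
have Afin : (@lebesgue_measure R A < +oo)%E by rewrite -[lebesgue_measure A]/(lam A) A0.
have [U [oU AU Usmall]] := lebesgue_regularity_outer mA Afin dl0.
have mU : measurable U by exact: open_measurable.
have lamU : (lam U < dl%:E)%E.
  have : (lam U <= lam A + lam (U `\` A))%E.
    by rewrite -[X in (lam X <= _)%E](setDUK AU); apply: measureU2 => //; exact: measurableD.
  by rewrite A0 add0e => /le_lt_trans; apply.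
pose h n : R := (b - a) / n.+1%:R.
pose c n k : R := a + k%:R * h n.
have h0 n : 0 < h n by rewrite divr_gt0// subr_gt0.
have cmono n k l : (k <= l)%N -> c n k <= c n l.
  by move=> kl; rewrite lerD2l ler_wpM2r ?ler_nat// ltW.
have cn n : c n n.+1 = b by rewrite /c /h mulrC divfK ?pnatr_eq0// subrKC.
have c0 n : c n 0%N = a by rewrite /c mul0r addr0.
pose cell n k := `]c n k, c n k.+1]%classic : set R.
pose B n k := if `[< cell n k `<=` U >] then cell n k else set0.
pose F n := \big[setU/set0]_(k < n.+1) B n k.
have mB n k : measurable (B n k) by rewrite /B; case: asboolP => // _; exact: measurable_itv.
have tB n : trivIset setT (B n).
  apply: ltn_trivIset => l k kl; rewrite /B.
  case: asboolP => _; last by rewrite set0I.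
  case: asboolP => _; last by rewrite setI0.
  apply/seteqP; split => // x; rewrite /cell => -[] /=; rewrite !in_itv/= => /andP[_ h2] /andP[h1 _].
  by have := lt_le_trans h1 h2; rewrite ltNge cmono.
have mF n : measurable (F n) by apply: bigsetU_measurable.
have FE (mu : {measure set R -> \bar R}) n : mu (F n) = (\sum_(k < n.+1) mu (B n k))%E.
  apply: (@measure_semi_additive_ord_I _ _ _ mu (B n)) => //; [exact: sub_trivIset (tB n)|exact: mF].
(* A cell not contained in [U] is given length zero, so that the same index set serves for all
   sums. *)
pose y n (k : 'I_n.+1) := if `[< cell n k `<=` U >] then c n k.+1 else c n k.
have inab n k : (k <= n.+1)%N -> a <= c n k /\ c n k <= b.
  by move=> kn; split; [rewrite -(c0 n)|rewrite -[leRHS](cn n)]; exact: cmono.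
have lamB n (k : 'I_n.+1) : lam (B n k) = (y n k - c n k)%:E.
  rewrite /B /y; case: asboolP => _; first by rewrite lam_oc// cmono.
  by rewrite measure0 subrr.
have dsB n (k : 'I_n.+1) : ds (B n k) = (s (y n k) - s (c n k))%:E.
  rewrite /B /y; case: asboolP => _; last by rewrite measure0 subrr.
  have [h1 _] := inab n k (ltnW (ltn_ord k)); have [_ h2] := inab n k.+1 (ltn_ord k).
  by rewrite dsE// cmono.
have FU n : F n `<=` U.
  by rewrite /F -bigcup_mkord => x [k _]; rewrite /B; case: asboolP => // hU; exact: hU.
have cy n (k : 'I_n.+1) : c n k <= y n k <= c n k.+1.
  by rewrite /y; case: asboolP => _; rewrite ?lexx cmono.
have dsF n : (ds (F n) <= e%:E)%E.
  rewrite FE; under eq_bigr do rewrite dsB.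
  rewrite sumEFin lee_fin ltW//.
  apply: le_lt_trans (hdl _ (fun k => c n k) (y n) _ _ _).
  - by apply: ler_sum => k _; exact: ler_norm.
  - move=> k; have [h1 _] := inab n k (ltnW (ltn_ord k)); have [_ h2] := inab n k.+1 (ltn_ord k).
    by have /andP[h3 h4] := cy n k; do 2!split => //; exact: le_trans h2.
  - move=> k l; rewrite -val_eqE neq_ltn => /orP[kl|lk]; [left|right].
      by have /andP[_ h4] := cy n k; apply: le_trans h4 _; exact: cmono.
    by have /andP[_ h4] := cy n l; apply: le_trans h4 _; exact: cmono.
  - rewrite -lte_fin -sumEFin; apply: le_lt_trans lamU.
    under eq_bigr do rewrite -lamB.
    by rewrite -FE; apply: le_measure; rewrite ?inE//; exact: FU.
(* The grids are not nested, so [F] need not increase; the intersections of its tails do. *)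
pose G n := \bigcap_(k in [set k | (n <= k)%N]) F k.
have mG n : measurable (G n) by apply: bigcap_measurableType => k _.
have ndG : nondecreasing_seq G.
  by move=> n k nk; apply/subsetPset => x Gx l /= kl; apply: Gx => /=; exact: leq_trans kl.
have mUG : measurable (\bigcup_n G n) by exact: bigcupT_measurable.
have AG : A `<=` \bigcup_n G n.
  move=> x Ax; have Ux := AU x Ax; have [] := Ax; rewrite /= in_itv/= => /andP[ax xb] _.
  have [r /= r0 rU] : nbhs_ball x U by apply/nbhs_ballP; exact: open_nbhs_nbhs.
  have [n0 hn0] := exists_nat_gt ((b - a) / r).
  exists n0 => // n /= n0n.
  have hr : h n < r.
    rewrite ltr_pdivrMr ?ltr0n// mulrC -ltr_pdivrMr//; apply: lt_le_trans hn0 _.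
    by rewrite ler_nat ltnW.
  have [k [kn /andP[k1 k2]]] : exists k, (k < n.+1)%N /\ c n k < x <= c n k.+1.
    have : x <= c n n.+1 by rewrite cn ltW.
    elim: (n.+1) => [|k IH]; first by rewrite c0 leNgt ax.
    have [/IH[l [lk hl]] _|ckx xck] := lerP x (c n k); last by exists k; rewrite ckx.
    by exists l; split => //; exact: ltnW.
  rewrite /F -bigcup_mkord; exists k => //; rewrite /B; case: asboolP => [_|[]].
    by rewrite /cell/= in_itv/= k1.
  move=> z; rewrite /cell/= in_itv/= => /andP[z1 z2]; apply: rU; rewrite /ball/=.
  have ck : c n k.+1 = c n k + h n by rewrite /c -natr1; ring.
  by rewrite ltr_norml; move: k1 k2 z1 z2 hr; rewrite ck; move: (c n k) (h n) => C H; clear; lra.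
apply: le_trans (le_measure ds _ _ AG) _; rewrite ?inE//.
apply: (@cvge_to_le _ _ _ _ _ _ _ (nondecreasing_cvg_mu mG mUG ndG)); near=> n => /=.
apply: le_trans (dsF n); apply: le_measure; rewrite ?inE// => x; apply => /=; exact: leqnn.
Unshelve. all: by end_near. Qed.

End singular_part.

Section process_domain.
Variables (R : realType) (dT : measure_display) (T : measurableType dT).
Variables (D : set T) (mD : measurable D) (X : process R D).
Hypothesis m1 : forall x : T, measurable [set x].
Variable m : {measure set T -> \bar R}.
Hypothesis sX : forall t, symmetric_kernel (mrestr m mD) (process_kernel X t).

Lemma patch_lin a (u v : T -> R) : (a *: u + v) \_ D = a *: (u \_ D) + v \_ D.
Proof. by apply/funext => x; rewrite fun_linE !patchE; case: ifPn => // _; rewrite mulr0 addr0. Qed.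

Lemma dirichlet_domain_lin a u v : dirichlet_domain X m u -> dirichlet_domain X m v ->
  dirichlet_domain X m (a *: u + v).
Proof.
move=> /(dirichlet_domainE m1 sX)[hu fu] /(dirichlet_domainE m1 sX)[hv fv].
apply/(dirichlet_domainE m1 sX); rewrite patch_lin; split; first exact: L2_linear.
exact: form_linear_lty.
Qed.

End process_domain.

Section density_scale.
Variables (R : realType) (I : set R) (t : R -> R) (g : R -> R).
Hypothesis oI : open_interval I.
Hypothesis mg : measurable_fun I g.
Hypothesis g0 : forall x, I x -> 0 <= g x.
Hypothesis tE : forall a b, I a -> I b -> a < b ->
  (t b - t a)%:E = (\int[lam]_(x in `]a, b]) (g x)%:E)%E.

Let mI : measurable I. Proof. exact: measurable_interval oI. Qed.

Let tE' a b : I a -> I b -> a <= b -> (t b - t a)%:E = (\int[lam]_(x in `]a, b]) (g x)%:E)%E.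
Proof.
move=> Ia Ib; rewrite le_eqVlt => /predU1P[->|]; last exact: tE.
by rewrite subrr set_itvoc0 integral_set0.
Qed.

Lemma density_loc_abs_cont : loc_abs_cont I t.
Proof.
move=> a b ab sub e e0.
have Isub x : a <= x -> x <= b -> I x by move=> ax xb; apply: sub; rewrite /= in_itv/= ax.
have Ia := Isub a (lexx _) ab; have Ib := Isub b ab (lexx _).
have goc := interval_oc oI Ia Ib.
apply: (@abs_cont_integral R lam a b id t g e) => //.
- by move=> c d _ cd _; exact: lam_oc.
- exact: measurable_funS mg.
- by move=> x /andP[/ltW ax xb]; apply: g0; exact: Isub.
- by rewrite -tE'// ltry.
move=> c d ac cd db; have Ic := Isub c ac (le_trans cd db); have Id := Isub d (le_trans ac cd) db.
rewrite -tE'// lee_fin ger0_norm// -lee_fin tE'//.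
by apply: integral_ge0 => x /(interval_oc oI Ic Id) Ix; rewrite lee_fin g0.
Qed.

Lemma density_scale_continuous : {within I, continuous t}.
Proof.
apply: continuous_in_subspaceT => x /set_mem Ix.
have [a [b [Ia Ib /andP[ax xb] _]]] := interval_nbhs oI Ix ltr01.
apply: (abs_cont_continuous _ ax xb); apply: density_loc_abs_cont; first by lra.
exact: (interval_seg oI).
Qed.

(** A nonnegative density with zero integral over an interval would vanish there almost everywhere,
    against [good_density]. *)
Lemma density_scale_mono : good_density I g -> forall x y, I x -> I y -> x < y -> t x < t y.
Proof.
move=> gd x y Ix Iy xy; rewrite -subr_gt0 -lte_fin tE//.
have sub := interval_oc oI Ix Iy.
rewrite lt0e integral_ge0 ?andbT; last by move=> z /sub Iz; rewrite lee_fin g0.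
apply/eqP => h.
have mgD : measurable_fun `]x, y] (EFin \o g) by apply/measurable_EFinP; exact: measurable_funS mg.
have g00 : {ae lam, forall z, `]x, y]%classic z -> (g z)%:E = 0%E}.
  apply/(ae_eq_integral_abs lam _ mgD) => //; rewrite -[RHS]h.
  by apply: eq_integral => z /set_mem/sub Iz /=; rewrite ger0_norm ?g0.
have [_ gne _] := gd x y Ix Iy xy.
have [B [mB B0 sB]] : {ae lam, forall z, ~ `]x, y]%classic z}.
  by apply: filterS2 gne g00 => z h1 h2 zxy; have := h1 zxy; have [->] := h2 zxy; rewrite eqxx.
have : (lam `]x, y]%classic <= lam B)%E.
  by apply: le_measure; rewrite ?inE// => z zxy; apply: sB => /=; apply.
have lam0 : (0 < lam `]x, y]%classic)%E by rewrite lam_oc ?ltW// lte_fin subr_gt0.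
by rewrite B0 => /(lt_le_trans lam0); rewrite ltxx.
Qed.

Lemma stieltjes_density (dt : {measure set R -> \bar R}) : stieltjes I t dt ->
  forall a b A, I a -> I b -> a < b -> measurable A -> A `<=` `]a, b]%classic ->
  dt A = (\int[lam]_(x in A) (g x)%:E)%E.
Proof.
move=> hst a b A Ia Ib ab mA AD; have sub := interval_oc oI Ia Ib.
have mgD : measurable_fun `]a, b] (EFin \o g) by apply/measurable_EFinP; exact: measurable_funS mg.
have [||nu [nuA _]] := density_measureE lam _ mgD; first by [].
  by move=> x /sub Ix; rewrite lee_fin g0.
rewrite (@measure_eq_oc R dt nu a b)//; last 2 first.
- exact: ltW.
- by rewrite hst ?ltry// ltW.
- by rewrite nuA// setIidl.
move=> c d ac cd db; rewrite (stieltjes_seg oI hst Ia Ib)// nuA// setIidl.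
  by apply: tE' => //; apply: (interval_seg oI Ia Ib); rewrite /= in_itv/= ?ac ?db ?(le_trans cd)// (le_trans ac).
by move=> x /=; rewrite !in_itv/= => /andP[cx xd]; rewrite (le_lt_trans ac cx) (le_trans xd db).
Qed.

End density_scale.

(** * The Dirichlet form of a one-dimensional minimal diffusion *)

Section diffusion.
Variables (R : realType) (I : set R) (s : R -> R) (m : {measure set R -> \bar R}) (X : process R I).
Hypothesis oI : open_interval I.
Hypothesis smono : forall x y, I x -> I y -> x < y -> s x < s y.
Hypothesis scont : {within I, continuous s}.
Hypothesis hm : speed_measure I m.
Hypothesis hX : minimal_diffusion s m X.
Let mI : measurable I := measurable_interval oI.

Lemma diffusion_kernel t : symmetric_kernel (mrestr m mI) (process_kernel X t).
Proof. by case: hX => _ sX _ f h; exact: symmetric_process_kernel. Qed.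

Lemma diffusion_lin a u v : dirichlet_domain X m u -> dirichlet_domain X m v ->
  dirichlet_domain X m (a *: u + v).
Proof. by apply: (dirichlet_domain_lin (@measurable_set1 R) diffusion_kernel). Qed.

(** The scale enters through its density alone, so this covers both the scale sbar and an absolutely
    continuous original scale; the energy of smooth functions is then the same for both. *)
Lemma ac_diffusion (g : R -> R) : measurable_fun I g -> (forall x, I x -> 0 <= g x) ->
  good_density I g ->
  (forall a b, I a -> I b -> a < b -> (s b - s a)%:E = (\int[lam]_(x in `]a, b]) (g x)%:E)%E) ->
  [/\ Cc_smooth (V := R) I `<=` dirichlet_domain X m,
      forall f, Cc_smooth (V := R) I f -> dirichlet_form X m f f = smooth_energy I g f &
      forall u e, dirichlet_domain X m u -> 0 < e ->
        exists2 f, Cc_smooth (V := R) I f & E1_norm2 X m (u \- f) < e].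
Proof.
move=> mg g0 gd sE; have [_ _ [ds [hst domE formE]]] := hX.
have dsE := stieltjes_density oI mg g0 sE hst.
have sub : Cc_smooth (V := R) I `<=` scale_domain I s ds m.
  by move=> f Cf; have [] := smooth_in_scale_domain oI smono scont hst hm mg g0 gd dsE Cf.
split; first by rewrite domE.
  move=> f Cf; have df : dirichlet_domain X m f by rewrite domE; exact: sub.
  (* The decomposition has no singular part here: [kappa] is zero and [N] is empty. *)
  apply: (@scale_energy_smooth R I s ds m oI smono scont hst hm mzero g set0 _ _ _ _ _ _ sub f) => //.
  - by move=> a b A Ia Ib ab mA AD; rewrite adde0; exact: (dsE a b).
  - exact: formE.
move=> u e du e0.
have := du; rewrite domE => -[L2u [w [hw L2w app]]].
have [f Cf fe] := scale_domain_smooth_dense oI smono scont hst hm mg g0 gd dsE L2u L2w app e0.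
exists f => //.
have df : dirichlet_domain X m f by rewrite domE; exact: sub.
have [_ _ hf _] := smooth_in_scale_domain oI smono scont hst hm mg g0 gd dsE Cf.
have uf : u \- f = -1 *: f + u by apply/funext => x; rewrite fun_linE mulN1r addrC.
have duf := diffusion_lin (-1) df du.
rewrite /E1_norm2 uf (scale_energyE oI smono scont hm (scale_derivative_lin (-1) hf hw) (formE _ _ duf duf)).
apply: le_lt_trans fe; rewrite le_eqVlt; apply/orP; left; apply/eqP.
congr (_ * _ + _); apply: eq_Rintegral => x _; rewrite fun_linE; congr (_ ^+ 2); ring.
Qed.

Lemma scale_comp_domain (ds : {measure set R -> \bar R}) psi : stieltjes I s ds ->
  Cc_smooth (V := R) (s @` I) psi ->
  [/\ scale_derivative I s ds m (psi \o s) (psi^`()%classic \o s), L2 ds I (psi^`()%classic \o s) &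
      scale_domain I s ds m (psi \o s)].
Proof.
move=> hst Cpsi; have sps : smooth (V := R) psi by case: Cpsi.
have [a' [b' [Ia' Ib' ab' ps0']]] := Cc_smooth_image oI smono Cpsi.
have [a [_ [Ia _ /andP[aa' _] _]]] := interval_nbhs oI Ia' ltr01.
have [_ [b [_ Ib /andP[_ bb'] _]]] := interval_nbhs oI Ib' ltr01.
have ab : a < b by lra.
have saa' : s a < s a' by apply: smono. have sbb' : s b' < s b by apply: smono.
have ps0 y : y <= s a \/ s b <= y -> psi y = 0.
  by move=> h; apply: ps0'; case: h => h; [left|right]; lra.
have dps0 y : y <= s a \/ s b <= y -> psi^`()%classic y = 0.
  by move=> h; apply: (derive1_supp ps0'); case: h => h; [left|right]; lra.
have cps := @smooth_continuous _ _ _ sps.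
have cdps := @smooth_continuous _ _ _ (smooth_derive1 sps).
have [L2ps _] := L2_scale_comp oI smono scont hst hm cps Ia Ib ab ps0.
have [_ L2dps] := L2_scale_comp oI smono scont hst hm cdps Ia Ib ab dps0.
have hps : scale_derivative I s ds m (psi \o s) (psi^`()%classic \o s).
  apply: (@scale_derivative_FTC R I s ds m) => //; first by case: L2dps.
    by move=> c d Ic Id cd; exact: (scale_domain_integrable oI hst Ic Id (ltW cd) L2dps).
  move=> c d Ic Id cd.
  by rewrite (FTC_scale cd (scale_mono_on oI smono Ic Id) (scale_within oI scont Ic Id)
    (stieltjes_seg oI hst Ic Id) (fun x => is_derive_smooth x sps) cdps).
split => //; split => //; exists (psi^`()%classic \o s); split => // e e0; exists psi => //.
under eq_Rintegral do rewrite subrr expr0n.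
under [X in _ + X]eq_Rintegral do rewrite subrr expr0n.
by rewrite !Rintegral_cst// !mul0r mulr0 addr0.
Qed.

Section lebesgue_decomposition.
Variables (e : R) (sbar : R -> R).
Hypothesis Ie : I e.
Hypothesis hac : ac_part I e s sbar.
Hypothesis Cdom : Cc_smooth (V := R) I `<=` dirichlet_domain X m.

Lemma smooth_bump_slope1 a b : I a -> I b -> a < b -> exists2 psi, Cc_smooth (V := R) (s @` I) psi &
  forall y, s a <= y <= s b -> psi^`()%classic y = 1.
Proof.
move=> Ia Ib ab.
have [a1 [_ [Ia1 _ /andP[a1a _] _]]] := interval_nbhs oI Ia ltr01.
have [_ [b1 [_ Ib1 /andP[_ bb1] _]]] := interval_nbhs oI Ib ltr01.
have sa : s a1 < s a by apply: smono. have sb : s b < s b1 by apply: smono.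
have a12 : s a1 < (s a1 + s a) / 2 by lra. have b12 : (s b + s b1) / 2 < s b1 by lra.
have [th [sth _ th0 th1]] := smooth_plateau a12 b12.
exists (fun x => (1 * x + 0) * th x).
  apply: (@Cc_smooth_seg R (s @` I) (s a1) (s b1)) => //.
  - exact: (scale_image_seg oI smono scont).
  - apply: smoothM => //; apply: (@smooth_affine R 1 0 id).
    by apply: (@smooth_primitive R id (cst 1)) => //; exact: smooth_cst.
  - by move=> x /th0 ->; rewrite mulr0.
move=> x /andP[ax xb].
rewrite derive1E; transitivity ('D_1 (id : R -> R) x); last exact: derive_id.
apply: near_eq_derive.
near=> y; rewrite th1 ?mulr1 ?mul1r ?addr0//; apply/andP; split; apply: ltW; near: y.
  by apply: lt_nbhsr; lra.
by apply: lt_nbhsl; lra.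
Unshelve. all: by end_near. Qed.

(** All that the product asks from dimension one. The lower bound in the last clause is uniform in
    [f] and quadratic in [c], since a section of a tensor is a multiple of [v] whose coefficient
    varies with the section. *)
Lemma ac_part_diffusion : exists g : R -> R,
  [/\ measurable_fun I g, forall x, I x -> 0 <= g x, good_density I g,
      forall f, Cc_smooth (V := R) I f -> dirichlet_form X m f f = smooth_energy I g f &
  [/\ forall a b, I a -> I b -> a < b -> (sbar b - sbar a)%:E = (\int[lam]_(x in `]a, b]) (g x)%:E)%E,
      scaling_function I e sbar,
      loc_abs_cont I s -> forall a b, I a -> I b -> a < b ->
        (s b - s a)%:E = (\int[lam]_(x in `]a, b]) (g x)%:E)%E &
      ~ loc_abs_cont I s -> exists v k, [/\ dirichlet_domain X m v, 0 < k & forall c f,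
        Cc_smooth (V := R) I f ->
        c ^+ 2 * k <= dirichlet_form X m (c *: v + (-1) *: f) (c *: v + (-1) *: f)]]].
Proof.
have [ds' [kappa [g [hst' [mg g0] [N [mN N0 kN]] ds'E sbarE]]]] := hac.
have [_ _ [ds [hst domE formE]]] := hX.
have dsE a b A : I a -> I b -> a < b -> measurable A -> A `<=` `]a, b]%classic ->
    ds A = (\int[lam]_(x in A) (g x)%:E + kappa A)%E.
  move=> Ia Ib ab mA AD; have sub := interval_oc oI Ia Ib.
  rewrite (@measure_eq_oc R ds ds' a b)//; last 2 first.
  - exact: ltW.
  - by rewrite hst ?ltry// ltW.
  - rewrite ds'E//; last exact: subset_trans AD sub.
    rewrite integral_lam//; apply/measurable_EFinP.
    by apply: measurable_funS mg => //; exact: subset_trans AD sub.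
  by move=> c d ac cd db; rewrite (stieltjes_seg oI hst Ia Ib)// (stieltjes_seg oI hst' Ia Ib).
have sub : Cc_smooth (V := R) I `<=` scale_domain I s ds m by rewrite -domE.
have N0' : lam N = 0%E by [].
have gd := smooth_good_density oI smono scont hst hm mg g0 mN N0' kN dsE sub.
have gfin a b : I a -> I b -> a <= b -> (\int[lam]_(x in `]a, b]) (g x)%:E < +oo)%E.
  move=> Ia Ib; rewrite le_eqVlt => /predU1P[->|ab]; first by rewrite set_itvoc0 integral_set0.
  by have [] := gd a b Ia Ib ab.
have gint a b : I a -> I b -> a <= b -> lam.-integrable `]a, b] (EFin \o g).
  move=> Ia Ib ab; have sab := interval_oc oI Ia Ib; apply/integrableP; split.
    by apply/measurable_EFinP; exact: measurable_funS mg.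
  apply: le_lt_trans (gfin a b Ia Ib ab); rewrite le_eqVlt; apply/orP; left; apply/eqP.
  by apply: eq_integral => x /set_mem/sab Ix /=; rewrite ger0_norm ?g0.
(* [signed_integral] uses closed intervals; a single point has no Lebesgue mass. *)
have seg a b : I a -> I b -> a <= b ->
    \int[lebesgue_measure]_(x in `[a, b]) g x = \int[lam]_(x in `]a, b]) g x.
  move=> Ia Ib ab; have mgs : measurable_fun `[a, b] (EFin \o g).
    apply/measurable_EFinP; apply: (@measurable_funS _ _ _ _ I) => //.
    exact: (interval_seg oI).
  rewrite /Rintegral -integral_itv_obnd_cbnd; last first.
    by apply: measurable_funS mgs => // x /=; rewrite !in_itv/= => /andP[/ltW-> ->].
  rewrite integral_lam//.
  by apply: measurable_funS mgs => // x /=; rewrite !in_itv/= => /andP[/ltW-> ->].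
have sbE x : I x -> sbar x = if e <= x then \int[lam]_(z in `]e, x]) g z else - \int[lam]_(z in `]x, e]) g z.
  move=> Ix; rewrite sbarE// /signed_integral; case: ifPn => [ex|]; first by rewrite seg.
  by rewrite -ltNge => /ltW xe; rewrite seg.
have split3 a c b : I a -> I b -> a <= c -> c <= b ->
    \int[lam]_(z in `]a, b]) g z = \int[lam]_(z in `]a, c]) g z + \int[lam]_(z in `]c, b]) g z.
  by move=> Ia Ib ac cb; apply: Rintegral_oc_split => //; apply: gint => //; exact: le_trans cb.
have tE a b : I a -> I b -> a < b -> (sbar b - sbar a)%:E = (\int[lam]_(x in `]a, b]) (g x)%:E)%E.
  move=> Ia Ib ab; rewrite -EFin_Rintegral//; last exact: gint (ltW ab).
  congr _%:E; rewrite !sbE//; case: ifPn => eb; case: ifPn => ea.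
  - by rewrite (split3 e a b)// ?(ltW ab)// addrC addKr.
  - by rewrite opprK addrC (split3 a e b)// ltW// ltNge.
  - by move: eb; rewrite (le_trans ea (ltW ab)).
  - by rewrite opprK addrC (split3 a b e)// ?(ltW ab)// ?addrK// ltW// ltNge.
exists g; split => //.
  move=> f Cf; have df := Cdom Cf.
  by apply: (scale_energy_smooth oI smono scont hst hm mg g0 mN N0' kN dsE sub Cf); exact: formE.
split => //.
- split => //.
  + by rewrite sbE// lexx set_itvoc0 Rintegral_set0.
  + exact: (density_scale_mono oI mg g0 tE gd).
  + exact: (density_scale_continuous oI mg g0 tE).
(* [abs_cont_null] concerns an open interval, so [b] is enclosed in a larger one. *)
- move=> ac a b Ia Ib ab; have [_ [b' [_ Ib' /andP[_ bb'] _]]] := interval_nbhs oI Ib ltr01.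
  have ab' := lt_trans ab bb'.
  suff k0 : kappa `]a, b]%classic = 0%E by rewrite -(hst a b Ia Ib (ltW ab)) (dsE a b)// k0 adde0.
  have dsN : ds (`]a, b'[%classic `&` N) = 0%E.
    apply: (@abs_cont_null R s ds a b' N) => //; first exact: (stieltjes_seg oI hst).
    by apply: ac; [exact: ltW|exact: (interval_seg oI)].
  apply/eqP; rewrite eq_le measure_ge0 andbT.
  have -> : kappa `]a, b]%classic = (kappa (`]a, b]%classic `&` N) + kappa (`]a, b]%classic `\` N))%E.
    rewrite -measureU//; [by rewrite setUIDK|exact: measurableI|exact: measurableD|].
    by rewrite setDE setIACA setICr setI0.
  have mD1 : measurable (`]a, b]%classic `&` N) by exact: measurableI.
  rewrite -[leRHS]adde0; apply: leeD.
    rewrite -dsN; apply: (@le_trans _ _ (ds (`]a, b]%classic `&` N))).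
      by rewrite (dsE a b)//= leeDr// integral_ge0// => x [/(interval_oc oI Ia Ib) Ix _]; rewrite lee_fin g0.
    apply: le_measure; rewrite ?inE//; first exact: measurableI.
    by move=> x [/=]; rewrite !in_itv/= => /andP[-> /le_lt_trans ->].
  rewrite -kN; apply: le_measure; rewrite ?inE//; try exact: measurableD.
  by move=> x [/(interval_oc oI Ia Ib)].
move=> nac.
(* If [kappa] charged no interval ]a, b], then [s] would have density [g] and be absolutely
   continuous. *)
have [a [b [Ia Ib ab kab]]] : exists a b, [/\ I a, I b, a < b & kappa `]a, b]%classic != 0%E].
  apply: contrapT => h; apply: nac; apply: (density_loc_abs_cont oI mg g0) => a b Ia Ib ab.
  rewrite -(hst a b Ia Ib (ltW ab)) (dsE a b)//.
  suff -> : kappa `]a, b]%classic = 0%E by rewrite adde0.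
  by apply/eqP; apply: contrapT => /negP k0; apply: h; exists a, b.
have [psi Cpsi psi1] := smooth_bump_slope1 Ia Ib ab.
have [hpsi L2psi dpsi] := scale_comp_domain hst Cpsi.
have dv : dirichlet_domain X m (psi \o s) by rewrite domE.
have kfin : (kappa `]a, b]%classic < +oo)%E.
  apply: le_lt_trans (ds_oc_fin hst Ia Ib (ltW ab)); rewrite (dsE a b)// leeDr//.
  by rewrite integral_ge0// => x /(interval_oc oI Ia Ib) Ix; rewrite lee_fin g0.
exists (psi \o s), (fine (kappa `]a, b]%classic) / 2); split => //.
  by rewrite divr_gt0// fine_gt0// kfin andbT lt0e kab measure_ge0.
move=> c f Cf; rewrite mulrA.
have df := Cdom Cf.
have dnf : dirichlet_domain X m ((-1) *: f + ((-1) *: f + f)) by do 2!apply: diffusion_lin => //.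
have dd : dirichlet_domain X m (c *: (psi \o s) + (-1) *: f).
  have -> : (-1) *: f = (-1) *: f + ((-1) *: f + f) by rewrite scaleN1r addNr addr0.
  exact: diffusion_lin.
apply: (singular_energy_ge oI smono scont hst hm mg mN N0' kN dsE sub Ia Ib ab Cpsi psi1 Cf hpsi) => //.
exact: formE.
Qed.

End lebesgue_decomposition.
End diffusion.

(** * Cartesian products of diffusions *)

Section speed_cover.
Variables (R : realType) (I : set R) (m : {measure set R -> \bar R}).
Hypothesis oI : open_interval I.
Hypothesis hm : speed_measure I m.

Lemma speed_seg_fin a b : I a -> I b -> (m `[a, b]%classic < +oo)%E.
Proof. by move=> Ia Ib; apply: hm.1; [exact: segment_compact|exact: (interval_seg oI)]. Qed.

(** The complement of [I] has no mass for the restricted measure, so it is added to finite unions of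
    segments of [I] to make them exhaust the line. *)
Lemma speed_cover (mI : measurable I) : exists (C : nat -> set R) (K : set R),
  [/\ forall k, measurable (C k), forall k, (mrestr m mI (C k) < +oo)%E,
      nondecreasing_seq C, \bigcup_k C k = setT &
      [/\ measurable K, (0 < mrestr m mI K)%E & (mrestr m mI K < +oo)%E]].
Proof.
have [a [b [abI cov]]] := interval_cover oI.
pose V k := \big[setU/set0]_(j < k) `[a j, b j]%classic.
have mV k : measurable (V k) by apply: bigsetU_measurable.
have Vfin k : (m (V k) < +oo)%E.
  elim: k => [|k IH]; first by rewrite /V big_ord0 measure0.
  rewrite /V big_ord_recr/=; apply: le_lt_trans (measureU2 _ _ _) _ => //; first exact: mV.
  by apply: lte_add_pinfty => //; have [Ia Ib _] := abI k; exact: speed_seg_fin.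
exists (fun k => ~` I `|` V k), `]a 0%N, b 0%N[%classic; split.
- by move=> k; apply: measurableU => //; exact: measurableC.
- move=> k; apply: le_lt_trans (Vfin k); apply: le_measure; rewrite ?inE//.
    by apply: measurableI => //; apply: measurableU => //; exact: measurableC.
  by move=> x [[]].
- move=> k l kl; apply/subsetPset => x [nIx|Vx]; [by left|right].
  move: Vx; rewrite /V -!(bigcup_mkord _ (fun j => `[a j, b j]%classic)) => -[j /= jk xj]; exists j => //=; exact: leq_trans kl.
- apply/seteqP; split => // x _; have [Ix|nIx] := pselect (I x); last by exists 0%N => //; left.
  have [k /andP[ax xb]] := cov x Ix; exists k.+1 => //; right.
  rewrite /V -(bigcup_mkord _ (fun j => `[a j, b j]%classic)); exists k => //=.
  by rewrite in_itv/= !ltW.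
have [Ia Ib ab] := abI 0%N.
have KI : `]a 0%N, b 0%N[%classic `<=` I.
  by move=> x /=; rewrite in_itv/= => /andP[/ltW ax /ltW xb]; apply: (interval_seg oI Ia Ib); rewrite /= in_itv/= ax.
split; rewrite ?/mrestr ?setIidl//.
  apply: hm.2 => //.
  by exists ((a 0%N + b 0%N) / 2); rewrite /= in_itv/=; apply/andP; split; lra.
apply: le_lt_trans (speed_seg_fin Ia Ib); apply: le_measure; rewrite ?inE//.
by move=> x /=; rewrite !in_itv/= => /andP[/ltW-> /ltW->].
Qed.

Lemma Cc_smooth_patch (V : normedModType R) (U : set V) (f : V -> R) : Cc_smooth U f -> f \_ U = f.
Proof.
move=> [_ [K [_ KU f0]]]; apply/funext => x; rewrite patchE; case: ifPn => // xU.
by rewrite f0// => Kx; move: xU; rewrite mem_set//; exact: KU.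
Qed.

Lemma Cc_smooth_L2 f : Cc_smooth (V := R) I f -> L2 m I f.
Proof.
move=> Cf; have sf : smooth (V := R) f by case: Cf.
have [a [b [Ia Ib ab f0]]] := Cc_smooth_interval oI Cf.
have mf : measurable_fun setT f by apply: continuous_measurable_fun; exact: smooth_continuous.
have [c _ fc] := bounded_supp (@smooth_continuous _ _ _ sf) f0.
apply: (@L2_supp _ _ _ m I `[a, b]%classic) => //; [exact: (interval_seg oI)|exact: measurable_funTS| |].
  move=> x _ h; apply: f0; have [xa|ax] := lerP x a; first by left.
  by right; rewrite leNgt; apply/negP => xb; apply: h; rewrite /= in_itv/= !ltW.
apply: (L2_bounded (c := c)) => //; [exact: speed_seg_fin|exact: measurable_funTS].
Qed.

(** Such functions fill the other coordinates of a tensor when information about one coordinate has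
    to be extracted from it. *)
Lemma Cc_smooth_nontrivial (mI : measurable I) : exists2 f, Cc_smooth (V := R) I f &
  0 < L2_ip (mrestr m mI) f f.
Proof.
have [a [b [abI _]]] := interval_cover oI; have [Ia Ib ab] := abI 0%N; move: Ia Ib ab.
move: (a 0%N) (b 0%N) => {abI b}a b Ia Ib ab.
have h1 : a < a + (b - a) / 3 by lra. have h2 : b - (b - a) / 3 < b by lra.
have [th [sth th01 th0 th1]] := smooth_plateau h1 h2.
have Cth : Cc_smooth (V := R) I th by apply: Cc_smooth_seg sth th0; exact: (interval_seg oI).
exists th => //; have L2th := Cc_smooth_L2 Cth.
set A := `]a + (b - a) / 3, b - (b - a) / 3[%classic.
have mA : measurable (A : set R) by exact: measurable_itv.
have AI : A `<=` I.
  move=> x; rewrite /A/= in_itv/= => /andP[ax xb]; apply: (interval_seg oI Ia Ib).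
  by rewrite /= in_itv/=; apply/andP; split; lra.
have mI' : measurable I by [].
have -> : L2_ip (mrestr m mI) th th = \int[m]_(x in I) (th x) ^+ 2.
  rewrite -{1 2}(Cc_smooth_patch Cth) L2_ip_restrict//; by case: L2th.
apply: lt_le_trans (Rintegral_sqr_subset mI mA AI L2th).
have -> : \int[m]_(x in A) (th x) ^+ 2 = \int[m]_(x in A) (cst 1 x).
  apply: eq_Rintegral => x /set_mem; rewrite /A/= in_itv/= => /andP[h3 h4].
  by rewrite th1 ?expr1n// !ltW.
rewrite Rintegral_cst// mul1r fine_gt0//; apply/andP; split.
  apply: hm.2 => //.
  by exists ((a + b) / 2); rewrite /A/= in_itv/=; apply/andP; split; lra.
apply: le_lt_trans (speed_seg_fin Ia Ib); apply: le_measure; rewrite ?inE//.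
by move=> x; rewrite /A/= !in_itv/= => /andP[h3 h4]; apply/andP; split; lra.
Qed.

End speed_cover.

Section form_comparison.
Variables (R : realType) (n : nat).
Variables (mu : 'I_n -> {measure set R -> \bar R}).
Variable (muE : {measure set 'rV[R]_n -> \bar R}).
Variables (C : 'I_n -> nat -> set R) (K : 'I_n -> set R).
Hypothesis mC : forall i k, measurable (C i k).
Hypothesis Cfin : forall i k, (mu i (C i k) < +oo)%E.
Hypothesis Cnd : forall i, nondecreasing_seq (C i).
Hypothesis CT : forall i, \bigcup_k C i k = setT.
Hypothesis mK : forall i, measurable (K i).
Hypothesis K0 : forall i, (0 < mu i (K i))%E.
Hypothesis Kfin : forall i, (mu i (K i) < +oo)%E.
Hypothesis muEE : forall A : 'I_n -> set R, (forall i, measurable (A i)) ->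
  muE (box A) = (\prod_i mu i (A i))%E.
Variables (P Pb : forall i, kernel_semigroup (mu i)) (PE PEb : kernel_semigroup muE).
Hypothesis PE_box : forall t x (A : 'I_n -> set R), (forall i, measurable (A i)) ->
  PE t x (box A) = (\prod_i P i t (x ord0 i) (A i))%E.
Hypothesis PEb_box : forall t x (A : 'I_n -> set R), (forall i, measurable (A i)) ->
  PEb t x (box A) = (\prod_i Pb i t (x ord0 i) (A i))%E.

Lemma form_product_congr u : L2 muE setT u ->
  (forall i x, form (L2_semigroup (P i)) (section i x u) = form (L2_semigroup (Pb i)) (section i x u)) ->
  form (L2_semigroup PE) u = form (L2_semigroup PEb) u.
Proof.
move=> hu h; rewrite (form_product mC Cfin Cnd CT mK K0 Kfin muEE PE_box hu).
rewrite (form_product mC Cfin Cnd CT mK K0 Kfin muEE PEb_box hu).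
by apply: eq_bigr => i _; apply: form_coord_congr.
Qed.

End form_comparison.

(** * The smooth closure for one process and the domain of another *)

Section process_comparison.
Variables (R : realType) (dT : measure_display) (T : measurableType dT).
Variables (D : set T) (m mu : {measure set T -> \bar R}) (X Xb : process R D).
Variables (S Sb : semigroup (L2_space mu)) (C : (T -> R) -> Prop).
Hypothesis domX : forall u, dirichlet_domain X m u <->
  L2 mu setT (u \_ D) /\ (form S (u \_ D) < +oo)%E.
Hypothesis domXb : forall u, dirichlet_domain Xb m u <->
  L2 mu setT (u \_ D) /\ (form Sb (u \_ D) < +oo)%E.
Hypothesis formX : forall u v, dirichlet_domain X m u -> dirichlet_domain X m v ->
  dirichlet_form X m u v =
  4^-1 * (fine (form S ((u + v) \_ D)) - fine (form S ((u - v) \_ D))).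
Hypothesis formXb : forall u v, dirichlet_domain Xb m u -> dirichlet_domain Xb m v ->
  dirichlet_form Xb m u v =
  4^-1 * (fine (form Sb ((u + v) \_ D)) - fine (form Sb ((u - v) \_ D))).
Hypothesis closureX : forall u, dirichlet_domain X m u ->
  (E1_closure X m C u <-> in_closure S C (u \_ D)).
Hypothesis CH : forall f, C f -> L2_space mu f.
Hypothesis CL : forall a f g, C f -> C g -> C (a *: f + g).
Hypothesis form_smooth : forall f, C f -> form S f = form Sb f.
Hypothesis dense : forall u, dirichlet_domain Xb m u -> in_closure Sb C (u \_ D).

Let DL := @domL _ _ (L2_space mu).

Let closure_sub u : E1_closure X m C u -> dirichlet_domain Xb m u /\ in_closure S C (u \_ D).
Proof.
move=> cu; have [du _] := cu; have hu := (closureX du).1 cu.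
have [L2u fu] := (domX u).1 du; split; last exact: hu.
apply/domXb; split; first exact: L2u.
apply: le_lt_trans fu; apply: (@form_le_of_dense _ _ (L2_space mu) Sb S C CH _ _ L2u hu).
by move=> f Cf; rewrite form_smooth.
Qed.

(** On the closure for [Sb] the form [S] is at most [Sb]; applied to [u - f], this turns
    approximation in the norm of [Sb] into approximation in that of [S]. *)
Let sub_closure u : dirichlet_domain Xb m u -> E1_closure X m C u.
Proof.
move=> du; have cu := dense du; have [L2u fu] := (domXb u).1 du.
have le v : L2 mu setT v -> in_closure Sb C v -> (form S v <= form Sb v)%E.
  by move=> L2v cv; exact: (@form_le_of_dense _ _ (L2_space mu) S Sb C CH form_smooth _ L2v cv).
have dX : dirichlet_domain X m u.
  by apply/domX; split; [exact: L2u|exact: le_lt_trans (le _ L2u cu) fu].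
apply/(closureX dX) => e e0; have [f Cf fe] := cu e e0; exists f; first exact: Cf.
have L2f := CH Cf.
have L2uf : L2 mu setT (u \_ D - f) := linB DL L2u L2f.
apply: le_lt_trans fe; rewrite /norm1; apply: leeD; last exact: lexx.
apply: le L2uf _.
have cf : in_closure Sb C f.
  move=> e' e'0; exists f; first exact: Cf.
  rewrite subrr /norm1.
  have -> : form Sb 0 = 0%E by rewrite -[X in form Sb X](scale0r f) formZ// expr0n mul0e.
  by rewrite add0e lte_fin (psd0l DL (ip_psd (L2_space mu)) (lin0 DL L2f)).
have -> : u \_ D - f = (-1) *: f + u \_ D by rewrite scaleN1r addrC.
exact: (in_closure_lin CH CL _ L2f L2u cf cu).
Qed.

Lemma E1_closure_comparison :
  E1_closure X m C = dirichlet_domain Xb m /\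
  (forall u v, E1_closure X m C u -> E1_closure X m C v ->
     dirichlet_form X m u v = dirichlet_form Xb m u v).
Proof.
split.
  by apply/seteqP; split => u; [move=> /closure_sub[]|exact: sub_closure].
move=> u v hu hv; have [du cu] := closure_sub hu; have [dv cv] := closure_sub hv.
have [du' _] := hu; have [dv' _] := hv.
have [L2u _] := (domX u).1 du'; have [L2v _] := (domX v).1 dv'.
rewrite (formX du' dv') (formXb du dv).
(* Sums and differences stay in the closure, where the two forms coincide; polarization does the
   rest. *)
have key a : form S ((a *: v + u) \_ D) = form Sb ((a *: v + u) \_ D).
  rewrite patch_lin; symmetry; apply: (@form_eq_of_dense _ _ (L2_space mu) Sb S C CH).
  - by move=> f Cf; rewrite form_smooth.
  - by move=> f g Cf Cg; rewrite addrC -scaleN1r; exact: CL.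
  - exact: (L2_linear a L2v L2u).
  - exact: (in_closure_lin CH CL a L2v L2u cv cu).
have := key 1; have := key (-1); rewrite scale1r scaleN1r addrC [v + u]addrC => k1 k2.
by rewrite k1 k2.
Qed.

End process_comparison.

(** * Forms, densities and obstructions for Cartesian products *)

Section product_process.
Variables (R : realType) (d : nat) (I : 'I_d -> set R) (m : 'I_d -> {measure set R -> \bar R}).
Variable mE : {measure set 'rV[R]_d -> \bar R}.
Hypothesis oI : forall i, open_interval (I i).
Hypothesis hm : forall i, speed_measure (I i) (m i).
Hypothesis hmE : product_measure_on I m mE.

Let mI i : measurable (I i) := measurable_interval (oI i).
Let mB : measurable (box I) := measurable_box mI.
Let mu i := mrestr (m i) (mI i).
Let muE := mrestr mE mB.
Let m1 : forall x : R, measurable [set x] := @measurable_set1 R.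
Let m1E : forall x : 'rV[R]_d, measurable [set x] := @measurable_set1_rV R d.

Let muEE (A : 'I_d -> set R) : (forall i, measurable (A i)) ->
  muE (box A) = (\prod_i mu i (A i))%E.
Proof.
move=> mA; rewrite /muE/= /mrestr (_ : box A `&` box I = box (fun i => A i `&` I i)).
  by apply: hmE => i; split; [exact: measurableI|move=> x []].
by apply/seteqP; split => [x [h1 h2] i|x h]; [split|split => i; have [] := h i].
Qed.

Section cartesian.
Variables (X : forall i, process R (I i)) (XE : process R (box I)).
Hypothesis sX : forall i t, symmetric_kernel (mu i) (process_kernel (X i) t).
Hypothesis cX : cartesian_product X XE.

Lemma cartesian_kernel t x (A : 'I_d -> set R) : (forall i, measurable (A i)) ->
  process_kernel XE t x (box A) = (\prod_i process_kernel (X i) t (x ord0 i) (A i))%E.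
Proof.
move=> mA; have [Bx|nBx] := pselect (box I x); last first.
  rewrite process_kernel_out//.
  have [j nIj] : exists j, ~ I j (x ord0 j) by apply: contrapT => h; apply: nBx => j; apply: contrapT => hj; apply: h; exists j.
  by rewrite (bigD1 j)//= process_kernel_out ?mul0e.
rewrite process_kernelE//; last exact: measurable_box.
under eq_bigr do rewrite process_kernelE//.
(* Independence of the components, at a single time. *)
have [_ /(_ x 1%N (fun _ => Num.max t 0) (fun _ => A) Bx)] := cX.
rewrite (_ : [set w | _] = at_time (X := XE) (Num.max t 0) (box A)); last first.
  by apply/seteqP; split => w h //; exact: (h ord0).
move=> ->//; last by move=> _; rewrite le_max lexx orbT.
apply: eq_bigr => i _; congr (proc_law _ _ _).
by apply/seteqP; split => w h //; exact: (h ord0).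
Qed.

Section covered.
Variables (C : 'I_d -> nat -> set R) (K : 'I_d -> set R).
Hypothesis mC : forall i k, measurable (C i k).
Hypothesis Cfin : forall i k, (mu i (C i k) < +oo)%E.
Hypothesis Cnd : forall i, nondecreasing_seq (C i).
Hypothesis CT : forall i, \bigcup_k C i k = setT.
Hypothesis mK : forall i, measurable (K i).
Hypothesis K0 : forall i, (0 < mu i (K i))%E.
Hypothesis Kfin : forall i, (mu i (K i) < +oo)%E.

Let P i : kernel_semigroup (mu i) := process_semigroup m1 (sX i).
Let T i := L2_semigroup (P i).
Let TC i := L2_semigroup (coord_semigroup mC Cfin Cnd CT mK K0 Kfin muEE (P i)).

Lemma cartesian_symmetric t : symmetric_kernel muE (process_kernel XE t).
Proof.
apply: (symmetric_product mC Cfin Cnd CT mK K0 Kfin muEE (P := P)).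
  by move=> t'; exact: subMarkov_process.
exact: cartesian_kernel.
Qed.

Let PE : kernel_semigroup muE := process_semigroup m1E cartesian_symmetric.
Let TE := L2_semigroup PE.

Let PE_box t x (A : 'I_d -> set R) : (forall i, measurable (A i)) ->
  PE t x (box A) = (\prod_i P i t (x ord0 i) (A i))%E.
Proof. exact: cartesian_kernel. Qed.

Lemma form_cartesian u : L2 muE setT u -> form TE u = (\sum_i form (TC i) u)%E.
Proof. exact: (form_product mC Cfin Cnd CT mK K0 Kfin muEE PE_box). Qed.

Let domE u : dirichlet_domain XE mE u <-> L2 muE setT (u \_ (box I)) /\ (form TE (u \_ (box I)) < +oo)%E.
Proof. exact: (dirichlet_domainE m1E cartesian_symmetric). Qed.

Let domP i u : dirichlet_domain (X i) (m i) u <-> L2 (mu i) setT (u \_ (I i)) /\ (form (T i) (u \_ (I i)) < +oo)%E.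
Proof. exact: (dirichlet_domainE m1 (sX i)). Qed.

Let Ci i : (R -> R) -> Prop := Cc_smooth (V := R) (I i).
Let CE : ('rV[R]_d -> R) -> Prop := Cc_smooth (box I).

Lemma Cc_smooth_mrestr i f : Ci i f -> L2 (mu i) setT f.
Proof. by move=> Cf; rewrite -(Cc_smooth_patch Cf); apply/(L2_restrict _ (mI i)); exact: Cc_smooth_L2. Qed.

Lemma coord_form_ge0 i u : L2 muE setT u -> (0 <= form (TC i) u)%E.
Proof. by move=> hu; exact: (@form_ge0 _ _ _ (TC i) u hu). Qed.

(** The tensor of [f] with smooth factors of positive norm is smooth with compact support in the
    box. The [i]-th term of its form is a positive multiple of the form of [f], which is therefore
    finite. *)
Lemma Cc_smooth_factor : CE `<=` dirichlet_domain XE mE ->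
  forall i, Ci i `<=` dirichlet_domain (X i) (m i).
Proof.
move=> Cdom i f Cf; apply/domP; rewrite (Cc_smooth_patch Cf).
have L2f := Cc_smooth_mrestr Cf; split => //.
have eta j := Cc_smooth_nontrivial (oI j) (hm j) (mI j).
have eta' j : exists f, Ci j f /\ 0 < L2_ip (mu j) f f by have [f' ? ?] := eta j; exists f'.
have [h hP] := choice eta'.
pose u j := if j == i then f else h j.
have Cu j : Ci j (u j) by rewrite /u; case: eqP => [->//|_]; have [] := hP j.
have L2u j : L2 (mu j) setT (u j) by exact: Cc_smooth_mrestr.
have Ct : CE (tensor u) by exact: Cc_smooth_tensor.
have /domE := Cdom _ Ct; rewrite (Cc_smooth_patch Ct) => -[L2t].
rewrite form_cartesian// => fin.
have : (form (TC i) (tensor u) < +oo)%E.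
  apply: le_lt_trans fin; rewrite (bigD1 i)//= leeDl// sume_ge0// => j _.
  exact: coord_form_ge0.
have ui : u i = f by rewrite /u eqxx.
rewrite /TC form_tensor// ui.
have q0 : 0 < \prod_(j | j != i) L2_ip (mu j) (u j) (u j).
  by apply: prodr_gt0 => j ji; rewrite /u (negbTE ji); have [] := hP j.
rewrite /T; case: (form _ f) => [r _|/=|//]; first exact: ltry.
by rewrite gt0_muley ?lte_fin.
Qed.

(** [product_density] speaks of functions on the whole line and the one-dimensional density of
    functions on [I i]. The two are bridged by weak equality, since the complement of [I i] has no
    mass. *)
Lemma cartesian_dense : (forall f, CE f -> L2 muE setT f) ->
  (forall i, Ci i `<=` dirichlet_domain (X i) (m i)) ->
  (forall i v e, dirichlet_domain (X i) (m i) v -> 0 < e ->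
     exists2 f, Ci i f & E1_norm2 (X i) (m i) (v \- f) < e) ->
  forall u, L2 muE setT u -> (form TE u < +oo)%E -> in_closure TE CE u.
Proof.
move=> CEH Cdom dense u L2u fu.
apply: (product_density mC Cfin Cnd CT mK K0 Kfin muEE PE_box (Ci := Ci)) => //.
- exact: Cc_smooth_mrestr.
- by move=> i f Cf; have /domP := Cdom i f Cf; rewrite (Cc_smooth_patch Cf) => -[].
- move=> i v L2v fv e e0.
  have mvI : measurable_fun (I i) v by apply: measurable_funTS; case: L2v.
  have vI : L2 (mu i) setT (v \_ (I i)).
    apply/(L2_restrict _ (mI i)); split => //.
    by have [mv] := L2v; rewrite /mu (integral_like_mrestr _ _ (nonneg_mfun_sqr mv)).
  have weq : weak_eq (L2_space (mu i)) (v \_ (I i)) v.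
    move=> w hw; apply: L2_ip_ae => //; last exact: aeW.
    exists (~` I i); split; [exact: measurableC|by rewrite /mu/= /mrestr setICl measure0|].
    by move=> x /= h Ix; apply: h; rewrite patchE mem_set.
  have dv : dirichlet_domain (X i) (m i) v.
    by apply/domP; split => //; rewrite (weak_eq_form (T i) vI L2v weq).
  have [f Cf fe] := dense i v e dv e0; exists f => //.
  have L2f := Cc_smooth_mrestr Cf.
  have df := Cdom i f Cf.
  have vf : v \- f = -1 *: f + v by apply/funext => x; rewrite fun_linE mulN1r addrC.
  have dvf : dirichlet_domain (X i) (m i) (v \- f).
    by rewrite vf; exact: (dirichlet_domain_lin m1 (sX i)).
  have [L2vf _] := (domP _ _).1 dvf.
  have L2vf' : L2 (mu i) setT (v - f) := linB (@domL _ _ (L2_space (mu i))) L2v L2f.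
  have weq' : weak_eq (L2_space (mu i)) (v - f) ((v \- f) \_ (I i)).
    move=> w hw; apply: L2_ip_ae => //; last exact: aeW.
    exists (~` I i); split; [exact: measurableC|by rewrite /mu/= /mrestr setICl measure0|].
    by move=> x /= h Ix; apply: h; rewrite patchE mem_set.
  rewrite (norm1_weak_eq (T i) L2vf' L2vf weq') -(E1_norm2E m1 (sX i) dvf) lte_fin//.
- by move=> a f g; exact: Cc_smooth_lin.
- by move=> v Cv; exact: Cc_smooth_tensor.
Qed.

Lemma E1_closure_cartesian : CE `<=` dirichlet_domain XE mE ->
  forall u, dirichlet_domain XE mE u ->
  (E1_closure XE mE CE u <-> in_closure TE CE (u \_ (box I))).
Proof.
move=> Cdom u du.
have key f : CE f -> (E1_norm2 XE mE (u \- f))%:E = norm1 TE (u \_ (box I) - f).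
  move=> Cf; have uf : u \- f = -1 *: f + u by apply/funext => x; rewrite fun_linE mulN1r addrC.
  have duf : dirichlet_domain XE mE (u \- f).
    by rewrite uf; apply: (dirichlet_domain_lin m1E cartesian_symmetric) => //; exact: Cdom.
  rewrite (E1_norm2E m1E cartesian_symmetric duf); congr norm1.
  by rewrite uf patch_lin (Cc_smooth_patch Cf) scaleN1r addrC.
split=> [[_ h] e e0|h].
  by have [f Cf fe] := h e e0; exists f => //; rewrite -key// lte_fin.
by split => // e e0; have [f Cf fe] := h e e0; exists f => //; rewrite -lte_fin key.
Qed.

(** The tensor of [v] with smooth factors keeps its distance from smooth functions [f]. Each section
    of the difference is a multiple of [v] minus a smooth section, so by [hk] its form is at least
    [k] times the squared coefficient. Integrated over the sections, this gives the bound [k * q]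
    whatever [f] is. *)
Lemma singular_not_dense i v k : CE `<=` dirichlet_domain XE mE ->
  dirichlet_domain (X i) (m i) v -> 0 < k ->
  (forall c f, Ci i f -> c ^+ 2 * k <= dirichlet_form (X i) (m i) (c *: v + (-1) *: f) (c *: v + (-1) *: f)) ->
  ~ (dirichlet_domain XE mE `<=` E1_closure XE mE CE).
Proof.
move=> Cdom dv k0 hk dense.
have Cidom := Cc_smooth_factor Cdom.
have [L2v fv] := (domP _ _).1 dv.
have eta j := Cc_smooth_nontrivial (oI j) (hm j) (mI j).
have eta' j : exists f, Ci j f /\ 0 < L2_ip (mu j) f f by have [f' ? ?] := eta j; exists f'.
have [h hP] := choice eta'.
pose u j : R -> R := if j == i then v \_ (I i) else h j.
have ui : u i = v \_ (I i) by rewrite /u eqxx.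
have L2u j : L2 (mu j) setT (u j).
  by rewrite /u; case: eqP => [->//|_]; have [Ch _] := hP j; exact: Cc_smooth_mrestr.
have fu j : (form (T j) (u j) < +oo)%E.
  rewrite /u; case: eqP => [->//|_]; have [Ch _] := hP j.
  by have /domP := Cidom j _ Ch; rewrite (Cc_smooth_patch Ch) => -[].
have L2t : L2 muE setT (tensor u) by have [] := tensor_ip muEE L2u.
have tp : tensor u \_ (box I) = tensor u.
  apply/funext => x; rewrite patchE; case: ifPn => // /negP nB.
  have [j nIj] : exists j, ~ I j (x ord0 j).
    apply: contrapT => h'; apply: nB; rewrite inE => j; apply: contrapT => hj; apply: h'; by exists j.
  rewrite /tensor (bigD1 j)//= /u; case: eqP nIj => [->|_] nIj; first by rewrite patchE memNset// mul0r.
  by have [Ch _] := hP j; rewrite -(Cc_smooth_patch Ch) patchE memNset// mul0r.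
have dt : dirichlet_domain XE mE (tensor u).
  apply/domE; rewrite tp; split => //; rewrite form_cartesian//.
  apply: lte_sum_pinfty => j _; rewrite /TC form_tensor//.
  apply: lte_mul_pinfty; [|by []|exact: fu].
  by rewrite lee_fin; apply: prodr_ge0 => l _; exact: (psd_ge0 (L2_psd _) (L2u l)).
pose q := \prod_(j | j != i) L2_ip (mu j) (u j) (u j).
have q0 : 0 < q.
  by apply: prodr_gt0 => j ji; rewrite /u (negbTE ji); have [] := hP j.
have := (E1_closure_cartesian Cdom dt).1 (dense _ dt); rewrite tp.
move=> /(_ (k * q)); rewrite mulr_gt0// => /(_ isT)[f Cf].
have df := Cdom f Cf; have [L2f _] := (domE _).1 df; rewrite (Cc_smooth_patch Cf) in L2f.
apply/negP; rewrite -leNgt.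
have L2w : L2 muE setT (tensor u - f) := linB (@domL _ _ (L2_space muE)) L2t L2f.
apply: le_trans (@form_le_norm1 _ _ _ TE _ L2w).
rewrite form_cartesian// (bigD1 i)//=.
apply: (@le_trans _ _ (form (TC i) (tensor u - f))); last first.
  by rewrite leeDl// sume_ge0// => j _; exact: coord_form_ge0.
have mcop : measurable_fun setT (coprod i u).
  have -> : coprod i u = tensor (fun j => if j != i then u j else cst 1).
    by apply/funext => x; rewrite /coprod /tensor big_mkcond; apply: eq_bigr => j _; case: ifP.
  by apply: measurable_tensor => j; case: ifP => // _; have [] := L2u j.
pose g x := (k%:E * ((coprod i u x) ^+ 2)%:E)%E.
have hg0 : nonneg_mfun (fun x => ((coprod i u x) ^+ 2)%:E) by exact: nonneg_mfun_sqr.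
have hg : nonneg_mfun g by apply: nonneg_mfunZ => //; exact: ltW.
have hw : nonneg_mfun (fun x => (weight mu K i x)%:E * ((coprod i u x) ^+ 2)%:E)%E.
  by apply: nonneg_mfunM => //; exact: nonneg_mfun_weight.
have -> : ((k * q)%:E = \int[muE]_x ((weight mu K i x)%:E * g x))%E.
  under eq_integral do rewrite /g muleCA.
  rewrite ge0_integralZl//; [|by case: hw|by move=> x _; case: hw|by rewrite lee_fin ltW].
  by rewrite (integral_weight_coprod mK K0 Kfin muEE).
apply: (form_coord_ge mC Cfin Cnd CT mK K0 Kfin muEE L2w hg) => x _.
set sf := section i x f.
have Csf : Ci i sf by exact: Cc_smooth_section.
have Cnsf : Ci i ((-1) *: sf).
  have -> : (-1) *: sf = (-2) *: sf + sf by apply/funext => y; rewrite fun_linE -[LHS]/(-1 * sf y); ring.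
  exact: Cc_smooth_lin.
set c := coprod i u x.
have -> : section i x (tensor u - f) = (c *: v + (-1) *: sf) \_ (I i).
  rewrite patch_lin (Cc_smooth_patch Cnsf) -ui /c -section_tensor scaleN1r.
  by apply/funext => y.
have dd : dirichlet_domain (X i) (m i) (c *: v + (-1) *: sf).
  by apply: (dirichlet_domain_lin m1 (sX i)) => //; exact: Cidom.
rewrite -[form _ _]/(form (T i) _) -(dirichlet_formE m1 (sX i) dd) /g -EFinM lee_fin mulrC.
exact: hk.
Qed.

End covered.
End cartesian.

Section comparison.
Variables (X Xb : forall i, process R (I i)) (XE XEb : process R (box I)).
Hypothesis sX : forall i t, symmetric_kernel (mu i) (process_kernel (X i) t).
Hypothesis cX : cartesian_product X XE.
Hypothesis sXb : forall i t, symmetric_kernel (mu i) (process_kernel (Xb i) t).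
Hypothesis cXb : cartesian_product Xb XEb.
Variables (C : 'I_d -> nat -> set R) (K : 'I_d -> set R).
Hypothesis mC : forall i k, measurable (C i k).
Hypothesis Cfin : forall i k, (mu i (C i k) < +oo)%E.
Hypothesis Cnd : forall i, nondecreasing_seq (C i).
Hypothesis CT : forall i, \bigcup_k C i k = setT.
Hypothesis mK : forall i, measurable (K i).
Hypothesis K0 : forall i, (0 < mu i (K i))%E.
Hypothesis Kfin : forall i, (mu i (K i) < +oo)%E.

Local Notation CE := (@Cc_smooth R _ (box I) : ('rV[R]_d -> R) -> Prop).

Hypothesis Cdom : CE `<=` dirichlet_domain XE mE.
Hypothesis Cb : forall i, Cc_smooth (V := R) (I i) `<=` dirichlet_domain (Xb i) (m i).
Hypothesis energy : forall i f, Cc_smooth (V := R) (I i) f ->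
  dirichlet_form (X i) (m i) f f = dirichlet_form (Xb i) (m i) f f.
Hypothesis dense : forall i v e, dirichlet_domain (Xb i) (m i) v -> 0 < e ->
  exists2 f, Cc_smooth (V := R) (I i) f & E1_norm2 (Xb i) (m i) (v \- f) < e.

Lemma smooth_closure_covered :
  E1_closure XE mE CE = dirichlet_domain XEb mE /\
  (forall u v, E1_closure XE mE CE u -> E1_closure XE mE CE v ->
     dirichlet_form XE mE u v = dirichlet_form XEb mE u v).
Proof.
pose sXE := cartesian_symmetric sX cX mC Cfin Cnd CT mK K0 Kfin.
pose sXEb := cartesian_symmetric sXb cXb mC Cfin Cnd CT mK K0 Kfin.
have CEH f : CE f -> L2 muE setT f.
  by move=> Cf; have /(dirichlet_domainE m1E sXE) := Cdom Cf; rewrite (Cc_smooth_patch Cf) => -[].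
apply: (E1_closure_comparison (dirichlet_domainE m1E sXE) (dirichlet_domainE m1E sXEb)
  (@dirichlet_form_cvg _ _ _ _ mB XE m1E mE sXE) (@dirichlet_form_cvg _ _ _ _ mB XEb m1E mE sXEb)
  (E1_closure_cartesian sX cX mC Cfin Cnd CT mK K0 Kfin Cdom) CEH).
- by move=> a f g; exact: Cc_smooth_lin.
- move=> f Cf; have L2f := CEH f Cf.
  apply: (form_product_congr mC Cfin Cnd CT mK K0 Kfin muEE
    (P := fun i => process_semigroup m1 (sX i)) (Pb := fun i => process_semigroup m1 (sXb i)) _ _ L2f).
  + exact: cartesian_kernel.
  + exact: cartesian_kernel.
  move=> i x; have Cs := Cc_smooth_section i x Cf.
  have Xi := Cc_smooth_factor sX cX mC Cfin Cnd CT mK K0 Kfin Cdom Cs.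
  have Xbi := Cb Cs.
  have := dirichlet_formE m1 (sX i) Xi; have := dirichlet_formE m1 (sXb i) Xbi.
  by rewrite (Cc_smooth_patch Cs) => e1 e2; rewrite -[LHS]e2 -[RHS]e1 energy.
- move=> u /(dirichlet_domainE m1E sXEb)[L2u fu].
  exact: (cartesian_dense CEH (@Cb) (@dense) L2u fu).
Qed.

End comparison.
End product_process.

Theorem theorem2p5 (R : realType) (d : nat) (I : 'I_d -> set R)
    (e : 'I_d -> R) (s : 'I_d -> R -> R)
    (m : 'I_d -> {measure set R -> \bar R})
    (X : forall i, process R (I i))
    (mE : {measure set 'rV[R]_d -> \bar R})
    (XE : process R (box I))
    (sbar : 'I_d -> R -> R) :
  (2 <= d)%N ->
  (forall i, open_interval (I i)) ->
  (forall i, scaling_function (I i) (e i) (s i)) ->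
  (forall i, speed_measure (I i) (m i)) ->
  (forall i, minimal_diffusion (s i) (m i) (X i)) ->
  product_measure_on I m mE ->
  cartesian_product X XE ->
  (forall i, ac_part (I i) (e i) (s i) (sbar i)) ->
  Cc_smooth (box I) `<=` dirichlet_domain XE mE ->
  [/\ (forall i, scaling_function (I i) (e i) (sbar i)),
      (forall (Xbar : forall i, process R (I i))
          (XEbar : process R (box I)),
        (forall i, minimal_diffusion (sbar i) (m i) (Xbar i)) ->
        cartesian_product Xbar XEbar ->
        E1_closure XE mE (Cc_smooth (box I)) = dirichlet_domain XEbar mE /\
        (forall u v, E1_closure XE mE (Cc_smooth (box I)) u ->
           E1_closure XE mE (Cc_smooth (box I)) v ->
           dirichlet_form XE mE u v = dirichlet_form XEbar mE u v)) &
      (special_standard_core XE mE <->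
       forall i, loc_abs_cont (I i) (s i))].
Proof.
move=> _ oI hs hm hX hmE cX hac Cdom.
have smono i : forall x y, I i x -> I i y -> x < y -> s i x < s i y by have [] := hs i.
have scont i : {within I i, continuous s i} by have [] := hs i.
have Ie i : I i (e i) by have [] := hs i.
have sX i t := diffusion_kernel (oI i) (hX i) t.
have [C covC] := choice (fun i => speed_cover (oI i) (hm i) (measurable_interval (oI i))).
have [K cov] := choice covC.
have mC i k : measurable (C i k) by have [] := cov i.
have Cfin i k : (mrestr (m i) (measurable_interval (oI i)) (C i k) < +oo)%E by have [] := cov i.
have Cnd i : nondecreasing_seq (C i) by have [] := cov i.
have CT i : \bigcup_k C i k = setT by have [] := cov i.
have mK i : measurable (K i) by have [_ _ _ _ []] := cov i.
have K0 i : (0 < mrestr (m i) (measurable_interval (oI i)) (K i))%E by have [_ _ _ _ []] := cov i.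
have Kfin i : (mrestr (m i) (measurable_interval (oI i)) (K i) < +oo)%E by have [_ _ _ _ []] := cov i.
have Cidom i : Cc_smooth (V := R) (I i) `<=` dirichlet_domain (X i) (m i).
  by move=> f Cf; exact: (Cc_smooth_factor hm hmE sX cX mC Cfin Cnd CT mK K0 Kfin Cdom Cf).
have [g gP] := choice (fun i => ac_part_diffusion (oI i) (smono i) (scont i) (hm i) (hX i)
  (Ie i) (hac i) (Cidom i)).
(* Stated for any scales with densities [g i], as it is used twice: for the scales [sbar], and for
   the scales [s] themselves when they are absolutely continuous. *)
have product (Xb : forall i, process R (I i)) (XEb : process R (box I)) t :
    (forall i, [/\ forall x y, I i x -> I i y -> x < y -> t i x < t i y,
      {within I i, continuous t i}, minimal_diffusion (t i) (m i) (Xb i) &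
      forall a b, I i a -> I i b -> a < b ->
        (t i b - t i a)%:E = (\int[lam]_(x in `]a, b]) (g i x)%:E)%E]) ->
    cartesian_product Xb XEb ->
    E1_closure XE mE (Cc_smooth (box I)) = dirichlet_domain XEb mE /\
    (forall u v, E1_closure XE mE (Cc_smooth (box I)) u ->
       E1_closure XE mE (Cc_smooth (box I)) v ->
       dirichlet_form XE mE u v = dirichlet_form XEb mE u v).
  move=> ht cXb.
  have hXb i : minimal_diffusion (t i) (m i) (Xb i) by have [] := ht i.
  have sXb i t' := diffusion_kernel (oI i) (hXb i) t'.
  have acb i : [/\ Cc_smooth (V := R) (I i) `<=` dirichlet_domain (Xb i) (m i),
      forall f, Cc_smooth (V := R) (I i) f ->
        dirichlet_form (Xb i) (m i) f f = smooth_energy (I i) (g i) f &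
      forall u eps, dirichlet_domain (Xb i) (m i) u -> 0 < eps ->
        exists2 f, Cc_smooth (V := R) (I i) f & E1_norm2 (Xb i) (m i) (u \- f) < eps].
    have [tmono tcont _ tE] := ht i; have [mg g0 gd _ _] := gP i.
    exact: (ac_diffusion (oI i) tmono tcont (hm i) (hXb i) mg g0 gd tE).
  apply: (smooth_closure_covered hm hmE sX cX sXb cXb mC Cfin Cnd CT mK K0 Kfin Cdom).
  - by move=> i; have [] := acb i.
  - move=> i f Cf; have [_ eb _] := acb i; have [_ _ _ eX _] := gP i.
    by rewrite eX// eb.
  - by move=> i v eps; have [_ _ db] := acb i; exact: db.
split.
- by move=> i; have [_ _ _ _ []] := gP i.
- move=> Xbar XEbar hXb cXb; apply: (product _ _ sbar) cXb => i.
  by have [_ _ _ _ [sE [_ _ mono cont] _ _]] := gP i.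
split=> [[_ dense] i|hs_ac].
  apply: contrapT => nac.
  have [_ _ _ _ [_ _ _ /(_ nac)[v [k [dv k0 hk]]]]] := gP i.
  exact: (singular_not_dense hm hmE sX cX mC Cfin Cnd CT mK K0 Kfin Cdom dv k0 hk dense).
split; first exact: Cdom.
(* Compared with itself, the process has a smooth closure equal to its whole domain. *)
have [|-> _] := product X XE s _ cX; last by [].
by move=> i; have [_ _ _ _ [_ _ sE _]] := gP i; split;
  [exact: smono|exact: scont|exact: hX|exact: sE (hs_ac i)].
Qed.
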